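(* Let $0<q<1$, $0\le k_1,k_2,k_4<1$ (nonzero wherever they occur in a denominator), $j\in\mathbb Z_{\ge0}$ and let $\rho,\sigma,\tau,\zeta,\xi\in\mathbb T$ (the unit circle in $\mathbb C$). The Askey-Wilson functions and Askey-Wilson polynomials satisfy $$\phi_\sigma(\rho;\,k_1k_2\xi q^j,\,k_4\tau,\,k_4/\tau,\,\xi q^{1-j}/k_1k_2\,|q)\;p_j(\zeta;k_2\sigma,k_2/\sigma,k_1\tau,k_1/\tau|q)$$ $$=\frac{1}{4\pi i}\int_{\mathbb T}p_j(\omega;k_2\xi,k_2/\xi,k_1\rho,k_1/\rho|q)\;\phi_\tau(\omega;k_1\rho,k_4\zeta,k_4/\zeta,q\rho/k_1|q)\;\phi_\sigma(\omega;k_2\xi,k_4\zeta,k_4/\zeta,\xi q/k_2|q)$$ $$\times\frac{k_4^{-j}\,(\omega^{\pm2},\,k_1k_2\xi q^j\rho^{\pm1},\,k_1k_2q^j\rho^{\pm1}/\xi;q)_\infty}{(k_2\xi\omega^{\pm1},\,k_2\omega^{\pm1}/\xi,\,k_4\zeta\omega^{\pm1},\,k_4\omega^{\pm1}/\zeta,\,k_1\rho\omega^{\pm1},\,k_1\omega^{\pm1}/\rho;q)_\infty}\,\frac{d\omega}\omega,$$ with $\mathbb T$ oriented counterclockwise.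
   Context: Notation: $(a;q)_n=\prod_{i=0}^{n-1}(1-aq^i)$ for $n\in\mathbb Z_{\ge0}\cup\{\infty\}$, $(a_1,\dots,a_s;q)_n=\prod_i(a_i;q)_n$, and a $\pm$ in an exponent means the product over both signs, e.g. $(ax^{\pm1};q)_\infty=(ax,a/x;q)_\infty$. Askey-Wilson polynomials: $$p_n(x;a,b,c,d|q)=a^{-n}(ab,ac,ad;q)_n\sum_{i=0}^n\frac{(q^{-n},abcdq^{n-1},ax,a/x;q)_i}{(q,ab,ac,ad;q)_i}q^i.$$ Askey-Wilson function: for $\overline a=q/d$, $\overline b=c$, put $\tilde a=|b|e^{i\arg a}$, $\tilde b=ab/\tilde a$, $\tilde c=ac/\tilde a$, $\tilde d=ad/\tilde a$, and $$\phi_\lambda(x;a,b,c,d|q)=\frac{(qa\lambda x^{\pm1}/\tilde d,\,q/\tilde d\lambda,\,ab,\,ac,\,qa/d;q)_\infty}{(\tilde a\tilde b\tilde c\lambda;q)_\infty}\;{}_8W_7(\tilde a\tilde b\tilde c\lambda/q;ax,a/x,\tilde a\lambda,\tilde b\lambda,\tilde c\lambda;q,q/\tilde d\lambda),$$ $${}_8W_7(A;b,c,d,e,f;q,z)=\sum_{n=0}^\infty\frac{1-Aq^{2n}}{1-A}\frac{(A,b,c,d,e,f;q)_n}{(q,Aq/b,Aq/c,Aq/d,Aq/e,Aq/f;q)_n}z^n.$$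
   Formalization: The printed identity is off by a constant: the numerator in the integrand must carry the extra factor (q;q)_∞ (for j=0 and k_1,k_2,k_4→0 the left side tends to 1, the printed right side to 1/(q;q)_∞); k_1,k_2,k_4 are taken strictly positive, as each occurs in a denominator. *)

(* Defs.v *)
From HB Require Import structures.
From mathcomp Require Import all_boot all_order all_algebra.
From mathcomp Require Import complex.
From mathcomp Require Import all_classical all_reals all_analysis.

Set Implicit Arguments.
Unset Strict Implicit.
Unset Printing Implicit Defensive.

Import Order.TTheory GRing.Theory Num.Theory.
Import numFieldNormedType.Exports.

Local Open Scope ring_scope.
Local Open Scope complex_scope.
Local Open Scope classical_set_scope.

(* Limits in R[i] are taken in R[i]^o, which carries the topology of the
   complex modulus. *)

Definition qpoch (R : realType) (a q : R[i]) (n : nat) : R[i] :=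
  \prod_(i < n) (1 - a * q ^+ i).

Definition qpoch_inf (R : realType) (a q : R[i]) : R[i] :=
  limn (fun n => qpoch a q n : R[i]^o).

(* (a_1, ..., a_s; q)_n and (a_1, ..., a_s; q)_oo *)
Definition qpochs (R : realType) (s : seq R[i]) (q : R[i]) (n : nat) : R[i] :=
  \prod_(a <- s) qpoch a q n.

Definition qpochs_inf (R : realType) (s : seq R[i]) (q : R[i]) : R[i] :=
  \prod_(a <- s) qpoch_inf a q.

(* The two entries abbreviated by a x^{+-1} in a q-shifted factorial. *)
Definition pm (R : realType) (a x : R[i]) : seq R[i] := [:: a * x; a / x].

Definition AW_poly (R : realType) (n : nat) (x a b c d q : R[i]) : R[i] :=
  a ^- n * qpochs [:: a * b; a * c; a * d] q n *
  \sum_(i < n.+1)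
    qpochs [:: q ^- n, a * b * c * d * q ^ (n%:Z - 1) & pm a x] q i /
    qpochs [:: q; a * b; a * c; a * d] q i * q ^+ i.

(* (1 - A q^{2n}) / (1 - A) * (A; q)_n, with the factor 1 - A cancelled, so
   that the value at the removable singularity A = 1 is the right one.
   See vwp_factorE. *)
Definition vwp_factor (R : realType) (A q : R[i]) (n : nat) : R[i] :=
  if n is m.+1 then (1 - A * q ^+ (2 * n)) * qpoch (A * q) q m else 1.

Lemma vwp_factorE (R : realType) (A q : R[i]) (n : nat) : A != 1 ->
  vwp_factor A q n = (1 - A * q ^+ (2 * n)) / (1 - A) * qpoch A q n.
Proof.
move=> A1; have nz : 1 - A != 0 by rewrite subr_eq0 eq_sym.
rewrite /vwp_factor /qpoch; case: n => [|m].
  by rewrite big_ord0 muln0 expr0 !mulr1 divff.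
rewrite big_ord_recl expr0 mulr1 -!mulrA (mulKf nz).
by congr (_ * _); apply: eq_bigr => i _; rewrite /= -mulrA -exprS.
Qed.

Definition W87_term (R : realType) (A b c d e f q z : R[i]) (n : nat) : R[i] :=
  vwp_factor A q n * qpochs [:: b; c; d; e; f] q n /
  qpochs [:: q; A * q / b; A * q / c; A * q / d; A * q / e; A * q / f] q n *
  z ^+ n.

Definition W87 (R : realType) (A b c d e f q z : R[i]) : R[i] :=
  limn (series (fun n => W87_term A b c d e f q z n : R[i]^o)).

(* Meant for a, b, d nonzero with a^* = q / d and b^* = c; here
   a / `|a| is e^{i arg a}. *)
Definition AW_fun (R : realType) (la x a b c d q : R[i]) : R[i] :=
  let ta := `|b| * (a / `|a|) in
  let tb := a * b / ta in
  let tc := a * c / ta in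
  let td := a * d / ta in
  qpochs_inf (pm (q * a * la / td) x ++
              [:: q / (td * la); a * b; a * c; q * a / d]) q /
  qpoch_inf (ta * tb * tc * la) q *
  W87 (ta * tb * tc * la / q) (a * x) (a / x) (ta * la) (tb * la) (tc * la)
      q (q / (td * la)).

Definition expi (R : realType) (t : R) : R[i] := cos t +i* sin t.

(* Contour integral over the unit circle, oriented counterclockwise. *)
Definition circle_integral (R : realType) (f : R[i] -> R[i]) : R[i] :=
  let g := fun t : R => f (expi t) * ('i%C * expi t) in
  (\int[lebesgue_measure]_(t in `[0%R, 2 * pi]) complex.Re (g t))%R +i*
  (\int[lebesgue_measure]_(t in `[0%R, 2 * pi]) complex.Im (g t))%R.

(* Main.v *)
Require Import Defs.
From HB Require Import structures.
From mathcomp Require Import all_boot all_order all_algebra.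
From mathcomp Require Import complex.
From mathcomp Require Import all_classical all_reals all_analysis.
From mathcomp Require Import zify ring lra.

(** The Askey-Wilson functions of the statement are, up to infinite products,
    bilinear generating functions. Let h_n(x; kr) be the coefficient of z^n in
    (krz, kz/r; q)_oo / (xz, z/x; q)_oo (an Al-Salam-Chihara polynomial with
    parameters kr, k/r) and put

      P_k(x, y; r, s | t) = sum_n t^n (q; q)_n / (k^2; q)_n h_n(x; kr) h_n(y; ks).

    Both sides of [bilin_vwp] are power series which solve one q-difference
    equation, an analogue of the Euler-Poisson-Darboux equation, and which agree
    where the first variable vanishes; hence P_k is a very-well-poised series.
    Reading the same kernel in several ways gives

      phi_s(x; kr, ty, t/y, qr/k) = (k^2, txy, tx/y, ty/x, t/(xy); q)_oo P_k(x, y; r, s | t)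

    ([AW_fun_kern]) and the symmetry of the right-hand side under
    (x, y) <-> (r, s) ([kern_sym]). The theorem thereby says that, for the
    Askey-Wilson weight with parameters a, b, c, d = k2 xi, k2 / xi, k1 rho, k1 / rho, the mean
    over omega of

      p_j(omega) P_k1(omega, zeta; rho, tau | t) P_k2(xi, sigma; omega, zeta | t)

    is a constant times t^j p_j(zeta) P_(k1 k2 q^j)(xi, sigma; rho, tau | t).

    The coefficient of t^N in the product of the two kernels is a finite sum,
    bilinear in the products f_n = h_n(omega; k1 rho) h_(N-n)(xi; k2 omega).
    The Askey-Wilson operator acts on f_0, ..., f_N by a tridiagonal matrix which
    depends on q, k1, k2 and N only ([AWop_gg]) and is symmetric for the weights of the
    bilinear sum ([kweight_sym]). Expanding the f_n in Askey-Wilson polynomials therefore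
    diagonalises the sum ([kernel_expansion]): it becomes
    sum_i C_(i,N) p_i(omega) p_i(zeta) h_(N-i)(xi; k_i rho) h_(N-i)(sigma; k_i tau) with
    k_i = k1 k2 q^i. Orthogonality selects i = j, and the sum over N is again a kernel,
    with k = k1 k2 q^j ([cmean_kernels]).

    Orthogonality and the norms ([AWpol_orth], [AWpol_norm]) follow from the
    Askey-Wilson integral. Its parameters are switched on one at a time: a
    contiguous relation determines the integral, as a power series in one parameter,
    from its value at 0 ([contiguous_uniq]). The case of a single parameter
    is the mean of the q-Hermite polynomials ([cmean_hermite]), which comes from the Jacobi
    triple product and the finite q-binomial theorem. *)

Set Implicit Arguments.
Unset Strict Implicit.
Unset Printing Implicit Defensive.
Import Order.TTheory GRing.Theory Num.Theory.
Import numFieldNormedType.Exports.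
Local Open Scope ring_scope.
Local Open Scope complex_scope.
Local Open Scope classical_set_scope.
(** * The real-valued modulus *)

Notation nm := (@ComplexField.Normc.normc _).

Section Modulus.
Variable R : realType.
Implicit Types x y z : R[i].

Lemma nmE x : `|x| = (nm x)%:C.
Proof. by rewrite normc_def; case: x. Qed.
Lemma nm_ge0 x : 0 <= nm x.
Proof. by case: x => a b; exact: sqrtr_ge0. Qed.
Lemma nm0 : nm (0 : R[i]) = 0. Proof. exact: ComplexField.Normc.normc0. Qed.
Lemma nm1 : nm (1 : R[i]) = 1. Proof. exact: ComplexField.Normc.normc1. Qed.
Lemma nmM x y : nm (x * y) = nm x * nm y.
Proof. exact: ComplexField.Normc.normcM. Qed.
Lemma nmV x : nm x^-1 = (nm x)^-1. Proof. exact: ComplexField.Normc.normcV. Qed.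
Lemma nmX x n : nm (x ^+ n) = nm x ^+ n.
Proof. by elim: n => [|n IH]; rewrite ?expr0 ?nm1 // !exprS nmM IH. Qed.
Lemma nmN x : nm (- x) = nm x. Proof. exact: normcN. Qed.
Lemma nmD x y : nm (x + y) <= nm x + nm y. Proof. exact: le_normcD. Qed.
Lemma nmB x y : nm (x - y) <= nm x + nm y.
Proof. by rewrite -(nmN y); exact: nmD. Qed.
Lemma nmBC x y : nm (x - y) = nm (y - x).
Proof. by rewrite -nmN opprB. Qed.
Lemma nm_eq0 x : (nm x == 0) = (x == 0).
Proof. by rewrite -(normr_eq0 x) nmE -(inj_eq (@complexI R)). Qed.
Lemma nm_gt0 x : (0 < nm x) = (x != 0).
Proof. by rewrite lt_def nm_ge0 andbT nm_eq0. Qed.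
Lemma nmC (a : R) : nm a%:C = `|a|.
Proof. by rewrite /= expr0n /= addr0 sqrtr_sqr. Qed.
Lemma nm_sum I (r : seq I) (P : pred I) (F : I -> R[i]) :
  nm (\sum_(i <- r | P i) F i) <= \sum_(i <- r | P i) nm (F i).
Proof.
elim/big_rec2 : _ => [|i y x _ le]; first by rewrite nm0.
by apply: le_trans (nmD _ _) _; rewrite lerD2l.
Qed.
Lemma nm_prod I (r : seq I) (P : pred I) (F : I -> R[i]) :
  nm (\prod_(i <- r | P i) F i) = \prod_(i <- r | P i) nm (F i).
Proof. by elim/big_rec2 : _ => [|i y x _ <-]; rewrite ?nm1 ?nmM. Qed.
Lemma nm_Re x : `|complex.Re x| <= nm x.
Proof. by rewrite -lecR -nmE; exact: normc_ge_Re. Qed.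
Lemma nm_Im x : `|complex.Im x| <= nm x.
Proof.
case: x => a b /=; rewrite -[X in X <= _]sqrtr_sqr ler_wsqrtr //.
by rewrite lerDr sqr_ge0.
Qed.
Lemma nm_ReIm x : nm x <= `|complex.Re x| + `|complex.Im x|.
Proof.
case: x => a b /=; rewrite -[X in _ <= X]ger0_norm ?addr_ge0 // -sqrtr_sqr ler_wsqrtr //.
rewrite sqrrD -!normrX !(@ger0_norm _ (_ ^+ 2)) ?sqr_ge0 // -addrA lerD2l lerDr.
by rewrite mulrn_wge0 ?mulr_ge0.
Qed.

(** * Convergence of complex sequences and series *)

(** Convergence stated through the modulus; [ccvg_limn] passes to limits in R[i]^o. *)
Definition ccvg (u : nat -> R[i]) (l : R[i]) : Prop :=
  (fun n => nm (u n - l)) @ \oo --> (0 : R).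

Lemma ccvg_bound (u : nat -> R[i]) l (v : nat -> R) :
  (forall n, nm (u n - l) <= v n) -> v @ \oo --> (0 : R) -> ccvg u l.
Proof.
move=> uv v0; apply: (squeeze_cvgr _ _ v0); last exact: cvg_cst.
by apply: nearW => n; rewrite nm_ge0 uv.
Qed.

Lemma ccvg_near (u v : nat -> R[i]) l :
  (\forall n \near \oo, u n = v n) -> ccvg u l -> ccvg v l.
Proof.
move=> uv; apply: cvg_trans; apply: near_eq_cvg.
by near=> n; rewrite (near uv n).
Unshelve. all: by end_near. Qed.

Lemma eq_ccvg (u v : nat -> R[i]) l : u =1 v -> ccvg u l -> ccvg v l.
Proof. by move=> uv; apply: ccvg_near; apply: nearW. Qed.

Lemma ccvg_cst c : ccvg (fun=> c) c.
Proof. by apply: (ccvg_bound (v := fun=> 0)); [move=> n; rewrite subrr nm0|exact: cvg_cst]. Qed.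

Lemma ccvgD u v a b : ccvg u a -> ccvg v b -> ccvg (fun n => u n + v n) (a + b).
Proof.
move=> ua vb; apply: ccvg_bound; last by rewrite -(addr0 0); exact: (cvgD ua vb).
by move=> n; rewrite opprD addrACA; exact: nmD.
Qed.

Lemma ccvgM u v a b : ccvg u a -> ccvg v b -> ccvg (fun n => u n * v n) (a * b).
Proof.
move=> ua vb; pose A n := nm (u n - a); pose B n := nm (v n - b).
apply: (ccvg_bound (v := fun n => A n * B n + nm a * B n + A n * nm b)).
  move=> n; have -> : u n * v n - a * b = (u n - a) * (v n - b) + a * (v n - b) + (u n - a) * b.
    by rewrite -mulrDl subrK mulrBr mulrBl addrA subrK.
  by apply: le_trans (nmD _ _) _; rewrite !nmM lerD // (le_trans (nmD _ _)) // !nmM.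
have -> : (0 : R) = 0 * 0 + nm a * 0 + 0 * nm b by rewrite !(mulr0, mul0r, addr0).
apply: cvgD; last exact: cvgMl.
by apply: cvgD; [exact: cvgM|exact: cvgMr].
Qed.

Lemma ccvgZ c u a : ccvg u a -> ccvg (fun n => c * u n) (c * a).
Proof. exact: ccvgM (ccvg_cst c). Qed.

Lemma ccvgN u a : ccvg u a -> ccvg (fun n => - u n) (- a).
Proof. by move/(ccvgZ (-1)); rewrite mulN1r; apply: eq_ccvg => n; rewrite mulN1r. Qed.

Lemma ccvgB u v a b : ccvg u a -> ccvg v b -> ccvg (fun n => u n - v n) (a - b).
Proof. by move=> ua vb; apply: ccvgD ua (ccvgN vb). Qed.

Lemma ccvg_sum (I : Type) (r : seq I) (u : I -> nat -> R[i]) (l : I -> R[i]) :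
  (forall i, ccvg (u i) (l i)) -> ccvg (fun n => \sum_(i <- r) u i n) (\sum_(i <- r) l i).
Proof.
move=> ul; elim: r => [|i r IH].
  by rewrite big_nil; apply: eq_ccvg (ccvg_cst 0) => n; rewrite big_nil.
by rewrite big_cons; apply: eq_ccvg (ccvgD (ul i) IH) => n; rewrite big_cons.
Qed.

Lemma ccvg_uniq u a b : ccvg u a -> ccvg u b -> a = b.
Proof.
move=> ua ub; apply/eqP; rewrite -subr_eq0 -nm_eq0; apply/eqP.
have : (fun n => nm (u n - a) + nm (u n - b)) @ \oo --> (0 : R).
  by rewrite -(addr0 0); exact: (cvgD ua ub).
have h0 : (fun=> nm (a - b)) @ \oo --> nm (a - b) by exact: cvg_cst.
move=> h; apply/eqP; rewrite eq_le nm_ge0 andbT.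
apply: (ler_cvg_to h0 h); apply: nearW => n.
have -> : a - b = (a - u n) + (u n - b) by rewrite addrA subrK.
by apply: le_trans (nmD _ _) _; rewrite nmBC.
Qed.

Lemma ccvg_le u a M : ccvg u a -> (forall n, nm (u n) <= M) -> nm a <= M.
Proof.
move=> ua uM; have h0 : (fun=> nm a) @ \oo --> nm a by exact: cvg_cst.
have h : (fun n => nm (u n - a) + M) @ \oo --> 0 + M by apply: cvgD => //; exact: cvg_cst.
rewrite -[M]add0r; apply: (ler_cvg_to h0 h); apply: nearW => n.
rewrite -{1}(subrK (u n) a); apply: le_trans (nmD _ _) _.
by rewrite nmBC lerD.
Qed.

Lemma ccvg_shift k u a : ccvg u a -> ccvg (fun n => u (n + k)%N) a.
Proof. by move=> ua; rewrite /ccvg (cvg_shiftn k (fun n => nm (u n - a))). Qed.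

Lemma ccvgS u a : ccvg u a -> ccvg (fun n => u n.+1) a.
Proof. by move/(ccvg_shift 1); apply: eq_ccvg => n; rewrite addn1. Qed.

Lemma ccvg_ReIm u (a b : R) : (fun n => complex.Re (u n)) @ \oo --> a ->
  (fun n => complex.Im (u n)) @ \oo --> b -> ccvg u (a +i* b).
Proof.
move=> ua ub.
apply: (ccvg_bound (v := fun n => `|complex.Re (u n) - a| + `|complex.Im (u n) - b|)).
  by move=> n; apply: le_trans (nm_ReIm _) _; case: (u n).
rewrite -(addr0 0); apply: cvgD; apply/norm_cvg0P; rewrite -(subrr a) -?(subrr b).
  by apply: cvgB => //; exact: cvg_cst.
by rewrite subrr -(subrr b); apply: cvgB => //; exact: cvg_cst.
Qed.

Lemma ccvg_limn u a : ccvg u a -> limn (fun n => u n : R[i]^o) = a.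
Proof.
move=> ua; apply: (@cvg_lim R[i]^o) => //; apply/(@cvgrPdist_lt _ R[i]^o) => e e0.
have ep : e = (nm e)%:C by rewrite -nmE gtr0_norm.
have e0' : 0 < nm e by rewrite -ltcR -ep.
near=> n; rewrite nmE ep ltcR nmBC.
by near: n; move/cvgr0_norm_lt : ua => /(_ _ e0'); apply: filterS => n; rewrite ger0_norm ?nm_ge0.
Unshelve. all: by end_near. Qed.

Lemma ccvg_nm u a : ccvg u a -> (fun n => nm (u n)) @ \oo --> nm a.
Proof.
move=> ua; apply: cvg_sub0 (cvg_cst (nm a)).
apply/norm_cvg0P; apply: (squeeze_cvgr _ _ ua); last exact: cvg_cst.
apply: nearW => n /=; rewrite normr_ge0 /= !fctE ler_norml.
have h1 := nmD (u n - a) a; have h2 := nmD (a - u n) (u n).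
move: h1 h2; rewrite !subrK (nmBC a) => h1 h2.
by apply/andP; split; lra.
Qed.

Lemma ccvg_unshift k u a : ccvg (fun n => u (n + k)%N) a -> ccvg u a.
Proof. by rewrite /ccvg => ua; rewrite -(cvg_shiftn k (fun n => nm (u n - a))). Qed.

(** Dominating sequences. The bound is kept explicit, so that bounds on double
    series can be stated with the same predicate. *)
Definition dom (b : nat -> R) (M : R) : Prop :=
  (forall i, 0 <= b i) /\ forall n, \sum_(i < n) b i <= M.

Lemma dom_lim b M : dom b M -> exists B, [/\ B <= M, forall n, \sum_(i < n) b i <= B &
  (fun n => \sum_(i < n) b i) @ \oo --> B].
Proof.
move=> [b0 bM]; pose s n := \sum_(i < n) b i.
have nd : nondecreasing_seq s.
  apply/nondecreasing_seqP => n; rewrite /s big_ord_recr /= lerDl; exact: b0.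
have cs : cvgn s by apply: nondecreasing_is_cvgn => //; exists M => _ [n _ <-]; exact: bM.
exists (limn s); split => //.
- by apply: limr_le => //; apply: nearW => n; exact: bM.
- exact: nondecreasing_cvgn_le.
Qed.

Lemma dom_ge0 b M : dom b M -> 0 <= M.
Proof. by move=> [_ /(_ 0%N)]; rewrite big_ord0. Qed.

Lemma dom_le b c M : (forall i, 0 <= b i <= c i) -> dom c M -> dom b M.
Proof.
move=> bc [c0 cM]; split=> [i|n]; first by case/andP: (bc i).
by apply: le_trans (cM n); apply: ler_sum => i _; case/andP: (bc i).
Qed.

Lemma domM b M (K : R) : 0 <= K -> dom b M -> dom (fun n => K * b n) (K * M).
Proof.
move=> K0 [b0 bM]; split=> [i|n]; first exact: mulr_ge0.
by rewrite -mulr_sumr ler_wpM2l.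
Qed.

Lemma domD b c M1 M2 : dom b M1 -> dom c M2 -> dom (fun n => b n + c n) (M1 + M2).
Proof.
by move=> [b0 bM] [c0 cM]; split=> [i|n]; [exact: addr_ge0|rewrite big_split lerD].
Qed.

Lemma dom_term b M i : dom b M -> b i <= M.
Proof.
move=> [b0 bM]; apply: le_trans (bM i.+1); rewrite big_ord_recr /= lerDr.
by apply: sumr_ge0 => k _; exact: b0.
Qed.

Lemma dom_geom (r : R) : 0 <= r < 1 -> dom (fun n => r ^+ n) (1 - r)^-1.
Proof.
move=> /andP[r0 r1]; split=> [i|n]; first exact: exprn_ge0.
have d0 : 0 < 1 - r by rewrite subr_gt0.
rewrite -[leRHS]mul1r ler_pdivlMr // mulrC.
have -> : (1 - r) * (\sum_(i < n) r ^+ i) = 1 - r ^+ n.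
  by apply: oppr_inj; rewrite -mulNr !opprB subrX1.
by rewrite gerBl exprn_ge0.
Qed.

Lemma triangle_sum (V : pzRingType) (a b : nat -> V) n :
  \sum_(k < n) \sum_(i < k.+1) a i * b (k - i)%N =
  \sum_(i < n) a i * \sum_(j < n - i) b j.
Proof.
elim: n => [|n IH]; first by rewrite !big_ord0.
rewrite big_ord_recr /= IH [in RHS]big_ord_recr /= subSnn big_ord1 big_ord_recr /= subnn addrA.
congr (_ + _); rewrite -big_split /=; apply: eq_bigr => i _.
by rewrite subSn ?(ltnW (ltn_ord i)) // big_ord_recr /= mulrDr.
Qed.

Lemma dom_cauchy b c M1 M2 : dom b M1 -> dom c M2 ->
  dom (fun n => \sum_(i < n.+1) b i * c (n - i)%N) (M1 * M2).
Proof.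
move=> [b0 bM] d2; have [c0 cM] := d2; split=> [n|n].
  by apply: sumr_ge0 => i _; exact: mulr_ge0.
rewrite triangle_sum; apply: (@le_trans _ _ (\sum_(i < n) b i * M2)).
  by apply: ler_sum => i _; rewrite ler_wpM2l.
by rewrite -mulr_suml ler_wpM2r // (dom_ge0 d2).
Qed.

(** The third Cauchy power of the geometric series has quadratically growing coefficients. *)
Lemma dom_sqr_geom (r : R) : 0 <= r < 1 -> exists M, dom (fun n => (n.+1)%:R ^+ 2 * r ^+ n) M.
Proof.
move=> r01; have d := dom_geom r01; have d2 := dom_cauchy d d; have d3 := dom_cauchy d2 d.
exists (2 * ((1 - r)^-1 * (1 - r)^-1 * (1 - r)^-1)).
have [r0 _] := andP r01.
apply: (dom_le _ (domM _ d3)) => // n; rewrite mulr_ge0 ?exprn_ge0 //=.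
have e1 i : \sum_(j < i.+1) r ^+ j * r ^+ (i - j) = i.+1%:R * r ^+ i.
  rewrite (eq_bigr (fun=> r ^+ i)); first by rewrite sumr_const card_ord mulr_natl.
  by move=> j _; rewrite -exprD subnKC // -ltnS.
rewrite (eq_bigr (fun i : 'I_n.+1 => i.+1%:R * r ^+ n)); last first.
  by move=> i _; rewrite e1 -mulrA -exprD subnKC // -ltnS.
rewrite -mulr_suml mulrA ler_wpM2r ?exprn_ge0 //.
have -> : \sum_(i < n.+1) i.+1%:R = n.+1%:R * (n.+2)%:R / 2 :> R.
  elim: n => [|n IH]; first by rewrite big_ord1 mul1r divff ?pnatr_eq0.
  by rewrite big_ord_recr /= IH -!natr1; field.
rewrite mulrCA divff ?pnatr_eq0 // mulr1 expr2 ler_wpM2l // ler_nat //.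
Qed.

Definition sumto (u : nat -> R[i]) (s : R[i]) : Prop := ccvg (fun n => \sum_(i < n) u i) s.
Definition Csum (u : nat -> R[i]) : R[i] := xget 0 [set s | sumto u s].

Lemma CsumE u s : sumto u s -> Csum u = s.
Proof. by move=> us; apply: xget_unique => // y; move/ccvg_uniq; apply. Qed.

Lemma sumto_uniq u s t : sumto u s -> sumto u t -> s = t.
Proof. exact: ccvg_uniq. Qed.

Lemma eq_sumto u v s : u =1 v -> sumto u s -> sumto v s.
Proof. by move=> uv; apply: eq_ccvg => n; apply: eq_bigr => i _; exact: uv. Qed.

Lemma eq_Csum u v : u =1 v -> Csum u = Csum v.
Proof. by move=> uv; congr Csum; apply/funext. Qed.

Lemma sumtoD u v s t : sumto u s -> sumto v t -> sumto (fun n => u n + v n) (s + t).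
Proof. by move=> us vt; apply: eq_ccvg (ccvgD us vt) => n; rewrite big_split. Qed.
Lemma sumtoZ c u s : sumto u s -> sumto (fun n => c * u n) (c * s).
Proof. by move=> us; apply: eq_ccvg (ccvgZ c us) => n; rewrite mulr_sumr. Qed.
Lemma sumtoB u v s t : sumto u s -> sumto v t -> sumto (fun n => u n - v n) (s - t).
Proof. by move=> us vt; apply: eq_ccvg (ccvgB us vt) => n; rewrite sumrB. Qed.
Lemma sumto_sum (I : Type) (r : seq I) (u : I -> nat -> R[i]) (s : I -> R[i]) :
  (forall i, sumto (u i) (s i)) -> sumto (fun n => \sum_(i <- r) u i n) (\sum_(i <- r) s i).
Proof.
by move=> us; apply: eq_ccvg (ccvg_sum r us) => n; rewrite exchange_big.
Qed.

Lemma sumto_fin u N : (forall i, (N <= i)%N -> u i = 0) -> sumto u (\sum_(i < N) u i).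
Proof.
move=> u0; apply: ccvg_near (ccvg_cst _); exists N => // n /= Nn.
by rewrite -(subnKC Nn) big_split_ord /= [X in _ + X]big1 ?addr0 // => i _; rewrite u0 ?leq_addr.
Qed.

Lemma sumto_recl u s : sumto (fun n => u n.+1) s -> sumto u (u 0%N + s).
Proof.
move=> us; apply: (@ccvg_unshift 1); apply: eq_ccvg (ccvgD (ccvg_cst (u 0%N)) us) => n.
by rewrite addn1 big_ord_recl.
Qed.

Lemma sumto_sumto u b M : dom b M -> (forall i, nm (u i) <= b i) -> sumto u (Csum u).
Proof.
move=> dM ub; have [b0 bM] := dM.
have cv (f : R[i] -> R) : (forall x, `|f x| <= nm x) -> cvgn (series (fun k => f (u k))).
  move=> fn; apply: normed_cvg; apply: nondecreasing_is_cvgn.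
    by apply/nondecreasing_seqP => n; rewrite -subr_ge0 seriesSB normr_ge0.
  exists M => _ [n _ <-]; apply: le_trans (bM n).
  change (\sum_(0 <= k < n) `|f (u k)| <= \sum_(i < n) b i); rewrite big_mkord.
  by apply: ler_sum => i _; apply: le_trans (fn _) _.
have [cR cI] := (cv _ nm_Re, cv _ nm_Im).
suff us : sumto u (limn (series (fun k => complex.Re (u k))) +i* limn (series (fun k => complex.Im (u k)))).
  by rewrite (CsumE us).
by apply: ccvg_ReIm; [move: cR|move: cI]; rewrite /= => c;
  (apply: cvg_trans c; apply: near_eq_cvg; apply: nearW => n; rewrite /series /= big_mkord raddf_sum).
Qed.

Lemma Csum_le u b M : dom b M -> (forall i, nm (u i) <= b i) -> nm (Csum u) <= M.
Proof.
move=> dM ub; apply: (ccvg_le (sumto_sumto dM ub)) => n.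
by apply: le_trans (nm_sum _ _ _) _; apply: le_trans (dM.2 n); exact: ler_sum.
Qed.

Lemma Csum_tail u b M K : dom b M -> (forall i, nm (u i) <= b i) ->
  nm (Csum u - \sum_(i < K) u i) <= M - \sum_(i < K) b i.
Proof.
move=> dM ub; have us := ccvgB (ccvg_shift K (sumto_sumto dM ub)) (ccvg_cst (\sum_(i < K) u i)).
apply: (ccvg_le us) => n; rewrite addnC big_split_ord /= [_ + \sum_(_ < n) _]addrC addrK.
apply: le_trans (nm_sum _ _ _) _; rewrite lerBrDl.
apply: le_trans (dM.2 (K + n)%N); rewrite big_split_ord /= lerD2l.
by apply: ler_sum => i _; exact: ub.
Qed.

(** Dominated convergence for series: the tails are uniformly small. *)
Lemma tannery (u : nat -> nat -> R[i]) (l : nat -> R[i]) b M : dom b M ->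
  (forall n k, nm (u n k) <= b k) -> (forall k, ccvg (fun n => u n k) (l k)) ->
  ccvg (fun n => Csum (u n)) (Csum l).
Proof.
move=> dM ub ul; have [B [BM bB cB]] := dom_lim dM.
have dB : dom b B by split => //; case: dM.
have lb k : nm (l k) <= b k by apply: (ccvg_le (ul k)) => n; exact: ub.
apply/cvgr0Pnorm_lt => e e0.
have e4 : 0 < e / 4 by rewrite divr_gt0.
have [K _ HK] : \forall K \near \oo, B - \sum_(i < K) b i < e / 4.
  by move/cvgrPdist_lt : cB => /(_ _ e4); apply: filterS => K; apply: le_lt_trans; exact: ler_norm.
have tK : B - \sum_(i < K) b i < e / 4 by apply: HK => /=.
have cK : ccvg (fun n => \sum_(k < K) u n k) (\sum_(k < K) l k).
  exact: ccvg_sum (fun k : 'I_K => ul k).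
near=> n; rewrite ger0_norm ?nm_ge0 //.
have -> : Csum (u n) - Csum l = (Csum (u n) - \sum_(k < K) u n k) +
   (\sum_(k < K) u n k - \sum_(k < K) l k) - (Csum l - \sum_(k < K) l k).
  by ring.
apply: le_lt_trans (nmB _ _) _.
have h1 : nm (Csum (u n) - \sum_(k < K) u n k) < e / 4 := le_lt_trans (Csum_tail K dB (ub n)) tK.
have h2 : nm (Csum l - \sum_(k < K) l k) < e / 4 := le_lt_trans (Csum_tail K dB lb) tK.
have h3 : nm (\sum_(k < K) u n k - \sum_(k < K) l k) < e / 4.
  near: n; move/cvgr0_norm_lt : cK => /(_ _ e4); apply: filterS => n; rewrite ger0_norm ?nm_ge0 //.
have h4 := nmD (Csum (u n) - \sum_(k < K) u n k) (\sum_(k < K) u n k - \sum_(k < K) l k).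
lra.
Unshelve. all: by end_near. Qed.

(** The second clause makes the column sums absolutely summable in turn. *)
Lemma fubini (a : nat -> nat -> R[i]) (b : nat -> nat -> R) (B : nat -> R) M :
  dom B M -> (forall i, dom (b i) (B i)) -> (forall i j, nm (a i j) <= b i j) ->
  sumto (fun j => Csum (fun i => a i j)) (Csum (fun i => Csum (a i))) /\
  forall n, \sum_(j < n) nm (Csum (fun i => a i j)) <= M.
Proof.
move=> dB db ab; have aB j i : nm (a i j) <= B i by apply: le_trans (ab i j) (dom_term j (db i)).
split.
  apply: (@eq_ccvg (fun n => Csum (fun i => \sum_(j < n) a i j))).
    move=> n; apply: CsumE; apply: sumto_sum => j; exact: sumto_sumto dB (aB j).
  apply: (tannery dB) => [n i|i]; last exact: sumto_sumto (db i) (ab i).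
  apply: le_trans (nm_sum _ _ _) _; apply: le_trans ((db i).2 n).
  by apply: ler_sum => j _; exact: ab.
move=> n; have h (m : nat) : \sum_(j < n) nm (\sum_(i < m) a i j) <= M.
  apply: (@le_trans _ _ (\sum_(j < n) \sum_(i < m) nm (a i j))).
    by apply: ler_sum => j _; exact: nm_sum.
  rewrite exchange_big /=; apply: le_trans (dB.2 m); apply: ler_sum => i _.
  by apply: le_trans ((db i).2 n); apply: ler_sum => j _; exact: ab.
have c : (fun m => \sum_(j < n) nm (\sum_(i < m) a i j)) @ \oo --> \sum_(j < n) nm (Csum (fun i => a i j)).
  have cj (j : 'I_n) : (fun m => nm (\sum_(i < m) a i j)) @ \oo --> nm (Csum (fun i => a i j)).
    by apply: ccvg_nm; exact: sumto_sumto dB (aB j).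
  elim: (index_enum _) => [|j s IH].
    by rewrite big_nil; under eq_fun do rewrite big_nil; exact: cvg_cst.
  by rewrite big_cons; under eq_fun do rewrite big_cons; exact: cvgD.
by apply: (ler_cvg_to c (cvg_cst M)); exact: nearW.
Qed.

Lemma sumto_cauchy (u v : nat -> R[i]) b c M1 M2 : dom b M1 -> dom c M2 ->
  (forall i, nm (u i) <= b i) -> (forall i, nm (v i) <= c i) ->
  sumto (fun n => \sum_(i < n.+1) u i * v (n - i)%N) (Csum u * Csum v).
Proof.
move=> db dc ub vc.
have db' := domM (dom_ge0 dc) db.
pose a i n := if (i <= n)%N then u i * v (n - i)%N else 0.
pose d i n := if (i <= n)%N then b i * c (n - i)%N else 0.
have bi := db.1.
have dd i : dom (d i) (M2 * b i).
  split=> [n|n]; first by rewrite /d; case: ifP => // _; rewrite mulr_ge0 // dc.1.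
  case: (leqP i n) => [le|lt].
    rewrite -(subnKC le) big_split_ord /= big1 ?add0r.
      under eq_bigr do rewrite /d leq_addr addKn.
      by rewrite -mulr_sumr mulrC ler_wpM2r // dc.2.
    by move=> k _; rewrite /d leqNgt ltn_ord.
  rewrite big1 ?mulr_ge0 ?(dom_ge0 dc) // => k _.
  by rewrite /d leqNgt (ltn_trans (ltn_ord k) lt).
have ad i n : nm (a i n) <= d i n.
  by rewrite /a /d; case: ifP => _; rewrite ?nm0 // nmM ler_pM ?nm_ge0.
have [h _] := fubini db' dd ad.
have e1 : Csum (fun i => Csum (a i)) = Csum u * Csum v.
  rewrite mulrC; rewrite -(CsumE (sumtoZ (Csum v) (sumto_sumto db ub))); apply: eq_Csum => i.
  apply: CsumE; apply: (@ccvg_unshift i); rewrite mulrC.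
  apply: eq_ccvg (ccvgZ (u i) (sumto_sumto dc vc)) => n.
  rewrite addnC big_split_ord /= [X in _ = X + _]big1 ?add0r; last by move=> k _; rewrite /a leqNgt ltn_ord.
  by rewrite mulr_sumr; apply: eq_bigr => k _; rewrite /a leq_addr addKn.
rewrite -e1; apply: eq_sumto h => n; apply: CsumE.
have -> : \sum_(i < n.+1) u i * v (n - i)%N = \sum_(i < n.+1) a i n.
  by apply: eq_bigr => i _; rewrite /a -ltnS ltn_ord.
by apply: sumto_fin => i; rewrite /a ltnNge => /negbTE ->.
Qed.

End Modulus.

Lemma ccvg_expr (R : realType) (z : R[i]) : nm z < 1 -> ccvg (fun n => z ^+ n) 0.
Proof.
move=> z1; apply: (ccvg_bound (v := fun n => nm z ^+ n)).
  by move=> n; rewrite subr0 nmX.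
have := @cvg_geometric R 1 (nm z); rewrite ger0_norm ?nm_ge0 // => /(_ z1).
by apply: cvg_trans; apply: near_eq_cvg; apply: nearW => n; rewrite /geometric /= mul1r.
Qed.

(** * q-shifted factorials *)

Section QPochhammer.
Variables (R : realType) (q : R[i]).
Hypothesis q1 : nm q < 1.
Implicit Types a z : R[i].
Local Notation p := (nm q).
Local Notation P a n := (qpoch a q n).
Local Notation Pi a := (qpoch_inf a q).

Let p0 : 0 <= p := nm_ge0 q.
Let p01 : 0 <= p < 1. Proof. by rewrite p0 q1. Qed.
Let d0 : 0 < 1 - p. Proof. by rewrite subr_gt0. Qed.

Lemma qpoch0 a : P a 0 = 1. Proof. by rewrite /qpoch big_ord0. Qed.
Lemma qpochS a n : P a n.+1 = P a n * (1 - a * q ^+ n).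
Proof. by rewrite /qpoch big_ord_recr. Qed.
Lemma qpochSl a n : P a n.+1 = (1 - a) * P (a * q) n.
Proof.
rewrite /qpoch big_ord_recl expr0 mulr1; congr (_ * _).
by apply: eq_bigr => i _; rewrite /= -mulrA -exprS.
Qed.
Lemma qpochD a m n : P a (m + n) = P a m * P (a * q ^+ m) n.
Proof.
rewrite /qpoch big_split_ord; congr (_ * _).
by apply: eq_bigr => i _; rewrite /= exprD mulrA.
Qed.
Lemma qpoch_0 n : P 0 n = 1.
Proof. by rewrite /qpoch big1 // => i _; rewrite mul0r subr0. Qed.

Lemma qpoch_bound a x n : nm a <= x -> nm (P a n) <= expR (x / (1 - p)).
Proof.
move=> ax; have x0 : 0 <= x := le_trans (nm_ge0 a) ax.
rewrite /qpoch nm_prod; apply: (@le_trans _ _ (\prod_(i < n) expR (x * p ^+ i))).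
  apply: ler_prod => i _; rewrite nm_ge0 /=; apply: le_trans (nmB _ _) _.
  rewrite nm1 nmM nmX; apply: le_trans (expR_ge1Dx _); rewrite lerD2l.
  by rewrite ler_wpM2r ?exprn_ge0.
rewrite -expR_sum ler_expR -mulr_sumr ler_wpM2l //.
exact: (dom_geom p01).2.
Qed.

Lemma qpoch_Vbound a x n : nm a <= x -> x < 1 ->
  nm (P a n)^-1 <= expR (x / (1 - x) / (1 - p)).
Proof.
move=> ax x1; have x0 : 0 <= x := le_trans (nm_ge0 a) ax.
have dx : 0 < 1 - x by rewrite subr_gt0.
have y0 : 0 <= x / (1 - x) by rewrite divr_ge0 // ltW.
rewrite /qpoch -prodfV nm_prod.
apply: (@le_trans _ _ (\prod_(i < n) expR (x / (1 - x) * p ^+ i))).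
  apply: ler_prod => i _; rewrite nm_ge0 /= nmV; apply: le_trans (expR_ge1Dx _).
  have t1 : p ^+ i <= 1 by rewrite exprn_ile1 // ltW.
  have t0 : 0 <= p ^+ i by rewrite exprn_ge0.
  have h : 1 - x * p ^+ i <= nm (1 - a * q ^+ i).
    have := nmD (1 - a * q ^+ i) (a * q ^+ i); rewrite subrK nm1 nmM nmX => h.
    rewrite lerBlDr; apply: le_trans h _; rewrite lerD2l.
    by rewrite ler_wpM2r.
  have xt : x * p ^+ i <= x by rewrite ler_piMr.
  have h' : 0 < 1 - x * p ^+ i by lra.
  apply: (@le_trans _ _ (1 - x * p ^+ i)^-1).
    by rewrite lef_pV2 // posrE // (lt_le_trans h').
  rewrite -[leLHS]mul1r ler_pdivrMr // -subr_ge0.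
  have -> : (1 + x / (1 - x) * p ^+ i) * (1 - x * p ^+ i) - 1 = 
     x / (1 - x) * p ^+ i * (x - x * p ^+ i) by field; lra.
  by rewrite !mulr_ge0 // ?subr_ge0 // invr_ge0 ltW.
rewrite -expR_sum ler_expR -mulr_sumr ler_wpM2l //.
exact: (dom_geom p01).2.
Qed.

Lemma qpoch_neq0 a n : nm a < 1 -> P a n != 0.
Proof.
move=> a1; apply/prodf_neq0 => i _; rewrite subr_eq0 eq_sym.
apply/eqP => h; have : nm (a * q ^+ i) < 1; last by rewrite h nm1 ltxx.
rewrite nmM nmX; apply: le_lt_trans a1; rewrite ler_piMr ?nm_ge0 //.
by rewrite exprn_ile1 // ltW.
Qed.

(** Telescoping the partial products turns the infinite product into an absolutely
    convergent series. *)
Lemma qpoch_sum a n : P a n = 1 + \sum_(k < n) - (a * q ^+ k * P a k).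
Proof.
elim: n => [|n IH]; first by rewrite qpoch0 big_ord0 addr0.
by rewrite big_ord_recr /= addrA -IH qpochS; ring.
Qed.

Lemma qpochV_sum a n : nm a < 1 -> (P a n)^-1 = 1 + \sum_(k < n) a * q ^+ k / P a k.+1.
Proof.
move=> a1; elim: n => [|n IH]; first by rewrite qpoch0 big_ord0 addr0 invr1.
rewrite big_ord_recr /= addrA -IH.
have := qpoch_neq0 n.+1 a1; rewrite qpochS mulf_eq0 negb_or => /andP[h1 h2].
by field; rewrite h1 h2.
Qed.

Lemma dom_pgeom x K : 0 <= x -> 0 <= K ->
  dom (fun k => x * p ^+ k * K) (x * K / (1 - p)).
Proof.
move=> x0 K0; have := domM (mulr_ge0 x0 K0) (dom_geom p01).
by apply: dom_le => i; rewrite mulr_ge0 ?mulr_ge0 ?exprn_ge0 //= mulrAC.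
Qed.

Lemma qpoch_sumto a : sumto (fun k => - (a * q ^+ k * P a k)) (Csum (fun k => - (a * q ^+ k * P a k))).
Proof.
apply: (sumto_sumto (dom_pgeom (nm_ge0 a) (expR_ge0 (nm a / (1 - p))))) => k.
by rewrite nmN !nmM nmX ler_wpM2l ?mulr_ge0 ?nm_ge0 ?exprn_ge0 // qpoch_bound.
Qed.

Lemma qpoch_cvg_sum a : ccvg (fun n => P a n) (1 + Csum (fun k => - (a * q ^+ k * P a k))).
Proof.
by apply: eq_ccvg (ccvgD (ccvg_cst 1) (qpoch_sumto a)) => n; rewrite -qpoch_sum.
Qed.

Lemma qinf_sum a : Pi a = 1 + Csum (fun k => - (a * q ^+ k * P a k)).
Proof. exact: ccvg_limn (qpoch_cvg_sum a). Qed.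

Lemma qpoch_cvg a : ccvg (fun n => P a n) (Pi a).
Proof. by rewrite qinf_sum; exact: qpoch_cvg_sum. Qed.

Lemma qinf_bound a x : nm a <= x -> nm (Pi a) <= expR (x / (1 - p)).
Proof. by move=> ax; apply: (ccvg_le (qpoch_cvg a)) => n; exact: qpoch_bound. Qed.

Lemma qinf_split a n : Pi a = P a n * Pi (a * q ^+ n).
Proof.
apply: (ccvg_uniq (ccvg_shift n (qpoch_cvg a))).
apply: eq_ccvg (ccvgZ (P a n) (qpoch_cvg (a * q ^+ n))) => m.
by rewrite addnC qpochD.
Qed.

Lemma qinf_rec a : Pi a = (1 - a) * Pi (a * q).
Proof. by rewrite (qinf_split a 1) qpochS qpoch0 mul1r expr0 mulr1 expr1. Qed.

Lemma qinf0 : Pi 0 = 1.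
Proof.
by apply: (ccvg_uniq (qpoch_cvg 0)); apply: eq_ccvg (ccvg_cst 1) => n; rewrite qpoch_0.
Qed.

Lemma qinf_neq0 a : nm a < 1 -> Pi a != 0.
Proof.
move=> a1; have h := qpoch_cvg a; apply/eqP => e; move: h; rewrite e => h.
pose M := expR (nm a / (1 - nm a) / (1 - p)).
have h1 : ccvg (fun=> 1 : R[i]) 0.
  apply: (ccvg_bound (v := fun n => nm (P a n - 0) * M)).
    move=> n; rewrite !subr0 -(divff (qpoch_neq0 n a1)) nmM ler_wpM2l ?nm_ge0 //.
    exact: qpoch_Vbound.
  by rewrite -(mul0r M); apply: cvgMl.
by have /eqP := ccvg_uniq h1 (ccvg_cst 1); rewrite eq_sym oner_eq0.
Qed.

Lemma qinf_Vbound a x : nm a <= x -> x < 1 ->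
  nm (Pi a)^-1 <= expR (x / (1 - x) / (1 - p)).
Proof.
move=> ax x1; have a1 := le_lt_trans ax x1; have := qinf_neq0 a1.
rewrite -nm_gt0 nmV => h; rewrite -[leLHS]mul1r ler_pdivrMr // mulrC -ler_pdivrMr ?expR_gt0 //.
have cn := ccvg_nm (qpoch_cvg a); apply: (ler_cvg_to (cvg_cst _) cn); apply: nearW => n.
have := qpoch_neq0 n a1; rewrite -nm_gt0 => hn.
by rewrite ler_pdivrMr ?expR_gt0 // -ler_pdivrMl // mulr1 -nmV qpoch_Vbound.
Qed.

Lemma qpochV_cvg a : nm a < 1 -> ccvg (fun n => (P a n)^-1) (Pi a)^-1.
Proof.
move=> a1; pose M := expR (nm a / (1 - nm a) / (1 - p)).
apply: (ccvg_bound (v := fun n => nm (P a n - Pi a) * (M * M))); last first.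
  by rewrite -(mul0r (M * M)); apply: cvgMl; exact: qpoch_cvg.
move=> n; have -> : (P a n)^-1 - (Pi a)^-1 = (Pi a - P a n) * ((P a n)^-1 * (Pi a)^-1).
  by field; rewrite qpoch_neq0 // qinf_neq0.
rewrite !nmM nmBC ler_wpM2l ?nm_ge0 // ler_pM ?nm_ge0 //.
  exact: qpoch_Vbound.
exact: qinf_Vbound.
Qed.

Lemma qinfV_sum a : nm a < 1 -> (Pi a)^-1 = 1 + Csum (fun k => a * q ^+ k / P a k.+1).
Proof.
move=> a1; apply: (ccvg_uniq (qpochV_cvg a1)).
have h : sumto (fun k => a * q ^+ k / P a k.+1) (Csum (fun k => a * q ^+ k / P a k.+1)).
  apply: (sumto_sumto (dom_pgeom (nm_ge0 a) (expR_ge0 (nm a / (1 - nm a) / (1 - p))))) => k.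
  by rewrite !nmM nmX ler_wpM2l ?mulr_ge0 ?nm_ge0 ?exprn_ge0 // qpoch_Vbound.
by apply: eq_ccvg (ccvgD (ccvg_cst 1) h) => n; rewrite -qpochV_sum.
Qed.

Lemma qinf_near1 a x : nm a <= x -> nm (Pi a - 1) <= nm a * (expR (x / (1 - p)) / (1 - p)).
Proof.
move=> ax; rewrite qinf_sum addrC addKr.
rewrite mulrA; apply: (Csum_le (dom_pgeom (nm_ge0 a) (expR_ge0 (x / (1 - p))))) => k.
by rewrite nmN !nmM nmX ler_wpM2l ?mulr_ge0 ?nm_ge0 ?exprn_ge0 // qpoch_bound.
Qed.

Lemma ccvg_qn c : ccvg (fun n => c * q ^+ n) 0.
Proof. by rewrite -(mulr0 c); exact: ccvgZ (ccvg_expr q1). Qed.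

Lemma nm_qn c n : nm (c * q ^+ n) <= nm c.
Proof. by rewrite nmM nmX ler_piMr ?nm_ge0 // exprn_ile1 // ltW. Qed.

Lemma qratio_rec a n : P a n.+1 / P q n.+1 * (1 - q ^+ n.+1) = P a n / P q n * (1 - a * q ^+ n).
Proof.
have := qpoch_neq0 n.+1 q1; rewrite !qpochS -exprS mulf_eq0 negb_or => /andP[].
move: (P a n) (P q n) (q ^+ n.+1) (q ^+ n) => A B C D h1 h2.
by field; rewrite h1 h2.
Qed.
Definition qmaj x := expR (x / (1 - p)) * expR (p / (1 - p) / (1 - p)).

Lemma qratio_bound a x n : nm a <= x -> nm (P a n / P q n) <= qmaj x.
Proof.
by move=> ax; rewrite nmM ler_pM ?nm_ge0 ?qpoch_bound ?qpoch_Vbound.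
Qed.

Lemma qmaj_ge0 x : 0 <= qmaj x. Proof. by rewrite mulr_ge0 ?expR_ge0. Qed.

(** The q-binomial theorem: both sides satisfy (1 - z) f(z) = (1 - a z) f(q z)
    and are continuous at 0, where they equal 1. *)
Lemma q_binomial a z : nm z < 1 -> sumto (fun n => P a n / P q n * z ^+ n) (Pi (a * z) / Pi z).
Proof.
move=> z1; pose cq n := P a n / P q n; pose f w := Csum (fun n => cq n * w ^+ n).
have z01 : 0 <= nm z < 1 by rewrite nm_ge0.
have dz := domM (qmaj_ge0 (nm a)) (dom_geom z01).
have sf w : nm w <= nm z -> sumto (fun n => cq n * w ^+ n) (f w).
  move=> wz; apply: (sumto_sumto dz) => n; rewrite nmM nmX ler_pM ?nm_ge0 ?exprn_ge0 ?nm_ge0 //.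
    exact: qratio_bound.
  by rewrite lerXn2r ?nnegrE ?nm_ge0.
have lim1 : ccvg (fun n => f (z * q ^+ n)) 1.
  have f0 : f 0 = 1.
    rewrite /f; apply: CsumE; apply: (@ccvg_unshift _ 1); apply: eq_ccvg (ccvg_cst 1) => n.
    rewrite addn1 big_ord_recl big1 => [|i _]; last by rewrite /= expr0n mulr0.
    by rewrite /cq !qpoch0 divr1 expr0 mulr1 addr0.
  rewrite -{1}f0; apply: (tannery dz) => [n k|k].
    rewrite nmM nmX ler_pM ?nm_ge0 ?exprn_ge0 ?nm_ge0 ?qratio_bound //.
    by rewrite lerXn2r ?nnegrE ?nm_ge0 ?nm_qn.
  apply: ccvgZ; elim: k => [|k IH].
    by rewrite expr0; apply: eq_ccvg (ccvg_cst 1) => n; rewrite expr0.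
  by rewrite exprS; apply: eq_ccvg (ccvgM (ccvg_qn z) IH) => n; rewrite exprS.
have f2 w : nm w <= nm z -> f w - f (w * q) = w * f w - a * w * f (w * q).
  move=> wz; have wqz : nm (w * q) <= nm z.
    by apply: le_trans wz; have := nm_qn w 1; rewrite expr1.
  apply: (ccvg_uniq (ccvgS (sumtoB (sf _ wz) (sf _ wqz)))).
  apply: eq_ccvg (sumtoB (sumtoZ w (sf _ wz)) (sumtoZ (a * w) (sf _ wqz))) => n.
  rewrite big_ord_recl /= !expr0 subrr add0r; apply: eq_bigr => i _.
  rewrite /bump /= add1n !exprMn -!mulrBr.
  have -> : w ^+ i.+1 - w ^+ i.+1 * q ^+ i.+1 = (1 - q ^+ i.+1) * (w * w ^+ i).
    by rewrite exprS; move: (w ^+ i) (q ^+ i.+1) => A B; ring.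
  rewrite [RHS]mulrA /cq qratio_rec; move: (P a i / P q i) (w ^+ i) (q ^+ i) => A B C; ring.
clearbody f.
have step w : nm w <= nm z -> f w * (1 - w) = (1 - a * w) * f (w * q).
  move=> /f2; move: (f w) (f (w * q)) => A B h; apply/eqP; rewrite -subr_eq0.
  have -> : A * (1 - w) - (1 - a * w) * B = A - B - (w * A - a * w * B) by ring.
  by rewrite h subrr.
have iter n : f z * P z n = P (a * z) n * f (z * q ^+ n).
  elim: n => [|n IH]; first by rewrite !qpoch0 expr0 !mulr1 mul1r.
  rewrite !qpochS mulrA IH -mulrA step ?nm_qn //.
  by rewrite !mulrA exprSr mulrA.
have h : f z * Pi z = Pi (a * z).
  rewrite -[RHS]mulr1; apply: (ccvg_uniq (ccvgZ (f z) (qpoch_cvg z))).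
  by apply: eq_ccvg (ccvgM (qpoch_cvg (a * z)) lim1) => n; rewrite -iter.
by rewrite -h mulfK ?qinf_neq0 //; exact: sf.
Qed.

End QPochhammer.

(** * Power series on a disc *)

Section PowerSeries.
Variable R : realType.
Implicit Types (c : nat -> R[i]) (f g : R[i] -> R[i]) (r B : R).

(** The bound B on the absolute sum is part of the data: it survives sums, products and
    dominated series of functions, and so gives the expansions of infinite products. *)
Definition psw r c B f : Prop :=
  dom (fun n => nm (c n) * r ^+ n) B /\
  forall z, nm z <= r -> sumto (fun n => c n * z ^+ n) (f z).

Definition psn r B f : Prop := exists c, psw r c B f.

Lemma psw_bnd r c z n : nm z <= r -> nm (c n * z ^+ n) <= nm (c n) * r ^+ n.
Proof.
move=> zr; rewrite nmM nmX ler_wpM2l ?nm_ge0 // lerXn2r ?nnegrE ?nm_ge0 //.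
exact: le_trans (nm_ge0 z) zr.
Qed.

Lemma eq_psn r B f g : (forall z, nm z <= r -> f z = g z) -> psn r B f -> psn r B g.
Proof. by move=> fg [c [d h]]; exists c; split => // z zr; rewrite -fg //; exact: h. Qed.

Lemma psn_le r B B' f : B <= B' -> psn r B f -> psn r B' f.
Proof.
move=> BB' [c [[d1 d2] h]]; exists c; split => //.
by split => // n; exact: le_trans (d2 n) BB'.
Qed.

Lemma psn_cst r a : 0 <= r -> psn r (nm a) (fun=> a).
Proof.
move=> r0; exists (fun n => if n is 0%N then a else 0); split.
  split=> [n|[|n]]; first by rewrite mulr_ge0 ?nm_ge0 ?exprn_ge0.
    by rewrite big_ord0 nm_ge0.
  rewrite big_ord_recl expr0 mulr1 big1 ?addr0 // => i _.
  exact: etrans (congr1 ( *%R^~ (r ^+ _)) (nm0 R)) (mul0r _).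
move=> z _; apply: (@ccvg_unshift _ 1); apply: eq_ccvg (ccvg_cst a) => n.
by rewrite addn1 big_ord_recl /= mulr1 big1 ?addr0 // => i _; rewrite mul0r.
Qed.

Lemma psn_id r : 0 <= r -> psn r r id.
Proof.
move=> r0; pose c (n : nat) : R[i] := if n is 1%N then 1 else 0.
have e (h : nat -> R) n : h 0%N = 0 -> (forall m, h m.+2 = 0) -> 0 <= h 1%N -> \sum_(i < n) h i <= h 1%N.
  move=> h0 h2 h1; case: n => [|[|n]]; rewrite ?big_ord0 // ?big_ord1 ?h0 //.
  by rewrite 2!big_ord_recl h0 add0r big1 ?addr0 // => i _; exact: h2.
exists c; split.
  split=> [n|n]; first by rewrite mulr_ge0 ?nm_ge0 ?exprn_ge0.
  have := @e (fun n => nm (c n) * r ^+ n) n; rewrite [c 1%N]/c nm1 mul1r expr1.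
  by apply=> // [|m]; rewrite /c nm0 mul0r.
move=> z _; apply: (@ccvg_unshift _ 2); apply: eq_ccvg (ccvg_cst z) => n.
rewrite addn2 !big_ord_recl /= mul0r add0r mul1r expr1 big1 ?addr0 // => i _.
by rewrite /= mul0r.
Qed.

Lemma psnD r B1 B2 f g : psn r B1 f -> psn r B2 g -> psn r (B1 + B2) (fun z => f z + g z).
Proof.
move=> [c [dc hc]] [d [dd hd]]; exists (fun n => c n + d n).
have r0 : forall n, 0 <= nm (c n) * r ^+ n := dc.1.
split; last first.
  by move=> z zr; apply: eq_sumto (sumtoD (hc _ zr) (hd _ zr)) => n; rewrite mulrDl.
split=> [n|n].
  have [->|cd0] := eqVneq (c n + d n) 0; first by rewrite nm0 mul0r.
  rewrite pmulr_rge0 ?nm_gt0 //; have [c0|c0] := eqVneq (c n) 0.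
    by have := dd.1 n; rewrite c0 add0r in cd0; rewrite pmulr_rge0 ?nm_gt0.
  by have := dc.1 n; rewrite pmulr_rge0 ?nm_gt0.
apply: (@le_trans _ _ (\sum_(i < n) (nm (c i) * r ^+ i + nm (d i) * r ^+ i))); last first.
  exact: (domD dc dd).2.
apply: ler_sum => i _.
have [h|h] := lerP 0 (r ^+ i); first by rewrite -mulrDl ler_wpM2r // nmD.
have z0 x : 0 <= nm x * r ^+ i -> x = 0.
  by rewrite nmulr_lge0 // => h'; apply/eqP; rewrite -nm_eq0 eq_le h' nm_ge0.
by rewrite (z0 _ (dc.1 i)) (z0 _ (dd.1 i)) addr0 nm0 !mul0r addr0.
Qed.

Lemma psnM r B1 B2 f g : 0 <= r -> psn r B1 f -> psn r B2 g -> psn r (B1 * B2) (fun z => f z * g z).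
Proof.
move=> r0 [c [dc hc]] [d [dd hd]]; exists (fun n => \sum_(i < n.+1) c i * d (n - i)%N).
split.
  apply: (dom_le _ (dom_cauchy dc dd)) => n; rewrite mulr_ge0 ?nm_ge0 ?exprn_ge0 //=.
  apply: (@le_trans _ _ (\sum_(i < n.+1) nm (c i) * nm (d (n - i)%N) * r ^+ n)).
    rewrite -mulr_suml ler_wpM2r ?exprn_ge0 //; apply: le_trans (nm_sum _ _ _) _.
    by apply: ler_sum => i _; rewrite nmM.
  apply: ler_sum => i _; rewrite mulrACA -exprD subnKC // -ltnS; exact: ltn_ord.
move=> z zr.
have h := sumto_cauchy dc dd (fun n => psw_bnd c n zr) (fun n => psw_bnd d n zr).
rewrite (CsumE (hc _ zr)) (CsumE (hd _ zr)) in h.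
apply: eq_sumto h => n; rewrite mulr_suml; apply: eq_bigr => i _.
by rewrite mulrACA -exprD subnKC // -ltnS.
Qed.

Lemma psnZ r B a f : 0 <= r -> psn r B f -> psn r (nm a * B) (fun z => a * f z).
Proof. by move=> r0; exact: psnM r0 (psn_cst a r0). Qed.

Lemma psn_lin r x (a : R[i]) : 0 <= r -> nm a * r <= x -> psn r (1 + x) (fun z => 1 - a * z).
Proof.
move=> r0 ax; apply: (@psn_le _ (nm 1 + nm (- a) * r)); first by rewrite nm1 nmN lerD2l.
have := psnD (psn_cst 1 r0) (psnZ (- a) r0 (psn_id r0)).
by apply: eq_psn => z _; rewrite mulNr.
Qed.

Lemma psn_bound r B f z : psn r B f -> nm z <= r -> nm (f z) <= B.
Proof.
move=> [c [d h]] zr; rewrite -(CsumE (h _ zr)); apply: (Csum_le d) => n.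
exact: psw_bnd.
Qed.

Lemma psn_inv r x (a : R[i]) : 0 <= r -> nm a * r <= x -> x < 1 ->
  psn r (1 - x)^-1 (fun z => (1 - a * z)^-1).
Proof.
move=> r0 ax x1; have ar0 : 0 <= nm a * r by rewrite mulr_ge0 ?nm_ge0.
have x01 : 0 <= x < 1 by rewrite x1 (le_trans ar0 ax).
exists (fun n => a ^+ n); split.
  apply: (dom_le _ (dom_geom x01)) => n; rewrite nmX -exprMn exprn_ge0 //=.
  by rewrite lerXn2r // nnegrE ?(le_trans ar0 ax).
move=> z zr; have az : nm (a * z) < 1.
  rewrite nmM; apply: le_lt_trans x1; apply: le_trans ax.
  by rewrite ler_wpM2l ?nm_ge0.
have nz : 1 - a * z != 0.
  by rewrite subr_eq0 eq_sym; apply/eqP => h; move: az; rewrite h nm1 ltxx.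
rewrite -[(1 - a * z)^-1]subr0 -(mulr0 (1 - a * z)^-1).
apply: eq_ccvg (ccvgB (ccvg_cst (1 - a * z)^-1) (ccvgZ (1 - a * z)^-1 (ccvg_expr az))) => n.
under eq_bigr do rewrite -exprMn.
apply: (mulfI nz); rewrite mulrBr mulrA divff // mul1r.
by apply: oppr_inj; rewrite opprB -mulNr opprB subrX1.
Qed.

Lemma psn_sum r (f : nat -> R[i] -> R[i]) (B : nat -> R) M : 0 < r -> dom B M ->
  (forall i, psn r (B i) (f i)) -> psn r M (fun z => Csum (fun i => f i z)).
Proof.
move=> r0 dB /choice[c hc]; have r0' := ltW r0.
have db i : dom (fun n => nm (c i n) * r ^+ n) (B i) := (hc i).1.
exists (fun n => Csum (fun i => c i n)).
have cs n : sumto (fun i => c i n) (Csum (fun i => c i n)).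
  have rn : 0 <= (r ^+ n)^-1 by rewrite invr_ge0 exprn_ge0.
  apply: (sumto_sumto (domM rn dB)) => i.
  by rewrite mulrC ler_pdivlMr ?exprn_gt0 // (dom_term n (db i)).
have e z n : Csum (fun i => c i n * z ^+ n) = Csum (fun i => c i n) * z ^+ n.
  by rewrite mulrC -(CsumE (sumtoZ (z ^+ n) (cs n))); apply: eq_Csum => i; rewrite mulrC.
have nr : nm (r%:C) = r by rewrite nmC ger0_norm.
have F z (zr : nm z <= r) := fubini dB db (fun i n => psw_bnd (c i) n zr).
split.
  split=> [n|n]; first by rewrite mulr_ge0 ?nm_ge0 ?exprn_ge0.
  have zr : nm (r%:C) <= r by rewrite nr.
  apply: le_trans ((F _ zr).2 n); apply: ler_sum => i _.
  by rewrite e nmM nmX nr.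
move=> z zr; have := (F _ zr).1.
have -> : Csum (fun i => Csum (fun n => c i n * z ^+ n)) = Csum (fun i => f i z).
  by apply: eq_Csum => i; exact: CsumE ((hc i).2 _ zr).
by apply: eq_sumto => n; exact: e.
Qed.

(** Dividing by z^n, the first nonzero coefficient would be the limit of 0 as z -> 0. *)
Lemma ps_coef0 r c B : 0 < r -> dom (fun n => nm (c n) * r ^+ n) B ->
  (forall z, z != 0 -> nm z <= r -> sumto (fun n => c n * z ^+ n) 0) -> forall n, c n = 0.
Proof.
move=> r0 dc h n; elim/ltn_ind: n => n IH.
have r0' := ltW r0.
pose K := r ^- n.+1 * B.
have K0 : 0 <= K by rewrite mulr_ge0 ?(dom_ge0 dc) // invr_ge0 exprn_ge0.
have key z : z != 0 -> nm z <= r -> nm (c n) <= nm z * K.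
  move=> z0 zr; have zn : z ^+ n != 0 by rewrite expf_neq0.
  have s1 : ccvg (fun m => \sum_(k < m) c (n + k)%N * z ^+ k) 0.
    have := ccvgZ (z ^- n) (ccvg_shift n (h z z0 zr)); rewrite mulr0.
    apply: eq_ccvg => m; rewrite addnC big_split_ord /= big1 ?add0r => [|i _].
      by rewrite mulr_sumr; apply: eq_bigr => i _; rewrite exprD mulrCA mulKf.
    by rewrite IH ?mul0r.
  have s2 := ccvgN (ccvgB (ccvgS s1) (ccvg_cst (c n))).
  rewrite sub0r opprK in s2.
  apply: (ccvg_le s2) => m; rewrite nmN big_ord_recl /= expr0 mulr1 addn0 addrC addKr.
  have Kd : \sum_(i < m) nm (c (n + i.+1)%N) * r ^+ i <= K.
    rewrite ler_pdivlMl ?exprn_gt0 //; apply: le_trans (dc.2 (n.+1 + m)%N).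
    rewrite big_split_ord /= mulr_sumr.
    rewrite -[leLHS]add0r lerD ?sumr_ge0 // => [i _|]; first exact: dc.1.
    by apply: ler_sum => i _; rewrite mulrCA -exprD addnS addSn.
  rewrite (eq_bigr (fun i : 'I_m => z * (c (n + i.+1)%N * z ^+ i))) => [|i _]; last first.
    by rewrite /bump /= add1n exprS mulrCA.
  rewrite -mulr_sumr nmM ler_wpM2l ?nm_ge0 //; apply: le_trans Kd.
  apply: le_trans (nm_sum _ _ _) _; apply: ler_sum => i _.
  exact: (psw_bnd (fun i => c (n + i.+1)%N)).
apply/eqP; rewrite -nm_eq0 eq_le nm_ge0 andbT.
have rc k : nm ((r / 2 ^+ k)%:C) = r / 2 ^+ k.
  by rewrite nmC ger0_norm // divr_ge0 // exprn_ge0.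
have lim : (fun k => r / 2 ^+ k * K) @ \oo --> (0 : R).
  rewrite -(mul0r K); apply: cvgMl.
  have := @cvg_geometric R r 2^-1; rewrite ger0_norm ?invr_ge0 // invf_lt1 // ltr1n => /(_ isT).
  by apply: cvg_trans; apply: near_eq_cvg; apply: nearW => k; rewrite /geometric /= exprVn.
apply: (ler_cvg_to (cvg_cst _) lim); apply: nearW => k; rewrite -rc; apply: key.
  by rewrite -nm_gt0 rc divr_gt0 ?exprn_gt0.
rewrite rc ler_pdivrMr ?exprn_gt0 // ler_peMr // exprn_ege1 // ler1n //.
Qed.

End PowerSeries.

Section PowerSeriesQ.
Variables (R : realType) (q : R[i]) (r : R).
Hypothesis (q1 : nm q < 1) (r0 : 0 < r).
Local Notation p := (nm q).
Let p0 : 0 <= p := nm_ge0 q.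
Let p01 : 0 <= p < 1. Proof. by rewrite p0 q1. Qed.
Let r0' : 0 <= r := ltW r0.

Lemma prod_exp_bound (y : R) n : 0 <= y -> \prod_(i < n) (1 + y * p ^+ i) <= expR (y / (1 - p)).
Proof.
move=> y0; apply: (@le_trans _ _ (\prod_(i < n) expR (y * p ^+ i))).
  by apply: ler_prod => i _; rewrite expR_ge1Dx addr_ge0 ?mulr_ge0 ?exprn_ge0.
rewrite -expR_sum ler_expR -mulr_sumr ler_wpM2l //.
exact: (dom_geom p01).2.
Qed.

Lemma psn_prod (f : nat -> R[i] -> R[i]) (B : nat -> R) n : (forall i, psn r (B i) (f i)) ->
  psn r (\prod_(i < n) B i) (fun z => \prod_(i < n) f i z).
Proof.
move=> h; elim: n => [|n IH].
  rewrite big_ord0 -(nm1 R); apply: eq_psn (psn_cst 1 r0') => z _; by rewrite big_ord0.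
rewrite big_ord_recr /=; apply: eq_psn (psnM r0' IH (h n)) => z _; by rewrite big_ord_recr.
Qed.

Lemma psn_qpoch a x n : nm a * r <= x -> psn r (expR (x / (1 - p))) (fun z => qpoch (a * z) q n).
Proof.
move=> ax; have x0 : 0 <= x by apply: le_trans ax; rewrite mulr_ge0 ?nm_ge0.
apply: psn_le (prod_exp_bound n x0) _.
have h i : psn r (1 + x * p ^+ i) (fun z => 1 - a * z * q ^+ i).
  have h' : nm (a * q ^+ i) * r <= x * p ^+ i.
    by rewrite nmM nmX mulrAC ler_wpM2r ?exprn_ge0.
  by apply: eq_psn (psn_lin r0' h') => z _; rewrite mulrAC.
exact: psn_prod h.
Qed.

Lemma psn_qpochV a x n : nm a * r <= x -> x < 1 ->
  psn r (expR (x / (1 - x) / (1 - p))) (fun z => (qpoch (a * z) q n)^-1).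
Proof.
move=> ax x1; have x0 : 0 <= x by apply: le_trans ax; rewrite mulr_ge0 ?nm_ge0.
have dx : 0 < 1 - x by rewrite subr_gt0.
have y0 : 0 <= x / (1 - x) by rewrite divr_ge0 // ltW.
apply: psn_le (prod_exp_bound n y0) _.
have h i : psn r (1 + x / (1 - x) * p ^+ i) (fun z => (1 - a * z * q ^+ i)^-1).
  have t1 : p ^+ i <= 1 by rewrite exprn_ile1 // ltW.
  have t0 : 0 <= p ^+ i by rewrite exprn_ge0.
  have xt : x * p ^+ i <= x by rewrite ler_piMr.
  have h1 : 0 < 1 - x * p ^+ i by lra.
  have h' : nm (a * q ^+ i) * r <= x * p ^+ i.
    by rewrite nmM nmX mulrAC ler_wpM2r ?exprn_ge0.
  have h2 : x * p ^+ i < 1 by lra.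
  apply: (@psn_le _ _ (1 - x * p ^+ i)^-1).
    rewrite -[leLHS]mul1r ler_pdivrMr // -subr_ge0.
    have -> : (1 + x / (1 - x) * p ^+ i) * (1 - x * p ^+ i) - 1 =
       x / (1 - x) * p ^+ i * (x - x * p ^+ i) by field; lra.
    by rewrite !mulr_ge0 // ?subr_ge0 // invr_ge0 ltW.
  by apply: eq_psn (psn_inv r0' h' h2) => z _; rewrite mulrAC.
apply: eq_psn (psn_prod n h) => z _; by rewrite /qpoch prodfV.
Qed.

Definition qinf_maj (x : R) := 1 + x * expR (x / (1 - p)) / (1 - p).
Definition qinfV_maj (x : R) := 1 + x * expR (x / (1 - x) / (1 - p)) / (1 - p).

Lemma psn_qinf a x : nm a * r <= x -> psn r (qinf_maj x) (fun z => qpoch_inf (a * z) q).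
Proof.
move=> ax; have x0 : 0 <= x by apply: le_trans ax; rewrite mulr_ge0 ?nm_ge0.
have h k : psn r (x * p ^+ k * expR (x / (1 - p))) (fun z => - (a * z * q ^+ k * qpoch (a * z) q k)).
  apply: (@psn_le _ _ (nm (- (a * q ^+ k)) * (r * expR (x / (1 - p))))).
    rewrite nmN nmM nmX mulrA ler_wpM2r ?expR_ge0 // mulrAC.
    by rewrite ler_wpM2r ?exprn_ge0.
  have := psnZ (- (a * q ^+ k)) r0' (psnM r0' (psn_id r0') (psn_qpoch k ax)).
  by apply: eq_psn => z _; ring.
have h2 := psn_sum r0 (dom_pgeom q1 x0 (expR_ge0 (x / (1 - p)))) h.
have := psnD (psn_cst 1 r0') h2; rewrite nm1; apply: eq_psn => z _.
by rewrite qinf_sum.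
Qed.

Lemma psn_qinfV a x : nm a * r <= x -> x < 1 -> psn r (qinfV_maj x) (fun z => (qpoch_inf (a * z) q)^-1).
Proof.
move=> ax x1; have x0 : 0 <= x by apply: le_trans ax; rewrite mulr_ge0 ?nm_ge0.
have h k : psn r (x * p ^+ k * expR (x / (1 - x) / (1 - p))) (fun z => a * z * q ^+ k / qpoch (a * z) q k.+1).
  apply: (@psn_le _ _ (nm (a * q ^+ k) * (r * expR (x / (1 - x) / (1 - p))))).
    rewrite nmM nmX mulrA ler_wpM2r ?expR_ge0 // mulrAC.
    by rewrite ler_wpM2r ?exprn_ge0.
  have := psnZ (a * q ^+ k) r0' (psnM r0' (psn_id r0') (psn_qpochV k.+1 ax x1)).
  by apply: eq_psn => z _; rewrite mulrA; congr (_ / _); rewrite mulrAC.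
have h2 := psn_sum r0 (dom_pgeom q1 x0 (expR_ge0 (x / (1 - x) / (1 - p)))) h.
have := psnD (psn_cst 1 r0') h2; rewrite nm1; apply: eq_psn => z zr.
rewrite qinfV_sum //; apply: le_lt_trans x1; apply: le_trans ax.
by rewrite nmM ler_wpM2l ?nm_ge0.
Qed.

End PowerSeriesQ.

(** * The polynomials h_n *)

Section Hpoly.
Variables (R : realType) (q : R[i]).
Hypothesis q1 : nm q < 1.
Local Notation p := (nm q).
Local Notation P a n := (qpoch a q n).
Local Notation Pi a := (qpoch_inf a q).
Implicit Types X u v : R[i].

Definition hcoef u X n := P u n / P q n * X ^+ n.
(** The coefficients of (u X1, v X2; q)_oo / (X1, X2; q)_oo under a common dilation of
    X1 and X2, see [hpol_gf]; a homogeneous form of the Al-Salam-Chihara polynomials. *)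
Definition hpol n X1 X2 u v := \sum_(m < n.+1) hcoef u X1 m * hcoef v X2 (n - m).

Lemma hcoef0 u X : hcoef u X 0 = 1.
Proof. by rewrite /hcoef !qpoch0 divr1 expr0 mulr1. Qed.

Lemma hcoefS u X n : (1 - q ^+ n.+1) * hcoef u X n.+1 = X * (1 - u * q ^+ n) * hcoef u X n.
Proof.
have := qratio_rec q1 u n; rewrite /hcoef (exprS X).
move: (P u n.+1 / _) (P u n / P q n) (q ^+ n) (q ^+ n.+1) (X ^+ n) => A0 A B B1 C E.
by transitivity (A0 * (1 - B1) * (X * C)); [ring|rewrite E; ring].
Qed.

Lemma hcoef_q u X n : hcoef u (X * q) n = q ^+ n * hcoef u X n.
Proof. by rewrite /hcoef exprMn; ring. Qed.

Lemma hcoef_scale u X s n : hcoef u (X * s) n = s ^+ n * hcoef u X n.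
Proof. by rewrite /hcoef exprMn; ring. Qed.

Lemma hpol0 X1 X2 u v : hpol 0 X1 X2 u v = 1.
Proof. by rewrite /hpol big_ord1 !hcoef0 mulr1. Qed.

Lemma hpol_sym n X1 X2 u v : hpol n X1 X2 u v = hpol n X2 X1 v u.
Proof.
rewrite /hpol (reindex_inj rev_ord_inj) /=; apply: eq_bigr => i _.
by rewrite subSS subKn 1?mulrC // -ltnS.
Qed.

Lemma hpol_scale n X1 X2 u v s : hpol n (X1 * s) (X2 * s) u v = s ^+ n * hpol n X1 X2 u v.
Proof.
rewrite /hpol mulr_sumr; apply: eq_bigr => i _; rewrite !hcoef_scale mulrACA -exprD.
by rewrite subnKC // -ltnS.
Qed.

(** Bookkeeping for convolutions whose first or second factor starts with 0. *)
Lemma conv_recl (V : pzRingType) (a b : nat -> V) n : a 0%N = 0 ->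
  \sum_(m < n.+2) a m * b (n.+1 - m)%N = \sum_(m < n.+1) a m.+1 * b (n - m)%N.
Proof. by move=> a0; rewrite big_ord_recl a0 mul0r add0r. Qed.

Lemma conv_recr (V : pzRingType) (a b : nat -> V) n : b 0%N = 0 ->
  \sum_(m < n.+2) a m * b (n.+1 - m)%N = \sum_(m < n.+1) a m * b (n - m).+1.
Proof.
move=> b0; rewrite big_ord_recr /= subnn b0 mulr0 addr0; apply: eq_bigr => i _.
by rewrite subSn // -ltnS.
Qed.

(** A q-analogue of the Euler-Poisson-Darboux equation; by [hcoefS] both
    sides are the same convolution. *)
Lemma hpol_EPD n X1 X2 u v :
  X2 * (hpol n X1 X2 u v - hpol n (X1 * q) X2 u v - v * hpol n X1 (X2 * q) u v + v * hpol n (X1 * q) (X2 * q) u v) =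
  X1 * (hpol n X1 X2 u v - hpol n X1 (X2 * q) u v - u * hpol n (X1 * q) X2 u v + u * hpol n (X1 * q) (X2 * q) u v).
Proof.
pose al m := (1 - q ^+ m) * hcoef u X1 m; pose be l := (1 - q ^+ l) * hcoef v X2 l.
transitivity (X2 * \sum_(m < n.+1) al m * ((1 - v * q ^+ (n - m)) * hcoef v X2 (n - m))).
  congr (_ * _); rewrite /hpol mulr_sumr [v * \sum_(_ < _) _]mulr_sumr -!sumrB -big_split /=.
  apply: eq_bigr => m _; rewrite !hcoef_q /al.
  by move: (q ^+ m) (q ^+ (n - m)) (hcoef _ _ _) (hcoef _ _ _) => A B C D; ring.
transitivity (X1 * \sum_(m < n.+1) (1 - u * q ^+ m) * hcoef u X1 m * be (n - m)%N); last first.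
  congr (_ * _); rewrite /hpol [u * \sum_(_ < _) _]mulr_sumr [u * \sum_(_ < _) _]mulr_sumr -!sumrB -big_split /=.
  apply: eq_bigr => m _; rewrite !hcoef_q /be.
  by move: (q ^+ m) (q ^+ (n - m)) (hcoef _ _ _) (hcoef _ _ _) => A B C D; ring.
case: n => [|n].
  by rewrite !big_ord1 /al /be /= !expr0 subrr !(mul0r, mulr0).
rewrite (@conv_recl _ al (fun l => (1 - v * q ^+ l) * hcoef v X2 l)); last by rewrite /al expr0 subrr mul0r.
rewrite (@conv_recr _ (fun m => (1 - u * q ^+ m) * hcoef u X1 m) be); last by rewrite /be expr0 subrr mul0r.
rewrite !mulr_sumr; apply: eq_bigr => m _; rewrite /al /be !hcoefS.
by move: (q ^+ m) (q ^+ (n - m)) (hcoef _ _ _) (hcoef _ _ _) => A B C D; ring.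
Qed.

(** The three-term recurrence; it shows that h_n depends on the arguments only through
    X1 + X2, X1 X2, u X1 + v X2 and u v. *)
Lemma hpol_rec n X1 X2 u v :
  (1 - q ^+ n.+2) * hpol n.+2 X1 X2 u v =
  (X1 + X2 - q ^+ n.+1 * (u * X1 + v * X2)) * hpol n.+1 X1 X2 u v -
  X1 * X2 * (1 - u * v * q ^+ n) * hpol n X1 X2 u v.
Proof.
pose a := hcoef u X1; pose b := hcoef v X2; pose S k := \sum_(m < k.+1) q ^+ m * a m * b (k - m)%N.
have hE k : hpol k X1 X2 u v = \sum_(m < k.+1) a m * b (k - m)%N by [].
have r1 k : (1 - q ^+ k.+1) * hpol k.+1 X1 X2 u v =
    X1 * hpol k X1 X2 u v - u * X1 * S k + X2 * S k - v * X2 * q ^+ k * hpol k X1 X2 u v.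
  transitivity (\sum_(m < k.+2) (1 - q ^+ m) * a m * b (k.+1 - m)%N +
     \sum_(m < k.+2) q ^+ m * a m * ((1 - q ^+ (k.+1 - m)) * b (k.+1 - m)%N)).
    rewrite hE mulr_sumr -big_split /=; apply: eq_bigr => m _.
    have -> : q ^+ k.+1 = q ^+ m * q ^+ (k.+1 - m) by rewrite -exprD subnKC // -ltnS.
    by move: (q ^+ m) (q ^+ (_ - m)) (a m) (b _) => A B C D; ring.
  rewrite (@conv_recl _ (fun m => (1 - q ^+ m) * a m) b); last by rewrite expr0 subrr mul0r.
  rewrite (@conv_recr _ (fun m => q ^+ m * a m) (fun l => (1 - q ^+ l) * b l)); last by rewrite expr0 subrr mul0r.
  rewrite !hE /S !mulr_sumr -!(sumrB, big_split) /=; apply: eq_bigr => m _.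
  rewrite /a /b !hcoefS; have -> : q ^+ k = q ^+ m * q ^+ (k - m) by rewrite -exprD subnKC // -ltnS.
  by move: (q ^+ m) (q ^+ (k - m)) (hcoef _ _ _) (hcoef _ _ _) => A B C D; ring.
have r2 k : S k.+1 = hpol k.+1 X1 X2 u v - X1 * hpol k X1 X2 u v + u * X1 * S k.
  apply/eqP; rewrite -subr_eq0; apply/eqP.
  transitivity (X1 * hpol k X1 X2 u v - u * X1 * S k - \sum_(m < k.+2) (1 - q ^+ m) * a m * b (k.+1 - m)%N).
    rewrite {1}/S (hE k.+1).
    have -> : \sum_(m < k.+2) (1 - q ^+ m) * a m * b (k.+1 - m)%N =
       \sum_(m < k.+2) a m * b (k.+1 - m)%N - \sum_(m < k.+2) q ^+ m * a m * b (k.+1 - m)%N.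
      by rewrite -sumrB; apply: eq_bigr => m _; rewrite mulrBl mul1r mulrBl.
    by ring.
  rewrite (@conv_recl _ (fun m => (1 - q ^+ m) * a m) b); last by rewrite expr0 subrr mul0r.
  rewrite !hE /S !mulr_sumr -!sumrB /= big1 // => m _.
  rewrite /a !hcoefS.
  by move: (q ^+ m) (hcoef _ _ _) (b _) => A B C; ring.
have := r1 n; have := r1 n.+1; rewrite r2 (exprS q n).
move: (hpol n.+2 _ _ _ _) (hpol n.+1 _ _ _ _) (hpol n _ _ _ _) (S n) (q ^+ n) (q ^+ n.+2) => h2 h1 h0 s Q Q2 e2 e1.
have -> : (1 - Q2) * h2 = X1 * h1 - u * X1 * (h1 - X1 * h0 + u * X1 * s) + X2 * (h1 - X1 * h0 + u * X1 * s) - v * X2 * (q * Q) * h1 := e2.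
apply/eqP; rewrite -subr_eq0; apply/eqP.
transitivity (u * X1 * (X1 * h0 - u * X1 * s + X2 * s - v * X2 * Q * h0 - (1 - q * Q) * h1)); first by ring.
by rewrite -e1 subrr mulr0.
Qed.

Lemma hpol1 X1 X2 u v : (1 - q) * hpol 1 X1 X2 u v = X1 + X2 - (u * X1 + v * X2).
Proof.
rewrite /hpol big_ord_recl big_ord1 /bump /= !hcoef0 mul1r mulr1 mulrDr.
have := hcoefS u X1 0; have := hcoefS v X2 0; rewrite !hcoef0 expr0 expr1 subn0 => -> ->; ring.
Qed.

Lemma hpol_eq n X1 X2 u v X1' X2' u' v' : X1 + X2 = X1' + X2' -> X1 * X2 = X1' * X2' ->
  u * X1 + v * X2 = u' * X1' + v' * X2' -> u * v = u' * v' ->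
  hpol n X1 X2 u v = hpol n X1' X2' u' v'.
Proof.
move=> e1 e2 e3 e4.
suff [] : hpol n X1 X2 u v = hpol n X1' X2' u' v' /\ hpol n.+1 X1 X2 u v = hpol n.+1 X1' X2' u' v' by [].
have nz m : 1 - q ^+ m.+1 != 0.
  by have := qpoch_neq0 q1 m.+1 q1; rewrite qpochS mulf_eq0 negb_or -exprS => /andP[].
elim: n => [|n [IH1 IH2]].
  rewrite !hpol0; split => //; have := nz 0%N; rewrite expr1 => /mulfI; apply.
  by rewrite !hpol1 e1 e3.
by split => //; apply: (mulfI (nz n.+1)); rewrite !hpol_rec IH1 IH2 e1 e2 e3 e4.
Qed.

Lemma hpol_X10 n X2 u v : hpol n 0 X2 u v = hcoef v X2 n.
Proof.
rewrite /hpol big_ord_recl /= hcoef0 mul1r subn0 big1 ?addr0 // => i _.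
by rewrite /hcoef exprS mul0r mulr0 mul0r.
Qed.

Lemma hcoef_bound u X x n : nm X <= x -> nm (hcoef u X n) <= qmaj q (nm u) * x ^+ n.
Proof.
move=> Xx; rewrite /hcoef nmM nmX ler_pM ?nm_ge0 ?exprn_ge0 ?nm_ge0 ?qratio_bound //.
by rewrite lerXn2r ?nnegrE ?nm_ge0 // (le_trans (nm_ge0 _) Xx).
Qed.

Lemma hpol_bound n X1 X2 u v x U V : nm X1 <= x -> nm X2 <= x -> nm u <= U -> nm v <= V ->
  nm (hpol n X1 X2 u v) <= qmaj q U * qmaj q V * (n.+1%:R * x ^+ n).
Proof.
move=> h1 h2 uU vV; have x0 := le_trans (nm_ge0 _) h1.
apply: le_trans (nm_sum _ _ _) _.
apply: (@le_trans _ _ (\sum_(m < n.+1) qmaj q U * qmaj q V * x ^+ n)); last first.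
  by rewrite sumr_const card_ord -[leLHS]mulr_natl mulrCA.
have mono a b : a <= b -> qmaj q a <= qmaj q b.
  move=> ab; rewrite /qmaj ler_wpM2r ?expR_ge0 // ler_expR ler_wpM2r // invr_ge0 subr_ge0 ltW //.
apply: ler_sum => m _; rewrite nmM.
have -> : x ^+ n = x ^+ m * x ^+ (n - m) by rewrite -exprD subnKC // -ltnS.
rewrite mulrACA ler_pM ?nm_ge0 //.
  by apply: le_trans (hcoef_bound _ _ h1) _; rewrite ler_wpM2r ?exprn_ge0 // mono.
by apply: le_trans (hcoef_bound _ _ h2) _; rewrite ler_wpM2r ?exprn_ge0 // mono.
Qed.

Lemma hcoef_sumto u X : nm X < 1 -> sumto (hcoef u X) (Pi (u * X) / Pi X).
Proof. by move=> X1; exact: (q_binomial q1 u X1). Qed.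

Lemma dom_hcoef u X : nm X < 1 -> dom (fun n => qmaj q (nm u) * nm X ^+ n) (qmaj q (nm u) * (1 - nm X)^-1).
Proof. by move=> X1; apply: domM; [exact: qmaj_ge0|apply: dom_geom; rewrite nm_ge0]. Qed.

Lemma hpol_gf X1 X2 u v : nm X1 < 1 -> nm X2 < 1 ->
  sumto (fun n => hpol n X1 X2 u v) (Pi (u * X1) / Pi X1 * (Pi (v * X2) / Pi X2)).
Proof.
move=> x1 x2; rewrite -(CsumE (hcoef_sumto u x1)) -(CsumE (hcoef_sumto v x2)).
apply: (sumto_cauchy (dom_hcoef u x1) (dom_hcoef v x2)) => i; exact: hcoef_bound.
Qed.

(** * The bilinear generating function *)

Definition bilin_term X1 X2 u v Y1 Y2 u' v' n :=
  P q n / P (u * v) n * (hpol n X1 X2 u v * hpol n Y1 Y2 u' v').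
(** For u v = u' v' this is a very-well-poised series, see [bilin_vwp]. *)
Definition bilin X1 X2 u v Y1 Y2 u' v' := Csum (bilin_term X1 X2 u v Y1 Y2 u' v').

Definition bilin_maj (U V U' V' w : R) :=
  expR (p / (1 - p)) * expR (w / (1 - w) / (1 - p)) *
    (qmaj q U * qmaj q V) * (qmaj q U' * qmaj q V').

Lemma bilin_maj_ge0 U V U' V' w : 0 <= bilin_maj U V U' V' w.
Proof. by rewrite !mulr_ge0 ?expR_ge0 // qmaj_ge0. Qed.

Lemma bilin_term_bound X1 X2 u v Y1 Y2 u' v' x y U V U' V' w n :
  nm X1 <= x -> nm X2 <= x -> nm Y1 <= y -> nm Y2 <= y -> nm u <= U -> nm v <= V ->
  nm u' <= U' -> nm v' <= V' -> nm (u * v) <= w -> w < 1 ->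
  nm (bilin_term X1 X2 u v Y1 Y2 u' v' n) <= bilin_maj U V U' V' w * (n.+1%:R ^+ 2 * (x * y) ^+ n).
Proof.
move=> h1 h2 h3 h4 h5 h6 h7 h8 h9 w1; rewrite /bilin_term /bilin_maj !nmM.
have -> : forall a b c d : R, a * b * c * d * (n.+1%:R ^+ 2 * (x * y) ^+ n) =
   a * b * ((c * (n.+1%:R * x ^+ n)) * (d * (n.+1%:R * y ^+ n))).
  by move=> a b c d; rewrite exprMn; ring.
apply: ler_pM; rewrite ?mulr_ge0 ?nm_ge0 //.
  by apply: ler_pM; rewrite ?nm_ge0 ?qpoch_bound // qpoch_Vbound.
by apply: ler_pM; rewrite ?nm_ge0 // hpol_bound.
Qed.

Lemma dom_bilin (K z : R) : 0 <= K -> 0 <= z < 1 -> exists M, dom (fun n => K * (n.+1%:R ^+ 2 * z ^+ n)) M.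
Proof. by move=> K0 /dom_sqr_geom[M dM]; exists (K * M); exact: domM. Qed.

Lemma bilin_sumto X1 X2 u v Y1 Y2 u' v' x y :
  nm X1 <= x -> nm X2 <= x -> nm Y1 <= y -> nm Y2 <= y -> nm (u * v) < 1 -> x * y < 1 ->
  sumto (bilin_term X1 X2 u v Y1 Y2 u' v') (bilin X1 X2 u v Y1 Y2 u' v').
Proof.
move=> h1 h2 h3 h4 h5 xy; have xy0 : 0 <= x * y < 1.
  by rewrite xy andbT mulr_ge0 // ?(le_trans (nm_ge0 _) h1) ?(le_trans (nm_ge0 _) h3).
have [M dM] := dom_bilin (bilin_maj_ge0 (nm u) (nm v) (nm u') (nm v') (nm (u * v))) xy0.
by apply: (sumto_sumto dM) => n; exact: bilin_term_bound.
Qed.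

Lemma bilin_swap X1 X2 u v Y1 Y2 u' v' : bilin X1 X2 u v Y1 Y2 u' v' = bilin X2 X1 v u Y1 Y2 u' v'.
Proof. by apply: eq_Csum => n; rewrite /bilin_term (hpol_sym n X1) (mulrC u). Qed.

Lemma bilin_EPD X1 X2 u v Y1 Y2 u' v' x y :
  nm X1 <= x -> nm X2 <= x -> nm Y1 <= y -> nm Y2 <= y -> nm (u * v) < 1 -> x * y < 1 ->
  let F a b := bilin a b u v Y1 Y2 u' v' in
  X2 * (F X1 X2 - F (X1 * q) X2 - v * F X1 (X2 * q) + v * F (X1 * q) (X2 * q)) =
  X1 * (F X1 X2 - F X1 (X2 * q) - u * F (X1 * q) X2 + u * F (X1 * q) (X2 * q)).
Proof.
move=> h1 h2 h3 h4 h5 xy F.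
have hq X : nm X <= x -> nm (X * q) <= x.
  by move=> h; apply: le_trans h; have := nm_qn q1 X 1; rewrite expr1.
have s a b : nm a <= x -> nm b <= x -> sumto (bilin_term a b u v Y1 Y2 u' v') (F a b).
  by move=> ha hb; exact: bilin_sumto xy.
have [s11 s21] := (s _ _ h1 h2, s _ _ (hq _ h1) h2).
have [s12 s22] := (s _ _ h1 (hq _ h2), s _ _ (hq _ h1) (hq _ h2)).
have L := sumtoZ X2 (sumtoD (sumtoB (sumtoB s11 s21) (sumtoZ v s12)) (sumtoZ v s22)).
have RR := sumtoZ X1 (sumtoD (sumtoB (sumtoB s11 s12) (sumtoZ u s21)) (sumtoZ u s22)).
apply: (sumto_uniq L); apply: eq_sumto RR => n; rewrite /bilin_term.
have := hpol_EPD n X1 X2 u v.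
move: (P q n / _) (hpol n Y1 _ _ _) (hpol n X1 X2 _ _) (hpol n (X1 * q) X2 _ _) (hpol n X1 (X2 * q) _ _) (hpol n (X1 * q) (X2 * q) _ _).
move=> c d e f g h E.
transitivity (c * d * (X2 * (e - f - v * g + v * h))); last by ring.
by rewrite E; ring.
Qed.

(** The bound does not depend on X2, as needed along X2, X2 q, X2 q^2, ... *)
Lemma bilin_psn X2 u v Y1 Y2 u' v' x y r : 0 < r -> r <= x -> nm X2 <= x ->
  nm Y1 <= y -> nm Y2 <= y -> nm (u * v) < 1 -> x * y < 1 ->
  forall M, dom (fun n => bilin_maj (nm u) (nm v) (nm u') (nm v') (nm (u * v)) * (n.+1%:R ^+ 2 * (x * y) ^+ n)) M ->
  psn r M (fun z => bilin z X2 u v Y1 Y2 u' v').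
Proof.
move=> r0 rx h2 h3 h4 h5 xy M dM; have r0' := ltW r0; have x0 := le_trans r0' rx.
have y0 := le_trans (nm_ge0 _) h3.
apply: (psn_sum r0 dM) => n.
have powz m : psn r (r ^+ m) (fun z => z ^+ m).
  elim: m => [|m IH]; first by rewrite expr0 -(nm1 R); exact: psn_cst.
  by rewrite exprS; apply: eq_psn (psnM r0' (psn_id r0') IH) => z _; rewrite exprS.
have fs k (f : nat -> R[i] -> R[i]) (B : nat -> R) : (forall m, psn r (B m) (f m)) ->
    psn r (\sum_(m < k) B m) (fun z => \sum_(m < k) f m z).
  move=> hf; elim: k => [|k IH].
    by rewrite big_ord0 -(nm0 R); apply: eq_psn (psn_cst 0 r0') => z _; rewrite big_ord0.
  by rewrite big_ord_recr /=; apply: eq_psn (psnD IH (hf k)) => z _; rewrite big_ord_recr.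
have hn : psn r (qmaj q (nm u) * qmaj q (nm v) * (n.+1%:R * x ^+ n)) (fun z => hpol n z X2 u v).
  apply: (@psn_le _ _ (\sum_(m < n.+1) nm (P u m / P q m * hcoef v X2 (n - m)) * r ^+ m)).
    apply: (@le_trans _ _ (\sum_(m < n.+1) qmaj q (nm u) * qmaj q (nm v) * x ^+ n)); last first.
      by rewrite sumr_const card_ord -[leLHS]mulr_natl mulrCA.
    apply: ler_sum => m _; rewrite nmM.
    have -> : x ^+ n = x ^+ m * x ^+ (n - m) by rewrite -exprD subnKC // -ltnS.
    rewrite mulrAC mulrACA; apply: ler_pM; rewrite ?mulr_ge0 ?nm_ge0 ?exprn_ge0 //.
      by apply: ler_pM; rewrite ?nm_ge0 ?exprn_ge0 // ?qratio_bound // lerXn2r ?nnegrE.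
    exact: hcoef_bound.
  have := fs n.+1 (fun m z => P u m / P q m * hcoef v X2 (n - m) * z ^+ m) _ (fun m => psnZ (P u m / P q m * hcoef v X2 (n - m)) r0' (powz m)).
  apply: eq_psn => z _; apply: eq_bigr => m _; rewrite [in RHS]/hcoef; exact: mulrAC.
have := psnZ (P q n / P (u * v) n * hpol n Y1 Y2 u' v') r0' hn.
move/psn_le => /(_ (bilin_maj (nm u) (nm v) (nm u') (nm v') (nm (u * v)) * (n.+1%:R ^+ 2 * (x * y) ^+ n))) H.
apply: eq_psn (H _) => [z _|]; first by rewrite /bilin_term; move: (_ / _) (hpol _ _ _ _ _) (hpol _ _ _ _ _) => a b c; ring.
rewrite /bilin_maj !nmM -(nmM u).
have -> : forall a b c d : R, a * b * c * d * (n.+1%:R ^+ 2 * (x * y) ^+ n) =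
   a * b * (d * (n.+1%:R * y ^+ n)) * (c * (n.+1%:R * x ^+ n)).
  by move=> a b c d; rewrite exprMn; ring.
rewrite ler_wpM2r ?mulr_ge0 ?exprn_ge0 ?qmaj_ge0 //.
apply: ler_pM; rewrite ?mulr_ge0 ?nm_ge0 //.
  by apply: ler_pM; rewrite ?nm_ge0 ?qpoch_bound // qpoch_Vbound.
exact: hpol_bound.
Qed.

End Hpoly.

(** * The very-well-poised side *)

Lemma ccvgV (R : realType) (u : nat -> R[i]) a : a != 0 -> ccvg u a -> ccvg (fun n => (u n)^-1) a^-1.
Proof.
move=> a0 ua; have na : 0 < nm a by rewrite nm_gt0.
have n2 : 0 < nm a / 2 by rewrite divr_gt0.
pose K := (nm a / 2)^-1 * (nm a)^-1.
have h : \forall n \near \oo, nm (u n - a) < nm a / 2.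
  by move/cvgr0_norm_lt : ua => /(_ _ n2); apply: filterS => n; rewrite ger0_norm ?nm_ge0.
have hK : (fun n => nm (u n - a) * K) @ \oo --> (0 : R).
  by rewrite -(mul0r K); apply: cvgMl.
apply: (squeeze_cvgr _ _ hK); last exact: cvg_cst.
near=> n; rewrite nm_ge0 /=.
have un : nm a / 2 <= nm (u n).
  have h1 : nm (u n - a) < nm a / 2 by near: n.
  by have := nmB (u n) (u n - a); rewrite subKr; lra.
have un0 : u n != 0 by rewrite -nm_gt0 (lt_le_trans n2).
have -> : (u n)^-1 - a^-1 = (a - u n) * ((u n)^-1 * a^-1) by field; rewrite a0 un0.
rewrite nmM nmBC ler_wpM2l ?nm_ge0 // /K nmM !nmV ler_wpM2r ?invr_ge0 ?nm_ge0 //.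
by rewrite lef_pV2 // posrE // (lt_le_trans n2).
Unshelve. all: by end_near. Qed.

(** The core of the certificate below, with X = X1 / v and z = X2. Each mixed coefficient
    is a combination of the products N1, M1, N2, M2 with g or D; once all of them are
    replaced in this way, everything cancels. *)
Lemma epd_core (K : comNzRingType) (X z v Y1 Y2 w w' s : K) :
  let t := w * w' in let r := t * X * z * Y1 * Y2 in
  let N1 := (1 - z * Y1 * s) * (1 - z * Y2 * s) in
  let M1 := (1 - z * Y1 * w * s) * (1 - z * Y2 * w' * s) in
  let N2 := (1 - X * Y1 * w * s) * (1 - X * Y2 * w' * s) in
  let M2 := (1 - t * X * Y1 * s) * (1 - t * X * Y2 * s) in
  let g := (1 - v * X * Y1) * (1 - v * X * Y2) in
  let D := (1 - X * Y1 * w) * (1 - X * Y2 * w') in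
  g * ((1 - s) * (z - r * X * s) * M1 * M2 - (z - t * X) * (1 - r * s ^+ 2) * N2 * M1
       - t * (X - z * s) * (1 - r * s) * N1 * N2)
  + D * ((v - t * s) * (z - r * v * X * s) * N1 * N2 - (v * X - s * z) * (1 - v * X * z * Y1 * Y2 * s) * M1 * M2
         - v * (z - X) * (1 - r * s ^+ 2) * N1 * M2) = 0.
Proof.
move=> t r N1 M1 N2 M2 g D.
have i1 : (z - X) * (1 - r * s ^+ 2) = z * N2 - X * M1 by rewrite /r /t /N2 /M1; clear; ring.
have i2 : (z - t * X) * (1 - r * s ^+ 2) = z * M2 - t * X * N1 by rewrite /r /M2 /N1; clearbody t; clear; ring.
have i3 : t * (X - z * s) * (1 - r * s) = t * X * M1 - D * s * z * t by rewrite /r /t /D /M1; clear; ring.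
have i4 : (1 - s) * (z - r * X * s) = z * N2 - D * s * z by rewrite /r /t /D /N2; clear; ring.
have j1 : (v * X - s * z) * (1 - v * X * z * Y1 * Y2 * s) = v * X * N1 - g * s * z by rewrite /g /N1; clear; ring.
have j2 : (v - t * s) * (z - r * v * X * s) = v * z * M2 - g * s * z * t by rewrite /r /g /M2; clearbody t; clear; ring.
rewrite -[v * (z - X) * _]mulrA i1 i2 i3 i4 j1 j2.
by clear; move: t N1 M1 N2 M2 g D => t N1 M1 N2 M2 g D; ring.
Qed.

(** The certificate reduces to three polynomial relations: the difference of its two
    sides is a combination of them. *)
Lemma epd_fraction (K : fieldType) (X1 X2 u v s al ap aq b0 b1 P Pq k1 k2 k3 k4 N1 M1 N2 M2 g D us qs ss : K) :
  al != 0 -> aq != 0 -> P != 0 -> Pq != 0 -> M1 != 0 -> M2 != 0 -> D != 0 -> qs != 0 ->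
  (v * X2 - u * X1) * aq = us * v * k1 - u * (X1 - v * X2 * s) * Pq ->
  (X2 - X1) * al = ss * k4 - (X1 - s * X2) * b0 ->
  g * (ss * k3 * M1 * M2 - (X2 - u * X1) * ap * N2 * M1 - u * (X1 - v * X2 * s) * b1 * N1 * N2)
    + D * (v * us * k2 * N1 * N2 - (X1 - s * X2) * P * M1 * M2 - (v * X2 - X1) * ap * N1 * M2) = 0 ->
  let c := g / D in
  let t2 := ap * b0 * N1 / (al * P * M1) in
  let t1 := ap * b0 * c * N2 / (al * P * M2) in
  let t12 := aq * b0 * b1 * c * N1 * N2 / (al * P * Pq * M1 * M2) in
  X2 * (1 - t1 - v * t2 + v * t12) - X1 * (1 - t2 - u * t1 + u * t12) =
  qs / aq * (c * b1 * k1 / Pq - k2) * (v * us / qs * aq / al * b0 * N2 * N1 / (P * M1 * M2))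
  - ss / al * (c * b0 * k3 / P - k4).
Proof.
move=> al0 aq0 P0 Pq0 M10 M20 D0 qs0 Ea Eb core c t2 t1 t12.
rewrite /t1 /t2 /t12 /c; clear c t2 t1 t12.
pose ea := (v * X2 - u * X1) * aq - (us * v * k1 - u * (X1 - v * X2 * s) * Pq).
pose eb := (X2 - X1) * al - (ss * k4 - (X1 - s * X2) * b0).
move: core; set co := (X in X = 0) => core.
have ea0 : ea = 0 by rewrite /ea Ea subrr.
have eb0 : eb = 0 by rewrite /eb Eb subrr.
apply/eqP; rewrite -subr_eq0; apply/eqP.
transitivity (ea * (g * b0 * b1 * N1 * N2 / (D * al * P * Pq * M1 * M2)) + eb / al + co * (b0 / (al * P * D * M1 * M2))).
  rewrite /ea /eb /co; clear ea eb ea0 eb0 co core Ea Eb.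
  by field; rewrite al0 aq0 P0 Pq0 M10 M20 D0 qs0.
by rewrite ea0 eb0 core !mul0r !addr0.
Qed.

(** Certificate for the summation of the very-well-poised side: the combination of
    shifted terms on the left telescopes. The rational function G was found by creative
    telescoping. *)
Lemma epd_cert (K : fieldType) (X1 X2 u v Y1 Y2 w q s : K) :
  let A := u * X1 * X2 * Y1 * Y2 / q in let p := X1 * X2 * Y1 * Y2 in
  let e := X1 * Y1 * w / v in let f := X1 * Y2 * (u * v / w) / v in
  let b1 := X2 * Y1 * w in let b2 := X2 * Y2 * (u * v / w) in
  let N1 := (1 - X2 * Y1 * s) * (1 - X2 * Y2 * s) in
  let M1 := (1 - b1 * s) * (1 - b2 * s) in
  let N2 := (1 - e * s) * (1 - f * s) in
  let M2 := (1 - u * X1 * Y1 * s) * (1 - u * X1 * Y2 * s) in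
  let c := (1 - X1 * Y1) * (1 - X1 * Y2) / ((1 - e) * (1 - f)) in
  let t2 := (1 - A * q * s ^+ 2) * (1 - A * s) * N1 / ((1 - A * s ^+ 2) * (1 - p * s) * M1) in
  let t1 := (1 - A * q * s ^+ 2) * (1 - A * s) * c * N2 / ((1 - A * s ^+ 2) * (1 - p * s) * M2) in
  let t12 := (1 - A * q ^+ 2 * s ^+ 2) * (1 - A * s) * (1 - A * q * s) * c * N1 * N2 /
     ((1 - A * s ^+ 2) * (1 - p * s) * (1 - p * q * s) * M1 * M2) in
  let G s := (1 - s) / (1 - A * s ^+ 2) * (c * (1 - A * s) * (X2 - u * p * X1 * s / v) / (1 - p * s) - (X2 - A * X1 * s)) in
  let rho := v * (1 - u * s) / (1 - q * s) * (1 - A * q ^+ 2 * s ^+ 2) / (1 - A * s ^+ 2) *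
     (1 - A * s) * N2 * N1 / ((1 - p * s) * M1 * M2) in
  v != 0 -> w != 0 -> q != 0 -> 1 - e != 0 -> 1 - f != 0 ->
  1 - A * s ^+ 2 != 0 -> 1 - A * q ^+ 2 * s ^+ 2 != 0 -> 1 - p * s != 0 -> 1 - p * q * s != 0 ->
  1 - b1 * s != 0 -> 1 - b2 * s != 0 -> 1 - u * X1 * Y1 * s != 0 -> 1 - u * X1 * Y2 * s != 0 -> 1 - q * s != 0 ->
  X2 * (1 - t1 - v * t2 + v * t12) - X1 * (1 - t2 - u * t1 + u * t12) = G (q * s) * rho - G s.
Proof.
move=> A p e f b1 b2 N1 M1 N2 M2 c t2 t1 t12 G rho v0 w0 q0 he hf ha ha2 hp hpq hb1 hb2 hm1 hm2 hq.
have M10 : M1 != 0 by rewrite mulf_neq0.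
have M20 : M2 != 0 by rewrite mulf_neq0.
have D0 : (1 - e) * (1 - f) != 0 by rewrite mulf_neq0.
have Aq : A * q = u * p by rewrite /A /p; clear -q0; field.
(* These two relations cancel the denominators 1 - p q s and 1 - A s ^+ 2. *)
have Ea : (v * X2 - u * X1) * (1 - A * q ^+ 2 * s ^+ 2) =
    (1 - u * s) * v * (X2 - u * p * X1 * (q * s) / v) - u * (X1 - v * X2 * s) * (1 - p * q * s).
  rewrite expr2 mulrA Aq; clearbody p; clear -v0; by field.
have Eb : (X2 - X1) * (1 - A * s ^+ 2) = (1 - s) * (X2 - A * X1 * s) - (X1 - s * X2) * (1 - A * s).
  by clearbody A; clear; ring.
have core : (1 - X1 * Y1) * (1 - X1 * Y2) * ((1 - s) * (X2 - u * p * X1 * s / v) * M1 * M2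
      - (X2 - u * X1) * (1 - A * q * s ^+ 2) * N2 * M1 - u * (X1 - v * X2 * s) * (1 - A * q * s) * N1 * N2)
    + (1 - e) * (1 - f) * (v * (1 - u * s) * (X2 - A * X1 * (q * s)) * N1 * N2
      - (X1 - s * X2) * (1 - p * s) * M1 * M2 - (v * X2 - X1) * (1 - A * q * s ^+ 2) * N1 * M2) = 0.
  pose X := X1 / v; pose w' := u * v / w.
  have vX : v * X = X1 by rewrite /X; clear -v0; field.
  have tE : u * v = w * w' by rewrite /w'; clear -w0; field.
  have eX : e = X * Y1 * w by rewrite /e /X; clear; ring.
  have fX : f = X * Y2 * w' by rewrite /f /X /w'; clear; ring.
  have uX : u * X1 = w * w' * X by rewrite -tE -vX; clearbody X; clear; ring.
  have pX : u * p = w * w' * X * X2 * Y1 * Y2 by rewrite -uX /p; clear; ring.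
  rewrite Aq (_ : A * X1 * (q * s) = u * p * v * X * s); last first.
    by rewrite -Aq -vX; clearbody A X; clear; ring.
  rewrite (_ : u * p * X1 * s / v = u * p * X * s); last by rewrite /X; clearbody p; clear; ring.
  rewrite (_ : u * (X1 - v * X2 * s) = w * w' * (X - X2 * s)); last first.
    by rewrite -vX -tE; clearbody X; clear; ring.
  rewrite (_ : v * (1 - u * s) = v - w * w' * s); last by rewrite -tE; clear; ring.
  rewrite (_ : v * X2 - X1 = v * (X2 - X)); last by rewrite -vX; clearbody X; clear; ring.
  rewrite uX pX /p /N2 /M2 uX eX fX -vX.
  exact: epd_core.
have qs : (q * s) ^+ 2 = q ^+ 2 * s ^+ 2 by rewrite exprMn.
rewrite /G /rho /t1 /t2 /t12 /c qs [A * (q ^+ 2 * _)]mulrA [A * (q * s)]mulrA [p * (q * s)]mulrA.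
exact: epd_fraction hq Ea Eb core.
Qed.

Section VWP.
Variables (R : realType) (q : R[i]).
Hypotheses (q1 : nm q < 1) (q0 : q != 0).
Local Notation p := (nm q).
Local Notation P a n := (qpoch a q n).
Local Notation Pi a := (qpoch_inf a q).

Let p0 : 0 <= p := nm_ge0 q.
Let p01 : 0 <= p < 1. Proof. by rewrite p0 q1. Qed.

(** The very-well-poised factor divided by (A q; q)_oo, written in terms of a = A q. *)
Definition vwp_quot a i := if i is m.+1 then (1 - a * q ^+ (m + m).+1) / Pi (a * q ^+ m) else (Pi a)^-1.

Lemma sub1_neq0 (a : R[i]) : nm a < 1 -> 1 - a != 0.
Proof.
move=> a1; rewrite subr_eq0 eq_sym; apply/eqP => h.
by move: a1; rewrite h nm1 ltxx.
Qed.

Lemma vwp_quotE A i : nm A < 1 -> vwp_quot (A * q) i = (1 - A * (q ^+ i) ^+ 2) / Pi (A * q ^+ i).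
Proof.
move=> A1; case: i => [|m] /=.
  rewrite !expr0 mulr1 expr1n mulr1 (qinf_rec q1 A) invfM mulrA divff ?mul1r //.
  exact: sub1_neq0.
by rewrite -mulrA -exprS -mulrA -exprS -exprM muln2 -addnn addnS.
Qed.

Lemma vwp_quot_factor a A i : nm a < 1 -> A * q = a -> vwp_quot a i = vwp_factor A q i / Pi a.
Proof.
move=> a1 Aa; case: i => [|m] /=; first by rewrite mul1r.
rewrite -Aa (qinf_split q1 (A * q) m) -mulrA -exprS mul2n -addnn addSn addnS.
rewrite invfM; have h : P (A * q) m != 0 by rewrite qpoch_neq0 // Aa.
move: (P (A * q) m) (Pi _) (q ^+ _) h => B C D h.
by rewrite -!mulrA; congr (_ * _); rewrite mulrA divff ?mul1r.
Qed.

Lemma qinf_q b : nm b < 1 -> Pi (b * q) = Pi b / (1 - b).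
Proof. by move=> b1; rewrite (qinf_rec q1 b) mulrAC divff ?mul1r ?sub1_neq0. Qed.

Lemma qpoch_q a i : 1 - a != 0 -> P (a * q) i = P a i * (1 - a * q ^+ i) / (1 - a).
Proof. by move=> a1; rewrite -qpochS qpochSl mulrAC divff ?mul1r. Qed.

(** The terms of the very-well-poised series with the infinite products in front of it
    distributed over the factors, so that the shifts of X1 and X2 multiply each term by a
    rational function of q^i. *)
Definition vwp_term X1 X2 u v Y1 Y2 u' v' i :=
  v ^+ i * (P u i / P q i) * vwp_quot (u * X1 * X2 * Y1 * Y2) i *
  (P (X1 * Y1 * u' / v) i * P (X1 * Y2 * v' / v) i) *
  (Pi (X1 * X2 * Y1 * Y2 * q ^+ i) * (Pi (X2 * Y1 * u' * q ^+ i) * Pi (X2 * Y2 * v' * q ^+ i)) *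
    (Pi (u * X1 * Y1 * q ^+ i) * Pi (u * X1 * Y2 * q ^+ i))) *
  ((Pi (X2 * Y1 * q ^+ i))^-1 * (Pi (X2 * Y2 * q ^+ i))^-1 * ((Pi (X1 * Y1))^-1 * (Pi (X1 * Y2))^-1)).

Section Shifts.
Variables X1 X2 u v Y1 Y2 w : R[i].
Let v' := u * v / w.
Let A := u * X1 * X2 * Y1 * Y2 / q.
Let e := X1 * Y1 * w / v.
Let f := X1 * Y2 * v' / v.
Let pp := X1 * X2 * Y1 * Y2.
Let b1 := X2 * Y1 * w.
Let b2 := X2 * Y2 * v'.
Hypotheses (hA : nm A < 1) (he : nm e < 1) (hf : nm f < 1) (hp : nm pp < 1)
  (h11 : nm (X1 * Y1) < 1) (h12 : nm (X1 * Y2) < 1) (h21 : nm (X2 * Y1) < 1) (h22 : nm (X2 * Y2) < 1)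
  (hb1 : nm b1 < 1) (hb2 : nm b2 < 1) (hu1 : nm (u * X1 * Y1) < 1) (hu2 : nm (u * X1 * Y2) < 1).
Variable i : nat.
Local Notation s := (q ^+ i).
Local Notation T a b := (vwp_term a b u v Y1 Y2 w v' i).
Let N1 := (1 - X2 * Y1 * s) * (1 - X2 * Y2 * s).
Let M1 := (1 - b1 * s) * (1 - b2 * s).
Let N2 := (1 - e * s) * (1 - f * s).
Let M2 := (1 - u * X1 * Y1 * s) * (1 - u * X1 * Y2 * s).
Let c := (1 - X1 * Y1) * (1 - X1 * Y2) / ((1 - e) * (1 - f)).

Let lt1 b k : nm b < 1 -> nm (b * q ^+ k) < 1.
Proof. by apply: le_lt_trans; exact: nm_qn. Qed.
Let nz b k : nm b < 1 -> 1 - b * q ^+ k != 0.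
Proof. by move=> h; apply: sub1_neq0; exact: lt1. Qed.
Let qs b k : nm b < 1 -> Pi (b * q * q ^+ k) = Pi (b * q ^+ k) / (1 - b * q ^+ k).
Proof. by move=> h; rewrite mulrAC qinf_q ?lt1. Qed.

Let A_s2 : 1 - A * s ^+ 2 != 0.
Proof. by rewrite -exprM; exact: nz. Qed.

Let base k : vwp_term X1 X2 u v Y1 Y2 w v' k =
  v ^+ k * (P u k / P q k) * ((1 - A * (q ^+ k) ^+ 2) / Pi (A * q ^+ k)) *
  (P e k * P f k) * (Pi (pp * q ^+ k) * (Pi (b1 * q ^+ k) * Pi (b2 * q ^+ k)) *
    (Pi (u * X1 * Y1 * q ^+ k) * Pi (u * X1 * Y2 * q ^+ k))) *
  ((Pi (X2 * Y1 * q ^+ k))^-1 * (Pi (X2 * Y2 * q ^+ k))^-1 * ((Pi (X1 * Y1))^-1 * (Pi (X1 * Y2))^-1)).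
Proof. by rewrite /vwp_term -(vwp_quotE k hA) [A * q]divfK. Qed.

Let r2 := (1 - A * q * s ^+ 2) * (1 - A * s) * N1 / ((1 - A * s ^+ 2) * (1 - pp * s) * M1).
Let r1 := (1 - A * q * s ^+ 2) * (1 - A * s) * c * N2 / ((1 - A * s ^+ 2) * (1 - pp * s) * M2).
Let r12 := (1 - A * q ^+ 2 * s ^+ 2) * (1 - A * s) * (1 - A * q * s) * c * N1 * N2 /
  ((1 - A * s ^+ 2) * (1 - pp * s) * (1 - pp * q * s) * M1 * M2).
Let rho := v * (1 - u * s) / (1 - q * s) * (1 - A * q ^+ 2 * s ^+ 2) / (1 - A * s ^+ 2) *
  (1 - A * s) * N2 * N1 / ((1 - pp * s) * M1 * M2).

Lemma vwp_term_T2 : T X1 (X2 * q) = T X1 X2 * r2.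
Proof.
rewrite base /vwp_term.
have -> : u * X1 * (X2 * q) * Y1 * Y2 = A * q * q by rewrite /A; field.
have -> : X1 * (X2 * q) * Y1 * Y2 = pp * q by rewrite /pp; ring.
have -> : X2 * q * Y1 * w = b1 * q by rewrite /b1; ring.
have -> : X2 * q * Y2 * v' = b2 * q by rewrite /b2; ring.
have -> : X2 * q * Y1 = X2 * Y1 * q by ring.
have -> : X2 * q * Y2 = X2 * Y2 * q by ring.
rewrite vwp_quotE; last by have := lt1 1 hA; rewrite expr1.
rewrite !qs // -/e -/f.
have := (nz i hA, nz i hp, nz i hb1, nz i hb2, nz i h21, nz i h22).
have := (qinf_neq0 q1 (lt1 i hA), qinf_neq0 q1 (lt1 i h21), qinf_neq0 q1 (lt1 i h22)).
have := (qinf_neq0 q1 h11, qinf_neq0 q1 h12, A_s2).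
rewrite /r2 /N1 /M1; move: (Pi _) (Pi _) (Pi _) (Pi _) (Pi _) (Pi _) (Pi _) (Pi _) (Pi _) (Pi _) => z1 z2 z3 z4 z5 z6 z7 z8 z9 z10.
move: (P e i) (P f i) (P u i / _) => y1 y2 y3 [[g1 g2] g3] [[g4 g5] g6] [[[[[g7 g8] g9] g10] g11] g12].
field; rewrite ?g1 ?g2 ?g3 ?g4 ?g5 ?g6 ?g7 ?g8 ?g9 ?g10 ?g11 ?g12 //.
Qed.

Lemma vwp_term_T1 : T (X1 * q) X2 = T X1 X2 * r1.
Proof.
rewrite base /vwp_term.
have -> : u * (X1 * q) * X2 * Y1 * Y2 = A * q * q by rewrite /A; field.
have -> : X1 * q * X2 * Y1 * Y2 = pp * q by rewrite /pp; ring.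
have -> : X1 * q * Y1 * w / v = e * q by rewrite /e; ring.
have -> : X1 * q * Y2 * v' / v = f * q by rewrite /f; ring.
have -> : u * (X1 * q) * Y1 = u * X1 * Y1 * q by ring.
have -> : u * (X1 * q) * Y2 = u * X1 * Y2 * q by ring.
have -> : X1 * q * Y1 = X1 * Y1 * q by ring.
have -> : X1 * q * Y2 = X1 * Y2 * q by ring.
rewrite vwp_quotE; last by have := lt1 1 hA; rewrite expr1.
rewrite !qs // !qinf_q // !qpoch_q ?sub1_neq0 // -/b1 -/b2.
have := (nz i hA, nz i hp, nz i hu1, nz i hu2, sub1_neq0 h11, sub1_neq0 h12).
have := (qinf_neq0 q1 (lt1 i hA), qinf_neq0 q1 (lt1 i h21), qinf_neq0 q1 (lt1 i h22)).
have := (qinf_neq0 q1 h11, qinf_neq0 q1 h12, A_s2).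
have := (sub1_neq0 he, sub1_neq0 hf).
rewrite /r1 /N2 /M2 /c; move: (Pi _) (Pi _) (Pi _) (Pi _) (Pi _) (Pi _) (Pi _) (Pi _) (Pi _) (Pi _) => z1 z2 z3 z4 z5 z6 z7 z8 z9 z10.
move: (P e i) (P f i) (P u i / _) => y1 y2 y3 [d1 d2] [[g1 g2] g3] [[g4 g5] g6] [[[[[g7 g8] g9] g10] g11] g12].
field; rewrite ?d1 ?d2 ?g1 ?g2 ?g3 ?g4 ?g5 ?g6 ?g7 ?g8 ?g9 ?g10 ?g11 ?g12 //.
Qed.

Lemma vwp_term_T12 : T (X1 * q) (X2 * q) = T X1 X2 * r12.
Proof.
have ltq b : nm b < 1 -> nm (b * q) < 1 by move=> h; have := lt1 1 h; rewrite expr1.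
rewrite base /vwp_term.
have -> : u * (X1 * q) * (X2 * q) * Y1 * Y2 = A * q * q * q by rewrite /A; field.
have -> : X1 * q * (X2 * q) * Y1 * Y2 = pp * q * q by rewrite /pp; ring.
have -> : X1 * q * Y1 * w / v = e * q by rewrite /e; ring.
have -> : X1 * q * Y2 * v' / v = f * q by rewrite /f; ring.
have -> : u * (X1 * q) * Y1 = u * X1 * Y1 * q by ring.
have -> : u * (X1 * q) * Y2 = u * X1 * Y2 * q by ring.
have -> : X1 * q * Y1 = X1 * Y1 * q by ring.
have -> : X1 * q * Y2 = X1 * Y2 * q by ring.
have -> : X2 * q * Y1 * w = b1 * q by rewrite /b1; ring.
have -> : X2 * q * Y2 * v' = b2 * q by rewrite /b2; ring.
have -> : X2 * q * Y1 = X2 * Y1 * q by ring.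
have -> : X2 * q * Y2 = X2 * Y2 * q by ring.
rewrite vwp_quotE ?ltq // !qs ?ltq // !qinf_q // !qpoch_q ?sub1_neq0 //.
have := (nz i hA, nz i hp, nz i hu1, nz i hu2, sub1_neq0 h11, sub1_neq0 h12).
have := (nz i hb1, nz i hb2, nz i h21, nz i h22).
have := (qinf_neq0 q1 (lt1 i hA), qinf_neq0 q1 (lt1 i h21), qinf_neq0 q1 (lt1 i h22)).
have := (qinf_neq0 q1 h11, qinf_neq0 q1 h12, A_s2).
have := (sub1_neq0 he, sub1_neq0 hf, nz i (ltq _ hA), nz i (ltq _ hp)).
rewrite /r12 /N1 /M1 /N2 /M2 /c; move: (Pi _) (Pi _) (Pi _) (Pi _) (Pi _) (Pi _) (Pi _) (Pi _) (Pi _) (Pi _) => z1 z2 z3 z4 z5 z6 z7 z8 z9 z10.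
move: (P e i) (P f i) (P u i / _) => y1 y2 y3 [[[d1 d2] d3] d4] [[g1 g2] g3] [[g4 g5] g6] [[[c1 c2] c3] c4] [[[[[g7 g8] g9] g10] g11] g12].
field; rewrite ?c1 ?c2 ?c3 ?c4 ?d1 ?d2 ?d3 ?d4 ?g1 ?g2 ?g3 ?g4 ?g5 ?g6 ?g7 ?g8 ?g9 ?g10 ?g11 ?g12 //.
Qed.

Lemma vwp_term_S : vwp_term X1 X2 u v Y1 Y2 w v' i.+1 = T X1 X2 * rho.
Proof.
have qS b : nm b < 1 -> Pi (b * q ^+ i.+1) = Pi (b * s) / (1 - b * s).
  by move=> h; rewrite exprSr mulrA qinf_q ?lt1.
rewrite !base !qS // !qpochS (exprSr q) (exprSr v).
have := (nz i hA, nz i hp, nz i hu1, nz i hu2).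
have := (nz i hb1, nz i hb2, nz i h21, nz i h22).
have := (qinf_neq0 q1 (lt1 i hA), qinf_neq0 q1 (lt1 i h21), qinf_neq0 q1 (lt1 i h22)).
have := (qinf_neq0 q1 h11, qinf_neq0 q1 h12, A_s2).
have := (qpoch_neq0 q1 i q1, nz i q1).
rewrite /rho /N1 /M1 /N2 /M2; move: (Pi _) (Pi _) (Pi _) (Pi _) (Pi _) (Pi _) (Pi _) (Pi _) (Pi _) (Pi _) => z1 z2 z3 z4 z5 z6 z7 z8 z9 z10.
move: (P e i) (P f i) (P u i) (P q i) (v ^+ i) => y1 y2 y3 y4 y5 [d1 d2] [[g1 g2] g3] [[g4 g5] g6] [[[c1 c2] c3] c4] [[[g7 g8] g9] g10].
field; rewrite ?c1 ?c2 ?c3 ?c4 ?d1 ?d2 ?g1 ?g2 ?g3 ?g4 ?g5 ?g6 ?g7 ?g8 ?g9 ?g10 //.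
Qed.

Definition Gcert (x : R[i]) := (1 - x) / (1 - A * x ^+ 2) *
  (c * (1 - A * x) * (X2 - u * pp * X1 * x / v) / (1 - pp * x) - (X2 - A * X1 * x)).

Hypotheses (v0 : v != 0) (w0 : w != 0).

(** Each term solves the equation up to a difference, hence the sum solves it. *)
Lemma vwp_term_EPD :
  X2 * (T X1 X2 - T (X1 * q) X2 - v * T X1 (X2 * q) + v * T (X1 * q) (X2 * q)) -
  X1 * (T X1 X2 - T X1 (X2 * q) - u * T (X1 * q) X2 + u * T (X1 * q) (X2 * q)) =
  Gcert (q ^+ i.+1) * vwp_term X1 X2 u v Y1 Y2 w v' i.+1 - Gcert s * T X1 X2.
Proof.
rewrite vwp_term_T1 vwp_term_T2 vwp_term_T12 vwp_term_S.
have lA : nm (A * q) < 1 by have := lt1 1 hA; rewrite expr1.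
have lA2 : nm (A * q ^+ 2) < 1 by exact: lt1.
have lp : nm (pp * q) < 1 by have := lt1 1 hp; rewrite expr1.
have A4 : 1 - A * q ^+ 2 * s ^+ 2 != 0 by rewrite -(exprM q i); exact: nz.
have := epd_cert v0 w0 q0 (sub1_neq0 he) (sub1_neq0 hf) A_s2 A4 (nz i hp) (nz i lp)
  (nz i hb1) (nz i hb2) (nz i hu1) (nz i hu2) (nz i q1).
rewrite -/A -/e -/f -/pp -/b1 -/b2 -/N1 -/N2 -/M1 -/M2 -/c -/r1 -/r2 -/r12 -/rho.
rewrite -/(Gcert (q * s)) -/(Gcert s) exprS.
move: r1 r2 r12 rho (Gcert _) (Gcert _) (T X1 X2) => a1 a2 a12 a3 G1 G0 t E.
transitivity (t * (X2 * (1 - a1 - v * a2 + v * a12) - X1 * (1 - a2 - u * a1 + u * a12))); first by ring.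
by rewrite E; ring.
Qed.

End Shifts.
End VWP.

(** * Equality of the two sides *)

(** Bounded terms on one disc are absolutely summable on half of it. *)
Lemma ps_coef0_geom (R : realType) (c : nat -> R[i]) (r r' K : R) : 0 < r -> 0 < r' ->
  (forall n, nm (c n) * r ^+ n <= K) ->
  (forall z, nm z <= r' -> sumto (fun n => c n * z ^+ n) 0) -> forall n, c n = 0.
Proof.
move=> r0 r0' cK h; pose s := Num.min r' (r / 2).
have s0 : 0 < s by rewrite lt_min r0' divr_gt0.
have [sr sr'] : s <= r / 2 /\ s <= r' by rewrite !ge_min !lexx orbT.
have K0 : 0 <= K by apply: le_trans (cK 0%N); rewrite mulr_ge0 ?nm_ge0 ?exprn_ge0 // ltW.
have h2 : 0 <= (2^-1 : R) < 1 by lra.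
apply: (@ps_coef0 _ s c (K * (1 - 2^-1)^-1) s0); last by move=> z _ zs; apply: h; exact: le_trans zs sr'.
apply: (dom_le _ (domM K0 (dom_geom h2))) => n; rewrite mulr_ge0 ?nm_ge0 ?exprn_ge0 ?(ltW s0) //=.
apply: (@le_trans _ _ (nm (c n) * (r / 2) ^+ n)).
  by rewrite ler_wpM2l ?nm_ge0 // lerXn2r ?nnegrE ?(ltW s0) // divr_ge0 // ltW.
by rewrite exprMn mulrA ler_wpM2r // exprn_ge0 // invr_ge0.
Qed.

Lemma EPD_lin (S : comPzRingType) (c z u v C a1 a2 a3 a4 b1 b2 b3 b4 : S) :
  c * (a1 - a2 - v * a3 + v * a4) = z * (a1 - a3 - u * a2 + u * a4) ->
  c * (b1 - b2 - v * b3 + v * b4) = z * (b1 - b3 - u * b2 + u * b4) ->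
  c * (a1 + C * b1 - (a2 + C * b2) - v * (a3 + C * b3) + v * (a4 + C * b4)) =
  z * (a1 + C * b1 - (a3 + C * b3) - u * (a2 + C * b2) + u * (a4 + C * b4)).
Proof.
move=> E1 E2; transitivity (c * (a1 - a2 - v * a3 + v * a4) + C * (c * (b1 - b2 - v * b3 + v * b4))); first by ring.
by rewrite E1 E2; ring.
Qed.

Section PoissonKernel.
Variables (R : realType) (q : R[i]).
Hypotheses (q1 : nm q < 1) (q0 : q != 0).
Local Notation p := (nm q).
Local Notation P a n := (qpoch a q n).
Local Notation Pi a := (qpoch_inf a q).

Let p0 : 0 <= p := nm_ge0 q.
Let p01 : 0 <= p < 1. Proof. by rewrite p0 q1. Qed.

(** F N stands for a function of X evaluated at X q^N. If the coefficients of z^k vanish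
    for k < m, then the equation gives d_N = v d_(N+1) for the coefficient d_N of z^m in F N;
    as the d_N are bounded and nm v < 1, they vanish. *)
Lemma EPD_uniq (F : nat -> R[i] -> R[i]) (X u v : R[i]) (r r' B : R) :
  X != 0 -> nm v < 1 -> 0 < r -> 0 < r' ->
  (forall N, psn r B (F N)) -> (forall N, F N 0 = 0) ->
  (forall N z, nm z <= r' -> nm z <= r ->
    X * q ^+ N * (F N z - F N (z * q) - v * F N.+1 z + v * F N.+1 (z * q)) =
    z * (F N z - F N.+1 z - u * F N (z * q) + u * F N.+1 (z * q))) ->
  forall N z, nm z <= r -> F N z = 0.
Proof.
move=> X0 v1 r0 r0' /choice[d hd] F0 EPD.
have r00 := ltW r0.
have dB N m : nm (d N m) * r ^+ m <= B := dom_term m (hd N).1.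
have B0 : 0 <= B := dom_ge0 (hd 0%N).1.
have d0 N : d N 0%N = 0.
  have h : nm (0 : R[i]) <= r by rewrite nm0.
  apply: (sumto_uniq _ (eq_ind _ (sumto _) ((hd N).2 0 h) _ (F0 N))).
  apply: (@ccvg_unshift _ 1); apply: eq_ccvg (ccvg_cst (d N 0%N)) => n.
  by rewrite addn1 big_ord_recl /= mulr1 big1 ?addr0 // => i _; rewrite exprS mul0r mulr0.
pose c N m := X * q ^+ N * ((1 - q ^+ m) * (d N m - v * d N.+1 m)) -
  (if m is k.+1 then (1 - u * q ^+ k) * (d N k - d N.+1 k) else 0).
have hq z : nm z <= r -> nm (z * q) <= r.
  by move=> h; apply: le_trans h; have := nm_qn q1 z 1; rewrite expr1.
have c0 N m : c N m = 0.
  pose K := nm X * (2 * (B + nm v * B)) + r * ((1 + nm u) * (B + B)).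
  apply: (@ps_coef0_geom _ (c N) r (Num.min r r') K) => // [||z].
  - by rewrite lt_min r0 r0'.
  - move=> {}m; rewrite /c.
    have rm : 0 <= r ^+ m by rewrite exprn_ge0.
    apply: (@le_trans _ _ (nm (X * q ^+ N * ((1 - q ^+ m) * (d N m - v * d N.+1 m))) * r ^+ m +
       nm (if m is k.+1 then (1 - u * q ^+ k) * (d N k - d N.+1 k) else 0) * r ^+ m)).
      by rewrite -mulrDl ler_wpM2r // nmB.
    apply: lerD.
      rewrite !nmM -!mulrA ler_wpM2l ?nm_ge0 // nmX.
      apply: (@le_trans _ _ (1 * (2 * (B + nm v * B)))); last by rewrite mul1r.
      apply: ler_pM; rewrite ?mulr_ge0 ?nm_ge0 ?exprn_ge0 //; first by rewrite exprn_ile1 // ltW.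
      apply: ler_pM; rewrite ?mulr_ge0 ?nm_ge0 ?exprn_ge0 //.
        apply: le_trans (nmB _ _) _; rewrite nm1 nmX (_ : 2 = 1 + 1) // lerD2l exprn_ile1 //; exact: ltW.
      apply: (@le_trans _ _ ((nm (d N m) + nm v * nm (d N.+1 m)) * r ^+ m)).
        by rewrite ler_wpM2r // -nmM nmB.
      by rewrite mulrDl -mulrA lerD // ler_wpM2l ?nm_ge0.
    case: m rm => [|k] rm; first by rewrite nm0 mul0r !mulr_ge0 ?addr_ge0 ?nm_ge0.
    rewrite nmM exprS mulrCA ler_wpM2l // -mulrA; apply: ler_pM; rewrite ?mulr_ge0 ?nm_ge0 ?exprn_ge0 //.
      by apply: le_trans (nmB _ _) _; rewrite nm1 lerD2l; exact: nm_qn.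
    apply: (@le_trans _ _ ((nm (d N k) + nm (d N.+1 k)) * r ^+ k)).
      by rewrite ler_wpM2r ?exprn_ge0 // nmB.
    by rewrite mulrDl lerD.
  - rewrite le_min => /andP[zr zr'].
    have [s1 s2] := ((hd N).2 _ zr, (hd N).2 _ (hq _ zr)).
    have [s3 s4] := ((hd N.+1).2 _ zr, (hd N.+1).2 _ (hq _ zr)).
    have L := sumtoZ (X * q ^+ N) (sumtoD (sumtoB (sumtoB s1 s2) (sumtoZ v s3)) (sumtoZ v s4)).
    have RR := sumtoZ z (sumtoD (sumtoB (sumtoB s1 s3) (sumtoZ u s2)) (sumtoZ u s4)).
    rewrite -(subrr (z * (F N z - F N.+1 z - u * F N (z * q) + u * F N.+1 (z * q)))).
    rewrite -{1}(EPD N z zr' zr).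
    have RR' : sumto (fun n => if n is k.+1 then z * (d N k * z ^+ k - d N.+1 k * z ^+ k
       - u * (d N k * (z * q) ^+ k) + u * (d N.+1 k * (z * q) ^+ k)) else 0)
      (z * (F N z - F N.+1 z - u * F N (z * q) + u * F N.+1 (z * q))).
      by have := @sumto_recl _ (fun n => if n is k.+1 then _ else 0) _ RR; rewrite add0r.
    apply: eq_sumto (sumtoB L RR') => [[|k]]; rewrite /c ?exprMn.
      by rewrite !expr0; ring.
    rewrite (exprS z k) (exprS q k).
    by move: (q ^+ N) (q ^+ k) (z ^+ k) (d N k.+1) (d N.+1 k.+1) (d N k) (d N.+1 k) => a b e f g h i; ring.
have dz m N : d N m = 0.
  elim: m N => [//|m IH] N.
  have step M : d M m.+1 = v * d M.+1 m.+1.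
    have := c0 M m.+1; rewrite /c !IH subrr mulr0 subr0 => /eqP.
    rewrite mulf_eq0 mulf_eq0 (negbTE X0) expf_eq0 (negbTE q0) andbF /= mulf_eq0.
    have : nm (q ^+ m.+1) < 1 by rewrite exprS; apply: le_lt_trans q1; exact: nm_qn.
    by move/sub1_neq0/negbTE => -> /=; rewrite subr_eq0 => /eqP.
  have it k : d N m.+1 = v ^+ k * d (N + k)%N m.+1.
    elim: k => [|k ->]; first by rewrite expr0 mul1r addn0.
    by rewrite step exprSr addnS mulrA.
  apply/eqP; rewrite -nm_eq0 eq_le nm_ge0 andbT.
  pose K := B / r ^+ m.+1.
  have lim : (fun k => nm v ^+ k * K) @ \oo --> (0 : R).
    rewrite -(mul0r K); apply: cvgMl.
    have := @cvg_geometric R 1 (nm v); rewrite ger0_norm ?nm_ge0 // => /(_ v1).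
    by apply: cvg_trans; apply: near_eq_cvg; apply: nearW => k; rewrite /geometric /= mul1r.
  apply: (ler_cvg_to (cvg_cst _) lim); apply: nearW => k.
  by rewrite {1}(it k) nmM nmX ler_wpM2l ?exprn_ge0 ?nm_ge0 // ler_pdivlMr ?exprn_gt0.
move=> N z zr; rewrite -(CsumE ((hd N).2 z zr)); apply: CsumE.
by apply: eq_ccvg (ccvg_cst 0) => n; rewrite big1 // => i _; rewrite dz mul0r.
Qed.

Variables (u v Y1 Y2 w : R[i]).
Let v' := u * v / w.
Variables (x y : R).
Hypotheses (xy : x * y < 1) (hY1 : nm Y1 <= y) (hY2 : nm Y2 <= y)
  (u1 : nm u <= 1) (v1 : nm v < 1) (v0 : v != 0) (w0 : w != 0).
Let W := x * y.

(** The values of the second variable for which the very-well-poised series is summable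
    with bounds uniform in the first one; they are stable under X -> q X. *)
Definition good X := [/\ nm X <= x, nm (X * Y1 * w) < 1 & nm (X * Y2 * v') < 1].

Lemma good_q X : good X -> good (X * q).
Proof.
have hq (a : R[i]) : nm (a * q) <= nm a by have := nm_qn q1 a 1; rewrite expr1.
case=> h1 h2 h3; split; first exact: le_trans (hq _) h1.
  by have -> : X * q * Y1 * w = X * Y1 * w * q; [ring|exact: le_lt_trans (hq _) h2].
by have -> : X * q * Y2 * v' = X * Y2 * v' * q; [ring|exact: le_lt_trans (hq _) h3].
Qed.

Let y0 : 0 <= y := le_trans (nm_ge0 _) hY1.

Lemma XY_bound X : nm X <= x -> nm (X * Y1) <= W /\ nm (X * Y2) <= W.
Proof.
by move=> h; rewrite !nmM; split; rewrite ler_pM ?nm_ge0.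
Qed.

Lemma XXYY_bound X X' : nm X <= x -> nm X' <= x -> nm (X * X' * Y1 * Y2) <= W.
Proof.
move=> /XY_bound[b1 _] /XY_bound[_ b2].
have -> : X * X' * Y1 * Y2 = (X * Y1) * (X' * Y2) by ring.
rewrite nmM; have Wge0 : 0 <= W := le_trans (nm_ge0 _) b1.
by apply: le_trans (ler_pM _ _ b1 b2) _; rewrite ?nm_ge0 // ler_piMr // ltW.
Qed.

Lemma u_bound a : nm (u * a) <= nm a.
Proof. by rewrite nmM ler_piMl ?nm_ge0. Qed.

Lemma vwp_term_psn (r : R) : 0 < r -> r <= x -> exists K, 0 <= K /\ forall X, good X -> forall i,
  psn r (K * nm v ^+ i) (fun z => vwp_term q z X u v Y1 Y2 w v' i).
Proof.
move=> r0 rx; have r00 := ltW r0.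
have x0 : 0 <= x := le_trans r00 rx.
have Wge0 : 0 <= W by rewrite mulr_ge0.
pose Ee b := expR (nm (b / v) * r / (1 - p)).
pose k1 := expR (1 / (1 - p)).
pose V0 := expR (W / (1 - W) / (1 - p)).
exists (qmaj q 1 * ((1 + W) * qinfV_maj q W) * (Ee (Y1 * w) * Ee (Y2 * v')) *
   (qinf_maj q W * (k1 * k1) * (qinf_maj q W * qinf_maj q W)) * (V0 * V0 * (qinfV_maj q W * qinfV_maj q W))).
have d0 : 0 < 1 - p by rewrite subr_gt0.
have dW : 0 < 1 - W by rewrite subr_gt0.
have qB0 : 0 <= qinf_maj q W by rewrite addr_ge0 // mulr_ge0 ?invr_ge0 ?(ltW d0) // mulr_ge0 ?expR_ge0.
have qV0 : 1 <= qinfV_maj q W by rewrite lerDl mulr_ge0 ?invr_ge0 ?(ltW d0) // mulr_ge0 ?expR_ge0.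
have qV00 : 0 <= qinfV_maj q W := le_trans ler01 qV0.
split; first by do ![assumption|exact: qmaj_ge0|exact: expR_ge0|exact: ler01|apply: mulr_ge0|apply: addr_ge0].
move=> X [hX hb1 hb2] i.
have rr : nm (r%:C) <= x by rewrite nmC ger0_norm.
have nr : nm (r%:C) = r by rewrite nmC ger0_norm.
have cst a B : nm a <= B -> psn r B (fun=> a) by move=> aB; apply: psn_le aB (psn_cst a r00).
have aW k : nm (u * X * Y1 * Y2 * q ^+ k) * r <= W.
  apply: (@le_trans _ _ (nm (u * X * Y1 * Y2) * r)); first by rewrite ler_wpM2r // nm_qn.
  rewrite -nr -nmM; have -> : u * X * Y1 * Y2 * r%:C = u * (r%:C * X * Y1 * Y2) by ring.
  by apply: le_trans (u_bound _) _; exact: XXYY_bound.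
have [yr1 yr2] : nm Y1 * r <= W /\ nm Y2 * r <= W.
  by have := XY_bound rr; rewrite !nmM nr ![r * _]mulrC.
have hvw : psn r ((1 + W) * qinfV_maj q W) (fun z => vwp_quot q (u * z * X * Y1 * Y2) i).
  case: i => [|m].
    have h := aW 0%N; rewrite expr0 mulr1 in h.
    have h1 := psn_qinfV q1 r0 h xy.
    apply: psn_le (eq_psn _ h1) => [|z _]; last by rewrite /vwp_quot; congr (Pi _)^-1; ring.
    by rewrite ler_peMl // lerDl.
  have h := psnM r00 (psn_lin r00 (aW (m + m).+1)) (psn_qinfV q1 r0 (aW m) xy).
  apply: eq_psn h => z _; rewrite /vwp_quot; congr ((1 - _) / Pi _); ring.
have he b : psn r (Ee b) (fun z => P (z * b / v) i).
  have h : nm (b / v) * r <= nm (b / v) * r by [].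
  by apply: eq_psn (psn_qpoch q1 r0 i h) => z _; congr (P _ i); ring.
have hpp : psn r (qinf_maj q W) (fun z => Pi (z * X * Y1 * Y2 * q ^+ i)).
  have h : nm (X * Y1 * Y2 * q ^+ i) * r <= W.
    apply: (@le_trans _ _ (nm (X * Y1 * Y2) * r)); first by rewrite ler_wpM2r // nm_qn.
    rewrite -nr -nmM; have -> : X * Y1 * Y2 * r%:C = r%:C * X * Y1 * Y2 by ring.
    exact: XXYY_bound.
  by apply: eq_psn (psn_qinf q1 r0 h) => z _; congr (Pi _); ring.
have hb b : nm b < 1 -> psn r k1 (fun=> Pi (b * q ^+ i)).
  move=> b1; apply: cst; apply: qinf_bound => //.
  by apply: le_trans (nm_qn q1 _ _) _; exact: ltW.
have hu b : nm b * r <= W -> psn r (qinf_maj q W) (fun z => Pi (u * z * b * q ^+ i)).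
  move=> b1; have h : nm (u * b * q ^+ i) * r <= W.
    apply: (@le_trans _ _ (nm (u * b) * r)); first by rewrite ler_wpM2r // nm_qn.
    by apply: le_trans b1; rewrite ler_wpM2r // u_bound.
  by apply: eq_psn (psn_qinf q1 r0 h) => z _; congr (Pi _); ring.
have hx b : nm b <= W -> psn r V0 (fun=> (Pi (b * q ^+ i))^-1).
  move=> b1; apply: cst; apply: qinf_Vbound => //.
  by apply: le_trans (nm_qn q1 _ _) _.
have hz b : nm b * r <= W -> psn r (qinfV_maj q W) (fun z => (Pi (z * b))^-1).
  by move=> b1; apply: eq_psn (psn_qinfV q1 r0 b1 xy) => z _; rewrite mulrC.
have [xy1 xy2] := XY_bound hX.
have hc : psn r (nm v ^+ i * qmaj q 1) (fun=> v ^+ i * (P u i / P q i)).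
  by apply: cst; rewrite nmM nmX ler_wpM2l ?exprn_ge0 ?nm_ge0 // qratio_bound.
have M := psnM r00 (psnM r00 (psnM r00 (psnM r00 hc hvw) (psnM r00 (he (Y1 * w)) (he (Y2 * v'))))
  (psnM r00 (psnM r00 hpp (psnM r00 (hb _ hb1) (hb _ hb2))) (psnM r00 (hu _ yr1) (hu _ yr2))))
  (psnM r00 (psnM r00 (hx _ xy1) (hx _ xy2)) (psnM r00 (hz _ yr1) (hz _ yr2))).
apply: psn_le (eq_psn _ M) => [|z _].
  rewrite le_eqVlt; apply/orP; left; apply/eqP; rewrite /Ee.
  by move: (nm v ^+ i) (qmaj q 1) (qinfV_maj q W) (qinf_maj q W) (expR _) (expR _) => *; ring.
by rewrite /vwp_term !(mulrA z).
Qed.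

Definition vwp_sum X1 X2 := Csum (vwp_term q X1 X2 u v Y1 Y2 w v').

Lemma dom_v K : 0 <= K -> dom (fun i => K * nm v ^+ i) (K * (1 - nm v)^-1).
Proof. by move=> K0; apply: domM => //; apply: dom_geom; rewrite nm_ge0. Qed.

Lemma vwp_sum_sumto z X : 0 < x -> nm z <= x -> good X ->
  sumto (vwp_term q z X u v Y1 Y2 w v') (vwp_sum z X) /\ ccvg (vwp_term q z X u v Y1 Y2 w v') 0.
Proof.
move=> x0 zx gX; have [K [K0 hK]] := vwp_term_psn x0 (lexx x).
have b i : nm (vwp_term q z X u v Y1 Y2 w v' i) <= K * nm v ^+ i by exact: psn_bound (hK X gX i) zx.
split; first exact: sumto_sumto (dom_v K0) b.
apply: (ccvg_bound (v := fun i => K * nm v ^+ i)); first by move=> i; rewrite subr0.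
have := @cvg_geometric R K (nm v); rewrite ger0_norm ?nm_ge0 // => /(_ v1).
by apply: cvg_trans; apply: near_eq_cvg; apply: nearW => k; rewrite /geometric /=.
Qed.

Lemma sumto_telescope (g : nat -> R[i]) l : ccvg g l -> sumto (fun i => g i.+1 - g i) (l - g 0%N).
Proof.
move=> gl; apply: eq_ccvg (ccvgB gl (ccvg_cst (g 0%N))) => n.
elim: n => [|n IH]; first by rewrite big_ord0 subrr.
by rewrite big_ord_recr /= -IH; ring.
Qed.

Lemma vwp_sum_EPD z X : 0 < x -> nm z <= x -> good X ->
  nm (u * z * X * Y1 * Y2 / q) < 1 -> nm (z * Y1 * w / v) < 1 -> nm (z * Y2 * v' / v) < 1 ->
  X * (vwp_sum z X - vwp_sum (z * q) X - v * vwp_sum z (X * q) + v * vwp_sum (z * q) (X * q)) =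
  z * (vwp_sum z X - vwp_sum z (X * q) - u * vwp_sum (z * q) X + u * vwp_sum (z * q) (X * q)).
Proof.
move=> x0 zx gX hA he hf; have gXq := good_q gX.
have hq (a : R[i]) : nm (a * q) <= nm a by have := nm_qn q1 a 1; rewrite expr1.
have zqx : nm (z * q) <= x := le_trans (hq z) zx.
have [s11 c11] := vwp_sum_sumto x0 zx gX; have [s21 _] := vwp_sum_sumto x0 zqx gX.
have [s12 _] := vwp_sum_sumto x0 zx gXq; have [s22 _] := vwp_sum_sumto x0 zqx gXq.
have L := sumtoZ X (sumtoD (sumtoB (sumtoB s11 s21) (sumtoZ v s12)) (sumtoZ v s22)).
have RR := sumtoZ z (sumtoD (sumtoB (sumtoB s11 s12) (sumtoZ u s21)) (sumtoZ u s22)).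
have [hX hb1 hb2] := gX.
have [[xy1 xy2] [zy1 zy2]] := (XY_bound hX, XY_bound zx).
have lW a : nm a <= W -> nm a < 1 by move=> h; exact: le_lt_trans h xy.
have huW b : nm (z * b) <= W -> nm (u * z * b) < 1.
  by move=> h; rewrite -mulrA; apply: lW; exact: le_trans (u_bound _) h.
pose g i := Gcert q z X u v Y1 Y2 w (q ^+ i) * vwp_term q z X u v Y1 Y2 w v' i.
have cg : ccvg g 0.
  have cs : ccvg (fun n => q ^+ n) 0 := ccvg_expr q1.
  have lin a : ccvg (fun n => a * q ^+ n) 0 by rewrite -(mulr0 a); exact: ccvgZ cs.
  have one a : ccvg (fun n => 1 - a * q ^+ n) 1.
    by rewrite -{2}(subr0 1); exact: ccvgB (ccvg_cst 1) (lin a).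
  have V1 (f : nat -> R[i]) : ccvg f 1 -> ccvg (fun n => (f n)^-1) 1.
    by move/(ccvgV (oner_neq0 _)); rewrite invr1.
  have oneV a : ccvg (fun n => (1 - a * q ^+ n)^-1) 1 := V1 _ (one a).
  pose A := u * z * X * Y1 * Y2 / q.
  have sq : ccvg (fun n => (1 - A * (q ^+ n) ^+ 2)^-1) 1.
    apply: V1; rewrite -{2}(subr0 1); apply: ccvgB (ccvg_cst 1) _; rewrite -(mulr0 A).
    by apply: ccvgZ; rewrite -(mul0r 0); have := ccvgM cs; apply; exact: ccvg_expr q1.
  have h1 : ccvg (fun n => 1 - q ^+ n) 1 by rewrite -{2}(subr0 1); exact: ccvgB (ccvg_cst 1) cs.
  pose c := (1 - z * Y1) * (1 - z * Y2) / ((1 - z * Y1 * w / v) * (1 - z * Y2 * v' / v)).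
  pose pp := z * X * Y1 * Y2.
  have h2 : ccvg (fun n => X - u * pp * z * q ^+ n / v) X.
    rewrite -{2}(subr0 X); apply: ccvgB (ccvg_cst X) _.
    by apply: eq_ccvg (lin (u * pp * z / v)) => n; ring.
  have h3 : ccvg (fun n => X - A * z * q ^+ n) X.
    by rewrite -{2}(subr0 X); apply: ccvgB (ccvg_cst X) (lin _).
  have h4 := ccvgB (ccvgM (ccvgM (ccvgM (ccvg_cst c) (one A)) h2) (oneV pp)) h3.
  rewrite -(mulr0 (1 * 1 * (c * 1 * X * 1 - X))).
  exact: ccvgM (ccvgM (ccvgM h1 sq) h4) c11.
have tele := sumto_telescope cg.
have g00 : g 0%N = 0 by rewrite /g /Gcert expr0 subrr !mul0r.
rewrite g00 subrr in tele.
apply/eqP; rewrite -subr_eq0; apply/eqP; apply: (sumto_uniq (sumtoB L RR)).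
apply: eq_sumto tele => i; rewrite /g.
rewrite -(vwp_term_EPD q1 q0 hA he hf (lW _ (XXYY_bound zx hX)) (lW _ zy1) (lW _ zy2)
  (lW _ xy1) (lW _ xy2) hb1 hb2 (huW _ zy1) (huW _ zy2) i v0 w0).
by [].
Qed.

(** At X1 = 0 the identity is the q-binomial theorem for (v)_n / (uv)_n followed by the
    generating function of the h_n. *)
Lemma bilin_base X : 0 < x -> good X ->
  bilin q 0 X u v Y1 Y2 w v' = Pi v / Pi (u * v) * vwp_sum 0 X.
Proof.
move=> x0 [hX hb1 hb2]; have [xy1 xy2] := XY_bound hX.
have Wge0 : 0 <= W := le_trans (nm_ge0 _) xy1.
have uv1 : nm (u * v) < 1 by apply: le_lt_trans v1; exact: u_bound.
have lW a : nm a <= W -> nm a < 1 by move=> h; exact: le_lt_trans h xy.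
pose a r n := v ^+ r * (P u r / P q r) * (q ^+ r) ^+ n * (X ^+ n * hpol q n Y1 Y2 w v').
pose K := qmaj q (nm u) * (qmaj q (nm w) * qmaj q (nm v')).
have W01 : 0 <= W < 1 by rewrite Wge0.
have [M dM] := dom_sqr_geom W01.
pose b r n := nm v ^+ r * K * (n.+1%:R ^+ 2 * W ^+ n).
have K0 : 0 <= K by rewrite !mulr_ge0 ?qmaj_ge0.
have db r : dom (b r) (nm v ^+ r * K * M).
  by apply: domM dM; rewrite mulr_ge0 ?exprn_ge0 ?nm_ge0.
have dB : dom (fun r => nm v ^+ r * K * M) (K * M * (1 - nm v)^-1).
  apply: dom_le (dom_v (mulr_ge0 K0 (dom_ge0 dM))) => i.
  apply/andP; split; first by rewrite !mulr_ge0 ?exprn_ge0 ?nm_ge0 ?(dom_ge0 dM).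
  by have -> : nm v ^+ i * K * M = K * M * nm v ^+ i by clearbody K; ring.
have hXY : nm (Y1 * X) <= W /\ nm (Y2 * X) <= W by rewrite ![_ * X]mulrC.
have hb n : nm (X ^+ n * hpol q n Y1 Y2 w v') <= qmaj q (nm w) * qmaj q (nm v') * (n.+1%:R * W ^+ n).
  by rewrite -hpol_scale; apply: hpol_bound; rewrite ?hXY.1 ?hXY.2.
have ab r n : nm (a r n) <= b r n.
  rewrite /a /b /K; move: (hb n); move: v' => v'' hbn; rewrite !(nmM (_ * _)) nmM.
  have -> : nm v ^+ r * (qmaj q (nm u) * (qmaj q (nm w) * qmaj q (nm v''))) * (n.+1%:R ^+ 2 * W ^+ n) =
    nm v ^+ r * qmaj q (nm u) * n.+1%:R * (qmaj q (nm w) * qmaj q (nm v'') * (n.+1%:R * W ^+ n)) by ring.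
  apply: ler_pM hbn; rewrite ?mulr_ge0 ?nm_ge0 //.
  apply: (@le_trans _ _ (nm v ^+ r * qmaj q (nm u) * 1)); last first.
    by rewrite ler_wpM2l ?mulr_ge0 ?exprn_ge0 ?nm_ge0 ?qmaj_ge0 // ler1n.
  apply: ler_pM; rewrite ?mulr_ge0 ?nm_ge0 //.
    by rewrite nmX ler_wpM2l ?exprn_ge0 ?nm_ge0 // qratio_bound.
  by rewrite !nmX -exprM exprn_ile1 ?nm_ge0 // ltW.
have [F _] := fubini dB db ab.
(* The q-binomial theorem for (v; q)_n / (uv; q)_n. *)
have e1 n : bilin_term q 0 X u v Y1 Y2 w v' n = Pi v / Pi (u * v) * Csum (fun r => a r n).
  rewrite /bilin_term hpol_X10 /hcoef.
  have vn : nm (v * q ^+ n) < 1 by apply: le_lt_trans v1; exact: nm_qn.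
  have -> : Csum (fun r => a r n) = X ^+ n * hpol q n Y1 Y2 w v' * (Pi (u * (v * q ^+ n)) / Pi (v * q ^+ n)).
    rewrite -(CsumE (sumtoZ (X ^+ n * hpol q n Y1 Y2 w v') (q_binomial q1 u vn))).
    apply: eq_Csum => r; rewrite /a exprMn -!exprM (mulnC n).
    by move: (X ^+ n) (hpol _ _ _ _ _ _) (P u r / _) (v ^+ r) (q ^+ _) => *; ring.
  rewrite (qinf_split q1 v n) (qinf_split q1 (u * v) n) -(mulrA u).
  have := (qpoch_neq0 q1 n q1, qinf_neq0 q1 vn, qpoch_neq0 q1 n uv1).
  have : Pi (u * (v * q ^+ n)) != 0.
    by apply: qinf_neq0 => //; apply: le_lt_trans vn; exact: u_bound.
  move: (Pi (u * _)) (Pi (v * _)) (P (u * v) n) (P v n) (P q n) (X ^+ n) (hpol _ _ _ _ _ _) => z1 z2 z3 z4 z5 z6 z7 g1 [[g2 g3] g4].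
  by field; rewrite g1 g2 g3 g4.
(* For fixed r the sum over n is the generating function of the h_n. *)
have e2 r : Csum (a r) = vwp_term q 0 X u v Y1 Y2 w v' r.
  have h1 : nm (Y1 * (X * q ^+ r)) < 1.
    by rewrite mulrA; apply: le_lt_trans (nm_qn q1 _ _) _; exact: lW hXY.1.
  have h2 : nm (Y2 * (X * q ^+ r)) < 1.
    by rewrite mulrA; apply: le_lt_trans (nm_qn q1 _ _) _; exact: lW hXY.2.
  have G := sumtoZ (v ^+ r * (P u r / P q r)) (hpol_gf q1 w v' h1 h2).
  transitivity (v ^+ r * (P u r / P q r) * (Pi (w * (Y1 * (X * q ^+ r))) / Pi (Y1 * (X * q ^+ r)) *
     (Pi (v' * (Y2 * (X * q ^+ r))) / Pi (Y2 * (X * q ^+ r))))).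
    rewrite -(CsumE G); apply: eq_Csum => n; rewrite /a hpol_scale exprMn.
    by move: (X ^+ n) (hpol _ _ _ _ _ _) (P u r / _) (v ^+ r) ((q ^+ r) ^+ n) => *; ring.
  rewrite /vwp_term.
  have quot0 : vwp_quot q (u * 0 * X * Y1 * Y2) r = 1.
    rewrite mulr0 !mul0r /vwp_quot; case: (r) => [|m]; first by rewrite qinf0 // invr1.
    by rewrite !mul0r subr0 qinf0 // invr1 mulr1.
  rewrite quot0 !(mulr0, mul0r) !qpoch_0 !qinf0 // invr1 !mulr1 !mul1r.
  have -> : w * (Y1 * (X * q ^+ r)) = X * Y1 * w * q ^+ r by ring.
  have -> : v' * (Y2 * (X * q ^+ r)) = X * Y2 * v' * q ^+ r by ring.
  have -> : Y1 * (X * q ^+ r) = X * Y1 * q ^+ r by ring.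
  have -> : Y2 * (X * q ^+ r) = X * Y2 * q ^+ r by ring.
  by rewrite -[RHS]mulrA; congr (_ * _); exact: mulrACA.
rewrite /bilin (eq_Csum e1) /vwp_sum -(eq_Csum e2); apply: CsumE.
rewrite -(CsumE F); exact: sumtoZ (eq_ind _ (sumto _) F _ (esym (CsumE F))).
Qed.

(** Both sides are power series in X1, equal at X1 = 0. The equation is only used near
    0, where no factor of the very-well-poised side is singular. *)
Theorem bilin_vwp X1 X2 : X2 != 0 -> nm X1 <= x -> good X2 ->
  bilin q X1 X2 u v Y1 Y2 w v' = Pi v / Pi (u * v) * vwp_sum X1 X2.
Proof.
move=> X20 hX1 gX; have [hX hb1 hb2] := gX.
have x0 : 0 < x by apply: lt_le_trans hX; rewrite nm_gt0.
have gX2 N : good (X2 * q ^+ N).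
  elim: N => [|N IH]; first by rewrite expr0 mulr1.
  by rewrite exprSr mulrA; exact: good_q.
have uv1 : nm (u * v) < 1 by apply: le_lt_trans v1; exact: u_bound.
pose C0 := Pi v / Pi (u * v).
pose F N z := bilin q z (X2 * q ^+ N) u v Y1 Y2 w v' + (- C0) * vwp_sum z (X2 * q ^+ N).
have W01 : 0 <= W < 1 by rewrite xy andbT mulr_ge0 // ltW.
have [M dM] := dom_bilin (bilin_maj_ge0 q (nm u) (nm v) (nm w) (nm v') (nm (u * v))) W01.
have [K [K0 hK]] := vwp_term_psn x0 (lexx x).
pose B := M + nm (- C0) * (K * (1 - nm v)^-1).
have hF N : psn x B (F N).
  apply: psnD; first by case: (gX2 N) => h _ _; exact: (bilin_psn q1 x0 (lexx x) h hY1 hY2 uv1 xy dM).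
  apply: psnZ (ltW x0) _; apply: (psn_sum x0 (dom_v K0)) => i; exact: hK.
have F0 N : F N 0 = 0 by rewrite /F bilin_base // mulNr subrr.
pose m1 := nm (u * X2 * Y1 * Y2 / q); pose m2 := nm (Y1 * w / v); pose m3 := nm (Y2 * v' / v).
have [m10 m20 m30] : [/\ 0 <= m1, 0 <= m2 & 0 <= m3] by rewrite !nm_ge0.
have m0 : 0 < 1 + m1 + m2 + m3 by lra.
(* On the disc of radius r' all three conditions of [vwp_sum_EPD] hold. *)
pose r' := (1 + m1 + m2 + m3)^-1.
have r0' : 0 < r' by rewrite invr_gt0.
have small z m (a : R[i]) : nm z <= r' -> nm a <= m -> 0 <= m -> m < 1 + m1 + m2 + m3 -> nm (z * a) < 1.
  move=> zr am m0' mlt; rewrite nmM; apply: (@le_lt_trans _ _ (r' * m)).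
    by rewrite ler_pM ?nm_ge0.
  by rewrite /r' mulrC ltr_pdivrMr // mul1r.
have h := @EPD_uniq F X2 u v x r' B X20 v1 x0 r0' hF F0.
suff E N z : nm z <= r' -> nm z <= x ->
    X2 * q ^+ N * (F N z - F N (z * q) - v * F N.+1 z + v * F N.+1 (z * q)) =
    z * (F N z - F N.+1 z - u * F N (z * q) + u * F N.+1 (z * q)).
  have := h E 0%N X1 hX1; rewrite /F expr0 mulr1 mulNr => /eqP.
  by rewrite subr_eq0 => /eqP.
move=> zr zx; have [gX' gb1 gb2] := gX2 N.
have E1 := bilin_EPD q1 w v' zx gX' hY1 hY2 uv1 xy.
have E2 : X2 * q ^+ N * (vwp_sum z (X2 * q ^+ N) - vwp_sum (z * q) (X2 * q ^+ N) - v * vwp_sum z (X2 * q ^+ N * q) + v * vwp_sum (z * q) (X2 * q ^+ N * q)) =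
  z * (vwp_sum z (X2 * q ^+ N) - vwp_sum z (X2 * q ^+ N * q) - u * vwp_sum (z * q) (X2 * q ^+ N) + u * vwp_sum (z * q) (X2 * q ^+ N * q)).
  apply: vwp_sum_EPD => //.
  - have -> : u * z * (X2 * q ^+ N) * Y1 * Y2 / q = z * (u * X2 * Y1 * Y2 / q * q ^+ N) by ring.
    by apply: (small _ m1) => //; [exact: nm_qn|lra].
  - have -> : z * Y1 * w / v = z * (Y1 * w / v) by ring.
    by apply: (small _ m2) => //; lra.
  - have -> : z * Y2 * v' / v = z * (Y2 * v' / v) by ring.
    by apply: (small _ m3) => //; lra.
clear h hF F0 B; rewrite /F exprSr mulrA; exact: (EPD_lin _ E1 E2).
Qed.

End PoissonKernel.

(** * Askey-Wilson functions as bilinear generating functions *)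

Section W87form.
Variables (R : realType) (q : R[i]).
Hypotheses (q1 : nm q < 1) (q0 : q != 0).
Local Notation p := (nm q).
Local Notation P a n := (qpoch a q n).
Local Notation Pi a := (qpoch_inf a q).

Lemma qpochs_cons (a : R[i]) s n : qpochs (a :: s) q n = P a n * qpochs s q n.
Proof. by rewrite /qpochs big_cons. Qed.
Lemma qpochs_nil n : qpochs [::] q n = 1.
Proof. by rewrite /qpochs big_nil. Qed.
Lemma qinfs_cons (a : R[i]) s : qpochs_inf (a :: s) q = Pi a * qpochs_inf s q.
Proof. by rewrite /qpochs_inf big_cons. Qed.
Lemma qinfs_nil : qpochs_inf [::] q = 1.
Proof. by rewrite /qpochs_inf big_nil. Qed.
Lemma W87_sumto (A b c d e f z l : R[i]) : sumto (W87_term A b c d e f q z) l -> W87 A b c d e f q z = l.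
Proof.
move=> h; rewrite /W87; apply: ccvg_limn; apply: eq_ccvg h => n.
by rewrite /series /= big_mkord.
Qed.

Lemma eq_W87 (s t : nat -> R[i]) : s =1 t ->
  limn (series (s : nat -> R[i]^o)) = limn (series (t : nat -> R[i]^o)).
Proof. by move/funext => ->. Qed.

Lemma W87_perm (A b c d e f z : R[i]) : W87 A b c d e f q z = W87 A f c d b e q z.
Proof.
rewrite /W87; apply: eq_W87 => n; rewrite /W87_term !qpochs_cons !qpochs_nil.
move: (P _ n) (P _ n) (P _ n) (P _ n) (P _ n) (P _ n) (P _ n) (P _ n) (P _ n) (P _ n) (P _ n) => a1 a2 a3 a4 a5 a6 a7 a8 a9 a10 a11.
by congr (_ * _ / _ * _); ring.
Qed.

Lemma W87_permef (A b c d e f z : R[i]) : W87 A b c d e f q z = W87 A b c d f e q z.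
Proof.
rewrite /W87; apply: eq_W87 => n; rewrite /W87_term !qpochs_cons !qpochs_nil.
move: (P _ n) (P _ n) (P _ n) (P _ n) (P _ n) (P _ n) (P _ n) (P _ n) (P _ n) (P _ n) (P _ n) => a1 a2 a3 a4 a5 a6 a7 a8 a9 a10 a11.
by congr (_ * _ / _ * _); ring.
Qed.

Lemma W87_permcd (A b c d e f z : R[i]) : W87 A b c d e f q z = W87 A b e f c d q z.
Proof.
rewrite /W87; apply: eq_W87 => n; rewrite /W87_term !qpochs_cons !qpochs_nil.
move: (P _ n) (P _ n) (P _ n) (P _ n) (P _ n) (P _ n) (P _ n) (P _ n) (P _ n) (P _ n) (P _ n) => a1 a2 a3 a4 a5 a6 a7 a8 a9 a10 a11.
by congr (_ * _ / _ * _); ring.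
Qed.

Theorem bilin_W87 (X1 X2 u v Y1 Y2 w v' A e f : R[i]) (x y : R) :
  x * y < 1 -> nm X1 <= x -> nm X2 <= x -> nm Y1 <= y -> nm Y2 <= y -> nm u <= 1 -> nm v < 1 ->
  X1 != 0 -> X2 != 0 -> Y1 != 0 -> Y2 != 0 -> u != 0 -> v != 0 -> w != 0 ->
  nm (X2 * Y1 * w) < 1 -> nm (X2 * Y2 * v') < 1 -> w * v' = u * v ->
  A * q = u * X1 * X2 * Y1 * Y2 -> e * v = X1 * Y1 * w -> f * v = X1 * Y2 * v' ->
  bilin q X1 X2 u v Y1 Y2 w v' =
    Pi v * (Pi (X1 * X2 * Y1 * Y2) * (Pi (X2 * Y1 * w) * Pi (X2 * Y2 * v') * (Pi (u * X1 * Y1) * Pi (u * X1 * Y2)))) /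
    (Pi (u * v) * (Pi (u * X1 * X2 * Y1 * Y2) * (Pi (X1 * Y1) * Pi (X1 * Y2) * (Pi (X2 * Y1) * Pi (X2 * Y2))))) *
    W87 A u (X2 * Y1) (X2 * Y2) e f q v.
Proof.
move=> xy hX1 hX2 hY1 hY2 u1 v1 X10 X20 Y10 Y20 u0 v0 w0 hb1 hb2 ev' eA ee ef.
have x0 : 0 < x by apply: lt_le_trans hX2; rewrite nm_gt0.
have dv' : v' = u * v / w by rewrite -ev'; field; rewrite w0.
have de : e = X1 * Y1 * w / v by rewrite -ee; field; rewrite v0.
have df : f = X1 * Y2 * v' / v by rewrite -ef; field; rewrite v0.
have v'0 : v' != 0 by rewrite dv' !mulf_neq0 ?invr_eq0.
have [e0 f0] : e != 0 /\ f != 0 by rewrite de df !mulf_neq0 ?invr_eq0.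
pose a := u * X1 * X2 * Y1 * Y2.
have [c1 c2] := (XY_bound hY1 hY2 hX1, XY_bound hY1 hY2 hX2).
have lW z : nm z <= x * y -> nm z < 1 by move=> h; exact: le_lt_trans h xy.
have hp : nm (X1 * X2 * Y1 * Y2) < 1 by exact: lW (XXYY_bound xy hY1 hY2 hX1 hX2).
have hu z : nm z < 1 -> nm (u * z) < 1 by move=> h; apply: le_lt_trans h; exact: u_bound u1 z.
have ha : nm a < 1 by have -> : a = u * (X1 * X2 * Y1 * Y2); [rewrite /a; ring|exact: hu].
have hu1 : nm (u * X1 * Y1) < 1 by rewrite -mulrA; apply/hu/lW; case: c1.
have hu2 : nm (u * X1 * Y2) < 1 by rewrite -mulrA; apply/hu/lW; case: c1.
have [h11 h12] : nm (X1 * Y1) < 1 /\ nm (X1 * Y2) < 1 by case: c1 => ? ?; split; exact: lW.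
have [h21 h22] : nm (X2 * Y1) < 1 /\ nm (X2 * Y2) < 1 by case: c2 => ? ?; split; exact: lW.
have gX : good u v Y1 Y2 w x X2 by split=> //; rewrite -dv'.
rewrite dv' (bilin_vwp q1 q0 xy hY1 hY2 u1 v1 v0 w0 X20 hX1 gX) -dv'.
have [sE _] := vwp_sum_sumto q1 xy hY1 hY2 u1 v1 x0 hX1 gX.
pose C := Pi (X1 * X2 * Y1 * Y2) * (Pi (X2 * Y1 * w) * Pi (X2 * Y2 * v') * (Pi (u * X1 * Y1) * Pi (u * X1 * Y2))) /
  (Pi a * (Pi (X1 * Y1) * Pi (X1 * Y2) * (Pi (X2 * Y1) * Pi (X2 * Y2)))).
have nz z : nm z < 1 -> Pi z != 0 by by move=> z1; exact: qinf_neq0.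
have C0 : C != 0 by rewrite /C !mulf_neq0 // ?invr_eq0 ?mulf_neq0 ?nz.
have tE i : vwp_term q X1 X2 u v Y1 Y2 w (u * v / w) i = C * W87_term A u (X2 * Y1) (X2 * Y2) e f q v i.
  rewrite -dv' /vwp_term -/a (vwp_quot_factor q1 i ha eA) /W87_term !qpochs_cons !qpochs_nil !mulr1 -de -df.
  have -> : A * q / u = X1 * X2 * Y1 * Y2 by rewrite eA; field; rewrite u0.
  have -> : A * q / (X2 * Y1) = u * X1 * Y2 by rewrite eA; field; rewrite X20 Y10.
  have -> : A * q / (X2 * Y2) = u * X1 * Y1 by rewrite eA; field; rewrite X20 Y20.
  have -> : A * q / e = X2 * Y2 * v' by rewrite eA de dv'; field; rewrite X10 Y10 w0 v0.
  have -> : A * q / f = X2 * Y1 * w by rewrite eA df dv'; field; rewrite X10 Y20 w0 v0 u0.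
  have E (b : R[i]) : nm b < 1 -> Pi (b * q ^+ i) = Pi b / P b i.
    by move=> b1; rewrite (qinf_split q1 b i) mulrAC divff ?mul1r // qpoch_neq0.
  rewrite !E //.
  have := (nz _ ha, nz _ h11, nz _ h12, nz _ h21, nz _ h22).
  have := (qpoch_neq0 q1 i q1, qpoch_neq0 q1 i hp, qpoch_neq0 q1 i hu1, qpoch_neq0 q1 i hu2, qpoch_neq0 q1 i hb1, qpoch_neq0 q1 i hb2).
  have := (qpoch_neq0 q1 i h21, qpoch_neq0 q1 i h22).
  rewrite /C; clearbody a; clear.
  move: (P _ i) (P _ i) (P _ i) (P _ i) (P _ i) (P _ i) (P _ i) (P _ i) (P _ i) (P _ i) (P _ i) => a1 a2 a3 a4 a5 a6 a7 a8 a9 a10 a11.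
  move: (Pi _) (Pi _) (Pi _) (Pi _) (Pi _) (Pi _) (Pi _) (Pi _) (Pi _) (Pi _) => b1 b2 b3 b4 b5 b6 b7 b8 b9 b10.
  move: (vwp_factor _ _ _) (v ^+ i) => b11 b12 [z1 z2] [[[[[z3 z4] z5] z6] z7] z8] [[[[z9 z10] z11] z12] z13].
  by field; rewrite ?z1 ?z2 ?z3 ?z4 ?z5 ?z6 ?z7 ?z8 ?z9 ?z10 ?z11 ?z12 ?z13.
have sW : sumto (W87_term A u (X2 * Y1) (X2 * Y2) e f q v) (C^-1 * vwp_sum q u v Y1 Y2 w X1 X2).
  by apply: eq_sumto (sumtoZ C^-1 sE) => i; rewrite tE mulKf.
rewrite (W87_sumto sW) /C -/a; clear sW tE C0 C.
have uv1 : nm (u * v) < 1 by apply: hu.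
have := (nz _ ha, nz _ h11, nz _ h12, nz _ h21, nz _ h22).
have := (nz _ hp, nz _ hb1, nz _ hb2, nz _ hu1, nz _ hu2, nz _ uv1).
clearbody a; move: (vwp_sum _ _ _ _ _ _ _ _); clear => E.
move: (Pi _) (Pi _) (Pi _) (Pi _) (Pi _) (Pi _) (Pi _) (Pi _) (Pi _) (Pi _) (Pi _) (Pi _) => b1 b2 b3 b4 b5 b6 b7 b8 b9 b10 b11 b12.
move=> [[[[[z3 z4] z5] z6] z7] z8] [[[[z9 z10] z11] z12] z13].
by field; rewrite ?z3 ?z4 ?z5 ?z6 ?z7 ?z8 ?z9 ?z10 ?z11 ?z12 ?z13.
Qed.

(** [bilin_W87] with its arguments known up to equations. *)
Lemma bilin_W87_rewr (X1 X2 u v Y1 Y2 w v' A e f p a uv b1 b2 c1 c2 d11 d12 d21 d22 : R[i]) (x y : R) :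
  x * y < 1 -> nm X1 <= x -> nm X2 <= x -> nm Y1 <= y -> nm Y2 <= y -> nm u <= 1 -> nm v < 1 ->
  X1 != 0 -> X2 != 0 -> Y1 != 0 -> Y2 != 0 -> u != 0 -> v != 0 -> w != 0 ->
  nm b1 < 1 -> nm b2 < 1 ->
  [/\ w * v' = u * v, A * q = u * X1 * X2 * Y1 * Y2, e * v = X1 * Y1 * w & f * v = X1 * Y2 * v'] ->
  [/\ X1 * X2 * Y1 * Y2 = p, u * X1 * X2 * Y1 * Y2 = a, u * v = uv, X2 * Y1 * w = b1 & X2 * Y2 * v' = b2] ->
  [/\ u * X1 * Y1 = c1, u * X1 * Y2 = c2, X1 * Y1 = d11 & X1 * Y2 = d12] -> X2 * Y1 = d21 -> X2 * Y2 = d22 ->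
  bilin q X1 X2 u v Y1 Y2 w v' =
    Pi v * (Pi p * (Pi b1 * Pi b2 * (Pi c1 * Pi c2))) / (Pi uv * (Pi a * (Pi d11 * Pi d12 * (Pi d21 * Pi d22)))) *
    W87 A u d21 d22 e f q v.
Proof.
move=> xy h1 h2 h3 h4 h5 h6 h7 h8 h9 h10 h11 h12 h13 h14 h15 [e1 e2 e3 e4] [<- <- <- E1 E2] [<- <- <- <-] <- <-.
by rewrite -E1 -E2 in h14 h15 *; exact: bilin_W87 xy h1 h2 h3 h4 h5 h6 h7 h8 h9 h10 h11 h12 h13 h14 h15 e1 e2 e3 e4.
Qed.

(** P_k(x, y; r, s | t); its terms are invariant under inversion of each of x, y, r, s
    by [hpol_eq]. *)
Definition kern k t x y r s : R[i] :=
  bilin q (t * x) (t / x) (k * r / x) (k * x / r) y y^-1 (k * s / y) (k * y / s).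

Section Kern.
Variables (k t x y r s : R[i]) (kr tr : R).
Hypotheses (hk : nm k = kr) (ht : nm t = tr) (hx : nm x = 1) (hy : nm y = 1) (hr : nm r = 1) (hs : nm s = 1).
Hypotheses (k01 : 0 < kr < 1) (t01 : 0 < tr < 1).

Let nz (z : R[i]) : nm z = 1 -> z != 0. Proof. by move=> h; rewrite -nm_gt0 h. Qed.
Let k0 : k != 0. Proof. by rewrite -nm_gt0 hk; case/andP: k01. Qed.
Let t0 : t != 0. Proof. by rewrite -nm_gt0 ht; case/andP: t01. Qed.
Let nms := (nmM, nmV, hk, ht, hx, hy, hr, hs, invr1, mulr1, mul1r).
Let kt1 : kr * tr < 1. Proof. by case/andP: k01 => a b; case/andP: t01 => c d; rewrite mulr_ilt1 ?ltW. Qed.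

Lemma bilin_eq X1 X2 u v X1' X2' u' v' Y1 Y2 w w' :
  X1 + X2 = X1' + X2' -> X1 * X2 = X1' * X2' ->
  u * X1 + v * X2 = u' * X1' + v' * X2' -> u * v = u' * v' ->
  bilin q X1 X2 u v Y1 Y2 w w' = bilin q X1' X2' u' v' Y1 Y2 w w'.
Proof.
move=> e1 e2 e3 e4; apply: eq_Csum => n.
by rewrite /bilin_term (hpol_eq q1 n e1 e2 e3 e4) e4.
Qed.

Let Fl := (nz hx, nz hy, nz hr, nz hs, k0, t0, q0).
Let nmu (z z' : R[i]) : nm z = 1 -> nm z' = 1 -> nm (z * z') = 1. Proof. by move=> a b; rewrite nmM a b mulr1. Qed.
Let nmi (z : R[i]) : nm z = 1 -> nm z^-1 = 1. Proof. by move=> a; rewrite nmV a invr1. Qed.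
Let nz2 (a b : R[i]) : a != 0 -> b != 0 -> a * b != 0 := @mulf_neq0 _ a b.
Let nzi (a : R[i]) : a != 0 -> a^-1 != 0. Proof. by rewrite invr_eq0. Qed.

Ltac nzt := do ?[exact: k0|exact: t0|exact: nz hx|exact: nz hy|exact: nz hr|exact: nz hs|exact: oner_neq0|apply: nz2|apply: nzi].

Lemma kern_W87 : kern k t x y r s =
  Pi (k * r * x) * (Pi (t ^+ 2) * (Pi (t * k * s / x) * Pi (t * k / (x * s)) * (Pi (t * k * y / r) * Pi (t * k / (r * y))))) /
  (Pi (k ^+ 2) * (Pi (k * t ^+ 2 / (r * x)) * (Pi (t * x * y) * Pi (t * x / y) * (Pi (t * y / x) * Pi (t / (x * y)))))) *
  W87 (k * t ^+ 2 / (r * x) / q) (k / (r * x)) (t * y / x) (t / (x * y)) (t * s / r) (t / (r * s)) q (k * r * x).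
Proof.
have [[k1 k2] [t1 t2]] := (andP k01, andP t01).
transitivity (bilin q (t * x) (t / x) (k / (r * x)) (k * r * x) y y^-1 (k * s / y) (k * y / s)).
  by apply: bilin_eq; field; rewrite ?Fl.
have n1 : nm (t * k * s / x) < 1 by rewrite !nms mulrC.
have n2 : nm (t * k / (x * s)) < 1 by rewrite !nms mulrC.
have n3 : nm (k / (r * x)) <= 1 by rewrite !nms ltW.
have n4 : nm (k * r * x) < 1 by rewrite !nms.
have n5 : nm (t * x) <= tr /\ nm (t / x) <= tr by rewrite !nms.
have n6 : nm y <= 1 /\ nm y^-1 <= 1 by rewrite !nms.
have tr1 : tr * 1 < 1 by rewrite mulr1.
case: n5 n6 => n5 n5' [n6 n6'].
apply: (bilin_W87_rewr tr1 n5 n5' n6 n6' n3 n4 _ _ _ _ _ _ _ n1 n2); try by nzt.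
1-3: split.
all: by field; rewrite ?Fl.
Qed.

(** Two readings of one kernel, exchanging the pairs (tx, t/x) and (u, v), give
    Bailey's transformation of the very-well-poised series. *)
Theorem AW_fun_kern (kC : k = kr%:C) (tC : t = tr%:C) : AW_fun s x (k * r) (t * y) (t / y) (q * r / k) q =
  Pi (k ^+ 2) * (Pi (t * x * y) * Pi (t * x / y) * (Pi (t * y / x) * Pi (t / (x * y)))) * kern k t x y r s.
Proof.
have [[k1 k2] [t1 t2]] := (andP k01, andP t01).
have nkC : `|k * r| = k by rewrite nmE nmM hk hr mulr1 kC.
have ntC : `|t * y| = t by rewrite nmE nmM ht hy mulr1 tC.
have ta : t * (k * r / k) = t * r by field; rewrite ?Fl.
rewrite /AW_fun nkC ntC ta /=.
have -> : k * r * (t * y) / (t * r) = k * y by field; rewrite ?Fl.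
have -> : k * r * (t / y) / (t * r) = k / y by field; rewrite ?Fl.
have -> : k * r * (q * r / k) / (t * r) = q * r / t by field; rewrite ?Fl.
rewrite !qinfs_cons qinfs_nil mulr1.
have -> : q * (k * r) * s / (q * r / t) = k * t * s by field; rewrite ?Fl.
have -> : q / (q * r / t * s) = t / (r * s) by field; rewrite ?Fl.
have -> : k * r * (t * y) = k * r * t * y by ring.
have -> : k * r * (t / y) = k * r * t / y by field; rewrite ?Fl.
have -> : q * (k * r) / (q * r / k) = k ^+ 2 by field; rewrite ?Fl.
have -> : t * r * (k * y) * (k / y) * s = t * k ^+ 2 * r * s by field; rewrite ?Fl.
have -> : k * y * s = k * s * y by ring.
have -> : k / y * s = k * s / y by ring.
rewrite W87_permcd.
(* The two readings W1 and W2 below differ by exchanging the pairs (X1, u) and (1, v). *)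
pose X1 := t / (k * s * x).
pose PP1 := bilin q X1 1 (k * r * x) (t / (r * s)) (k * s * y) (k * s / y) (k / (s * y)) (t * x * y).
pose xx := Num.max 1 (tr / kr).
have xx1 : nm (1 : R[i]) <= xx by rewrite nm1 le_max lexx.
have xx2 : nm X1 <= xx by rewrite /X1 !nms le_max lexx orbT.
have xk : xx * kr < 1 by rewrite /xx maxr_pMl ?ltW // gt_max mul1r k2 divfK ?gt_eqF.
have n1 : nm (k ^+ 2) < 1 by rewrite expr2 nmM hk mulr_ilt1 ?ltW.
have n2 : nm (t ^+ 2) < 1 by rewrite expr2 nmM ht mulr_ilt1 ?ltW.
have n3 : nm (k * t * s * x) < 1 by rewrite !nms.
have n4 : nm (k * r * x) < 1 by rewrite !nms.
have n5 : nm (t / (r * s)) < 1 by rewrite !nms.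
have n6 : nm (k * s * y) <= kr by rewrite !nms.
have n7 : nm (k * s / y) <= kr by rewrite !nms.
have n8 : nm (t * k / (x * s)) < 1 by rewrite !nms mulrC.
have W1 : PP1 = Pi (t / (r * s)) * (Pi (k * t * s / x) * (Pi (k ^+ 2) * Pi (k * t * s * x) * (Pi (k * r * t * y) * Pi (k * r * t / y)))) /
   (Pi (k * t * x / s) * (Pi (t * k ^+ 2 * r * s) * (Pi (t * y / x) * Pi (t / (x * y)) * (Pi (k * s * y) * Pi (k * s / y))))) *
   W87 (t * k ^+ 2 * r * s / q) (k * r * x) (k * s * y) (k * s / y) (k * r / x) (t * r * s) q (t / (r * s)).
  apply: (bilin_W87_rewr xk xx2 xx1 n6 n7 (ltW n4) n5 _ _ _ _ _ _ _ n1 n3); rewrite /X1.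
  1-7: by nzt.
  1-3: split.
  1-15: by field; rewrite ?Fl.
have W2 : PP1 = Pi (k * r * x) * (Pi (k * t * s / x) * (Pi (t * k / (x * s)) * Pi (t ^+ 2) * (Pi (t * k * y / r) * Pi (t * k / (r * y))))) /
   (Pi (k * t * x / s) * (Pi (k * t ^+ 2 / (r * x)) * (Pi (k * s * y) * Pi (k * s / y) * (Pi (t * y / x) * Pi (t / (x * y)))))) *
   W87 (k * t ^+ 2 / (r * x) / q) (t / (r * s)) (t * y / x) (t / (x * y)) (k / (r * x)) (t * s / r) q (k * r * x).
  rewrite /PP1 bilin_swap.
  apply: (bilin_W87_rewr xk xx1 xx2 n6 n7 (ltW n5) n4 _ _ _ _ _ _ _ n8 n2); rewrite /X1.
  1-7: by nzt.
  1-3: split.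
  1-15: by field; rewrite ?Fl.
have iP (a : R[i]) : nm a < 1 -> Pi a != 0 by move=> h; exact: qinf_neq0.
have tk1 : tr * kr < 1 by rewrite mulrC.
rewrite kern_W87.
have -> : W87 (k * t ^+ 2 / (r * x) / q) (k / (r * x)) (t * y / x) (t / (x * y)) (t * s / r) (t / (r * s)) q (k * r * x) =
  W87 (k * t ^+ 2 / (r * x) / q) (t / (r * s)) (t * y / x) (t / (x * y)) (k / (r * x)) (t * s / r) q (k * r * x).
  by rewrite W87_perm W87_permef.
have a1 : nm (t * k ^+ 2 * r * s) < 1 by rewrite (nmM _ s) (nmM _ r) hr hs !mulr1 nmM ht mulr_ilt1 ?nm_ge0 ?ltW.
have a2 : nm (k * t ^+ 2 / (r * x)) < 1 by rewrite (nmM _ _^-1) (nmi (nmu hr hx)) mulr1 nmM hk mulr_ilt1 ?nm_ge0 ?ltW.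
have m0 : Pi (t * x * y) != 0 by apply: iP; rewrite !nms.
have m1 : Pi (t * x / y) != 0 by apply: iP; rewrite !nms.
have m2 : Pi (t * y / x) != 0 by apply: iP; rewrite !nms.
have m3 : Pi (t / (x * y)) != 0 by apply: iP; rewrite !nms.
have m4 : Pi (t / (r * s)) != 0 by apply: iP; rewrite !nms.
have m5 : Pi (k * s * y) != 0 by apply: iP; rewrite !nms.
have m6 : Pi (k * s / y) != 0 by apply: iP; rewrite !nms.
have m7 : Pi (k * t * s / x) != 0 by apply: iP; rewrite !nms.
have m8 : Pi (k * t * s * x) != 0 by apply: iP; rewrite !nms.
have m9 : Pi (k * r * t * y) != 0 by apply: iP; rewrite !nms.
have m10 : Pi (k * r * t / y) != 0 by apply: iP; rewrite !nms.
have m11 : Pi (k * t * x / s) != 0 by apply: iP; rewrite !nms.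
have m12 : Pi (k * r * x) != 0 by apply: iP; rewrite !nms.
have m13 : Pi (t * k / (x * s)) != 0 by apply: iP; rewrite !nms.
have m14 : Pi (t * k * y / r) != 0 by apply: iP; rewrite !nms.
have m15 : Pi (t * k / (r * y)) != 0 by apply: iP; rewrite !nms.
have m16 : Pi (t * k * s / x) != 0 by apply: iP; rewrite !nms.
have m20 := iP _ a1; have m21 := iP _ a2; have m22 := iP _ n1; have m23 := iP _ n2.
have E : t * k * s / x = k * t * s / x by rewrite (mulrC t k).
rewrite E in m16 *.
move: m0 m1 m2 m3 m4 m5 m6 m7 m8 m9 m10 m11 m12 m13 m14 m15 m20 m21 m22 m23 W2; rewrite W1; clear.
move: (Pi (t * x * y)) => p0.
move: (Pi (t * x / y)) => p1.
move: (Pi (t * y / x)) => p2.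
move: (Pi (t / (x * y))) => p3.
move: (Pi (t / (r * s))) => p4.
move: (Pi (k * s * y)) => p5.
move: (Pi (k * s / y)) => p6.
move: (Pi (k * t * s / x)) => p7.
move: (Pi (k * t * s * x)) => p8.
move: (Pi (k * r * t * y)) => p9.
move: (Pi (k * r * t / y)) => p10.
move: (Pi (k * t * x / s)) => p11.
move: (Pi (k * r * x)) => p12.
move: (Pi (t * k / (x * s))) => p13.
move: (Pi (t * k * y / r)) => p14.
move: (Pi (t * k / (r * y))) => p15.
move: (Pi (t * k ^+ 2 * r * s)) => p16.
move: (Pi (k * t ^+ 2 / (r * x))) => p17.
move: (Pi (k ^+ 2)) => p18.
move: (Pi (t ^+ 2)) => p19.
move: (W87 _ _ _ _ _ _ _ _) (W87 _ _ _ _ _ _ _ _) => w1 w2.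
move=> z0 z1 z2 z3 z4 z5 z6 z7 z8 z9 z10 z11 z12 z13 z14 z15 z16 z17 z18 z19 W2.
transitivity (p11 * (p2 * p3 * (p5 * p6)) * (p4 * (p7 * (p18 * p8 * (p9 * p10))) /
    (p11 * (p16 * (p2 * p3 * (p5 * p6)))) * w2)); first by field; rewrite ?z0 ?z1 ?z2 ?z3 ?z4 ?z5 ?z6 ?z7 ?z8 ?z9 ?z10 ?z11 ?z12 ?z13 ?z14 ?z15 ?z16 ?z17 ?z18 ?z19.
by rewrite W2; field; rewrite ?z0 ?z1 ?z2 ?z3 ?z4 ?z5 ?z6 ?z7 ?z8 ?z9 ?z10 ?z11 ?z12 ?z13 ?z14 ?z15 ?z16 ?z17 ?z18 ?z19.
Qed.

(** Read off by [bilin_W87], the two kernels are the same series up to the order of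
    its parameters. *)
Theorem kern_sym :
  Pi (t * x * y) * Pi (t * x / y) * (Pi (t * y / x) * Pi (t / (x * y))) * kern k t x y r s =
  Pi (t * r * s) * Pi (t * r / s) * (Pi (t * s / r) * Pi (t / (r * s))) * kern k t r s x y.
Proof.
have [[k1 k2] [t1 t2]] := (andP k01, andP t01).
have tr1 : tr * 1 < 1 by rewrite mulr1.
have n1 : nm (t * x) <= tr /\ nm (t / x) <= tr by rewrite !nms.
have n1' : nm (t * r) <= tr /\ nm (t / r) <= tr by rewrite !nms.
have n2 : nm y <= 1 /\ nm y^-1 <= 1 by rewrite !nms.
have n2' : nm s <= 1 /\ nm s^-1 <= 1 by rewrite !nms.
have n3 : nm (k * x / r) <= 1 by rewrite !nms ltW.
have n4 : nm (k * r / x) < 1 by rewrite !nms.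
have b1 : nm (t * k * x * s) < 1 by rewrite !nms mulrC.
have b2 : nm (t * k * x / s) < 1 by rewrite !nms mulrC.
have c1 : nm (t * k * y / r) < 1 by rewrite !nms mulrC.
have c2 : nm (t * k / (r * y)) < 1 by rewrite !nms mulrC.
have W1 : kern k t x y r s = Pi (k * r / x) * (Pi (t ^+ 2) * (Pi (t * k * x * s) * Pi (t * k * x / s) * (Pi (t * k * y / r) * Pi (t * k / (r * y))))) /
  (Pi (k ^+ 2) * (Pi (k * x / r * t ^+ 2) * (Pi (t * y / x) * Pi (t / (x * y)) * (Pi (t * x * y) * Pi (t * x / y))))) *
  W87 (k * x / r * t ^+ 2 / q) (k * x / r) (t * x * y) (t * x / y) (t * s / r) (t / (r * s)) q (k * r / x).
  rewrite /kern bilin_swap; apply: (bilin_W87_rewr tr1 n1.2 n1.1 n2.1 n2.2 n3 n4 _ _ _ _ _ _ _ b1 b2).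
  1-7: by nzt.
  1-3: split.
  1-15: by field; rewrite ?Fl.
have W2 : kern k t r s x y = Pi (k * r / x) * (Pi (t ^+ 2) * (Pi (t * k * y / r) * Pi (t * k / (r * y)) * (Pi (t * k * x * s) * Pi (t * k * x / s)))) /
  (Pi (k ^+ 2) * (Pi (k * x / r * t ^+ 2) * (Pi (t * r * s) * Pi (t * r / s) * (Pi (t * s / r) * Pi (t / (r * s)))))) *
  W87 (k * x / r * t ^+ 2 / q) (k * x / r) (t * s / r) (t / (r * s)) (t * x * y) (t * x / y) q (k * r / x).
  rewrite /kern; apply: (bilin_W87_rewr tr1 n1'.1 n1'.2 n2'.1 n2'.2 n3 n4 _ _ _ _ _ _ _ c1 c2).
  1-7: by nzt.
  1-3: split.
  1-15: by field; rewrite ?Fl.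
rewrite W1 W2 [W87 _ _ (t * s / r) _ _ _ _ _]W87_permcd.
have iP (a : R[i]) : nm a < 1 -> Pi a != 0 by move=> h; exact: qinf_neq0.
have m0 : Pi (t * x * y) != 0 by apply: iP; rewrite !nms.
have m1 : Pi (t * x / y) != 0 by apply: iP; rewrite !nms.
have m2 : Pi (t * y / x) != 0 by apply: iP; rewrite !nms.
have m3 : Pi (t / (x * y)) != 0 by apply: iP; rewrite !nms.
have m4 : Pi (t * r * s) != 0 by apply: iP; rewrite !nms.
have m5 : Pi (t * r / s) != 0 by apply: iP; rewrite !nms.
have m6 : Pi (t * s / r) != 0 by apply: iP; rewrite !nms.
have m7 : Pi (t / (r * s)) != 0 by apply: iP; rewrite !nms.
have m8 : Pi (k ^+ 2) != 0 by apply: iP; rewrite expr2 nmM hk mulr_ilt1 ?ltW.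
have m9 : Pi (k * x / r * t ^+ 2) != 0.
  have e1 : nm (k * x / r) < 1 by rewrite !nms.
  have e2 : nm (t ^+ 2) < 1 by rewrite expr2 nmM ht mulr_ilt1 ?ltW.
  by apply: iP; rewrite nmM mulr_ilt1 ?nm_ge0.
move: m0 m1 m2 m3 m4 m5 m6 m7 m8 m9; clear.
move: (W87 _ _ _ _ _ _ _ _) (Pi (t * x * y)) (Pi (t * x / y)) (Pi (t * y / x)) (Pi (t / (x * y))) (Pi (t * r * s)) (Pi (t * r / s)) (Pi (t * s / r)) (Pi (t / (r * s))) (Pi (k ^+ 2)) (Pi (k * x / r * _)).
move=> w p0 p1 p2 p3 p4 p5 p6 p7 p8 p9 z0 z1 z2 z3 z4 z5 z6 z7 z8 z9.
move: (Pi _) (Pi _) (Pi _) (Pi _) (Pi _) (Pi _) => a1 a2 a3 a4 a5 a6.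
by field; rewrite ?z0 ?z1 ?z2 ?z3 ?z4 ?z5 ?z6 ?z7 ?z8 ?z9.
Qed.

End Kern.

End W87form.

(** * Means over the unit circle *)

Section CircleMean.
Variable R : realType.
Implicit Types (f g : R[i] -> R[i]) (t : R).

Definition period_int (h : R -> R) : R := (\int[lebesgue_measure]_(t in `[0%R, (2 * pi)%R]) h t)%R.

Let pi2 : 0 < 2 * pi :> R. Proof. by rewrite mulr_gt0 // pi_gt0. Qed.

Lemma period_int_integrable (h : R -> R) : continuous h ->
  (@lebesgue_measure R).-integrable `[0%R, (2 * pi)%R]%classic (EFin \o h).
Proof.
move=> ch; apply: continuous_compact_integrable; first exact: segment_compact.
exact: continuous_subspaceT.
Qed.

Lemma period_intD (h1 h2 : R -> R) : continuous h1 -> continuous h2 ->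
  period_int (fun t => h1 t + h2 t) = period_int h1 + period_int h2.
Proof. by move=> c1 c2; apply: RintegralD => //; exact: period_int_integrable. Qed.

Lemma period_intZ a (h : R -> R) : continuous h -> period_int (fun t => a * h t) = a * period_int h.
Proof. by move=> c; apply: RintegralZl => //; exact: period_int_integrable. Qed.

Lemma period_int_cst a : period_int (fun=> a) = a * (2 * pi).
Proof.
rewrite /period_int Rintegral_cst //; congr (_ * _).
have := @lebesgue_measure_itv R (Interval (BLeft 0) (BRight (2 * pi))); rewrite /= lte_fin pi2 sube0 => ->.
by [].
Qed.

Lemma period_int_bound (h : R -> R) B : continuous h -> (forall t, `|h t| <= B) -> `|period_int h| <= B * (2 * pi).
Proof.
move=> c hB; apply: le_trans (le_normr_Rintegral _ (period_int_integrable c)) _ => //.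
rewrite -period_int_cst; apply: le_Rintegral => //.
- apply: (@period_int_integrable (fun t => `|h t|)) => t; apply: continuous_comp; [exact: c|exact: norm_continuous].
- by apply: period_int_integrable => t; exact: cvg_cst.
Qed.

Lemma period_int_FTC (F h : R -> R) : continuous h -> (forall t, is_derive t (1 : R) F (h t)) ->
  period_int h = F (2 * pi) - F 0.
Proof.
move=> ch dF; rewrite /period_int /Rintegral.
have cF : continuous F.
  by move=> t; apply/differentiable_continuous/derivable1_diffP; apply: ex_derive.
rewrite (continuous_FTC2 pi2 (F := F)) //.
- exact: continuous_subspaceT.
- split.
  + by move=> t _; exact: ex_derive.
  + by apply: cvg_at_right_filter; exact: cF.
  + by apply: cvg_at_left_filter; exact: cF.
- by move=> t _; rewrite derive1E; exact: derive_val.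
Qed.

Lemma continuous_scale k : continuous (fun t : R => k * t).
Proof. by move=> t; apply: cvgMr; exact: cvg_id. Qed.

Lemma is_derive_scale k t : is_derive t (1 : R) (fun t : R => k * t) k.
Proof.
have h := @is_deriveZ R R R id k t 1 1 (is_derive_id t 1).
have -> : (fun t : R => k * t) = k \*: id by [].
by apply: (is_derive_eq h); rewrite -[k *: 1]/(k * 1) mulr1.
Qed.

Lemma continuous_cosk k : continuous (fun t : R => cos (k * t)).
Proof. by move=> t; apply: (@continuous_comp _ _ _ (fun t : R => k * t)); [exact: continuous_scale|exact: continuous_cos]. Qed.
Lemma continuous_sink k : continuous (fun t : R => sin (k * t)).
Proof. by move=> t; apply: (@continuous_comp _ _ _ (fun t : R => k * t)); [exact: continuous_scale|exact: continuous_sin]. Qed.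

Lemma period_int_cos k : k != 0 -> sin (k * (2 * pi)) = 0 -> period_int (fun t => cos (k * t)) = 0.
Proof.
move=> k0 hk; have dF t : is_derive t (1 : R) (fun t => k^-1 * sin (k * t)) (cos (k * t)).
  have h := @is_derive1_comp R sin (fun t : R => k * t) t _ _ (is_derive_sin _) (is_derive_scale k t).
  have h2 := @is_deriveZ R R R _ k^-1 t 1 _ h.
  by apply: (is_derive_eq h2); rewrite -[_ *: _]/(_ * _) mulrCA mulVf // mulr1.
by rewrite (period_int_FTC (@continuous_cosk k) dF) hk !mulr0 sin0 !mulr0 subrr.
Qed.

Lemma period_int_sin k : k != 0 -> cos (k * (2 * pi)) = 1 -> period_int (fun t => sin (k * t)) = 0.
Proof.
move=> k0 hk; have dF t : is_derive t (1 : R) (fun t => - k^-1 * cos (k * t)) (sin (k * t)).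
  have h := @is_derive1_comp R cos (fun t : R => k * t) t _ _ (is_derive_cos _) (is_derive_scale k t).
  have h2 := @is_deriveZ R R R _ (- k^-1) t 1 _ h.
  by apply: (is_derive_eq h2); rewrite -[_ *: _]/(_ * _); field.
by rewrite (period_int_FTC (@continuous_sink k) dF) hk !mulr0 cos0 subrr.
Qed.

Lemma expiD t u : expi (t + u) = expi t * expi u.
Proof. by apply/eqP; rewrite eq_complex /= cosD sinD eqxx /= addrC. Qed.

Lemma expi0 : expi (0 : R) = 1. Proof. by rewrite /expi cos0 sin0. Qed.

Lemma nm_expi t : nm (expi t) = 1.
Proof. by rewrite /expi /= cos2Dsin2 sqrtr1. Qed.

Lemma expiV t : (expi t)^-1 = expi (- t).
Proof.
have e0 : expi t != 0 by rewrite -nm_gt0 nm_expi.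
by apply: (mulfI e0); rewrite divff // -expiD subrr expi0.
Qed.

Lemma expiX t n : expi t ^+ n = expi (n%:R * t).
Proof.
elim: n => [|n IH]; first by rewrite mul0r expi0.
by rewrite exprS IH -expiD -{1}(mul1r t) -mulrDl -natr1 addrC.
Qed.

Lemma expi_period n : expi (n%:R * (2 * pi) : R) = 1.
Proof.
rewrite -expiX (_ : expi (2 * pi) = 1) ?expr1n // /expi mulr2n mulrDl mul1r.
by rewrite cos2pi sin2pi.
Qed.

(** Coordinatewise, because the integrals over the circle are. *)
Definition ccont f := continuous (fun t => complex.Re (f (expi t))) /\ continuous (fun t => complex.Im (f (expi t))).

Definition cmean f : R[i] := ((2 * pi)^-1)%:C *
  (period_int (fun t => complex.Re (f (expi t))) +i* period_int (fun t => complex.Im (f (expi t)))).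

Lemma eq_ccont f g : (forall t, f (expi t) = g (expi t)) -> ccont f -> ccont g.
Proof. by move=> E; rewrite /ccont; under eq_fun do rewrite E; under [X in _ /\ continuous X]eq_fun do rewrite E. Qed.

Lemma eq_cmean f g : (forall t, f (expi t) = g (expi t)) -> cmean f = cmean g.
Proof.
by move=> E; rewrite /cmean /period_int; congr (_ * (_ +i* _)); apply: eq_Rintegral => t _; rewrite E.
Qed.

Lemma ccont_cst c : ccont (fun=> c).
Proof. by split=> t; exact: cvg_cst. Qed.

Lemma ccont_id : ccont id.
Proof. by split=> t; [exact: continuous_cos|exact: continuous_sin]. Qed.

Lemma ReD (x y : R[i]) : complex.Re (x + y) = complex.Re x + complex.Re y. Proof. by case: x; case: y. Qed.
Lemma ImD (x y : R[i]) : complex.Im (x + y) = complex.Im x + complex.Im y. Proof. by case: x; case: y. Qed.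
Lemma ReM (x y : R[i]) : complex.Re (x * y) = complex.Re x * complex.Re y - complex.Im x * complex.Im y.
Proof. by case: x => a b; case: y => c d. Qed.
Lemma ImM (x y : R[i]) : complex.Im (x * y) = complex.Re x * complex.Im y + complex.Im x * complex.Re y.
Proof. by case: x => a b; case: y => c d. Qed.

Lemma ccontD f g : ccont f -> ccont g -> ccont (fun w => f w + g w).
Proof.
case=> f1 f2 [g1 g2]; split=> t.
  by under eq_fun do rewrite ReD; apply: cvgD; [exact: f1|exact: g1].
by under eq_fun do rewrite ImD; apply: cvgD; [exact: f2|exact: g2].
Qed.

Lemma ccontM f g : ccont f -> ccont g -> ccont (fun w => f w * g w).
Proof.
case=> f1 f2 [g1 g2]; split=> t.
  under eq_fun do rewrite ReM.
  by apply: cvgB; apply: cvgM; [exact: f1|exact: g1|exact: f2|exact: g2].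
under eq_fun do rewrite ImM.
by apply: cvgD; apply: cvgM; [exact: f1|exact: g2|exact: f2|exact: g1].
Qed.

Lemma ccontZ c f : ccont f -> ccont (fun w => c * f w). Proof. exact: ccontM (ccont_cst c). Qed.

Lemma ccont_sum (I : Type) (r : seq I) (F : I -> R[i] -> R[i]) : (forall i, ccont (F i)) -> ccont (fun w => \sum_(i <- r) F i w).
Proof.
move=> h; elim: r => [|i r IH]; first by apply: eq_ccont (ccont_cst 0) => t; rewrite big_nil.
by apply: eq_ccont (ccontD (h i) IH) => t; rewrite big_cons.
Qed.

Lemma ccont_prod (I : Type) (r : seq I) (F : I -> R[i] -> R[i]) : (forall i, ccont (F i)) -> ccont (fun w => \prod_(i <- r) F i w).
Proof.
move=> h; elim: r => [|i r IH]; first by apply: eq_ccont (ccont_cst 1) => t; rewrite big_nil.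
by apply: eq_ccont (ccontM (h i) IH) => t; rewrite big_cons.
Qed.

Lemma ccontX f n : ccont f -> ccont (fun w => f w ^+ n).
Proof.
move=> cf; elim: n => [|n IH]; first exact: ccont_cst.
by apply: eq_ccont (ccontM cf IH) => t; rewrite exprS.
Qed.

Lemma ccont_inv : ccont (fun w => w^-1).
Proof.
split=> t; under eq_fun do rewrite expiV /expi /= ?cosN ?sinN; first exact: continuous_cos.
by apply: cvgN; exact: continuous_sin.
Qed.

Lemma ccont_lim (F : nat -> R[i] -> R[i]) f (e : nat -> R) : (forall n, ccont (F n)) ->
  (forall n t, nm (F n (expi t) - f (expi t)) <= e n) -> e @ \oo --> (0 : R) -> ccont f.
Proof.
move=> cF hF e0.
have key (P : R[i] -> R) : (forall x y, `|P x - P y| <= nm (x - y)) -> (forall n, continuous (fun t => P (F n (expi t)))) ->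
    continuous (fun t => P (f (expi t))).
  move=> hP cP t; apply/cvgrPdist_lt => d d0.
  have d3 : 0 < d / 3 by rewrite divr_gt0.
  have e0' := e0; move/cvgr0_norm_lt : e0' => /(_ _ d3) [n _ hn].
  have hen : e n < d / 3 by apply: le_lt_trans (ler_norm _) _; exact: (hn n (leqnn n)).
  have /cvgrPdist_lt /(_ _ d3) := cP n t; apply: filterS => u hu.
  have h1 := le_lt_trans (le_trans (hP _ _) (hF n t)) hen.
  have h2 := le_lt_trans (le_trans (hP _ _) (hF n u)) hen.
  rewrite distrC in h1.
  have -> : P (f (expi t)) - P (f (expi u)) = (P (f (expi t)) - P (F n (expi t))) + (P (F n (expi t)) - P (F n (expi u))) + (P (F n (expi u)) - P (f (expi u))) by ring.
  apply: le_lt_trans (ler_normD _ _) _.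
  have h3 := ler_normD (P (f (expi t)) - P (F n (expi t))) (P (F n (expi t)) - P (F n (expi u))).
  lra.
split; apply: key => [x y|n].
- by rewrite (_ : _ - _ = complex.Re (x - y)) ?nm_Re //; case: x; case: y.
- by case: (cF n).
- by rewrite (_ : _ - _ = complex.Im (x - y)) ?nm_Im //; case: x; case: y.
- by case: (cF n).
Qed.

Lemma cmeanD f g : ccont f -> ccont g -> cmean (fun w => f w + g w) = cmean f + cmean g.
Proof.
case=> f1 f2 [g1 g2]; rewrite /cmean -mulrDr; congr (_ * _).
have -> : period_int (fun t => complex.Re (f (expi t) + g (expi t))) = period_int (fun t => complex.Re (f (expi t))) + period_int (fun t => complex.Re (g (expi t))).
  by rewrite -period_intD //; apply: eq_Rintegral => t _; rewrite ReD.
have -> : period_int (fun t => complex.Im (f (expi t) + g (expi t))) = period_int (fun t => complex.Im (f (expi t))) + period_int (fun t => complex.Im (g (expi t))).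
  by rewrite -period_intD //; apply: eq_Rintegral => t _; rewrite ImD.
by [].
Qed.

Lemma cmeanZ c f : ccont f -> cmean (fun w => c * f w) = c * cmean f.
Proof.
case=> f1 f2; rewrite /cmean mulrCA; congr (_ * _).
have cZ a (h : R -> R) : continuous h -> continuous (fun t => a * h t).
  by move=> ch t; apply: cvgMr; exact: ch.
case: c => a b.
have -> : period_int (fun t => complex.Re ((a +i* b) * f (expi t))) = a * period_int (fun t => complex.Re (f (expi t))) + (- b) * period_int (fun t => complex.Im (f (expi t))).
  rewrite -!period_intZ // -period_intD; [|exact: cZ..].
  by apply: eq_Rintegral => t _; rewrite ReM /= mulNr.
have -> : period_int (fun t => complex.Im ((a +i* b) * f (expi t))) = a * period_int (fun t => complex.Im (f (expi t))) + b * period_int (fun t => complex.Re (f (expi t))).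
  rewrite -!period_intZ // -period_intD; [|exact: cZ..].
  by apply: eq_Rintegral => t _; rewrite ImM /=.
by apply/eqP; rewrite eq_complex /= mulNr !eqxx.
Qed.

(** The factor 2 comes from estimating the real and the imaginary part separately. *)
Lemma cmean_bound f B : ccont f -> (forall t, nm (f (expi t)) <= B) -> nm (cmean f) <= 2 * B.
Proof.
case=> f1 f2 hB; rewrite /cmean nmM nmC ger0_norm ?invr_ge0 ?(ltW pi2) //.
rewrite mulrC ler_pdivrMr //; apply: le_trans (nm_ReIm _) _ => /=.
have b1 := period_int_bound f1 (fun t => le_trans (nm_Re _) (hB t)).
have b2 := period_int_bound f2 (fun t => le_trans (nm_Im _) (hB t)).
have -> : 2 * B * (2 * pi) = B * (2 * pi) + B * (2 * pi) by ring.
exact: lerD b1 b2.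
Qed.

Lemma cmean_cst c : cmean (fun=> c) = c.
Proof.
rewrite -[RHS]mulr1 -[in LHS](mulr1 c) (cmeanZ c (ccont_cst 1)); congr (_ * _).
rewrite /cmean /= !period_int_cst mul1r mul0r; simpc.
by rewrite mulVf ?gt_eqF.
Qed.

Lemma cmean_sum (I : Type) (r : seq I) (F : I -> R[i] -> R[i]) : (forall i, ccont (F i)) ->
  cmean (fun w => \sum_(i <- r) F i w) = \sum_(i <- r) cmean (F i).
Proof.
move=> h; elim: r => [|i r IH].
  by rewrite big_nil -[RHS](cmean_cst 0); apply: eq_cmean => t; rewrite big_nil.
rewrite big_cons -IH -cmeanD //; last exact: ccont_sum.
by apply: eq_cmean => t; rewrite big_cons.
Qed.

Lemma cmean_lim (F : nat -> R[i] -> R[i]) f (e : nat -> R) : (forall n, ccont (F n)) ->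
  (forall n t, nm (F n (expi t) - f (expi t)) <= e n) -> e @ \oo --> (0 : R) -> ccvg (fun n => cmean (F n)) (cmean f).
Proof.
move=> cF hF e0; have cf := ccont_lim cF hF e0.
apply: (ccvg_bound (v := fun n => 2 * e n)); last by rewrite -(mulr0 2); apply: cvgMr.
move=> n; have -> : cmean (F n) - cmean f = cmean (fun w => F n w + (-1) * f w).
  by rewrite cmeanD ?cmeanZ ?mulN1r //; exact: ccontZ.
apply: cmean_bound => [|t]; first by apply: ccontD => //; exact: ccontZ.
by rewrite mulN1r.
Qed.

Lemma cmean_mono (n m : nat) : cmean (fun w => w ^+ n / w ^+ m) = (n == m)%:R.
Proof.
have rat t : expi t ^+ n / expi t ^+ m = expi ((n%:R - m%:R) * t).
  by rewrite -exprVn expiV !expiX -expiD mulrN mulrBl.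
case: eqVneq => [->|nm'].
  by rewrite -[RHS](cmean_cst 1); apply: eq_cmean => t; rewrite divff // expf_neq0 // -nm_gt0 nm_expi.
set k : R := n%:R - m%:R.
have k0 : k != 0 by rewrite subr_eq0 eqr_nat.
have ek : expi (k * (2 * pi)) = 1 by rewrite /k mulrBl expiD -expiV !expi_period divr1.
have [ck sk] : cos (k * (2 * pi)) = 1 /\ sin (k * (2 * pi)) = 0 by move: ek; rewrite /expi => -[].
rewrite /cmean; have -> : period_int (fun t => complex.Re (expi t ^+ n / expi t ^+ m)) = 0.
  by rewrite -(period_int_cos k0 sk); apply: eq_Rintegral => t _; rewrite rat.
have -> : period_int (fun t => complex.Im (expi t ^+ n / expi t ^+ m)) = 0.
  by rewrite -(period_int_sin k0 ck); apply: eq_Rintegral => t _; rewrite rat.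
exact: mulr0.
Qed.

End CircleMean.

(** * A three-term recurrence and its shifts *)

Section ThreeTerm.
Variables (K : fieldType) (q : K).
Hypotheses (q0 : q != 0) (qn1 : forall n, 1 - q ^+ n.+1 != 0).

(** The Al-Salam-Chihara polynomials g_n with parameters a, b, as a function of
    eta = x + 1/x, s = a + b and al = a b. The pair (g_n, g_(n-1)) is defined at once;
    starting from g_(-1) = 0 makes the recurrence uniform in n. *)
Fixpoint gpair (eta s al : K) n : K * K :=
  if n is m.+1 then
    (((eta - q ^+ m * s) * (gpair eta s al m).1 - (1 - al * q ^+ m / q) * (gpair eta s al m).2)
       / (1 - q ^+ m.+1), (gpair eta s al m).1)
  else (1, 0).
Definition gpol eta s al n := (gpair eta s al n).1.
Definition gpolm eta s al n := (gpair eta s al n).2.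

Lemma gpolmS eta s al n : gpolm eta s al n.+1 = gpol eta s al n. Proof. by []. Qed.

Lemma gpol_rec eta s al n : (1 - q ^+ n * q) * gpol eta s al n.+1 =
  (eta - q ^+ n * s) * gpol eta s al n - (1 - al * q ^+ n / q) * gpolm eta s al n.
Proof.
rewrite /gpol /gpolm -exprSr /=; move: (gpair _ _ _ _) (qn1 n) => [g h] /= n1.
by rewrite mulrC divfK.
Qed.

Definition et (x : K) := x + x^-1.

(** A q-shift of w is expressed by the polynomials at w, in the variable here and in
    the parameter in [gpol_shift_par]; this is what lets the Askey-Wilson operator act on
    products. *)
Lemma gpol_shift (w s al : K) n : w != 0 ->
  let c := 1 - s * w + al * w ^+ 2 in let e := 1 - q * w ^+ 2 in
  let g := gpol (et w) s al in let h := gpolm (et w) s al in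
  let g' := gpol (et (q * w)) s al in
  c * g' n = (c - e) * g n + e * (al * w / q) * h n + e / q ^+ n * (g n - w * h n).
Proof.
move=> w0 c e g h g'; pose h' := gpolm (et (q * w)) s al.
suff [] : c * g' n = (c - e) * g n + e * (al * w / q) * h n + e / q ^+ n * (g n - w * h n) /\
   c * h' n = (c - e + e / q ^+ n * q) * h n +
      e * w * (q / q ^+ n) * ((1 - q ^+ n) * g n - (et w - q ^+ n / q * s) * h n) by [].
elim: n => [|n [IH1 IH2]].
  rewrite /g' /h' /g /h /gpol /gpolm /= expr0 subrr !(mulr0, mul0r, addr0, subr0, mulr1) divr1.
  by rewrite subrK.
have r1 := gpol_rec (et w) s al n; have r2 := gpol_rec (et (q * w)) s al n.
have nz := qn1 n; have z0 : q ^+ n != 0 by rewrite expf_neq0.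
rewrite /h' /h !gpolmS -/(g n) -/(g' n) !exprS in nz *.
rewrite -/g' -/(g' n.+1) -/(h' n) in r2; rewrite -/(g n) -/(g n.+1) -/(h n) in r1.
move: (q ^+ n) z0 nz r1 r2 IH1 IH2 => Z z0 nz r1 r2 IH1 IH2.
have e1 : g n.+1 = ((et w - Z * s) * g n - (1 - al * Z / q) * h n) / (1 - q * Z).
  by rewrite -r1 (mulrC q) mulrAC divff ?mul1r // mulrC.
have e2 : c * g' n.+1 = ((et (q * w) - Z * s) * (c * g' n) - (1 - al * Z / q) * (c * h' n)) / (1 - q * Z).
  by rewrite !(mulrCA _ c) -mulrBr -r2 -mulrA (mulrC q) mulrAC divff ?mul1r // mulrC.
split.
  rewrite e2 IH1 IH2 e1 /c /e /et; move: (g n) (h n) => G H; field; by rewrite q0 w0 z0 nz.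
rewrite IH1 e1 /c /e /et; move: (g n) (h n) => G H; field; by rewrite q0 w0 z0 nz.
Qed.

Lemma gpol_shift_par (w k X : K) n : w != 0 -> k != 0 ->
  let be := k ^+ 2 in let c := 1 - k * X * w + be * w ^+ 2 in let e := be / q * (1 - q * w ^+ 2) in
  let g := gpol X (k * et w) be in let h := gpolm X (k * et w) be in
  let g' := gpol X (k * et (q * w)) be in
  c * g' n = (c + e) * g n - e / (k * w) * h n - e * q ^+ n * (g n - k / (w * q) * h n).
Proof.
move=> w0 k0 be c e g h g'; pose h' := gpolm X (k * et (q * w)) be.
suff [] : c * g' n = (c + e) * g n - e / (k * w) * h n - e * q ^+ n * (g n - k / (w * q) * h n) /\
   c * h' n = (c + e * (1 - q ^+ n / q)) * h n -
     e / (k * w) * ((X - q ^+ n / q * (k * et w)) * h n - (1 - q ^+ n) * g n) by [].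
elim: n => [|n [IH1 IH2]].
  rewrite /g' /h' /g /h /gpol /gpolm /= expr0 subrr !(mulr0, mul0r, addr0, subr0, mulr1).
  by rewrite addrK.
have r1 := gpol_rec X (k * et w) be n; have r2 := gpol_rec X (k * et (q * w)) be n.
have nz := qn1 n.
rewrite /h' /h !gpolmS -/(g n) -/(g' n) !exprS in nz *.
rewrite -/g' -/(g' n.+1) -/(h' n) in r2; rewrite -/(g n) -/(g n.+1) -/(h n) in r1.
move: (q ^+ n) nz r1 r2 IH1 IH2 => Z nz r1 r2 IH1 IH2.
have e1 : g n.+1 = ((X - Z * (k * et w)) * g n - (1 - be * Z / q) * h n) / (1 - q * Z).
  by rewrite -r1 (mulrC q) mulrAC divff ?mul1r // mulrC.
have e2 : c * g' n.+1 = ((X - Z * (k * et (q * w))) * (c * g' n) - (1 - be * Z / q) * (c * h' n)) / (1 - q * Z).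
  by rewrite !(mulrCA _ c) -mulrBr -r2 -mulrA (mulrC q) mulrAC divff ?mul1r // mulrC.
split.
  rewrite e2 IH1 IH2 e1 /c /e /be /et; move: (g n) (h n) => G H; field; by rewrite q0 w0 k0 nz.
rewrite IH1 e1 /c /e /be /et; move: (g n) (h n) => G H; field; by rewrite q0 w0 k0 nz.
Qed.

(** The Askey-Wilson operator, acting on functions of eta = w + 1/w. *)
Definition AWcoef s al X k w :=
  (1 - s * w + al * w ^+ 2) * (1 - k * X * w + k ^+ 2 * w ^+ 2) / ((1 - w ^+ 2) * (1 - q * w ^+ 2)).
Definition AWop s al X k w (F : K -> K) :=
  AWcoef s al X k w * (F (et (q * w)) - F (et w)) +
  AWcoef s al X k w^-1 * (F (et (q * w^-1)) - F (et w)).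

(** The points at which the coefficients of the operator at w and at 1/w have no pole. *)
Definition regular w := [/\ w != 0, 1 - w ^+ 2 != 0, 1 - q * w ^+ 2 != 0 & w ^+ 2 - q != 0].

(** The operator acts tridiagonally on the products with n + l fixed, and the coefficients
    do not involve w, s or X. *)
Lemma AWop_gg s al X k w n l : regular w -> k != 0 ->
  let be := k ^+ 2 in let g := gpol (et w) s al in let g1 := gpolm (et w) s al in
  let h := gpol X (k * et w) be in let h1 := gpolm X (k * et w) be in
  AWop s al X k w (fun y => gpol y s al n * gpol X (k * y) be l) =
  k * (1 - (q ^+ n * q)^-1) * (1 - be * q ^+ l / q) * (g n.+1 * h1 l) +
  (be * (1 + al / q) * q ^+ l - (1 + al * be / q) + (1 + be / q) / q ^+ n - be * (1 + q^-1) * (q ^+ l / q ^+ n)) * (g n * h l) -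
  k / q ^+ n * (1 - al * q ^+ n / q) * (1 - q ^+ l * q) * (g1 n * h l.+1).
Proof.
case=> w0 w1 w2 w3 k0 be g g1 h h1.
have wV0 : w^-1 != 0 by rewrite invr_eq0.
have eV : et w^-1 = et w by rewrite /et invrK addrC.
have s1 := gpol_shift s al n w0; have s2 := gpol_shift_par X l w0 k0.
have s3 := gpol_shift s al n wV0; have s4 := gpol_shift_par X l wV0 k0.
move: s1 s2 s3 s4; rewrite !eV.
have nz := qn1 n; have nl := qn1 l; rewrite !exprS in nz nl.
have z0 : q ^+ n != 0 by rewrite expf_neq0.
have rg : g n.+1 = ((et w - q ^+ n * s) * g n - (1 - al * q ^+ n / q) * g1 n) / (1 - q * q ^+ n).
  by rewrite -gpol_rec (mulrC q) mulrAC divff ?mul1r // mulrC.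
have rh : h l.+1 = ((X - q ^+ l * (k * et w)) * h l - (1 - be * q ^+ l / q) * h1 l) / (1 - q * q ^+ l).
  by rewrite -gpol_rec (mulrC q) mulrAC divff ?mul1r // mulrC.
rewrite rg rh /AWop /AWcoef; clear rg rh; rewrite /g /g1 /h /h1 /be; clear g g1 h h1 be.
move: (q ^+ n) (q ^+ l) z0 nz nl => Z W z0 nz nl.
move: (gpol (et (q * w)) s al n) (gpol X (k * et (q * w)) (k ^+ 2) l) => ga ha.
move: (gpol (et (q * w^-1)) s al n) (gpol X (k * et (q * w^-1)) (k ^+ 2) l) => gb hb.
move: (gpol (et w) s al n) (gpol X (k * et w) (k ^+ 2) l) (gpolm (et w) s al n) (gpolm X (k * et w) (k ^+ 2) l) => G H G1 H1.
rewrite /et.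
set ca := 1 - s * w + _; set da := 1 - k * X * w + _; set cb := 1 - s * w^-1 + _; set db := 1 - k * X * w^-1 + _.
move=> s1 s2 s3 s4.
have -> : ca * da / ((1 - w ^+ 2) * (1 - q * w ^+ 2)) * (ga * ha - G * H) =
   ((ca * ga) * (da * ha) - ca * da * (G * H)) / ((1 - w ^+ 2) * (1 - q * w ^+ 2)) by clearbody ca da; clear; ring.
have -> : cb * db / ((1 - w^-1 ^+ 2) * (1 - q * w^-1 ^+ 2)) * (gb * hb - G * H) =
   ((cb * gb) * (db * hb) - cb * db * (G * H)) / ((1 - w^-1 ^+ 2) * (1 - q * w^-1 ^+ 2)) by clearbody cb db; clear; ring.
rewrite s1 s2 s3 s4 /ca /cb /da /db; clear s1 s2 s3 s4 ca cb da db ga gb ha hb eV.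
field.
by rewrite nl q0 w0 z0 nz w3 k0 w2 w1 -(opprB 1) oppr_eq0 w1.
Qed.

(** ** Askey-Wilson polynomials as eigenfunctions *)

(** The q-shifted factorial over an arbitrary field. *)
Definition qp (a : K) n := \prod_(i < n) (1 - a * q ^+ i).

Lemma qp0 a : qp a 0 = 1. Proof. by rewrite /qp big_ord0. Qed.
Lemma qpS a n : qp a n.+1 = qp a n * (1 - a * q ^+ n). Proof. by rewrite /qp big_ord_recr. Qed.
Lemma qpSl a n : qp a n.+1 = (1 - a) * qp (a * q) n.
Proof.
rewrite /qp big_ord_recl expr0 mulr1; congr (_ * _); apply: eq_bigr => i _.
by rewrite -mulrA -exprS.
Qed.
Lemma qpq_neq0 n : qp q n != 0.
Proof. by apply/prodf_neq0 => i _; rewrite -exprS. Qed.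

(** The basis (a w, a / w; q)_i as a polynomial in w + 1/w, see [awbasis_et]. *)
Definition awbasisP a i : {poly K} := \prod_(m < i) ((1 + (a * q ^+ m) ^+ 2)%:P - (a * q ^+ m) *: 'X).
Definition awbasis a i y := (awbasisP a i).[y].

Lemma awbasisS a i y : awbasis a i.+1 y = awbasis a i y * (1 + (a * q ^+ i) ^+ 2 - a * q ^+ i * y).
Proof. by rewrite /awbasis /awbasisP big_ord_recr /= hornerM !hornerE. Qed.

Lemma awbasis_et a i w : w != 0 -> awbasis a i (et w) = qp (a * w) i * qp (a / w) i.
Proof.
move=> w0; elim: i => [|i IH]; first by rewrite !qp0 mulr1 /awbasis /awbasisP big_ord0 hornerC.
by rewrite awbasisS IH !qpS /et; move: (qp _ i) (qp _ i) (q ^+ i) => *; field.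
Qed.

Lemma AWop_awbasis s al X k w a b c d i : regular w -> a != 0 ->
  s = c + d -> al = c * d -> k * X = a + b -> k ^+ 2 = a * b ->
  AWop s al X k w (awbasis a i.+1) =
  ((q ^+ i * q)^-1 - 1) * (1 - a * b * c * d * q ^+ i) * awbasis a i.+1 (et w) -
  (q ^+ i * q)^-1 * (1 - q ^+ i * q) * (1 - a * b * q ^+ i) * (1 - a * c * q ^+ i) * (1 - a * d * q ^+ i) * awbasis a i (et w).
Proof.
case=> w0 w1 w2 w3 a0 -> -> kX k2.
have wV0 : w^-1 != 0 by rewrite invr_eq0.
have qw0 : q * w != 0 by rewrite mulf_neq0.
have qv0 : q * w^-1 != 0 by rewrite mulf_neq0.
rewrite /AWop /AWcoef kX k2 !awbasis_et // !qpS.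
have e1 : (1 - a * w) * qp (a * (q * w)) i = qp (a * w) i * (1 - a * w * q ^+ i).
  by rewrite -qpS qpSl; congr (_ * qp _ i); ring.
have e2 : (1 - a / w) * qp (a * (q / w)) i = qp (a / w) i * (1 - a / w * q ^+ i).
  by rewrite -qpS qpSl; congr (_ * qp _ i); ring.
have e3 : qp (a / (q * w)) i * (1 - a / (q * w) * q ^+ i) = (1 - a / (q * w)) * qp (a / w) i.
  by rewrite -qpS qpSl; congr (_ * qp _ i); field; rewrite w0 q0.
have e4 : qp (a / (q / w)) i * (1 - a / (q / w) * q ^+ i) = (1 - a / (q / w)) * qp (a * w) i.
  by rewrite -qpS qpSl; congr (_ * qp _ i); field; rewrite w0 q0.
have z0 : q ^+ i != 0 by rewrite expf_neq0.
have f1 : (1 - (c + d) * w + c * d * w ^+ 2) * (1 - (a + b) * w + a * b * w ^+ 2) / ((1 - w ^+ 2) * (1 - q * w ^+ 2)) *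
  (qp (a * (q * w)) i * (1 - a * (q * w) * q ^+ i) * (qp (a / (q * w)) i * (1 - a / (q * w) * q ^+ i))) =
  (1 - c * w) * (1 - d * w) * (1 - b * w) / ((1 - w ^+ 2) * (1 - q * w ^+ 2)) *
    (qp (a * w) i * (1 - a * w * q ^+ i) * (1 - a * (q * w) * q ^+ i) * ((1 - a / (q * w)) * qp (a / w) i)).
  by rewrite e3 -e1; field; rewrite w1 w2 q0 w0.
have v1 : 1 - w^-1 ^+ 2 != 0.
  by have -> : 1 - w^-1 ^+ 2 = - (1 - w ^+ 2) / w ^+ 2; [field|rewrite mulf_neq0 ?invr_eq0 ?expf_neq0 ?oppr_eq0].
have v2 : 1 - q * w^-1 ^+ 2 != 0.
  by have -> : 1 - q * w^-1 ^+ 2 = (w ^+ 2 - q) / w ^+ 2; [field|rewrite mulf_neq0 ?invr_eq0 ?expf_neq0 ?oppr_eq0].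
have f2 : (1 - (c + d) * w^-1 + c * d * w^-1 ^+ 2) * (1 - (a + b) * w^-1 + a * b * w^-1 ^+ 2) / ((1 - w^-1 ^+ 2) * (1 - q * w^-1 ^+ 2)) *
  (qp (a * (q * w^-1)) i * (1 - a * (q * w^-1) * q ^+ i) * (qp (a / (q * w^-1)) i * (1 - a / (q * w^-1) * q ^+ i))) =
  (1 - c / w) * (1 - d / w) * (1 - b / w) / ((1 - w^-1 ^+ 2) * (1 - q * w^-1 ^+ 2)) *
    (qp (a / w) i * (1 - a / w * q ^+ i) * (1 - a * (q / w) * q ^+ i) * ((1 - a / (q / w)) * qp (a * w) i)).
  rewrite e4 -e2; move: v1 v2 wV0; move: (w^-1) => v v1 v2 v0.
  by field; rewrite v1 v2 q0 v0.
rewrite 2!(mulrBr (_ / _)) f1 f2; clear e1 e2 e3 e4 f1 f2.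
move: (qp (a * w) i) (qp (a / w) i) (q ^+ i) z0 => P Q Z z0.
field.
by rewrite q0 z0 w0 w3 w2 w1 -(opprB 1) oppr_eq0 w1.
Qed.

Lemma AWop_sum s al X k w n (c : nat -> K) (F : nat -> K -> K) :
  AWop s al X k w (fun y => \sum_(i < n) c i * F i y) = \sum_(i < n) c i * AWop s al X k w (F i).
Proof.
rewrite /AWop -!sumrB !mulr_sumr -big_split /=; apply: eq_bigr => i _.
move: (AWcoef _ _ _ _ w) (AWcoef _ _ _ _ w^-1) (c i) => A1 A2 C; ring.
Qed.

Lemma eq_AWop s al X k w (F G : K -> K) : F =1 G -> AWop s al X k w F = AWop s al X k w G.
Proof. by move=> E; rewrite /AWop !E. Qed.

(** The Askey-Wilson polynomials, free of divisions by (ab)_n, (ac)_n, (ad)_n. *)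
Definition awc n a b c d i := qp (q ^+ n)^-1 i * qp (a * b * c * d * q ^+ n / q) i / qp q i * q ^+ i *
  (qp (a * b * q ^+ i) (n - i) * qp (a * c * q ^+ i) (n - i) * qp (a * d * q ^+ i) (n - i)).
Definition AWpol n a b c d : {poly K} := a ^- n *: \sum_(i < n.+1) awc n a b c d i *: awbasisP a i.

Lemma AWpol_horner n a b c d y : (AWpol n a b c d).[y] = a ^- n * \sum_(i < n.+1) awc n a b c d i * awbasis a i y.
Proof. by rewrite /AWpol hornerZ horner_sum; congr (_ * _); apply: eq_bigr => i _; rewrite hornerZ. Qed.

(** Eigenvalues of the Askey-Wilson operator. *)
Definition AWev n D := ((q ^+ n)^-1 - 1) * (1 - D * q ^+ n / q).

Lemma awcS n a b c d i : (i < n)%N ->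
  awc n a b c d i.+1 * (- ((q ^+ i * q)^-1 * (1 - q ^+ i * q) * (1 - a * b * q ^+ i) * (1 - a * c * q ^+ i) * (1 - a * d * q ^+ i))) =
  (AWev n (a * b * c * d) - AWev i (a * b * c * d)) * awc n a b c d i.
Proof.
move=> lin; rewrite /awc /AWev !qpS exprS !(mulrA _ q).
have -> : (n - i = (n - i.+1).+1)%N by rewrite subnSK.
rewrite !qpSl -!(mulrA _ (q ^+ i) q) -!exprSr.
have := qpq_neq0 i; have := qn1 i; rewrite exprS.
have : q ^+ i != 0 by rewrite expf_neq0.
have : q ^+ n != 0 by rewrite expf_neq0.
have e (y : K) : y * q * q ^+ i = y * (q * q ^+ i) by rewrite mulrA.
rewrite !e; clear e; move: (qp (a * b * _) _) (qp (a * c * _) _) (qp (a * d * _) _) => P4 P5 P6.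
move: (qp (q ^- n) i) (qp (a * b * c * d * q ^+ n / q) i) (qp q i) => P1 P2 P3.
move: (q ^+ n) (q ^+ i) => N Z h1 h2 h3 h4.
by field; rewrite h1 h2 h3 h4 q0.
Qed.

Lemma AWop_AWpol s al X k w a b c d n : regular w -> a != 0 ->
  s = c + d -> al = c * d -> k * X = a + b -> k ^+ 2 = a * b ->
  AWop s al X k w (horner (AWpol n a b c d)) = AWev n (a * b * c * d) * (AWpol n a b c d).[et w].
Proof.
move=> rw a0 es eal ek ek2; set D := a * b * c * d.
have hE : horner (AWpol n a b c d) =1 (fun y => \sum_(i < n.+1) (a ^- n * awc n a b c d i) * awbasis a i y).
  by move=> y; rewrite AWpol_horner mulr_sumr; apply: eq_bigr => i _; rewrite mulrA.
rewrite (eq_AWop _ _ _ _ _ hE) (AWop_sum _ _ _ _ _ _ (fun i => a ^- n * awc n a b c d i)) hE mulr_sumr.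
have part m : (m <= n)%N -> \sum_(i < m.+1) a ^- n * awc n a b c d i * AWop s al X k w (awbasis a i) =
  \sum_(i < m.+1) AWev n D * (a ^- n * awc n a b c d i * awbasis a i (et w)) -
    (AWev n D - AWev m D) * (a ^- n * awc n a b c d m * awbasis a m (et w)).
  elim: m => [_|m IH mn].
    rewrite !big_ord1 /AWop /awbasis /awbasisP big_ord0 !hornerC !subrr !mulr0 addr0 mulr0.
    by rewrite [X in _ - (_ - X) * _](_ : _ = 0) ?subr0 ?subrr // /AWev expr0 invr1 subrr mul0r.
  rewrite big_ord_recr IH; last exact: ltnW.
  rewrite [in RHS]big_ord_recr /= (AWop_awbasis _ rw a0 es eal ek ek2) -/D.
  have := awcS a b c d mn; rewrite -/D.
  have -> : AWev m.+1 D = ((q ^+ m * q)^-1 - 1) * (1 - D * q ^+ m) by rewrite /AWev exprSr mulrA mulfK.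
  set S0 := bigop _ _ _; move: S0 => S0.
  move: (AWev n D) (AWev m D) (awc _ _ _ _ _ m.+1) (awc _ _ _ _ _ m) (awbasis a m.+1 _) (awbasis a m _) => ev em c1 c0 p1 p0.
  move: (_ * (1 - a * d * _)) => kap h.
  transitivity (S0 - (ev - em) * (a ^- n * c0 * p0) + a ^- n * (c1 * ((q ^+ m * q)^-1 - 1) * (1 - D * q ^+ m) * p1 + (c1 * - kap) * p0)); first by ring.
  by rewrite h; ring.
by rewrite part // subrr mul0r subr0.
Qed.

Lemma awbasisP_size a i : (size (awbasisP a i) <= i.+1)%N /\ (awbasisP a i)`_i = \prod_(m < i) (- (a * q ^+ m)).
Proof.
elim: i => [|i [IH1 IH2]]; first by rewrite /awbasisP !big_ord0 size_poly1 coef1.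
rewrite /awbasisP !big_ord_recr /= -/(awbasisP a i); split.
  apply: leq_trans (size_polyMleq _ _) _; rewrite -subn1 leq_subLR addnC (_ : 1 + i.+2 = 2 + i.+1)%N //.
  apply: leq_add IH1; apply: leq_trans (size_polyD _ _) _; rewrite geq_max size_polyC size_polyN.
  by rewrite (leq_trans (size_scale_leq _ _)) ?size_polyX ?andbT //; case: (_ != 0).
rewrite mulrBr -scalerAr mulrC coefB coefCM coefZ coefMX /= -IH2.
by rewrite [_`_i.+1]nth_default // mulr0 sub0r mulrC mulrN.
Qed.

Lemma AWpol_size a b c d n : a != 0 ->
  (size (AWpol n a b c d) <= n.+1)%N /\ (AWpol n a b c d)`_n = qp (a * b * c * d * q ^+ n / q) n.
Proof.
move=> a0; split.
  apply: leq_trans (size_scale_leq _ _) _; apply: leq_trans (size_sum _ _ _) _.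
  apply/bigmax_leqP => i _; apply: leq_trans (size_scale_leq _ _) _.
  by apply: leq_trans (awbasisP_size a i).1 _.
rewrite coefZ coef_sum big_ord_recr /= big1 ?add0r => [|i _]; last first.
  by rewrite coefZ nth_default ?mulr0 // (leq_trans (awbasisP_size a i).1).
rewrite coefZ (awbasisP_size a n).2 /awc subnn !qp0 !mulr1.
have E : qp (q ^+ n)^-1 n * q ^+ n * (\prod_(m < n) - (a * q ^+ m)) = a ^+ n * qp q n.
  elim: n => [|n IH]; first by rewrite !qp0 big_ord0 !expr0 !mulr1.
  rewrite qpSl big_ord_recr /= qpS exprS (_ : (q * q ^+ n)^-1 * q = (q ^+ n)^-1); last by field; rewrite q0 expf_neq0.
  transitivity ((1 - (q * q ^+ n)^-1) * q * (- (a * q ^+ n)) * (qp (q ^+ n)^-1 n * q ^+ n * (\prod_(m < n) - (a * q ^+ m)))).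
    by move: (qp _ _) (\prod_(m < _) _) => *; ring.
  rewrite IH; have : q ^+ n != 0 by rewrite expf_neq0.
  by rewrite exprS; move: (q ^+ n) => Z Z0; field; rewrite Z0 q0.
have := qpq_neq0 n; have : a ^+ n != 0 by rewrite expf_neq0.
move: E; move: (\prod_(m < n) _) (qp (a * b * c * d * q ^+ n / q) n) (qp q n) (qp (q ^- n) n) => p1 p2 p3 p4.
move: (q ^+ n) (a ^+ n) => p5 p6 E h1 h2.
transitivity (p6^-1 * p2 / p3 * (p4 * p5 * p1)); first by ring.
by rewrite E; field; rewrite h1 h2.
Qed.

End ThreeTerm.

(** * Sequences as formal power series *)

Section Sequences.
Variables (K : fieldType) (q : K).
Hypotheses (q0 : q != 0) (qn1 : forall n, 1 - q ^+ n.+1 != 0).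
Implicit Types u v : nat -> K.
Local Notation gpol := (gpol q).
Local Notation gpolm := (gpolm q).

(** Multiplication by z, by 1 - A z + B z^2, and the dilation z -> q z. *)
Definition sh (V : zmodType) (u : nat -> V) n := if n is m.+1 then u m else 0.
Definition qm A B u n := u n - A * sh u n + B * sh (sh u) n.
Definition dil u n := q ^+ n * u n.
Definition conv u v n := \sum_(m < n.+1) u m * v (n - m)%N.

Lemma qm_rec A B u n : qm A B u n.+2 = u n.+2 - A * u n.+1 + B * u n. Proof. by []. Qed.
Lemma qm_1 A B u : qm A B u 1 = u 1%N - A * u 0%N. Proof. by rewrite /qm /= mulr0 addr0. Qed.
Lemma qm_0 A B u : qm A B u 0 = u 0%N. Proof. by rewrite /qm /= !mulr0 addr0 subr0. Qed.

Lemma eq_sh u v : u =1 v -> sh u =1 sh v. Proof. by move=> E [|n] /=. Qed.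
Lemma eq_qm A B u v : u =1 v -> qm A B u =1 qm A B v.
Proof. by move=> E n; rewrite /qm E (eq_sh E) (eq_sh (eq_sh E)). Qed.
Lemma eq_dil u v : u =1 v -> dil u =1 dil v. Proof. by move=> E n; rewrite /dil E. Qed.
Lemma eq_conv u u' v v' : u =1 u' -> v =1 v' -> conv u v =1 conv u' v'.
Proof. by move=> E E' n; apply: eq_bigr => i _; rewrite E E'. Qed.

Lemma conv_shl u v : conv (sh u) v =1 sh (conv u v).
Proof.
case=> [|n]; first by rewrite /conv big_ord1 mul0r.
by rewrite /conv big_ord_recl mul0r add0r; apply: eq_bigr => i _.
Qed.

Lemma convC u v : conv u v =1 conv v u.
Proof.
move=> n; rewrite /conv (reindex_inj rev_ord_inj) /=; apply: eq_bigr => i _.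
have hi : (i <= n)%N by rewrite -ltnS.
by rewrite subSS (subKn hi); exact: mulrC.
Qed.

Lemma conv_qml A B u v : conv (qm A B u) v =1 qm A B (conv u v).
Proof.
have shl := conv_shl; move=> n; rewrite /qm -shl -(eq_sh (shl u v)) -shl /conv !mulr_sumr -sumrB -big_split.
by apply: eq_bigr => i _ /=; move: (u i) (sh u i) (sh (sh u) i) (v _) => *; ring.
Qed.

Lemma conv_qmr A B u v : conv u (qm A B v) =1 qm A B (conv u v).
Proof. by move=> n; rewrite convC conv_qml; apply: eq_qm; exact: convC. Qed.

Lemma conv_dil u v : conv (dil u) (dil v) =1 dil (conv u v).
Proof.
move=> n; rewrite /conv /dil mulr_sumr; apply: eq_bigr => i _.
by rewrite mulrACA -exprD subnKC // -ltnS.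
Qed.

Lemma dil_qm A B u : dil (qm A B u) =1 qm (q * A) (q ^+ 2 * B) (dil u).
Proof.
case=> [|[|n]]; rewrite /qm /dil /= ?expr0 ?expr1 ?mulr0 ?addr0 ?subr0 ?mul1r //.
  by ring.
by rewrite !exprS expr0; move: (u _) (u _) (u _) (q ^+ n) => *; ring.
Qed.

Lemma qm_comm A B C E u : qm A B (qm C E u) =1 qm C E (qm A B u).
Proof. by case=> [|[|[|[|n]]]]; rewrite /qm /=; ring. Qed.

Lemma qdiff_uniq A B C E u v : qm A B u =1 qm C E (dil u) -> qm A B v =1 qm C E (dil v) ->
  u 0%N = v 0%N -> u =1 v.
Proof.
move=> hu hv e0; suff h n : u n = v n /\ u n.+1 = v n.+1 by move=> n; case: (h n).
have e1 : u 1%N = v 1%N.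
  have := hu 1%N; have := hv 1%N; rewrite !qm_1 /dil expr1 expr0 !mul1r e0 => h1 h2.
  apply: (mulfI (qn1 0)); rewrite expr1 !mulrBl !mul1r.
  by apply/eqP; rewrite -subr_eq0; apply/eqP;
    transitivity ((u 1%N - A * v 0%N - (q * u 1%N - C * v 0%N)) - (v 1%N - A * v 0%N - (q * v 1%N - C * v 0%N)));
    [ring | rewrite h1 h2 !subrr].
elim: n => [|n [IH1 IH2]]; first by [].
split=> //; have := hu n.+2; have := hv n.+2; rewrite !qm_rec /dil IH1 IH2 => h1 h2.
apply: (mulfI (qn1 n.+1)).
apply/eqP; rewrite -subr_eq0; apply/eqP.
move: (q ^+ n.+2) (q ^+ n.+1) (q ^+ n) (u n.+2) (v n.+2) (v n.+1) (v n) h1 h2 => Z Y X a b c d h1 h2.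
transitivity ((a - A * c + B * d - (Z * a - C * (Y * c) + E * (X * d))) - (b - A * c + B * d - (Z * b - C * (Y * c) + E * (X * d)))); first by ring.
by rewrite h1 h2 !subrr.
Qed.

Lemma gpol_qm y s al : qm y 1 (gpol y s al) =1 qm s al (dil (gpol y s al)).
Proof.
case=> [|[|n]]; first by rewrite !qm_0 /dil mul1r.
  have := gpol_rec qn1 y s al 0; rewrite !qm_1 /dil /gpolm /gpol /= expr0 mulr0 subr0 !mulr1 !mul1r.
  move: (_ / _) => g h; apply/eqP; rewrite -subr_eq0; apply/eqP.
  by transitivity ((1 - q) * g - (y - s)); [rewrite expr1; ring|rewrite h subrr].
have := gpol_rec qn1 y s al n.+1; rewrite !qm_rec /dil gpolmS !exprS.
move: (gpol y s al n.+2) (gpol y s al n.+1) (gpol y s al n) (q ^+ n) => g2 g1 g0 Z.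
rewrite (_ : al * (q * Z) / q = al * Z); last by field; rewrite q0.
move=> h; apply/eqP; rewrite -subr_eq0; apply/eqP.
transitivity ((1 - q * Z * q) * g2 - ((y - q * Z * s) * g1 - (1 - al * Z) * g0)); first by ring.
by rewrite h subrr.
Qed.

(** The generating function of g_n solves (1 - eta z + z^2) f(z) = (1 - s z + al z^2) f(q z). *)
Lemma gpol_uniq y s al u : u 0%N = 1 -> qm y 1 u =1 qm s al (dil u) -> u =1 gpol y s al.
Proof. by move=> u0 hu; apply: qdiff_uniq hu (gpol_qm y s al) _. Qed.

(** A dilation of the generating function raises both parameters, up to a quadratic factor. *)
Lemma dil_gpol y s al : dil (gpol y s al) =1 qm y 1 (gpol y (q * s) (q ^+ 2 * al)).
Proof.
apply: (@qdiff_uniq (q * y) (q ^+ 2) (q * s) (q ^+ 2 * al)) => [n|n|].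
- rewrite -[q ^+ 2 in LHS]mulr1 -dil_qm (eq_dil (gpol_qm y s al)); exact: dil_qm.
- have h := gpol_qm y (q * s) (q ^+ 2 * al).
  rewrite [RHS](eq_qm _ _ (dil_qm _ _ _)) mulr1 [RHS]qm_comm.
  by apply: eq_qm => m; exact: h.
- by rewrite qm_0 /dil mul1r.
Qed.

Definition scl (l : K) u n := l ^+ n * u n.
Lemma scl_qm l A B u : scl l (qm A B u) =1 qm (l * A) (l ^+ 2 * B) (scl l u).
Proof.
case=> [|[|n]]; rewrite /qm /scl /= ?expr0 ?expr1 ?mulr0 ?addr0 ?subr0 ?mul1r //.
  by ring.
by rewrite !exprS expr0; move: (u _) (u _) (u _) (l ^+ n) => *; ring.
Qed.
Lemma eq_scl l u v : u =1 v -> scl l u =1 scl l v. Proof. by move=> E n; rewrite /scl E. Qed.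
Lemma scl_dil l u : scl l (dil u) =1 dil (scl l u).
Proof. by move=> n; rewrite /scl /dil mulrCA. Qed.

(** A linearisation: at dilation parameter k the dependence on y disappears. *)
Lemma conv_gpol y s al X k :
  conv (scl k (gpol y s al)) (gpol X (k * y) (k ^+ 2)) =1 gpol X (k * s) (k ^+ 2 * al).
Proof.
apply: gpol_uniq; first by rewrite /conv big_ord1 /scl expr0 !mul1r.
move=> n; rewrite -conv_qmr (eq_conv (frefl _) (gpol_qm _ _ _)) conv_qmr -conv_qml.
have e : qm (k * y) (k ^+ 2) (scl k (gpol y s al)) =1 qm (k * s) (k ^+ 2 * al) (dil (scl k (gpol y s al))).
  move=> m; rewrite -[X in qm _ X _ _]mulr1 -scl_qm (eq_scl k (gpol_qm y s al)) scl_qm.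
  by apply: eq_qm; exact: scl_dil.
rewrite (eq_conv e (frefl _)) conv_qml; apply: eq_qm; exact: conv_dil.
Qed.

(** The leading coefficient in y of the quotient of generating functions at dilation k q^i. *)
Definition topc (k : K) i := \prod_(m < i) (- (k * q ^+ m)).

(** At dilation parameter k q^i the degree in y is at most i. *)
Lemma conv_gpol_top k i s al X : exists P : nat -> {poly K},
  forall N, [/\ (size (P N) <= i.+1)%N,
    (P N)`_i = topc k i * iter i (@sh K) (gpol X (k * q ^+ i * s) (k ^+ 2 * al * (q ^+ i) ^+ 2)) N &
    forall y, conv (scl (k * q ^+ i) (gpol y s al)) (gpol X (k * y) (k ^+ 2)) N = (P N).[y]].
Proof.
elim: i s al => [|i IH] s al.
  exists (fun N => (gpol X (k * s) (k ^+ 2 * al) N)%:P) => N; split.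
  - by rewrite size_polyC; case: (_ != 0).
  - by rewrite coefC /= /topc big_ord0 expr0 expr1n !mulr1 mul1r.
  - by move=> y; rewrite hornerC expr0 mulr1; exact: conv_gpol.
have [P hP] := IH (q * s) (q ^+ 2 * al); set l := k * q ^+ i.
have sP N : (size (sh P N) <= i.+1)%N by case: N => [|N]; rewrite /sh ?size_poly0 //; case: (hP N).
have ssP N : (size (sh (sh P) N) <= i.+1)%N by case: N => [|N]; rewrite /= ?size_poly0 //; exact: sP.
exists (fun N => P N - l *: (sh P N * 'X) + l ^+ 2 *: sh (sh P) N) => N; split.
- apply: leq_trans (size_polyD _ _) _; rewrite geq_max; apply/andP; split; last first.
    by apply: leq_trans (size_scale_leq _ _) _; apply: leq_trans (ssP N) _.
  apply: leq_trans (size_polyD _ _) _; rewrite geq_max size_polyN; apply/andP; split.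
    by have [h _ _] := hP N; apply: leq_trans h _.
  apply: leq_trans (size_scale_leq _ _) _; apply: leq_trans (size_polyMleq _ _) _.
  by rewrite size_polyX addn2 ltnS.
- rewrite !coefD coefN !coefZ coefMX /= [(P N)`_i.+1]nth_default; last by case: (hP N).
  rewrite [(sh (sh P) N)`_i.+1]nth_default // mulr0 addr0 sub0r.
  rewrite /topc big_ord_recr /= -/(topc k i) -/l.
  have -> : (sh P N)`_i = topc k i * sh (iter i (@sh K) (gpol X (k * q ^+ i * (q * s)) (k ^+ 2 * (q ^+ 2 * al) * (q ^+ i) ^+ 2))) N.
    by case: N => [|N] /=; [rewrite coef0 mulr0|case: (hP N)].
  rewrite (exprSr q i) (_ : k * q ^+ i * (q * s) = k * (q ^+ i * q) * s); last by ring.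
  rewrite (_ : k ^+ 2 * (q ^+ 2 * al) * q ^+ i ^+ 2 = k ^+ 2 * al * (q ^+ i * q) ^+ 2); last by ring.
  by move: (sh (iter _ _ _) N) => S0; ring.
- move=> y; rewrite !hornerD hornerN !hornerZ hornerMX.
  have e : scl (k * q ^+ i.+1) (gpol y s al) =1 qm (l * y) (l ^+ 2) (scl l (gpol y (q * s) (q ^+ 2 * al))).
    move=> m; rewrite -[X in qm _ X]mulr1 -scl_qm -(eq_scl l (dil_gpol y s al)) /scl /dil exprSr mulrA exprMn.
    by rewrite -mulrA.
  rewrite (eq_conv e (frefl _)) conv_qml /qm.
  have h1 m : conv (scl l (gpol y (q * s) (q ^+ 2 * al))) (gpol X (k * y) (k ^+ 2)) m = (P m).[y] by case: (hP m).
  rewrite h1 (eq_sh h1) (eq_sh (eq_sh h1)).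
  by case: N => [|[|N]]; rewrite /= ?horner0; ring.
Qed.

Lemma gpol_poly s al n : exists2 P : {poly K}, (size P <= n.+1)%N & forall y, gpol y s al n = P.[y].
Proof.
suff [P [Q [h1 h2 h3 h4]]] : exists P Q : {poly K}, [/\ (size P <= n.+1)%N, (size Q <= n)%N,
  forall y, gpol y s al n = P.[y] & forall y, gpolm y s al n = Q.[y]] by exists P.
elim: n => [|n [P [Q [h1 h2 h3 h4]]]].
  by exists 1, 0; split => [||y|y]; rewrite ?size_poly1 ?size_poly0 ?hornerC.
exists ((1 - q ^+ n.+1)^-1 *: (P * 'X - (q ^+ n * s) *: P - (1 - al * q ^+ n / q) *: Q)), P; split=> //.
  apply: leq_trans (size_scale_leq _ _) _; rewrite -addrA.
  apply: leq_trans (size_polyD _ _) _; rewrite geq_max; apply/andP; split.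
    by apply: leq_trans (size_polyMleq _ _) _; rewrite size_polyX addn2 ltnS.
  apply: leq_trans (size_polyD _ _) _; rewrite geq_max !size_polyN; apply/andP; split.
    by apply: leq_trans (size_scale_leq _ _) _; apply: leq_trans h1 _.
  by apply: leq_trans (size_scale_leq _ _) _; apply: leq_trans h2 _; rewrite ltnW.
move=> y; rewrite hornerZ !hornerD !hornerN !hornerZ hornerMX -h3 -h4; apply: (mulfI (qn1 n)).
rewrite mulVKf //; have := gpol_rec qn1 y s al n; rewrite -exprSr => ->.
by ring.
Qed.

Lemma gpol_par_poly X k be l : exists2 P : {poly K}, (size P <= l.+1)%N & forall y, gpol X (k * y) be l = P.[y].
Proof.
suff [P [Q [h1 h2 h3 h4]]] : exists P Q : {poly K}, [/\ (size P <= l.+1)%N, (size Q <= l)%N,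
  forall y, gpol X (k * y) be l = P.[y] & forall y, gpolm X (k * y) be l = Q.[y]] by exists P.
elim: l => [|n [P [Q [h1 h2 h3 h4]]]].
  by exists 1, 0; split => [||y|y]; rewrite ?size_poly1 ?size_poly0 ?hornerC.
exists ((1 - q ^+ n.+1)^-1 *: (X *: P - (q ^+ n * k) *: (P * 'X) - (1 - be * q ^+ n / q) *: Q)), P; split=> //.
  apply: leq_trans (size_scale_leq _ _) _; rewrite -addrA.
  apply: leq_trans (size_polyD _ _) _; rewrite geq_max; apply/andP; split.
    by apply: leq_trans (size_scale_leq _ _) _; apply: leq_trans h1 _.
  apply: leq_trans (size_polyD _ _) _; rewrite geq_max !size_polyN; apply/andP; split.
    apply: leq_trans (size_scale_leq _ _) _; apply: leq_trans (size_polyMleq _ _) _.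
    by rewrite size_polyX addn2 ltnS.
  by apply: leq_trans (size_scale_leq _ _) _; apply: leq_trans h2 _; rewrite ltnW.
move=> y; rewrite hornerZ !hornerD !hornerN !hornerZ hornerMX -h3 -h4; apply: (mulfI (qn1 n)).
rewrite mulVKf //; have := gpol_rec qn1 X (k * y) be n; rewrite -exprSr => ->.
by ring.
Qed.

(** At this value one of the factors of the generating function cancels. *)
Lemma gpol_special x be l : x != 0 -> gpol (x + x^-1) (x^-1 + be * x) be l = qp q be l / qp q q l * x ^+ l.
Proof.
move=> x0; apply/esym; apply: (@gpol_uniq _ _ _ (fun l => qp q be l / qp q q l * x ^+ l)) => [|n].
  by rewrite !qp0 expr0 divr1 mulr1.
pose u m := qp q be m / qp q q m * x ^+ m; rewrite -/u.
have step m : u m.+1 * (1 - q ^+ m * q) = u m * x * (1 - be * q ^+ m).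
  rewrite /u !qpS exprSr; have := qpq_neq0 qn1 m; have := qn1 m; rewrite exprSr (mulrC _ q).
  move: (qp _ be m) (qp _ q m) (q ^+ m) (x ^+ m) => A1 A2 Z A3 h1 h2; by field; rewrite h2 h1.
have u0 : u 0%N = 1 by rewrite /u !qp0 expr0 divr1 mulr1.
clearbody u.
have sq m : q ^+ m.+1 = q ^+ m * q by rewrite exprSr.
case: n => [|[|n]]; first by rewrite !qm_0 /dil mul1r.
  rewrite !qm_1 /dil expr1 expr0 mul1r; have := step 0%N; rewrite expr0 mul1r mulr1.
  move: (u 1%N) (u 0%N) => a b h; apply/eqP; rewrite -subr_eq0; apply/eqP.
  by transitivity (a * (1 - q) - b * x * (1 - be)); [field; rewrite x0|rewrite h subrr].
rewrite !qm_rec /dil; have := step n; have := step n.+1; rewrite !sq.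
move: (u n.+2) (u n.+1) (u n) (q ^+ n) => a b c Z h1 h2; apply/eqP; rewrite -subr_eq0; apply/eqP.
transitivity ((a * (1 - Z * q * q) - b * x * (1 - be * (Z * q))) - x^-1 * (b * (1 - Z * q) - c * x * (1 - be * Z))); first by field; rewrite x0.
by rewrite h1 h2 !subrr mulr0 subr0.
Qed.

End Sequences.

(** * Diagonalising the bilinear kernel *)

Section Triangular.
Variables (K : fieldType) (P : nat -> {poly K}).
Hypothesis sP : forall j, (size (P j) <= j.+1)%N.
Hypothesis lP : forall j, (P j)`_j != 0.

Lemma tri_expand N (F : {poly K}) : (size F <= N)%N -> exists E : nat -> K, F = \sum_(j < N) E j *: P j.
Proof.
elim: N F => [|N IH] F sF.
  by exists (fun=> 0); rewrite big_ord0; apply/eqP; rewrite -size_poly_leq0.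
have [|E hE] := IH (F - (F`_N / (P N)`_N) *: P N).
  apply/leq_sizeP => m; rewrite leq_eqVlt => /orP[/eqP <-|Nm].
    by rewrite coefB coefZ divfK ?subrr.
  by rewrite coefB coefZ [F`_m]nth_default ?[(P N)`_m]nth_default ?mulr0 ?subrr ?(leq_trans _ Nm).
exists (fun j => if (j < N)%N then E j else F`_N / (P N)`_N).
rewrite big_ord_recr /= ltnn (eq_bigr (fun j : 'I_N => E j *: P j)) => [|i _]; last by rewrite ltn_ord.
by rewrite -hE subrK.
Qed.

(** If the sum has degree at most m, its higher coefficients vanish one after the other. *)
Lemma tri_top N (E : nat -> K) m : (m < N)%N -> (size (\sum_(j < N) E j *: P j)%R <= m.+1)%N ->
  E m * (P m)`_m = (\sum_(j < N) E j *: P j)`_m.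
Proof.
elim: N => [//|N IH]; rewrite ltnS leq_eqVlt => /orP[/eqP ->|mN].
  move=> _; rewrite big_ord_recr /= coefD coefZ coef_sum big1 ?add0r // => i _.
  by rewrite coefZ nth_default ?mulr0 // (leq_trans (sP i)).
move=> sz; have EN : E N = 0.
  have : (\sum_(j < N.+1) E j *: P j)`_N = 0 by rewrite nth_default // (leq_trans sz).
  rewrite big_ord_recr /= coefD coefZ coef_sum big1 ?add0r => [/eqP|i _]; last first.
    by rewrite coefZ nth_default ?mulr0 // (leq_trans (sP i)).
  by rewrite mulf_eq0 (negbTE (lP N)) orbF => /eqP.
by move: sz; rewrite big_ord_recr /= EN scale0r addr0; exact: IH.
Qed.

Lemma tri_free N (E : nat -> K) : \sum_(j < N) E j *: P j = 0 -> forall j, (j < N)%N -> E j = 0.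
Proof.
move=> h j jN; have := @tri_top N E j jN; rewrite h size_poly0 coef0 => /(_ isT) /eqP.
by rewrite mulf_eq0 (negbTE (lP j)) orbF => /eqP.
Qed.

End Triangular.

Section Expansion.
Variables (K : fieldType) (q : K).
Hypotheses (q0 : q != 0) (qn1 : forall n, 1 - q ^+ n.+1 != 0).
Variables (k al : K).
Let be := k ^+ 2.
Hypotheses (k0 : k != 0) (al0 : al != 0).
Hypotheses (hal : forall m, 1 - al * q ^+ m != 0) (hbe : forall m, 1 - be * q ^+ m != 0)
  (hD : forall m, 1 - al * be * q ^+ m != 0).
Variable ws : nat -> K.
Hypotheses (ws_reg : forall n, regular q (ws n)) (ws_inj : injective (fun n => et (ws n))).
Local Notation gpol := (gpol q).
Local Notation gpolm := (gpolm q).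
Local Notation qp := (qp q).

(** A polynomial with infinitely many zeros. *)
Lemma et_poly0 (P : {poly K}) : (forall w, regular q w -> P.[et w] = 0) -> P = 0.
Proof.
move=> h; apply: (@roots_geq_poly_eq0 _ P [seq et (ws n) | n <- iota 0 (size P)]).
- by apply/allP => x /mapP[n _ ->]; rewrite /root h.
- by rewrite map_inj_uniq ?iota_uniq.
- by rewrite size_map size_iota.
Qed.

(** A pair (a, c) stands for the Askey-Wilson parameters a, be/a, c, al/c. Fixing the
    products al and be is what makes the tridiagonal matrix below common to all pairs. *)
Definition pX a := (a + be / a) / k.
Definition pS c := c + al / c.
Definition pP a c j := AWpol q j a (be / a) c (al / c).
Definition gprod a c y n l := gpol y (pS c) al n * gpol (pX a) (k * y) be l.

Section Data.
Variables (a c : K).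
Hypotheses (a0 : a != 0) (c0 : c != 0).

Let eD : a * (be / a) * c * (al / c) = al * be.
Proof. by field; rewrite a0 c0. Qed.

Lemma pP_size j : (size (pP a c j) <= j.+1)%N.
Proof. by case: (AWpol_size q0 qn1 (be / a) c (al / c) j a0). Qed.

Lemma pP_lead j : (pP a c j)`_j = qp (al * be * q ^+ j / q) j.
Proof. by case: (AWpol_size q0 qn1 (be / a) c (al / c) j a0) => _; rewrite eD. Qed.

Lemma lead_neq0 j : qp (al * be * q ^+ j / q) j != 0.
Proof.
apply/prodf_neq0 => i _; case: j i => [[]//|j] i.
have -> : al * be * q ^+ j.+1 / q * q ^+ i = al * be * q ^+ (j + i).
  by rewrite exprSr exprD; move: (q ^+ j) (q ^+ i) => *; field.
exact: hD.
Qed.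

Lemma gprod_poly n l : exists2 F : {poly K}, (size F <= (n + l).+1)%N & forall y, gprod a c y n l = F.[y].
Proof.
have [P sP hP] := gpol_poly qn1 (pS c) al n; have [Q sQ hQ] := gpol_par_poly qn1 (pX a) k be l.
exists (P * Q); last by move=> y; rewrite hornerM -hP -hQ.
apply: leq_trans (size_polyMleq _ _) _; rewrite -subn1 leq_subLR.
have -> : (1 + (n + l).+1 = n.+1 + l.+1)%N by rewrite add1n addSn addnS.
exact: leq_add.
Qed.

Lemma pP_eig w j : regular q w ->
  AWop q (pS c) al (pX a) k w (horner (pP a c j)) = AWev q j (al * be) * (pP a c j).[et w].
Proof.
move=> rw; rewrite (AWop_AWpol q0 qn1 (b := be / a) (c := c) (d := al / c)) ?eD //.
- by rewrite mulrC divfK.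
- by rewrite /pX mulrC divfK.
- by rewrite mulrC divfK.
Qed.

Variable N : nat.

(** The entries of the tridiagonal matrix of [AWop_gg] for n + l = N. *)
Definition cU n := k * (1 - (q ^+ n * q)^-1) * (1 - be * q ^+ (N - n) / q).
Definition cD n := be * (1 + al / q) * q ^+ (N - n) - (1 + al * be / q) + (1 + be / q) / q ^+ n - be * (1 + q^-1) * (q ^+ (N - n) / q ^+ n).
Definition cV n := - (k / q ^+ n * (1 - al * q ^+ n / q) * (1 - q ^+ (N - n) * q)).

Lemma AWop_gprod w n : regular q w -> (n <= N)%N ->
  AWop q (pS c) al (pX a) k w (fun y => gprod a c y n (N - n)) =
  (if (n < N)%N then cU n * gprod a c (et w) n.+1 (N - n.+1) else 0) + cD n * gprod a c (et w) n (N - n) +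
  (if n is m.+1 then cV n * gprod a c (et w) m (N - m) else 0).
Proof.
move=> rw nN; rewrite (AWop_gg q0 qn1 _ _ _ n (N - n) rw k0) -/be; congr (_ + _ + _).
- rewrite /cU /gprod; case: ltnP => h; first by rewrite -[in gpolm _ _ _ _](subnSK h).
  have -> : (N - n = 0)%N by apply/eqP; rewrite subn_eq0.
  by rewrite /gpolm /= !mulr0.
- rewrite /cV /gprod; case: n nN {rw} => [|n] nN; first by rewrite (_ : gpolm (et w) (pS c) al 0 = 0) // mul0r mulr0 oppr0.
  by rewrite mulNr gpolmS (subnSK nN).
Qed.

Lemma gprod_expand : exists E : nat -> nat -> K, forall n, (n <= N)%N ->
  forall y, gprod a c y n (N - n) = \sum_(j < N.+1) E n j * (pP a c j).[y].
Proof.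
have h n : exists E : nat -> K, (n <= N)%N -> forall y, gprod a c y n (N - n) = \sum_(j < N.+1) E j * (pP a c j).[y].
  case: (leqP n N) => nN; last by exists (fun=> 0).
  have [F sF hF] := gprod_poly n (N - n).
  rewrite (subnKC nN) in sF; have [|E hE] := tri_expand pP_size (N := N.+1) _ sF.
    by move=> j; rewrite pP_lead lead_neq0.
  exists E => _ y; rewrite hF hE horner_sum; apply: eq_bigr => i _; exact: hornerZ.
by have [E hE] := choice h; exists E.
Qed.

Definition trid (x : nat -> K) n :=
  (if (n < N)%N then cU n * x n.+1 else 0) + cD n * x n + (if n is m.+1 then cV n * x m else 0).

Definition expands (E : nat -> nat -> K) := forall n, (n <= N)%N ->
  forall y, gprod a c y n (N - n) = \sum_(j < N.+1) E n j * (pP a c j).[y].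

(** Comparing the coefficients of the j-th eigenfunction. *)
Lemma expands_rec E n j : expands E -> (n <= N)%N -> (j <= N)%N ->
  AWev q j (al * be) * E n j = trid (E^~ j) n.
Proof.
move=> hE nN jN; pose G i := AWev q i (al * be) * E n i - trid (E^~ i) n.
suff : G j = 0 by move/eqP; rewrite subr_eq0 => /eqP.
apply: (@tri_free _ (pP a c) _ _ N.+1) => //; first exact: pP_size.
  by move=> i; rewrite pP_lead lead_neq0.
apply: et_poly0 => w rw; rewrite horner_sum.
have h1 := AWop_gprod rw nN; have h2 := hE n nN.
rewrite (eq_AWop _ _ _ _ _ _ h2) (@AWop_sum _ q (pS c) al (pX a) k w N.+1 (E n) (fun i => horner (pP a c i))) in h1.
under eq_bigr do rewrite hornerZ /G mulrBl.
rewrite sumrB; apply/eqP; rewrite subr_eq0; apply/eqP.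
transitivity (\sum_(i < N.+1) E n i * AWop q (pS c) al (pX a) k w (horner (pP a c i))).
  by apply: eq_bigr => i _; rewrite pP_eig //; move: (AWev _ _ _) (E n i) ((pP a c i).[_]) => *; ring.
rewrite h1 h2 /trid.
under [RHS]eq_bigr do rewrite 2!mulrDl.
rewrite 2!big_split /=; congr (_ + _ + _).
- case: ifP => h; last by rewrite big1 // => i _; rewrite mul0r.
  by rewrite hE // mulr_sumr; apply: eq_bigr => i _; rewrite mulrA.
- by rewrite mulr_sumr; apply: eq_bigr => i _; rewrite mulrA.
- case: n nN {h1 h2 G} => [|m] nN; first by rewrite big1 // => i _; rewrite mul0r.
  by rewrite hE ?(ltnW nN) // mulr_sumr; apply: eq_bigr => i _; rewrite mulrA.
Qed.

Lemma cU_neq0 n : (n < N)%N -> cU n != 0.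
Proof.
move=> nN; rewrite /cU; have <- := subnSK nN.
rewrite !mulf_neq0 //; last by rewrite exprSr mulrA mulfK.
have h := qn1 n; rewrite -exprSr; have z : q ^+ n.+1 != 0 by rewrite expf_neq0.
have -> : 1 - (q ^+ n.+1)^-1 = - ((1 - q ^+ n.+1) / q ^+ n.+1) by field.
by rewrite oppr_eq0 mulf_neq0 ?invr_eq0.
Qed.

Lemma expands0 E j : expands E -> (j <= N)%N -> E 0%N j = 0 -> forall n, (n <= N)%N -> E n j = 0.
Proof.
move=> hE jN E0 n; suff h : (n <= N)%N -> E n j = 0 /\ (if n is m.+1 then E m j = 0 else True) by move=> nN; case: (h nN).
elim: n => [//|n IH nN]; have [h1 h2] := IH (ltnW nN); split=> //.
have r := expands_rec hE (ltnW nN) jN; rewrite /trid nN h1 !mulr0 addr0 in r.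
apply: (mulfI (cU_neq0 nN)); rewrite mulr0; move: r.
by case: n h2 {IH nN h1} => [|m] h2; rewrite ?h2 ?mulr0 addr0.
Qed.

(** At dilation parameter k q^j the generating sum over n has degree at most j in y, so its
    component along the j-th polynomial is given by leading coefficients. *)
Lemma expands_top E j : expands E -> (j <= N)%N ->
  (\sum_(n < N.+1) (k * q ^+ j) ^+ n * E n j) * qp (al * be * q ^+ j / q) j =
  topc q k j * gpol (pX a) (k * q ^+ j * pS c) (be * al * (q ^+ j) ^+ 2) (N - j).
Proof.
move=> hE jN; have [P hP] := conv_gpol_top q0 qn1 k j (pS c) al (pX a).
have [sP cP eP] := hP N.
pose T i := \sum_(n < N.+1) (k * q ^+ j) ^+ n * E n i.
have eT : \sum_(i < N.+1) T i *: pP a c i = P N.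
  apply/eqP; rewrite -subr_eq0; apply/eqP/et_poly0 => w rw.
  rewrite hornerD hornerN -eP horner_sum /conv; apply/eqP; rewrite subr_eq0; apply/eqP.
  under [RHS]eq_bigr => n _.
    rewrite /scl -mulrA -/(gprod a c (et w) n (N - n)) hE -1?ltnS // mulr_sumr.
    over.
  rewrite exchange_big /=; apply: eq_bigr => i _.
  by rewrite hornerZ /T mulr_suml; apply: eq_bigr => n _; rewrite mulrA.
have it i (u : nat -> K) M : (i <= M)%N -> iter i (@sh K) u M = u (M - i)%N.
  elim: i M => [|i IH] [|M] iM //=; by rewrite IH.
have lP i : (pP a c i)`_i != 0 by rewrite pP_lead lead_neq0.
have := @tri_top _ (pP a c) pP_size lP N.+1 T j; rewrite ltnS jN eT => /(_ isT sP).
by rewrite cP it // pP_lead.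
Qed.

End Data.

Variable N : nat.
Definition kweight n := qp q n * qp q (N - n) / (qp al n * qp be (N - n)).

(** The weights symmetrise the tridiagonal matrix. *)
Lemma kweight_sym n : (n < N)%N -> kweight n * cU N n = kweight n.+1 * cV N n.+1.
Proof.
move=> nN; rewrite /kweight /cU /cV; have -> : (N - n = (N - n.+1).+1)%N by rewrite subnSK.
rewrite !qpS !exprSr.
have [z1 z2] : q ^+ n != 0 /\ q ^+ (N - n.+1) != 0 by rewrite !expf_neq0.
have := (qpq_neq0 qn1 n, qpq_neq0 qn1 (N - n.+1), hal n, hbe (N - n.+1)).
have qa m : qp al m != 0 by apply/prodf_neq0 => i _; exact: hal.
have qb m : qp be m != 0 by apply/prodf_neq0 => i _; exact: hbe.
have := (qa n, qb (N - n.+1)%N); have := (qn1 n, qn1 (N - n.+1)); rewrite !exprS.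
clearbody be; clear qa qb.
move: (qp q n) (qp q (N - n.+1)) (qp al n) (qp be (N - n.+1)) => A1 A2 A3 A4.
move: (q ^+ n) (q ^+ (N - n.+1)) z1 z2 => Z Y z1 z2 [h1 h2] [h3 h4] [[[h5 h6] h7] h8].
by field; rewrite ?h1 ?h2 ?h3 ?h4 ?h5 ?h6 ?h7 ?h8 ?q0 ?z1 ?z2.
Qed.

Lemma trid_sym (x y : nat -> K) :
  \sum_(n < N.+1) kweight n * (trid N x n * y n) = \sum_(n < N.+1) kweight n * (x n * trid N y n).
Proof.
pose S (x y : nat -> K) := \sum_(n < N) kweight n * cU N n * (x n.+1 * y n).
have key (u v : nat -> K) : \sum_(n < N.+1) kweight n * (trid N u n * v n) = S u v + \sum_(n < N.+1) kweight n * cD N n * (u n * v n) + S v u.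
  have -> : \sum_(n < N.+1) kweight n * (trid N u n * v n) =
     \sum_(n < N.+1) kweight n * (if (n < N)%N then cU N n * u n.+1 else 0) * v n +
     \sum_(n < N.+1) kweight n * cD N n * (u n * v n) +
     \sum_(n < N.+1) kweight n * (if (n : nat) is m.+1 then cV N n * u m else 0) * v n.
    rewrite -!big_split /=; apply: eq_bigr => n _; rewrite /trid.
    have aux (A B C w1 u1 v1 : K) : w1 * ((A + B * u1 + C) * v1) = w1 * A * v1 + w1 * B * (u1 * v1) + w1 * C * v1 by ring.
    exact: aux.
  congr (_ + _ + _).
    rewrite big_ord_recr /= ltnn mulr0 mul0r addr0; apply: eq_bigr => n _.
    by rewrite ltn_ord; ring.
  rewrite big_ord_recl /= mulr0 mul0r add0r; apply: eq_bigr => n _.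
  by rewrite /bump /= add1n kweight_sym //; ring.
have -> : \sum_(n < N.+1) kweight n * (x n * trid N y n) = \sum_(n < N.+1) kweight n * (trid N y n * x n).
  by apply: eq_bigr => n _; rewrite (mulrC (x n)).
rewrite !key; have -> : \sum_(n < N.+1) kweight n * cD N n * (y n * x n) = \sum_(n < N.+1) kweight n * cD N n * (x n * y n).
  by apply: eq_bigr => n _; rewrite (mulrC (x n)).
by rewrite addrC addrA addrAC.
Qed.

Lemma AWev_inj i j : (i < j)%N -> AWev q i (al * be) != AWev q j (al * be).
Proof.
move=> ij; rewrite -subr_eq0.
have -> : AWev q i (al * be) - AWev q j (al * be) = ((q ^+ i)^-1 - (q ^+ j)^-1) * (1 - al * be * q ^+ (i + j).-1).
  have -> : q ^+ (i + j).-1 = q ^+ i * q ^+ j / q.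
    by case: j ij => // j _; rewrite addnS /= exprD exprSr mulrA mulfK.
  have : q ^+ i != 0 by rewrite expf_neq0.
  have : q ^+ j != 0 by rewrite expf_neq0.
  by rewrite /AWev; move: (q ^+ i) (q ^+ j) => Z Y z y; field; rewrite z y q0.
rewrite mulf_neq0 ?hD // -(subnKC ij) addSn exprS exprD mulrCA -exprS.
have := qn1 (j - i.+1); have : q ^+ i != 0 by rewrite expf_neq0.
have : q ^+ (j - i.+1).+1 != 0 by rewrite expf_neq0.
move: (q ^+ i) (q ^+ _) => Z Y z y h.
have -> : Z^-1 - (Z * Y)^-1 = - ((1 - Y) / (Z * Y)) by field; rewrite z y.
by rewrite oppr_eq0 mulf_neq0 ?invr_eq0 ?mulf_neq0.
Qed.

Section Pair.
Variables (a c a' c' : K) (E E' : nat -> nat -> K).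
Hypotheses (a0 : a != 0) (c0 : c != 0) (a0' : a' != 0) (c0' : c' != 0).
Hypotheses (hE : expands a c N E) (hE' : expands a' c' N E').

(** The three-term recurrence determines the coefficients up to a factor. *)
Lemma expands_prop n j : (n <= N)%N -> (j <= N)%N -> E n j * E' 0%N j = E' n j * E 0%N j.
Proof.
move=> nN jN; suff h : (n <= N)%N -> E n j * E' 0%N j = E' n j * E 0%N j /\ (if n is m.+1 then E m j * E' 0%N j = E' m j * E 0%N j else True) by case: (h nN).
elim: n {nN} => [_|n IH nN]; first by rewrite mulrC.
have [IH1 IH2] := IH (ltnW nN); split=> //.
have r1 := expands_rec a0 c0 hE (ltnW nN) jN; have r2 := expands_rec a0' c0' hE' (ltnW nN) jN.
have aux (A B C : K) : A = A + B + C - B - C by ring.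
rewrite /trid nN in r1 r2; apply: (mulfI (cU_neq0 nN)).
have e1 : cU N n * E n.+1 j = AWev q j (al * be) * E n j - cD N n * E n j - (if n is m.+1 then cV N n * E m j else 0).
  by rewrite r1; exact: aux.
have e2 : cU N n * E' n.+1 j = AWev q j (al * be) * E' n j - cD N n * E' n j - (if n is m.+1 then cV N n * E' m j else 0).
  by rewrite r2; exact: aux.
rewrite !mulrA e1 e2 !mulrBl -!(mulrA _ (E n j)) -!(mulrA _ (E' n j)) IH1; congr (_ - _).
by case: n IH2 {IH IH1 nN r1 r2 e1 e2} => [|m] IH2; rewrite ?mul0r // -!mulrA IH2.
Qed.

Definition wsum (E E' : nat -> nat -> K) i j := \sum_(n < N.+1) kweight n * (E n i * E' n j).

(** Eigenvectors of a symmetric matrix for distinct eigenvalues are orthogonal. *)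
Lemma wsum_orth i j : (i <= N)%N -> (j <= N)%N -> i != j -> wsum E E' i j = 0.
Proof.
move=> iN jN ij; have h : (AWev q i (al * be) - AWev q j (al * be)) * wsum E E' i j = 0.
  rewrite mulrBl /wsum !mulr_sumr; apply/eqP; rewrite subr_eq0; apply/eqP.
  transitivity (\sum_(n < N.+1) kweight n * (trid N (E^~ i) n * E' n j)).
    by apply: eq_bigr => n _; rewrite -(expands_rec a0 c0 hE) -1?ltnS //; ring.
  have /= -> := trid_sym (E^~ i) (E'^~ j); apply: eq_bigr => n _.
  by rewrite -(expands_rec a0' c0' hE') -1?ltnS //; ring.
move/eqP: h; rewrite mulf_eq0 subr_eq0 => /orP[|/eqP //].
case: (ltngtP i j) ij => // h _; first by rewrite (negbTE (AWev_inj h)).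
by rewrite eq_sym (negbTE (AWev_inj h)).
Qed.

Lemma kernel_diag y y' :
  \sum_(n < N.+1) kweight n * (gprod a c y n (N - n) * gprod a' c' y' n (N - n)) =
  \sum_(j < N.+1) wsum E E' j j * ((pP a c j).[y] * (pP a' c' j).[y']).
Proof.
transitivity (\sum_(i < N.+1) \sum_(j < N.+1) wsum E E' i j * ((pP a c i).[y] * (pP a' c' j).[y'])).
  under eq_bigr => n _.
    rewrite (hE _ y) -1?ltnS // (hE' _ y') -1?ltnS // mulr_suml mulr_sumr.
    under eq_bigr do rewrite mulr_sumr mulr_sumr.
    over.
  rewrite exchange_big /=; apply: eq_bigr => i _; rewrite exchange_big /=; apply: eq_bigr => j _.
  by rewrite /wsum mulr_suml; apply: eq_bigr => n _; ring.
apply: eq_bigr => i _; rewrite (bigD1 i) //= big1 ?addr0 // => j ji.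
by rewrite wsum_orth ?mul0r // -1?ltnS // eq_sym.
Qed.

Lemma E'_diag y' i : (i <= N)%N ->
  \sum_(n < N.+1) kweight n * (E n i * gprod a' c' y' n (N - n)) = wsum E E' i i * (pP a' c' i).[y'].
Proof.
move=> iN; transitivity (\sum_(j < N.+1) wsum E E' i j * (pP a' c' j).[y']).
  under eq_bigr => n _ do rewrite (hE' _ y') -1?ltnS // !mulr_sumr.
  rewrite exchange_big /=; apply: eq_bigr => j _.
  by rewrite /wsum mulr_suml; apply: eq_bigr => n _; ring.
have iN' : (i < N.+1)%N by [].
rewrite (bigD1 (Ordinal iN')) //= big1 ?addr0 // => j ji.
by rewrite wsum_orth ?mul0r // -1?ltnS // eq_sym.
Qed.

End Pair.

Lemma qp_rev n : qp q n * \prod_(m < n) (- q ^+ m) = q ^+ (n * n) * qp (q ^+ n)^-1 n.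
Proof.
elim: n => [|n IH]; first by rewrite !qp0 big_ord0 mulr1.
have z : q ^+ n != 0 by rewrite expf_neq0.
rewrite qpS big_ord_recr /= [in RHS]qpSl exprSr (_ : (q ^+ n * q)^-1 * q = (q ^+ n)^-1); last by field; rewrite q0 z.
transitivity ((qp q n * \prod_(m < n) (- q ^+ m)) * (- (1 - q * q ^+ n) * q ^+ n)).
  by move: (qp q n) (\prod_(m < _) _) => *; ring.
have -> : (n.+1 * n.+1 = n * n + n + n + 1)%N by rewrite addn1 mulSn mulnS addSn addnC (addnC n).
rewrite IH !exprD expr1; move: (qp _ _) (q ^+ (n * n)) => A1 A2; move: (q ^+ n) z => Z z.
by field; rewrite q0 z.
Qed.

(** The parameters z, z with z^2 q^j = 1 make every function factor at z + 1/z. *)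
Section SpecialPoint.
Variables (j : nat) (z : K).
Hypotheses (z0 : z != 0) (hz : z ^+ 2 * q ^+ j = 1) (jN : (j <= N)%N).

Let zk : z / k != 0. Proof. by rewrite mulf_neq0 ?invr_eq0. Qed.

Lemma gprod_special n l : gprod z z (et z) n l = qp al n / qp q n * z^-1 ^+ n * (qp be l / qp q l * (z / k) ^+ l).
Proof.
have zi : z^-1 != 0 by rewrite invr_eq0.
rewrite /gprod -(gpol_special q0 qn1 al n zi) -(gpol_special q0 qn1 be l zk) /et /pS /pX invrK.
rewrite (addrC z z^-1) (_ : (z + be / z) / k = z / k + (z / k)^-1); last by rewrite /be; field; rewrite z0 k0.
by rewrite (_ : k * (z^-1 + z) = (z / k)^-1 + be * (z / k)) // /be; field; rewrite z0 k0.
Qed.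

Lemma gpol_special_top l : gpol (pX z) (k * q ^+ j * pS z) (be * al * (q ^+ j) ^+ 2) l =
  qp (be * al * (q ^+ j) ^+ 2) l / qp q l * (z / k) ^+ l.
Proof.
rewrite -(gpol_special q0 qn1 _ l zk) /pX /pS.
have e : q ^+ j = (z ^+ 2)^-1 by rewrite -[RHS]mulr1 -hz mulKf // expf_neq0.
rewrite e (_ : (z + be / z) / k = z / k + (z / k)^-1); last by rewrite /be; field; rewrite z0 k0.
rewrite (_ : k / z ^+ 2 * (z + al / z) = (z / k)^-1 + be * al * (z ^+ 2)^-1 ^+ 2 * (z / k)) //.
by rewrite /be; field; rewrite z0 k0.
Qed.

Lemma pP_special : (pP z z j).[et z] = z ^- j * (qp be j * qp (q ^+ j)^-1 j * qp al j).
Proof.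
rewrite AWpol_horner big_ord_recl big1 ?addr0 => [|i _].
  rewrite /awbasis /awbasisP big_ord0 hornerC mulr1 /awc /= !qp0 !expr0 !mulr1 subn0 divr1 mul1r.
  have e : (q ^+ j)^-1 = z * z by rewrite -expr2 -[RHS]mulr1 -(divff (_ : q ^+ j != 0)) ?expf_neq0 // mulrA hz mul1r.
  by rewrite e (_ : z * (be / z) = be) 1?(_ : z * (al / z) = al) //; field.
by rewrite awbasis_et // divff // lift0 [qp 1 _]qpSl subrr mul0r !mulr0.
Qed.

End SpecialPoint.

(** By [expands_prop] the coefficient vectors of all pairs (a, c) are proportional; the
    factors of proportionality come from [expands_top]. The remaining universal diagonal sum
    is evaluated on the pair (z, z) with z^2 q^j = 1, where every function factors. *)
Theorem kernel_expansion a c a' c' y y' : (forall x : K, exists z, z ^+ 2 = x) ->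
  a != 0 -> c != 0 -> a' != 0 -> c' != 0 ->
  \sum_(n < N.+1) kweight n * (gprod a c y n (N - n) * gprod a' c' y' n (N - n)) =
  \sum_(j < N.+1) qp q (N - j) / (qp q j * qp al j * qp be j * qp (al * be * q ^+ j / q) j * qp (be * al * (q ^+ j) ^+ 2) (N - j)) *
    (gpol (pX a) (k * q ^+ j * pS c) (be * al * (q ^+ j) ^+ 2) (N - j) *
     gpol (pX a') (k * q ^+ j * pS c') (be * al * (q ^+ j) ^+ 2) (N - j)) *
    ((pP a c j).[y] * (pP a' c' j).[y']).
Proof.
move=> sqr a0 c0 a0' c0'.
have [E hE] := gprod_expand a0 c0 N; have [E' hE'] := gprod_expand a0' c0' N.
rewrite (kernel_diag a0 c0 a0' c0' hE hE'); apply: eq_bigr => -[j /= jN] _; congr (_ * _).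
rewrite ltnS in jN; have [z hz] := sqr (q ^+ j)^-1.
have qj0 : q ^+ j != 0 by rewrite expf_neq0.
have z0 : z != 0.
  by apply/eqP => h; move/eqP: hz; rewrite h expr0n /= eq_sym invr_eq0 (negbTE qj0).
have hz1 : z ^+ 2 * q ^+ j = 1 by rewrite hz mulVf.
(* The reference expansion at the pair (z, z), to which all others are proportional. *)
have [Eo hEo] := gprod_expand z0 z0 N.
pose top (F : nat -> nat -> K) := \sum_(n < N.+1) (k * q ^+ j) ^+ n * F n j.
have t1 := expands_top a0 c0 hE jN; have t2 := expands_top a0' c0' hE' jN; have t3 := expands_top z0 z0 hEo jN.
rewrite -!/(top _) in t1 t2 t3; rewrite (gpol_special_top z0 hz1) in t3.
have prop F G : (forall n, (n <= N)%N -> F n j * G 0%N j = G n j * F 0%N j) -> top F * G 0%N j = top G * F 0%N j.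
  move=> h; rewrite /top !mulr_suml; apply: eq_bigr => n _.
  by rewrite -!mulrA h // -ltnS.
have p1 n : (n <= N)%N -> E n j * Eo 0%N j = Eo n j * E 0%N j by move=> nN; exact: (expands_prop a0 c0 z0 z0 hE hEo nN jN).
have p2 n : (n <= N)%N -> E' n j * Eo 0%N j = Eo n j * E' 0%N j by move=> nN; exact: (expands_prop a0' c0' z0 z0 hE' hEo nN jN).
have T1 := prop _ _ p1; have T2 := prop _ _ p2.
have W : wsum E E' j j * Eo 0%N j ^+ 2 = wsum Eo Eo j j * (E 0%N j * E' 0%N j).
  rewrite /wsum !mulr_suml; apply: eq_bigr => n _; have nN : (n <= N)%N by rewrite -ltnS.
  transitivity (kweight n * ((E n j * Eo 0%N j) * (E' n j * Eo 0%N j))); first by ring.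
  by rewrite p1 // p2 //; ring.
have S := E'_diag z0 z0 z0 z0 hEo hEo (et z) jN.
have S' : \sum_(n < N.+1) kweight n * (Eo n j * gprod z z (et z) n (N - n)) = (z / k) ^+ N * top Eo.
  rewrite /top mulr_sumr; apply: eq_bigr => n _; have nN : (n <= N)%N by rewrite -ltnS.
  rewrite gprod_special // /kweight.
  have qa m : qp al m != 0 by apply/prodf_neq0 => i _; exact: hal.
  have qb m : qp be m != 0 by apply/prodf_neq0 => i _; exact: hbe.
  have -> : (k * q ^+ j) ^+ n = (z / k)^-1 ^+ n * z^-1 ^+ n.
    by rewrite -exprMn; congr (_ ^+ _); rewrite -[q ^+ j]invrK -hz; field; rewrite z0 k0.
  have -> : (z / k) ^+ N = (z / k) ^+ (N - n) * (z / k) ^+ n by rewrite -exprD subnK.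
  rewrite (exprVn (z / k)).
  have := (qpq_neq0 qn1 n, qpq_neq0 qn1 (N - n), qa n, qb (N - n)%N).
  have : (z / k) ^+ n != 0 by rewrite expf_neq0 // mulf_neq0 ?invr_eq0.
  clearbody be; move: (qp q n) (qp q (N - n)) (qp al n) (qp be (N - n)) ((z / k) ^+ n) ((z / k) ^+ (N - n)) (z^-1 ^+ n) (Eo n j).
  move=> A1 A2 A3 A4 A5 A6 A7 A8 h5 [[[h1 h2] h3] h4].
  by field; rewrite h1 h2 h3 h4 h5.
rewrite S' (pP_special z0 hz1) in S.
have L0 := lead_neq0 j.
have qa m : qp al m != 0 by apply/prodf_neq0 => i _; exact: hal.
have qb m : qp be m != 0 by apply/prodf_neq0 => i _; exact: hbe.
have D0 : qp (be * al * (q ^+ j) ^+ 2) (N - j) != 0.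
  apply/prodf_neq0 => i _; rewrite (_ : _ * q ^+ i = al * be * q ^+ (j + j + i)) ?hD //.
  by rewrite !exprD; ring.
have [Q EQ] : exists Q, topc q k j = k ^+ j * Q /\ qp q j * Q = q ^+ j ^+ j * qp (q ^+ j)^-1 j /\ Q != 0.
  exists (\prod_(m < j) (- q ^+ m)); split; last split.
  - rewrite /topc; elim: (j) => [|i IH]; first by rewrite !big_ord0 mulr1.
    by rewrite !big_ord_recr /= IH exprSr; move: (\prod_(m < i) _) => *; ring.
  - by rewrite qp_rev exprM.
  - by apply/prodf_neq0 => i _; rewrite oppr_eq0 expf_neq0.
have [ET [EQr Q0]] := EQ; rewrite ET in t1 t2 t3.
have zN : (z / k) ^+ N = (z / k) ^+ (N - j) * (z ^+ j / k ^+ j) by rewrite -expr_div_n -exprD subnK.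
rewrite zN in S.
have zj0 : z ^+ j != 0 by rewrite expf_neq0.
have kj0 : k ^+ j != 0 by rewrite expf_neq0.
have x0 : (z / k) ^+ (N - j) != 0 by rewrite expf_neq0 // mulf_neq0 ?invr_eq0.
have Qz : q ^+ j ^+ j = (z ^+ j)^-1 ^+ 2.
  by rewrite -[q ^+ j]invrK -hz exprVn -!exprM exprVn -exprM mulnC.
rewrite Qz in EQr; clear EQ ET Qz zN prop p1 p2 S'.
have q1' := qpq_neq0 qn1 (N - j); have q2' := qpq_neq0 qn1 j.
have Eo0 : Eo 0%N j != 0.
  apply/eqP => h; have h0 := expands0 z0 z0 hEo jN h.
  have : top Eo = 0 by rewrite /top big1 // => n _; rewrite h0 ?mulr0 // -ltnS.
  move=> h1; move: t3; rewrite h1 mul0r => /esym/eqP.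
  by rewrite !mulf_eq0 !invr_eq0 (negbTE kj0) (negbTE Q0) (negbTE D0) (negbTE q1') (negbTE x0).
move: t1 t2 t3 T1 T2 W S EQr; move: (wsum E E' j j) (wsum Eo Eo j j) (top E) (top E') (top Eo).
move: (E 0%N j) (E' 0%N j) (Eo 0%N j) Eo0 => e e' eo eo0 Wt Wo t t' tt.
have := (qa j, qb j).
move: (gpol (pX a) _ _ _) (gpol (pX a') _ _ _) => g g' [].
move: (qp (al * be * q ^+ j / q) j) L0 (qp (be * al * q ^+ j ^+ 2) (N - j)) D0 (qp q (N - j)) q1' (qp q j) q2' => L L0 D D0 q1 q1' q2 q2'.
move: (qp al j) (qp be j) (qp (q ^+ j)^-1 j) ((z / k) ^+ (N - j)) x0 (z ^+ j) zj0 (k ^+ j) kj0 => B1 B2 B3 x x0 zj zj0 kj kj0 B10 B20.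
move=> t1 t2 t3 T1 T2 W S EQr.
have B30 : B3 != 0.
  apply/eqP => h; move: EQr; rewrite h mulr0 => /eqP.
  by rewrite mulf_eq0 (negbTE q2') (negbTE Q0).
have et : t = kj * Q * g / L by rewrite -t1 mulfK.
have et' : t' = kj * Q * g' / L by rewrite -t2 mulfK.
have ett : tt = kj * Q * (D / q1 * x) / L by rewrite -t3 mulfK.
have tt0 : tt != 0 by rewrite ett !mulf_neq0 ?invr_eq0.
have ee : e = t * eo / tt by rewrite T1 mulrAC divff // mul1r.
have ee' : e' = t' * eo / tt by rewrite T2 mulrAC divff // mul1r.
have eWo : Wo = x * (zj / kj) * tt / (zj^-1 * (B2 * B3 * B1)) by rewrite S mulfK // !mulf_neq0 ?invr_eq0.
have -> : Wt = Wo * (e * e') / eo ^+ 2 by rewrite -W mulfK // expf_neq0.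
have eB : B3 = q2 * Q * zj ^+ 2 by rewrite EQr; field; exact: zj0.
rewrite ee ee' eWo et et' ett eB; field.
by rewrite L0 D0 q1' q2' B10 B20 x0 zj0 kj0 eo0 Q0.
Qed.

End Expansion.

(** * The Weierstrass test for means *)

Section MTest.
Variables (R : realType) (F : nat -> R[i] -> R[i]) (b : nat -> R) (M : R).
Hypotheses (dB : dom b M) (cF : forall n, ccont (F n)) (hF : forall n t, nm (F n (expi t)) <= b n).

Lemma tail_cvg0 : exists B, [/\ forall n, \sum_(i < n) b i <= B, dom b B & (fun n => B - \sum_(i < n) b i) @ \oo --> (0 : R)].
Proof.
have [B [BM Bn cB]] := dom_lim dB; exists B; split=> //; first by split=> //; case: dB.
have h : (fun n => B - \sum_(i < n) b i) @ \oo --> B - B by apply: cvgB cB; apply: cvg_cst.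
by rewrite subrr in h.
Qed.

Lemma ccont_part n : ccont (fun w => \sum_(i < n) F i w).
Proof. exact: (ccont_sum (index_enum _) (fun i : 'I_n => cF i)). Qed.

Lemma ccont_Csum : ccont (fun w => Csum (F^~ w)).
Proof.
have [B [Bn dB' cB]] := tail_cvg0; apply: (ccont_lim ccont_part _ cB) => n t.
by rewrite nmBC; apply: Csum_tail dB' (hF^~ t).
Qed.

Lemma cmean_Csum : sumto (fun n => cmean (F n)) (cmean (fun w => Csum (F^~ w))).
Proof.
have [B [Bn dB' cB]] := tail_cvg0.
have h := @cmean_lim _ (fun n w => \sum_(i < n) F i w) (fun w => Csum (F^~ w)) _ ccont_part _ cB.
apply: eq_ccvg (h _) => [n|n t]; last by rewrite nmBC; apply: Csum_tail dB' (hF^~ t).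
by rewrite (cmean_sum (index_enum _) (fun i : 'I_n => cF i)).
Qed.

End MTest.

(** * Infinite products on the circle *)

Section QCircle.
Variables (R : realType) (q : R[i]).
Hypotheses (q1 : nm q < 1) (q0 : q != 0).
Local Notation p := (nm q).
Local Notation P a n := (qpoch a q n).
Local Notation Pi a := (qpoch_inf a q).
Let p0 : 0 <= p := nm_ge0 q.
Let p01 : 0 <= p < 1. Proof. by rewrite p0 q1. Qed.

Lemma ccont_qpoch (a : R[i]) f n : ccont f -> ccont (fun w => P (a * f w) n).
Proof.
move=> cf; apply: (ccont_prod (index_enum _)) => i.
apply: eq_ccont (ccontD (ccont_cst 1) (ccontZ (- a * q ^+ i) cf)) => t; ring.
Qed.

Definition qnear (x : R) := expR (x / (1 - p)) * (x * (expR (x / (1 - p)) / (1 - p))).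

Lemma geom_cvg0 (C : R) : (fun n => p ^+ n * C) @ \oo --> (0 : R).
Proof.
rewrite -(mul0r C); apply: cvgMl.
have := @cvg_geometric R 1 p; rewrite ger0_norm // => /(_ q1).
by apply: cvg_trans; apply: near_eq_cvg; apply: nearW => k; rewrite /geometric /= mul1r.
Qed.

Lemma qpoch_near (a : R[i]) x n : nm a <= x -> nm (P a n - Pi a) <= p ^+ n * qnear x.
Proof.
move=> hx; rewrite (qinf_split q1 _ n) -[X in X - _]mulr1 -mulrBr nmM nmBC.
rewrite mulrCA; apply: ler_pM; rewrite ?nm_ge0 //; first exact: qpoch_bound.
have hq : nm (a * q ^+ n) <= x by apply: le_trans (nm_qn q1 _ _) _.
apply: le_trans (qinf_near1 q1 hq) _.
have c0 : 0 <= expR (x / (1 - p)) / (1 - p) by rewrite divr_ge0 ?expR_ge0 // subr_ge0 ltW.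
by rewrite [leRHS]mulrA ler_wpM2r // nmM nmX mulrC ler_wpM2l ?exprn_ge0.
Qed.

Lemma ccont_qinf (a : R[i]) f : ccont f -> (forall t, nm (f (expi t)) <= 1) -> ccont (fun w => Pi (a * f w)).
Proof.
move=> cf hf.
apply: (ccont_lim (F := fun n w => P (a * f w) n)) (geom_cvg0 (qnear (nm a))) => [n|n t].
  exact: ccont_qpoch.
by apply: qpoch_near; rewrite nmM ler_piMr ?nm_ge0.
Qed.

Lemma ccont_qinfV (a : R[i]) f : ccont f -> nm a < 1 -> (forall t, nm (f (expi t)) <= 1) -> ccont (fun w => (Pi (a * f w))^-1).
Proof.
move=> cf a1 hf; pose x := nm a.
have cV n : ccont (fun w => (P (a * f w) n)^-1).
  have inv (b : R[i]) : nm b < 1 -> ccont (fun w => (1 - b * f w)^-1).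
    move=> b1; have b01 : 0 <= nm b < 1 by rewrite nm_ge0.
    apply: eq_ccont (ccont_Csum (F := fun n w => b ^+ n * f w ^+ n) (dom_geom b01) _ _) => [t|m|m t].
    - have fb : nm (b * f (expi t)) < 1 by rewrite nmM; apply: le_lt_trans b1; rewrite ler_piMr ?nm_ge0.
      apply: CsumE; have n0 := sub1_neq0 fb.
      have c0 := ccvg_expr fb.
      have := ccvgZ (1 - b * f (expi t))^-1 (ccvgB (ccvg_cst 1) c0); rewrite subr0 mulr1.
      apply: eq_ccvg => m; apply: (mulfI n0); rewrite mulrA divff // mul1r.
      elim: m => [|m IH]; first by rewrite big_ord0 expr0 subrr mulr0.
      rewrite big_ord_recr [RHS]mulrDr -IH -exprMn exprS.
      by set v := b * _; move: (v ^+ m) => u; ring.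
    - by apply: ccontZ; exact: ccontX.
    - by rewrite nmM !nmX ler_piMr ?exprn_ge0 ?nm_ge0 // exprn_ile1 ?nm_ge0.
  apply: eq_ccont (ccont_prod (index_enum _) (fun i : 'I_n => inv (a * q ^+ i) (le_lt_trans (nm_qn q1 a i) a1))) => t.
  by rewrite /qpoch -prodfV; apply: eq_bigr => i _; congr (1 - _)^-1; ring.
pose C := expR (x / (1 - x) / (1 - p)) * (x * (expR (x / (1 - p)) / (1 - p))).
apply: (ccont_lim (F := fun n w => (P (a * f w) n)^-1) (e := fun n => p ^+ n * C)) (geom_cvg0 C) => [n|n t].
  exact: cV.
have hx : nm (a * f (expi t)) <= x by rewrite nmM ler_piMr ?nm_ge0.
have hx1 : nm (a * f (expi t)) < 1 by exact: le_lt_trans hx a1.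
have -> : (P (a * f (expi t)) n)^-1 - (Pi (a * f (expi t)))^-1 = (Pi (a * f (expi t)))^-1 * (Pi (a * f (expi t) * q ^+ n) - 1).
  rewrite (qinf_split q1 _ n); have := qpoch_neq0 q1 n hx1.
  have : Pi (a * f (expi t) * q ^+ n) != 0 by apply: qinf_neq0 => //; apply: le_lt_trans (nm_qn q1 _ _) hx1.
  by move: (P _ n) (Pi _) => u v v0 u0; field; rewrite u0 v0.
rewrite nmM mulrCA; apply: ler_pM; rewrite ?nm_ge0 //; first exact: qinf_Vbound.
have hq : nm (a * f (expi t) * q ^+ n) <= x by apply: le_trans (nm_qn q1 _ _) _.
apply: le_trans (qinf_near1 q1 hq) _.
have c0 : 0 <= expR (x / (1 - p)) / (1 - p) by rewrite divr_ge0 ?expR_ge0 // subr_ge0 ltW.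
by rewrite [leRHS]mulrA ler_wpM2r // nmM nmX mulrC ler_wpM2l ?exprn_ge0.
Qed.

End QCircle.

(** * Fourier coefficients of the theta function *)

Lemma ccvg_sub (R : realType) (u : nat -> R[i]) l f : (forall n, (n <= f n)%N) -> ccvg u l -> ccvg (fun n => u (f n)) l.
Proof.
move=> hf /cvgrPdist_lt cu; apply/cvgrPdist_lt => e /cu [N _ hN].
by exists N => // n /= hn; apply: hN => /=; exact: leq_trans hn (hf n).
Qed.

Section Theta.
Variables (R : realType) (q : R[i]).
Hypotheses (q1 : nm q < 1) (q0 : q != 0).
Local Notation P a n := (qpoch a q n).
Local Notation Pi a := (qpoch_inf a q).

Let qn0 n : q ^+ n != 0. Proof. exact: expf_neq0. Qed.
Let qq0 n : P q n != 0. Proof. exact: qpoch_neq0. Qed.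

Definition gauss n k := if (k <= n)%N then P q n / (P q k * P q (n - k)) else 0.

Lemma gaussS n k : gauss n.+1 k.+1 = gauss n k.+1 + q ^+ (n - k) * gauss n k.
Proof.
rewrite /gauss ltnS subSS; case: (ltngtP k n) => [lt|gt|->].
- rewrite -(subnSK lt); set m := (n - k.+1)%N.
  have en : n = (k + m.+1)%N by rewrite /m addnS -addSn subnKC.
  rewrite (qpochS q q n) (qpochS q q k) (qpochS q q m) -!exprS.
  have nz i : 1 - q ^+ i.+1 != 0 by have := qq0 i.+1; rewrite qpochS -exprS mulf_eq0 negb_or => /andP[].
  have := nz k; have := nz m; have := qq0 k; have := qq0 m.
  have -> : q ^+ n.+1 = q ^+ k.+1 * q ^+ m.+1 by rewrite -exprD en !addnS !addSn.
  move: (P q n) (P q k) (P q m) (q ^+ k.+1) (q ^+ m.+1) => a b c x y c0 b0 y0 x0.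
  by field; rewrite b0 c0 x0 y0.
- by rewrite mulr0 addr0.
- by rewrite !subnn expr0 add0r mul1r !qpoch0 !mulr1 !divff.
Qed.

Lemma gauss0 n : gauss n 0 = 1.
Proof. by rewrite /gauss leq0n subn0 qpoch0 mul1r divff. Qed.

Lemma gauss_big n k : (n < k)%N -> gauss n k = 0.
Proof. by rewrite /gauss ltnNge => /negbTE ->. Qed.

(** The finite q-binomial theorem, by Pascal's rule [gaussS]. *)
Lemma q_binomial_fin x n : P x n = \sum_(k < n.+1) gauss n k * (- x) ^+ k * q ^+ 'C(k, 2).
Proof.
elim: n => [|n IH]; first by rewrite big_ord1 qpoch0 gauss0 !expr0 !mulr1.
rewrite qpochS big_ord_recl gauss0 expr0 bin0n expr0 !mulr1.
transitivity (\sum_(k < n.+2) gauss n k * (- x) ^+ k * q ^+ 'C(k, 2) +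
   \sum_(k < n.+1) q ^+ (n - k) * gauss n k * (- x) ^+ k.+1 * q ^+ 'C(k.+1, 2)).
  rewrite [X in _ = X + _]big_ord_recr /= gauss_big // !mul0r addr0 -IH mulrBr mulr1; congr (_ + _).
  rewrite IH mulr_suml -sumrN; apply: eq_bigr => -[k /= hk] _.
  rewrite binS bin1 exprD exprS; have -> : q ^+ n = q ^+ (n - k) * q ^+ k by rewrite -exprD subnK.
  by move: (q ^+ _) (q ^+ k) (q ^+ 'C(k, 2)) (gauss _ _) => a b c d; ring.
rewrite [X in X + _]big_ord_recl /= gauss0 expr0 bin0n expr0 !mulr1 -addrA -big_split /=; congr (_ + _).
by apply: eq_bigr => k _; rewrite /bump leq0n add1n gaussS; ring.
Qed.

(** The product is (z q^(-M); q)_(2M) up to a monomial, so that the finite q-binomial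
    theorem gives its Laurent expansion. *)
Lemma theta_fin z M : z != 0 -> P z M * P (q / z) M =
  \sum_(k < M.*2.+1) gauss M.*2 k * ((- 1) ^+ M * (-1) ^+ k * q ^+ 'C(M.+1, 2) * q ^+ 'C(k, 2) / q ^+ (M * k)) * z ^+ k / z ^+ M.
Proof.
move=> z0.
have e1 : P (z / q ^+ M) M = (- z) ^+ M / q ^+ 'C(M.+1, 2) * P (q / z) M.
  elim: M => [|M IH]; first by rewrite !qpoch0 !expr0 divr1 mul1r.
  rewrite qpochSl; have -> : z / q ^+ M.+1 * q = z / q ^+ M by rewrite exprSr invfM mulrA divfK.
  rewrite IH [P (q / z) M.+1]qpochS [in RHS]binS bin1 [in RHS]exprD [(- z) ^+ M.+1]exprS ![q ^+ M.+1]exprS.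
  have := qn0 M; have := qn0 'C(M.+1, 2).
  by move: (P _ _) (q ^+ 'C(_, _)) (q ^+ M) ((- z) ^+ M) => a b c d b0 c0; field; rewrite b0 c0 z0 q0.
have -> : P z M = P (z / q ^+ M * q ^+ M) M by rewrite divfK.
transitivity ((- z) ^- M * q ^+ 'C(M.+1, 2) * P (z / q ^+ M) (M + M)).
  rewrite qpochD e1; have := qn0 'C(M.+1, 2); have : (- z) ^+ M != 0 by rewrite expf_neq0 // oppr_eq0.
  by move: (_ ^+ M) (q ^+ 'C(_, _)) (P (q / z) _) (P _ M) => a b c d a0 b0; field; rewrite a0 b0.
rewrite addnn q_binomial_fin mulr_sumr; apply: eq_bigr => k _.
rewrite -mulNr exprMn exprVn -exprM [(- z) ^+ M]exprNn [(- z) ^+ k]exprNn invfM.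
rewrite invr_sign; have := qn0 (M * k)%N; have : z ^+ M != 0 by exact: expf_neq0.
move: (q ^+ (M * k)) (z ^+ M) (z ^+ k) (_ ^+ M) (_ ^+ k) (q ^+ 'C(k, 2)) (q ^+ 'C(M.+1, 2)) (gauss _ _) => a b c d e f g h a0 b0.
by field; rewrite a0 b0.
Qed.

(** The coefficients, recentred at k = M, no longer involve M. *)
Lemma theta_expo M k u v : (k + v = M + u)%N ->
  (-1) ^+ M * (-1) ^+ k * q ^+ 'C(M.+1, 2) * q ^+ 'C(k, 2) / q ^+ (M * k) =
  (-1) ^+ u * (-1) ^+ v * q ^+ 'C(v.+1, 2) * q ^+ 'C(u, 2) / q ^+ (v * u).
Proof.
move=> e.
have s : (-1) ^+ M * (-1) ^+ k = (-1) ^+ u * (-1) ^+ v :> R[i].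
  have e2 : (-1) ^+ k * (-1) ^+ v = (-1) ^+ M * (-1) ^+ u :> R[i] by rewrite -!exprD e.
  have sq n : (-1) ^+ n * (-1) ^+ n = 1 :> R[i] by rewrite -expr2 sqrr_sign.
  move: e2 (sq v) (sq M); move: (_ ^+ k) (_ ^+ v) (_ ^+ M) (_ ^+ u) => a b c d e2 b1 c1.
  transitivity (c * (a * b) * b); first by rewrite -!mulrA b1 mulr1.
  by rewrite e2 !mulrA c1 mul1r.
rewrite s -!mulrA; congr (_ * (_ * _)).
have ex : ('C(M.+1, 2) + 'C(k, 2) + v * u = 'C(v.+1, 2) + 'C(u, 2) + M * k)%N.
  have d n : ('C(n, 2).*2 + n = n * n)%N.
    by elim: n => // n IH; rewrite binS bin1 doubleD; move: IH; rewrite -!mul2n; lia.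
  have := d k; have := d u; have := d v.+1; have := d M.+1; rewrite -!mul2n.
  case: (leqP v M) => [/subnKC eM|/ltnW/subnKC eM].
    have ek : k = (u + (M - v))%N by lia.
    by move: eM ek; move: (M - v)%N => x <- ->; lia.
  have eu : u = (k + (v - M))%N by lia.
  by move: eM eu; move: (v - M)%N => x <- ->; lia.
apply: (mulIf (qn0 (M * k)%N)); rewrite mulrA divfK // -exprD.
apply: (mulIf (qn0 (v * u)%N)); rewrite -!mulrA [_^-1 * (_ * _)]mulrCA mulVf // mulr1 !mulrA -!exprD.
by rewrite ex; congr (_ ^+ _); lia.
Qed.

Definition jacobi_coef M k := gauss M.*2 k * ((- 1) ^+ M * (-1) ^+ k * q ^+ 'C(M.+1, 2) * q ^+ 'C(k, 2) / q ^+ (M * k)).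

Lemma ccont_ratio a b : ccont (fun w : R[i] => w ^+ a / w ^+ b).
Proof. by apply: ccontM; [apply: ccontX; exact: ccont_id|apply: eq_ccont (ccontX b (@ccont_inv R)) => t; exact: exprVn]. Qed.

Lemma theta_lim a b : ccvg (fun M => \sum_(k < M.*2.+1) jacobi_coef M k * (k.*2 + a == M.*2 + b)%N%:R)
  (cmean (fun w => Pi (w ^+ 2) * Pi (q / w ^+ 2) * (w ^+ a / w ^+ b))).
Proof.
pose F M w := P (1 * w ^+ 2) M * P (q * (w^-1) ^+ 2) M * (w ^+ a / w ^+ b).
have cw2 : ccont (fun w : R[i] => w ^+ 2) by apply: ccontX; exact: ccont_id.
have cv2 : ccont (fun w : R[i] => w^-1 ^+ 2) by apply: ccontX; exact: ccont_inv.
have nw t : nm (expi t ^+ 2 : R[i]) <= 1 by rewrite nmX nm_expi expr1n.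
have nv t : nm ((expi t)^-1 ^+ 2 : R[i]) <= 1 by rewrite nmX nmV nm_expi invr1 expr1n.
have cF M : ccont (F M).
  by apply: ccontM; [apply: ccontM; exact: ccont_qpoch|exact: ccont_ratio].
pose C := expR (1 / (1 - nm q)) * qnear q 1 + expR (1 / (1 - nm q)) * qnear q 1.
have hlim : ccvg (fun M => cmean (F M)) (cmean (fun w => Pi (w ^+ 2) * Pi (q / w ^+ 2) * (w ^+ a / w ^+ b))).
  apply: (cmean_lim (e := fun M => nm q ^+ M * C)) => // [M t|]; last exact: geom_cvg0.
  rewrite /F exprVn mul1r -mulrBl nmM [nm (_ / _)](_ : _ = 1) ?mulr1; last first.
    by rewrite nmM nmV !nmX nm_expi !expr1n invr1 mulr1.
  set x := _ ^+ 2; have hx : nm x <= 1 by exact: nw.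
  set y := q / x; have hy : nm y <= 1.
    by rewrite /y nmM -exprVn; apply: le_trans (ltW q1); rewrite ler_piMr ?nm_ge0.
  have -> : P x M * P y M - Pi x * Pi y = P x M * (P y M - Pi y) + Pi y * (P x M - Pi x) by ring.
  apply: le_trans (nmD _ _) _; rewrite !nmM /C mulrDr; apply: lerD; rewrite mulrCA; apply: ler_pM; rewrite ?nm_ge0 //.
  - exact: qpoch_bound.
  - exact: qpoch_near.
  - exact: qinf_bound.
  - exact: qpoch_near.
apply: eq_ccvg hlim => M; symmetry.
transitivity (cmean (fun w => \sum_(k < M.*2.+1) jacobi_coef M k * (w ^+ (k.*2 + a) / w ^+ (M.*2 + b)))).
  rewrite (cmean_sum _ (fun k : 'I_(M.*2.+1) => ccontZ (jacobi_coef M k) (ccont_ratio _ _))).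
  by apply: eq_bigr => k _; rewrite (cmeanZ _ (ccont_ratio _ _)) cmean_mono.
apply: eq_cmean => t; rewrite /F mul1r exprVn theta_fin ?expf_neq0 -?nm_gt0 ?nm_expi // mulr_suml.
apply: eq_bigr => k _; rewrite -/(jacobi_coef M k) -!exprM !mul2n !exprD invfM.
by move: (_ ^+ M.*2) (_ ^+ k.*2) (_ ^+ a) (_ ^+ b) (jacobi_coef M k) => x y z s d; ring.
Qed.

Lemma theta_coef_odd a b : odd (a + b) -> cmean (fun w => Pi (w ^+ 2) * Pi (q / w ^+ 2) * (w ^+ a / w ^+ b)) = 0.
Proof.
move=> h; apply: ccvg_uniq (theta_lim a b) _; apply: eq_ccvg (ccvg_cst 0) => M.
rewrite big1 // => k _; rewrite (_ : _ == _ = false) ?mulr0 //.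
by apply/negP => /eqP; lia.
Qed.

(** Letting M tend to infinity: the Jacobi triple product, read through means. *)
Lemma theta_coef u v : cmean (fun w => Pi (w ^+ 2) * Pi (q / w ^+ 2) * (w ^+ v.*2 / w ^+ u.*2)) =
  (-1) ^+ u * (-1) ^+ v * q ^+ 'C(v.+1, 2) * q ^+ 'C(u, 2) / q ^+ (v * u) / Pi q.
Proof.
set T := _ / q ^+ (v * u).
have hF M : (u + v <= M)%N -> \sum_(k < M.*2.+1) jacobi_coef M k * (k.*2 + v.*2 == M.*2 + u.*2)%N%:R =
     gauss M.*2 (M + u - v) * T.
  move=> hM; pose k0 := inord (M + u - v) : 'I_(M.*2.+1).
  have vk0 : k0 = (M + u - v)%N :> nat by rewrite inordK // ltnS -addnn; lia.
  rewrite (bigD1 k0) //= big1 ?addr0.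
    rewrite vk0 (_ : _ == _) ?mulr1; last by lia.
    by rewrite /jacobi_coef (@theta_expo M _ u v) //; lia.
  move=> k kk0; rewrite (_ : _ == _ = false) ?mulr0 //.
  apply/negP => /eqP e; case/negP: kk0; apply/eqP/val_inj; rewrite /= vk0; lia.
apply: (ccvg_uniq (ccvg_shift (u + v) (theta_lim _ _))).
have sub f : (forall n, (n <= f n)%N) -> ccvg (fun n => P q (f n)) (Pi q).
  by move=> hf; exact: ccvg_sub hf (qpoch_cvg q1 q).
have subV f : (forall n, (n <= f n)%N) -> ccvg (fun n => (P q (f n))^-1) (Pi q)^-1.
  by move=> hf; apply: (ccvg_sub (u := fun n => (P q n)^-1) hf); exact: qpochV_cvg.
have := ccvgZ T (ccvgM (sub (fun M => (M + (u + v)).*2) _) (ccvgM (subV (fun M => M + u + u)%N _) (subV (fun M => M + v + v)%N _))).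
have Q0 : Pi q != 0 by exact: qinf_neq0.
rewrite [Pi q * _]mulrA divff // mul1r => h; apply: eq_ccvg (h _ _ _) => [M|n|n|n]; try lia.
rewrite hF ?leq_addl // /gauss ifT; last by lia.
rewrite [RHS]mulrC invfM; congr (_ * (_ * (_^-1 * _^-1))); congr (P q _); lia.
Qed.

Lemma gauss_sum x n : \sum_(m < n.+1) (P q m * P q (n - m))^-1 * ((- x) ^+ m * q ^+ 'C(m, 2)) = P x n / P q n.
Proof.
rewrite q_binomial_fin mulr_suml; apply: eq_bigr => -[m /= hm] _.
rewrite /gauss -ltnS hm; have := qq0 n; move: (P q n) (_ * P q (n - m)) (_ ^+ m) (q ^+ _) => a b c d a0.
by move: (b^-1) => e; field.
Qed.

Lemma qpoch_root x m n : (m < n)%N -> x * q ^+ m = 1 -> P x n = 0.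
Proof.
move=> mn e; rewrite /qpoch (bigD1 (Ordinal mn)) //= e subrr mul0r //.
Qed.

Lemma ccont_theta : ccont (fun w : R[i] => Pi (w ^+ 2) * Pi (q / w ^+ 2)).
Proof.
have cw2 : ccont (fun w : R[i] => w ^+ 2) by apply: ccontX; exact: ccont_id.
have cv2 : ccont (fun w : R[i] => w^-1 ^+ 2) by apply: ccontX; exact: ccont_inv.
apply: ccontM.
  apply: eq_ccont (ccont_qinf q1 1 cw2 _) => t; first by rewrite mul1r.
  by rewrite nmX nm_expi expr1n.
apply: eq_ccont (ccont_qinf q1 q cv2 _) => t; first by rewrite exprVn.
by rewrite nmX nmV nm_expi invr1 expr1n.
Qed.

(** For u = v = 0 the h_n are the continuous q-Hermite polynomials. As
    (w^-2; q)_oo = (1 - w^-2) (q/w^2; q)_oo, the mean is a combination of two terminating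
    q-binomial sums, each of which contains a zero factor when n > 0. *)
Lemma cmean_hermite n : cmean (fun w => Pi (w ^+ 2) * Pi (w ^- 2) * hpol q n w w^-1 0 0) = (n == 0%N)%:R * 2 / Pi q.
Proof.
pose c m := (P q m * P q (n - m))^-1.
pose th w := Pi (w ^+ 2) * Pi (q / w ^+ 2).
have cth a b : ccont (fun w => th w * (w ^+ a / w ^+ b)) by apply: ccontM (ccont_ratio a b); exact: ccont_theta.
have e : cmean (fun w => Pi (w ^+ 2) * Pi (w ^- 2) * hpol q n w w^-1 0 0) =
    \sum_(m < n.+1) c m * (cmean (fun w => th w * (w ^+ (n - m) / w ^+ m)) - cmean (fun w => th w * (w ^+ (n - m) / w ^+ m.+2))).
  transitivity (cmean (fun w => \sum_(m < n.+1) c m * (th w * (w ^+ (n - m) / w ^+ m) + (-1) * (th w * (w ^+ (n - m) / w ^+ m.+2))))).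
    apply: eq_cmean => t; rewrite hpol_sym /hpol mulr_sumr; apply: eq_bigr => m _.
    rewrite /hcoef !qpoch_0 (qinf_rec q1 (_ ^- 2)) [_ ^- 2 * q]mulrC /c /th exprVn invfM.
    have e0 : expi t != 0 :> R[i] by rewrite -nm_gt0 nm_expi.
    move: (expi t) e0 => w w0; have -> : w ^+ m.+2 = w ^+ m * w * w by rewrite !exprSr.
    move: (Pi _) (Pi _) (w ^+ (n - m)) => a b d.
    rewrite [(P q m * _)^-1]invfM; move: (P q m)^-1 (P q (n - m))^-1 => f g.
    have : w ^+ m != 0 by exact: expf_neq0.
    by move: (w ^+ m) => x x0; field; rewrite x0 w0.
  rewrite (cmean_sum _ (fun m : 'I_n.+1 => ccontZ (c m) (ccontD (cth _ _) (ccontZ (-1) (cth _ _))))).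
  apply: eq_bigr => m _; rewrite cmeanZ; last by apply: ccontD (cth _ _) (ccontZ _ (cth _ _)).
  by rewrite cmeanD ?cmeanZ ?mulN1r //; exact: ccontZ.
rewrite e; case: (boolP (odd n)) => hn.
  rewrite big1 => [|m _]; first by case: n hn {c e} => //= n _; rewrite !mul0r.
  have mn : (m <= n)%N by rewrite -ltnS.
  by rewrite !theta_coef_odd ?subrr ?mulr0 //; lia.
have [k nk] : exists k, n = k.*2 by exists n./2; lia.
have ev m u : (u = m \/ u = m.+1) -> (m <= n)%N -> cmean (fun w => th w * (w ^+ (n - m) / w ^+ (u + (u - m)))) = cmean (fun w => th w * (w ^+ k.*2 / w ^+ u.*2)).
  move=> hu mn; apply: eq_cmean => t; congr (_ * _).
  have e0 i : expi t ^+ i != 0 :> R[i] by rewrite expf_neq0 // -nm_gt0 nm_expi.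
  apply: (mulIf (e0 (u + (u - m))%N)); apply: (mulIf (e0 u.*2)); rewrite divfK // mulrAC divfK // -!exprD; congr (_ ^+ _); lia.
pose A := (-1) ^+ k * q ^+ 'C(k.+1, 2) / Pi q.
transitivity (A * (\sum_(m < n.+1) c m * ((- q ^- k) ^+ m * q ^+ 'C(m, 2)) + q ^- k * \sum_(m < n.+1) c m * ((- (q / q ^+ k)) ^+ m * q ^+ 'C(m, 2)))).
  rewrite [q ^- k * _]mulr_sumr -big_split mulr_sumr; apply: eq_bigr => -[m /= hm] _.
  have := ev m m (or_introl erefl) hm; rewrite subnn addn0 => ->.
  have := ev m m.+1 (or_intror erefl) hm; rewrite subSnn addn1 => ->.
  have bm : q ^+ 'C(m.+1, 2) = q ^+ 'C(m, 2) * q ^+ m by rewrite binS bin1 exprD.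
  rewrite /th !theta_coef mulnS [q ^+ (k + _)]exprD [(-1) ^+ m.+1]exprS bm.
  rewrite -[- q ^- k]mulN1r -[- (q / _)]mulN1r !exprMn !exprVn -!exprM /A.
  have := qinf_neq0 q1 q1; have := qn0 k; have := qn0 (k * m)%N.
  by move: (Pi q) (q ^+ 'C(k.+1, 2)) (q ^+ 'C(m, 2)) (q ^+ m) (_ ^+ m) (_ ^+ k) (q ^+ k) (q ^+ (k * m)) (c m) => a1 a2 a3 a4 a5 a6 a7 a8 a9 h8 h7 h1; field; rewrite h8 h7 h1.
have g1 := gauss_sum (q ^- k) n.
have g2 := gauss_sum (q / q ^+ k) n.
rewrite [X in _ * (X + _)]g1 [X in _ * (_ + _ * X)]g2 /A; clear A g1 g2 e ev cth c th hn.
case: k nk => [|k] nk.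
  have -> : n = 0%N by rewrite nk.
  have -> : q ^+ 'C(1, 2) = 1 by [].
  rewrite !qpoch0 !expr0 !invr1 eqxx /=; have := qinf_neq0 q1 q1; move: (Pi q) => a a0.
  by field.
have r1 : P (q ^- k.+1) n = 0 by apply: (@qpoch_root _ k.+1); rewrite ?mulVf // nk; lia.
have r2 : P (q / q ^+ k.+1) n = 0.
  by apply: (@qpoch_root _ k); [rewrite nk; lia|rewrite exprS invfM mulrA divff // mul1r mulVf].
by rewrite r1 r2 nk doubleS !mul0r mulr0 addr0 mulr0.
Qed.

End Theta.

(** * The Askey-Wilson integral *)

Section PSW.
Variables (R : realType) (r : R).
Hypothesis r0 : 0 <= r.
Implicit Types (c d : nat -> R[i]) (f g : R[i] -> R[i]).

Lemma pswD c d B1 B2 f g : psw r c B1 f -> psw r d B2 g ->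
  psw r (fun n => c n + d n) (B1 + B2) (fun z => f z + g z).
Proof.
move=> [dc hc] [dd hd]; split.
  apply: dom_le (domD dc dd) => n; rewrite mulr_ge0 ?nm_ge0 ?exprn_ge0 //= -mulrDl.
  by rewrite ler_wpM2r ?exprn_ge0 // nmD.
by move=> z zr; apply: eq_sumto (sumtoD (hc z zr) (hd z zr)) => n; rewrite mulrDl.
Qed.

Lemma pswZ c B f a : psw r c B f -> psw r (fun n => a * c n) (nm a * B) (fun z => a * f z).
Proof.
move=> [dc hc]; split.
  by apply: dom_le (domM (nm_ge0 a) dc) => n; rewrite mulr_ge0 ?nm_ge0 ?exprn_ge0 //= nmM mulrA.
by move=> z zr; apply: eq_sumto (sumtoZ a (hc z zr)) => n; rewrite mulrA.
Qed.

Lemma psw_shift c B f : psw r c B f -> psw r (sh c) (r * B) (fun z => z * f z).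
Proof.
move=> [dc hc]; split.
  split=> [n|[|n]]; first by rewrite mulr_ge0 ?nm_ge0 ?exprn_ge0.
    by rewrite big_ord0 mulr_ge0 ?(dom_ge0 dc).
  rewrite big_ord_recl [sh c _]/= nm0 mul0r add0r; apply: le_trans (_ : r * \sum_(i < n) nm (c i) * r ^+ i <= _).
    by rewrite mulr_sumr; apply: ler_sum => i _; rewrite lift0 [sh _ _]/= exprS mulrCA.
  by rewrite ler_wpM2l //; exact: dc.2.
move=> z zr; have := sumto_recl (u := fun n => sh c n * z ^+ n) (s := z * f z); rewrite mul0r add0r; apply.
by apply: eq_sumto (sumtoZ z (hc z zr)) => n; rewrite /= exprS mulrCA.
Qed.

Lemma psw_dil c B f q : nm q <= 1 -> psw r c B f -> psw r (fun n => q ^+ n * c n) B (fun z => f (z * q)).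
Proof.
move=> q1 [dc hc]; split.
  apply: dom_le dc => n; rewrite mulr_ge0 ?nm_ge0 ?exprn_ge0 //= ler_wpM2r ?exprn_ge0 // nmM nmX.
  by rewrite ler_piMl ?nm_ge0 // exprn_ile1 ?nm_ge0.
move=> z zr; apply: eq_sumto (hc (z * q) _) => [n|]; first by rewrite exprMn; ring.
by rewrite nmM; apply: le_trans zr; rewrite ler_piMr ?nm_ge0.
Qed.

Lemma psw_0 c B f : 0 < r -> psw r c B f -> (forall z, nm z <= r -> f z = 0) -> forall n, c n = 0.
Proof.
move=> r0' [dc hc] f0; apply: (ps_coef0 r0' dc) => z _ zr.
by rewrite -(f0 z zr); exact: hc.
Qed.

Lemma psw_at0 c B f : psw r c B f -> f 0 = c 0%N.
Proof.
move=> [_ hc]; have := hc 0; rewrite nm0 => /(_ r0) h.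
apply: sumto_uniq h _; apply: (@ccvg_unshift _ 1); apply: eq_ccvg (ccvg_cst (c 0%N)) => n.
by rewrite addn1 big_ord_recl expr0 mulr1 big1 ?addr0 // => i _; rewrite exprS mul0r mulr0.
Qed.

End PSW.

Section AWIntegral.
Variables (R : realType) (q : R[i]).
Hypotheses (q1 : nm q < 1) (q0 : q != 0).
Local Notation p := (nm q).
Local Notation P a n := (qpoch a q n).
Local Notation Pi a := (qpoch_inf a q).

(** The relation expresses the coefficient of a^m, as a function of b, by those of lower
    order at b and b q; the case b = 0 is lost to a division by b. *)
Lemma contiguous_uniq (D : R[i] -> R[i] -> R[i]) r : 0 < r ->
  (forall b, nm b < 1 -> exists B, psn r B (D^~ b)) ->
  (forall a b, nm a <= r -> nm b < 1 -> b * D (a * q) b - a * D a (b * q) = (b - a) * (1 - a * b) * D a b) ->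
  (forall b, nm b < 1 -> D 0 b = 0) ->
  forall a b, b != 0 -> nm a <= r -> nm b < 1 -> D a b = 0.
Proof.
move=> r0 hps hrel h0.
have r0' := ltW r0.
pose c b := xget (fun=> 0) [set c | exists B, psw r c B (D^~ b)].
have hc b : nm b < 1 -> exists B, psw r (c b) B (D^~ b).
  move=> b1; have [B [c0 hc0]] := hps b b1.
  by apply: (@xgetPex _ (fun=> 0) [set c | exists B, psw r c B (D^~ b)]); exists c0, B.
have bq b : nm b < 1 -> nm (b * q) < 1 by move=> b1; have := nm_qn q1 b 1; rewrite expr1 => /le_lt_trans; apply.
have hrec b n : nm b < 1 ->
   b * (q ^+ n * c b n) + (-1) * sh (c (b * q)) n + (- b) * c b n +
     (1 + b ^+ 2) * sh (c b) n + (- b) * sh (sh (c b)) n = 0.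
  move=> b1; have [B hB] := hc b b1; have [B' hB'] := hc (b * q) (bq b b1).
  have := pswD r0' (pswD r0' (pswD r0' (pswD r0' (pswZ r0' b (psw_dil r0' (ltW q1) hB)) (pswZ r0' (-1) (psw_shift r0' hB')))
    (pswZ r0' (- b) hB)) (pswZ r0' (1 + b ^+ 2) (psw_shift r0' hB))) (pswZ r0' (- b) (psw_shift r0' (psw_shift r0' hB))).
  move=> h; apply: (psw_0 r0 h) => z zr /=.
  by have := hrel z b zr b1; move=> /eqP; rewrite -subr_eq0 => /eqP <-; ring.
have c0 n : forall b, b != 0 -> nm b < 1 -> c b n = 0.
  elim/ltn_ind: n => n IH b b0 b1.
  case: n IH => [|n] IH.
    by have [B hB] := hc b b1; rewrite -(psw_at0 r0' hB) h0.
  have := hrec b n.+1 b1; rewrite /= (IH n) ?mulf_neq0 ?bq // (IH n) //.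
  have -> : sh (c b) n = 0 by case: n IH => // n IH; rewrite /= (IH n).
  have := sub1_neq0 (_ : nm (q ^+ n.+1) < 1); rewrite nmX exprn_ilt1 ?nm_ge0 // => /(_ isT).
  move: (q ^+ n.+1) (c b n.+1) => x y x1 e.
  have : b * (1 - x) * y = 0 by rewrite -[RHS]oppr0 -[in RHS]e; ring.
  by move/eqP; rewrite !mulf_eq0 (negbTE b0) (negbTE x1) => /eqP.
move=> a b b0 ar b1; have [B [_ hB]] := hc b b1.
apply: sumto_uniq (hB a ar) _; apply: eq_ccvg (ccvg_cst 0) => n.
by rewrite big1 // => i _; rewrite c0 // mul0r.
Qed.

Definition aw_factor a w := (Pi (a * w) * Pi (a / w))^-1.
(** The weight of the continuous q-Hermite polynomials; each Askey-Wilson parameter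
    contributes one [aw_factor] to it. *)
Definition hermite_weight w := Pi (w ^+ 2) * Pi (w ^- 2).

Lemma ccont_hermite_weight : ccont hermite_weight.
Proof.
have cw2 : ccont (fun w : R[i] => w ^+ 2) by apply: ccontX; exact: ccont_id.
have cv2 : ccont (fun w : R[i] => w^-1 ^+ 2) by apply: ccontX; exact: ccont_inv.
apply: ccontM.
  apply: eq_ccont (ccont_qinf q1 1 cw2 _) => t; first by rewrite mul1r.
  by rewrite nmX nm_expi expr1n.
apply: eq_ccont (ccont_qinf q1 1 cv2 _) => t; first by rewrite exprVn mul1r.
by rewrite nmX nmV nm_expi invr1 expr1n.
Qed.

Lemma ccont_aw_factor a : nm a < 1 -> ccont (aw_factor a).
Proof.
move=> a1; apply: eq_ccont (ccontM (ccont_qinfV q1 (a := a) (@ccont_id R) a1 _) (ccont_qinfV q1 (a := a) (@ccont_inv R) a1 _)) => t.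
- by rewrite /aw_factor invfM.
- by rewrite nm_expi.
- by rewrite nmV nm_expi invr1.
Qed.

Lemma aw_factor0 w : aw_factor 0 w = 1.
Proof. by rewrite /aw_factor !mul0r !(qinf0 q1) mulr1 invr1. Qed.

Lemma ccont_bounded f : ccont f -> exists2 G, 0 <= G & forall t : R, nm (f (expi t)) <= G.
Proof.
move=> [c1 c2].
have bnd (h : R -> R) : continuous h -> exists2 G, 0 <= G & forall t, t \in `[0%R, 2 * pi]%R -> `|h t| <= G.
  move=> ch; have pi0 : 0 <= 2 * pi :> R by rewrite mulr_ge0 // pi_ge0.
  have cn : continuous (fun t => `|h t|).
    by move=> t; apply: (@continuous_comp _ _ _ h (fun x => `|x|)); [exact: ch|exact: norm_continuous].
  have [s sI hs] := EVT_max pi0 (continuous_subspaceT cn).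
  by exists `|h s|.
have [G1 G10 h1] := bnd _ c1; have [G2 G20 h2] := bnd _ c2.
exists (G1 + G2); first exact: addr_ge0.
move=> t; have pi0 : 0 < 2 * pi :> R by rewrite mulr_gt0 // pi_gt0.
pose n := Num.floor (t / (2 * pi)); pose s := t - n%:~R * (2 * pi).
have sI : s \in `[0%R, 2 * pi]%R.
  rewrite in_itv /= /s subr_ge0 -ler_pdivlMr // floor_le_tmp /=.
  have := floorD1_gt (t / (2 * pi)); rewrite -/n rmorphD /= ltr_pdivrMr // mulrDl mul1r.
  by move: (2 * pi) => y /ltW; rewrite lerBlDl.
have en : expi (n%:~R * (2 * pi)) = 1 :> R[i].
  case: (n) => m; first by rewrite expi_period.
  by rewrite NegzE rmorphN mulNr -expiV expi_period invr1.
have -> : expi t = expi s by rewrite -[RHS]mulr1 -en -expiD /s subrK.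
by apply: le_trans (nm_ReIm _) _; apply: lerD; [exact: h1|exact: h2].
Qed.

Lemma aw_factor_sumto a w : nm a < 1 -> nm w = 1 -> sumto (fun n => hpol q n w w^-1 0 0 * a ^+ n) (aw_factor a w).
Proof.
move=> a1 w1.
have h1 : nm (w * a) < 1 by rewrite nmM w1 mul1r.
have h2 : nm (w^-1 * a) < 1 by rewrite nmM nmV w1 invr1 mul1r.
have := hpol_gf q1 0 0 h1 h2; rewrite !mul0r !(qinf0 q1) !mul1r -invfM [w * a]mulrC [w^-1 * a]mulrC.
by apply: eq_sumto => n; rewrite [a * w]mulrC [a * w^-1]mulrC hpol_scale mulrC.
Qed.

Lemma ccont_hpol n u v : ccont (fun w => hpol q n w w^-1 u v).
Proof.
apply: (ccont_sum (index_enum _)) => m; apply: ccontM; apply: ccontM; try exact: ccont_cst.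
  by apply: ccontX; exact: ccont_id.
by apply: ccontX; exact: ccont_inv.
Qed.

Lemma psw_cmean g r : ccont g -> 0 < r < 1 ->
  exists B, psw r (fun n => cmean (fun w => hpol q n w w^-1 0 0 * g w)) B (fun a => cmean (fun w => aw_factor a w * g w)).
Proof.
move=> cg /andP[r0 r1]; have [G G0 hG] := ccont_bounded cg.
pose K := qmaj q 0 * qmaj q 0.
have K0 : 0 <= K by rewrite mulr_ge0 ?qmaj_ge0.
have hb n t : nm (hpol q n (expi t) (expi t)^-1 0 0) <= K * n.+1%:R.
  have := @hpol_bound _ q q1 n (expi t) (expi t)^-1 0 0 1 0 0.
  rewrite nmV nm_expi invr1 nm0 expr1n mulr1; apply; exact: lexx.
have [M dM] : exists M, dom (fun n => K * G * (n.+1%:R ^+ 2 * r ^+ n)) M.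
  by apply: dom_bilin; rewrite ?mulr_ge0 // (ltW r0).
have dM2 : dom (fun n => 2 * (K * n.+1%:R * G) * r ^+ n) (2 * M).
  apply: dom_le (domM (_ : 0 <= 2) dM) => // n; rewrite !mulr_ge0 ?exprn_ge0 ?(ltW r0) //=.
  rewrite -mulrA ler_wpM2l //.
  have -> : K * n.+1%:R * G * r ^+ n = K * G * (n.+1%:R * r ^+ n) by ring.
  rewrite ler_wpM2l ?mulr_ge0 // ler_wpM2r ?exprn_ge0 ?(ltW r0) // expr2 ler_peMr //.
  by rewrite ler1n.
pose F a n w := hpol q n w w^-1 0 0 * g w * a ^+ n.
have cF n : ccont (fun w => hpol q n w w^-1 0 0 * g w) by apply: ccontM => //; exact: ccont_hpol.
have cFa a n : ccont (F a n) by apply: ccontM (ccont_cst _).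
exists (2 * M); split.
  apply: dom_le dM2 => n; rewrite mulr_ge0 ?nm_ge0 ?exprn_ge0 ?(ltW r0) // andTb.
  rewrite ler_wpM2r ?exprn_ge0 ?(ltW r0) //; apply: cmean_bound => // t.
  by rewrite nmM ler_pM ?nm_ge0.
move=> a ar; have a1 : nm a < 1 by exact: le_lt_trans r1.
have dF : dom (fun n => K * G * (n.+1%:R ^+ 2 * r ^+ n)) M by [].
have hF n t : nm (F a n (expi t)) <= K * G * (n.+1%:R ^+ 2 * r ^+ n).
  rewrite !nmM nmX; apply: (@le_trans _ _ (K * n.+1%:R * G * r ^+ n)).
    apply: ler_pM; rewrite ?mulr_ge0 ?exprn_ge0 ?nm_ge0 //; first by apply: ler_pM; rewrite ?nm_ge0.
    by rewrite lerXn2r ?nnegrE ?nm_ge0 ?(ltW r0).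
  have -> : K * n.+1%:R * G * r ^+ n = K * G * (n.+1%:R * r ^+ n) by ring.
  rewrite ler_wpM2l ?mulr_ge0 // ler_wpM2r ?exprn_ge0 ?(ltW r0) // expr2 ler_peMr //.
  by rewrite ler1n.
have := cmean_Csum dF (cFa a) hF.
have -> : cmean (fun w => Csum (F a ^~ w)) = cmean (fun w => aw_factor a w * g w).
  apply: eq_cmean => t; apply: CsumE.
  have := sumtoZ (g (expi t)) (aw_factor_sumto a1 (nm_expi t)); rewrite mulrC; apply: eq_sumto => n.
  by rewrite /F; ring.
apply: eq_sumto => n; rewrite [RHS]mulrC -cmeanZ //; apply: eq_cmean => t; rewrite /F; ring.
Qed.

Definition AW_int a b c d := cmean (fun w => aw_factor a w * (aw_factor b w * (aw_factor c w * (aw_factor d w * hermite_weight w)))).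
Definition AW_val a b c d := 2 * Pi (a * b * c * d) /
  (Pi q * (Pi (a * b) * Pi (a * c) * Pi (a * d) * Pi (b * c) * Pi (b * d) * Pi (c * d))).

Lemma AW_intC a b c d : AW_int a b c d = AW_int b a c d.
Proof. by apply: eq_cmean => t; rewrite mulrCA. Qed.

Lemma AW_int_rot a b c d : AW_int a b c d = AW_int b c d a.
Proof. by apply: eq_cmean => t; ring. Qed.

Lemma AW_valC a b c d : AW_val a b c d = AW_val b a c d.
Proof. by rewrite /AW_val [b * a]mulrC; congr (_ / (_ * _)); ring. Qed.

Lemma AW_val_rot a b c d : AW_val a b c d = AW_val b c d a.
Proof.
rewrite /AW_val [b * a]mulrC [c * a]mulrC [d * a]mulrC (_ : b * c * d * a = a * b * c * d); last by ring.
by congr (_ / (_ * _)); ring.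
Qed.

Lemma aw_factorS a w : nm a < 1 -> nm w = 1 -> aw_factor (a * q) w = (1 - a * w) * (1 - a / w) * aw_factor a w.
Proof.
move=> a1 w1; rewrite /aw_factor (qinf_rec q1 (a * w)) (qinf_rec q1 (a / w)).
have h1 : nm (a * w) < 1 by rewrite nmM w1 mulr1.
have h2 : nm (a / w) < 1 by rewrite nmM nmV w1 invr1 mulr1.
have e1 : a * q * w = a * w * q by ring.
have e2 : a * q / w = a / w * q by rewrite mulrAC.
rewrite e1 e2.
have qn b : nm b < 1 -> Pi (b * q) != 0.
  by move=> b1; apply: qinf_neq0 => //; have := nm_qn q1 b 1; rewrite expr1 => /le_lt_trans; apply.
have := qn _ h1; have := qn _ h2; have := sub1_neq0 h1; have := sub1_neq0 h2.
by move: (1 - _) (1 - _) (Pi _) (Pi _) => x y z t x0 y0 z0 t0; field; rewrite x0 y0 z0 t0.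
Qed.

Lemma ccont_rest b c d : nm b < 1 -> nm c < 1 -> nm d < 1 -> ccont (fun w => aw_factor b w * (aw_factor c w * (aw_factor d w * hermite_weight w))).
Proof. by move=> b1 c1 d1; do 3 (apply: ccontM; first exact: ccont_aw_factor); exact: ccont_hermite_weight. Qed.

(** Pointwise, since b (1 - a w) (1 - a / w) - a (1 - b w) (1 - b / w) = (b - a) (1 - a b). *)
Lemma AW_int_contig a b c d : nm a < 1 -> nm b < 1 -> nm c < 1 -> nm d < 1 ->
  b * AW_int (a * q) b c d - a * AW_int a (b * q) c d = (b - a) * (1 - a * b) * AW_int a b c d.
Proof.
move=> a1 b1 c1 d1.
have bq x : nm x < 1 -> nm (x * q) < 1 by move=> x1; have := nm_qn q1 x 1; rewrite expr1 => /le_lt_trans; apply.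
have cI x y : nm x < 1 -> nm y < 1 -> ccont (fun w => aw_factor x w * (aw_factor y w * (aw_factor c w * (aw_factor d w * hermite_weight w)))).
  by move=> x1 y1; apply: ccontM; [exact: ccont_aw_factor|exact: ccont_rest].
pose g x y w := aw_factor x w * (aw_factor y w * (aw_factor c w * (aw_factor d w * hermite_weight w))).
have e : cmean (fun w => b * g (a * q) b w + (- a) * g a (b * q) w) = cmean (fun w => (b - a) * (1 - a * b) * g a b w).
  apply: eq_cmean => t; rewrite /g !aw_factorS ?nm_expi //.
  have : expi t != 0 :> R[i] by rewrite -nm_gt0 nm_expi.
  by move: (expi t) (hermite_weight _) (aw_factor a _) (aw_factor b _) (aw_factor c _) (aw_factor d _) => w x y z s u w0; field.
have cab : ccont (g a b) by exact: cI.
change (b * cmean (g (a * q) b) - a * cmean (g a (b * q)) = (b - a) * (1 - a * b) * cmean (g a b)).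
have ca : ccont (g (a * q) b) by apply: cI => //; exact: bq.
have cb : ccont (g a (b * q)) by apply: cI => //; exact: bq.
clear cI; move: e ca cb cab; move: (g a b) (g (a * q) b) (g a (b * q)) => g1 g2 g3 e ca cb cab.
transitivity (cmean (fun w => b * g2 w + (- a) * g3 w)).
  by rewrite (cmeanD (ccontZ b ca) (ccontZ (- a) cb)) (cmeanZ _ ca) (cmeanZ _ cb) mulNr.
by rewrite e (cmeanZ _ cab).
Qed.

Lemma AW_val_contig a b c d : nm a < 1 -> nm b < 1 -> nm c < 1 -> nm d < 1 ->
  b * AW_val (a * q) b c d - a * AW_val a (b * q) c d = (b - a) * (1 - a * b) * AW_val a b c d.
Proof.
move=> a1 b1 c1 d1.
have m (x y : R[i]) : nm x < 1 -> nm y < 1 -> nm (x * y) < 1.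
  by move=> x1 y1; rewrite nmM; apply: le_lt_trans y1; rewrite ler_piMl ?nm_ge0 // ltW.
have qn x : nm x < 1 -> Pi (x * q) != 0 by move=> x1; apply: qinf_neq0 => //; exact: m.
rewrite /AW_val.
have -> : a * q * b * c * d = a * b * c * d * q by ring.
have -> : a * (b * q) * c * d = a * b * c * d * q by ring.
have -> : a * q * b = a * b * q by ring.
have -> : a * (b * q) = a * b * q by ring.
have -> : a * q * c = a * c * q by ring.
have -> : a * q * d = a * d * q by ring.
have -> : b * q * c = b * c * q by ring.
have -> : b * q * d = b * d * q by ring.
rewrite (qinf_rec q1 (a * b * c * d)) (qinf_rec q1 (a * b)) (qinf_rec q1 (a * c)) (qinf_rec q1 (a * d)) (qinf_rec q1 (b * c)) (qinf_rec q1 (b * d)).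
have : 1 - a * b != 0 by exact: sub1_neq0 (m _ _ _ _).
have : 1 - a * c != 0 by exact: sub1_neq0 (m _ _ _ _).
have : 1 - a * d != 0 by exact: sub1_neq0 (m _ _ _ _).
have : 1 - b * c != 0 by exact: sub1_neq0 (m _ _ _ _).
have : 1 - b * d != 0 by exact: sub1_neq0 (m _ _ _ _).
have := qn _ (m _ _ a1 b1); have := qn _ (m _ _ a1 c1); have := qn _ (m _ _ a1 d1); have := qn _ (m _ _ b1 c1); have := qn _ (m _ _ b1 d1).
have := qinf_neq0 q1 (m _ _ c1 d1); have := qinf_neq0 q1 q1.
move: (Pi q) (Pi (c * d)) (Pi (b * d * q)) (Pi (b * c * q)) (Pi (a * d * q)) (Pi (a * c * q)) (Pi (a * b * q)) (Pi (a * b * c * d * q)) => x1 x2 x3 x4 x5 x6 x7 x8 h1 h2 h3 h4 h5 h6 h7 h8 h9 h10 h11 h12.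
by field; rewrite h1 h2 h3 h4 h5 h6 h7 h8 h9 h10 h11 h12.
Qed.

Lemma psn_AW_val b c d r : 0 < r < 1 -> nm b < 1 -> nm c < 1 -> nm d < 1 -> exists B, psn r B (fun a => AW_val a b c d).
Proof.
move=> /andP[r0 r1] b1 c1 d1; have r0' := ltW r0.
have le x : nm x < 1 -> nm x * r <= r by move=> x1; rewrite ler_piMl // ltW.
pose K := 2 / (Pi q * Pi (b * c) * Pi (b * d) * Pi (c * d)).
have h := psnZ K r0' (psnM r0' (psn_qinf q1 r0 (lexx (nm (b * c * d) * r)))
   (psnM r0' (psn_qinfV q1 r0 (le _ b1) r1) (psnM r0' (psn_qinfV q1 r0 (le _ c1) r1) (psn_qinfV q1 r0 (le _ d1) r1)))).
eexists; apply: eq_psn h => a _.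
have -> : b * c * d * a = a * b * c * d by ring.
by rewrite /K /AW_val [b * a]mulrC [c * a]mulrC [d * a]mulrC !invfM; ring.
Qed.

Lemma AW_int_base d : nm d < 1 -> AW_int 0 0 0 d = AW_val 0 0 0 d.
Proof.
move=> d1; have [r r01 dr] : exists2 r, 0 < r < 1 & nm d <= r.
  by exists ((1 + nm d) / 2); have := nm_ge0 d; lra.
have -> : AW_val 0 0 0 d = 2 / Pi q by rewrite /AW_val !mul0r !(qinf0 q1) !mulr1.
have -> : AW_int 0 0 0 d = cmean (fun w => aw_factor d w * hermite_weight w).
  by apply: eq_cmean => t; rewrite !aw_factor0 !mul1r.
have [B [_ hB]] := psw_cmean ccont_hermite_weight r01.
apply: sumto_uniq (hB d dr) _; apply: (@ccvg_unshift _ 1); apply: eq_ccvg (ccvg_cst (2 / Pi q)) => n.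
have h m : cmean (fun w => hpol q m w w^-1 0 0 * hermite_weight w) = (m == 0%N)%:R * 2 / Pi q.
  by rewrite -(cmean_hermite q1 q0); apply: eq_cmean => t; rewrite mulrC.
rewrite addn1 big_ord_recl h expr0 mulr1 mul1r big1 ?addr0 // => i _.
by rewrite h !mul0r.
Qed.

Lemma AW_int_step c d : nm c < 1 -> nm d < 1 -> (forall b, nm b < 1 -> AW_int 0 b c d = AW_val 0 b c d) ->
  forall a b, nm a < 1 -> nm b < 1 -> AW_int a b c d = AW_val a b c d.
Proof.
move=> c1 d1 h0 a b a1 b1.
have [->|b0] := eqVneq b 0; first by rewrite AW_intC AW_valC h0.
have [r r01 ar] : exists2 r, 0 < r < 1 & nm a <= r.
  exists ((1 + nm a) / 2); last by have := nm_ge0 a; lra.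
  by have := nm_ge0 a; lra.
apply/eqP; rewrite -subr_eq0; apply/eqP.
apply: (@contiguous_uniq (fun a b => AW_int a b c d - AW_val a b c d) r) => //; first by case/andP: r01.
- move=> b' b1'; have [B1 p1'] := psw_cmean (ccont_rest b1' c1 d1) r01; have p1 : psn r B1 (fun a => cmean (fun w => aw_factor a w * (aw_factor b' w * (aw_factor c w * (aw_factor d w * hermite_weight w))))) by eexists; exact: p1'.
  have [B2 p2] := psn_AW_val r01 b1' c1 d1.
  have r0' : 0 <= r by case/andP: r01 => /ltW.
  have := psnD p1 (psnZ (-1) r0' p2) => h; eexists; apply: eq_psn h => z _.
  by rewrite mulN1r.
- move=> a' b' ar' b1'; have a1' : nm a' < 1 by case/andP: r01 => _; exact: le_lt_trans.
  rewrite [RHS]mulrBr -AW_int_contig // -AW_val_contig //.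
  by move: (AW_int _ _ _ _) (AW_int _ _ _ _) (AW_val _ _ _ _) (AW_val _ _ _ _) => x y z t; ring.
- by move=> b' b1'; rewrite h0 // subrr.
Qed.

(** Parameters are switched on one at a time, from the case of a single one. *)
Theorem askey_wilson_integral a b c d : nm a < 1 -> nm b < 1 -> nm c < 1 -> nm d < 1 ->
  AW_int a b c d = AW_val a b c d.
Proof.
have z1 : nm (0 : R[i]) < 1 by rewrite nm0.
have h1 : forall a b, nm a < 1 -> nm b < 1 -> AW_int a b 0 0 = AW_val a b 0 0.
  by apply: AW_int_step => // x x1; rewrite AW_intC AW_int_rot AW_valC AW_val_rot AW_int_base.
have h2 c' : nm c' < 1 -> forall a b, nm a < 1 -> nm b < 1 -> AW_int a b c' 0 = AW_val a b c' 0.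
  by move=> c1; apply: AW_int_step => // x x1; rewrite AW_int_rot AW_val_rot h1.
move=> a1 b1 c1 d1; apply: AW_int_step => // x x1; by rewrite AW_int_rot AW_val_rot h2.
Qed.

End AWIntegral.

(** * Norms of the Askey-Wilson polynomials *)

Section TerminatingSums.
Variables (R : realType) (q : R[i]).
Hypotheses (q1 : nm q < 1) (q0 : q != 0).
Local Notation P a n := (qpoch a q n).
Local Notation Pi a := (qpoch_inf a q).

Definition qpolX a n : {poly R[i]} := \prod_(i < n) (1 - (a * q ^+ i) *: 'X).

Lemma qpolX_horner a n x : (qpolX a n).[x] = P (a * x) n.
Proof.
rewrite /qpolX horner_prod; apply: eq_bigr => i _; rewrite !hornerE.
by rewrite mulrAC.
Qed.

Lemma qpolX_size a n : (size (qpolX a n) <= n.+1)%N.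
Proof.
elim: n => [|n IH]; first by rewrite /qpolX big_ord0 size_poly1.
rewrite /qpolX big_ord_recr /= -/(qpolX a n).
apply: leq_trans (size_polyMleq _ _) _; rewrite -subn1 leq_subLR addnC (_ : 1 + n.+2 = 2 + n.+1)%N //.
apply: leq_add IH; apply: leq_trans (size_polyD _ _) _; rewrite geq_max size_poly1 size_polyN.
by rewrite (leq_trans (size_scale_leq _ _)) ?size_polyX.
Qed.

Let qn0 n : q ^+ n != 0. Proof. exact: expf_neq0. Qed.

(** Up to a constant, the j-th q-difference of f at 1; it annihilates the polynomials of
    degree below j, see [qsum_poly]. *)
Definition qsum j (f : R[i] -> R[i]) := \sum_(i < j.+1) P (q ^- j) i / P q i * q ^+ i * f (q ^+ i).

Lemma qsumZ j c f : qsum j (fun x => c * f x) = c * qsum j f.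
Proof. by rewrite /qsum mulr_sumr; apply: eq_bigr => i _; rewrite mulrCA. Qed.

Lemma qpoch_terminates j n : (j < n)%N -> P (q ^- j) n = 0.
Proof. by move=> jn; apply: (qpoch_root jn); rewrite mulVf. Qed.

Lemma qsum_mono j k : (k < j)%N -> qsum j (fun x => x ^+ k) = 0.
Proof.
move=> kj; have h : nm (q ^+ k.+1) < 1 by rewrite nmX exprn_ilt1 ?nm_ge0.
have := q_binomial q1 (q ^- j) h.
have -> : Pi (q ^- j * q ^+ k.+1) = 0.
  rewrite (qinf_split q1 _ (j - k)) (@qpoch_root _ q _ (j - k.+1)) ?mul0r //; first by rewrite ltn_sub2l.
  by rewrite -mulrA -exprD subnKC // mulVf.
rewrite mul0r => hs; rewrite -[RHS](sumto_uniq (sumto_fin (N := j.+1) _) hs); last first.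
  by move=> i ji; rewrite qpoch_terminates // !mul0r.
by apply: eq_bigr => i _; rewrite -mulrA -!exprM -exprD mulSn [(i * k)%N]mulnC.
Qed.

Lemma qsum_poly j (f : {poly R[i]}) : (size f <= j)%N -> qsum j (horner f) = 0.
Proof.
move=> sf; transitivity (\sum_(k < j) f`_k * qsum j (fun x => x ^+ k)); last first.
  by rewrite big1 // => k _; rewrite qsum_mono ?mulr0.
rewrite /qsum; under [RHS]eq_bigr => k _ do rewrite mulr_sumr.
rewrite [RHS]exchange_big; apply: eq_bigr => i _.
by rewrite (horner_coef_wide _ sf) mulr_sumr; apply: eq_bigr => k _; rewrite mulrCA.
Qed.

(** Partial fractions: a numerator of degree j reduces to its value at the pole. *)
Lemma qsum_pole j A E : E != 0 -> (forall i, (i <= j)%N -> 1 - E * q ^+ i != 0) ->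
  qsum j (fun x => P (A * x) j / (1 - E * x)) = P (A / E) j * qsum j (fun x => (1 - E * x)^-1).
Proof.
move=> E0 hE.
have rt : root (qpolX A j - (P (A / E) j)%:P) E^-1.
  by rewrite /root !hornerE qpolX_horner subrr.
have [r er] := factor_theorem _ _ rt.
have sr : (size r <= j)%N.
  have [->|r0] := eqVneq r 0; first by rewrite size_poly0.
  have : (size (qpolX A j - (P (A / E) j)%:P)%R <= j.+1)%N.
    apply: leq_trans (size_polyD _ _) _; rewrite geq_max qpolX_size size_polyN size_polyC.
    by case: (_ != 0).
  by rewrite er size_Mmonic ?monicXsubC // size_XsubC addnS /= addn1 ltnS.
apply/eqP; rewrite -subr_eq0 -qsumZ; apply/eqP.
transitivity (qsum j (horner (- E^-1 *: r))); last by apply: qsum_poly; apply: leq_trans (size_scale_leq _ _) sr.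
rewrite /qsum -sumrB; apply: eq_bigr => -[i /= hi] _; rewrite -mulrBr; congr (_ * _).
have := congr1 (horner^~ (q ^+ i)) er; rewrite !hornerE qpolX_horner.
have := hE i hi; move: (q ^+ i) (r.[_]) (P _ j) (P _ j) => x y z t n0 e.
rewrite -mulrBl e; field; rewrite E0 andTb.
exact: n0.
Qed.

(** The case A = q^(-j) of [qsum_pole], in which a single term survives on the left. *)
Lemma qsum_pole_val j E : E != 0 -> (forall i, (i <= j)%N -> 1 - E * q ^+ i != 0) ->
  P (q ^- j / E) j * qsum j (fun x => (1 - E * x)^-1) = P (q ^- j) j / (1 - E).
Proof.
move=> E0 hE; rewrite -qsum_pole // /qsum big_ord_recl big1 ?addr0.
  by rewrite !qpoch0 !expr0 !mulr1 divr1 mul1r.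
move=> [i hi] _; rewrite lift0 /=.
rewrite [P (q ^- j * q ^+ i.+1) j](@qpoch_root _ _ _ (j - i.+1)%N) ?mul0r ?mulr0 //; first by rewrite subnS prednK ?leq_subr // subn_gt0.
by rewrite -mulrA -exprD subnKC // mulVf.
Qed.

Lemma qpoch_reverse y j : y != 0 -> P (q / (q ^+ j * y)) j = (- 1) ^+ j * P y j / (y ^+ j * q ^+ 'C(j, 2)).
Proof.
move=> y0; elim: j => [|j IH]; first by rewrite !qpoch0 !expr0 !mulr1 divr1.
rewrite qpochSl qpochS binS bin1 exprD [(-1) ^+ _]exprS [y ^+ _]exprS.
have -> : q / (q ^+ j.+1 * y) = (q ^+ j * y)^-1 by rewrite exprS; field; rewrite q0 qn0 y0.
rewrite [_ * q]mulrC IH; have := qn0 j; have := qn0 'C(j, 2); have : y ^+ j != 0 by exact: expf_neq0.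
move: (P _ _) (y ^+ j) (q ^+ 'C(j, 2)) (q ^+ j) (_ ^+ j) => x u v z t u0 v0 z0.
by field; rewrite u0 v0 z0 y0.
Qed.

Lemma qsum_pole_eval j A E : E != 0 -> (forall i, 1 - E * q ^+ i != 0) ->
  qsum j (fun x => P (A * x) j / (1 - E * x)) = P (A / E) j * (E ^+ j * P q j / P E j.+1).
Proof.
move=> E0 hE; rewrite qsum_pole //; congr (_ * _).
have PE n : P E n != 0 by apply/prodf_neq0 => i _.
have := qsum_pole_val E0 (fun i (_ : (i <= j)%N) => hE i).
have -> : q ^- j / E = q / (q ^+ j * (E * q)) by field; rewrite qn0 q0 E0.
have -> : q ^- j = q / (q ^+ j * q) by field; rewrite qn0 q0.
rewrite !qpoch_reverse ?mulf_neq0 // exprMn qpochSl.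
have := PE j.+1; rewrite qpochSl mulf_eq0 negb_or => /andP[].
have := qn0 'C(j, 2); have := qn0 j; have : E ^+ j != 0 by exact: expf_neq0.
have : (-1) ^+ j != 0 :> R[i] by rewrite signr_eq0.
move: (qsum _ _) (P (E * q) j) (P q j) (E ^+ j) (q ^+ 'C(j, 2)) (_ ^+ j) (q ^+ j) (1 - E) => x1 x2 x3 x4 x5 x6 x7 x8 h6 h4 h7 h5 h8 h2 e.
have h : x6 * x2 / (x4 * x7 * x5) != 0 by apply: mulf_neq0; [exact: mulf_neq0|rewrite invr_eq0; apply: mulf_neq0; [exact: mulf_neq0|]].
by apply: (mulfI h); rewrite e; field; rewrite h2 h4 h5 h7 h8.
Qed.

End TerminatingSums.

Lemma bin2_double j : ('C(j.+1, 2) + 'C(j.+1, 2) = j * j.+1)%N.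
Proof. by elim: j => // j IH; rewrite binS bin1; lia. Qed.

Lemma size_arith m j u v : (v <= (j - m).+1)%N -> (u <= m.+1)%N -> (m <= j)%N -> ((u + v).-1 <= j.+1)%N.
Proof. lia. Qed.

Section Norm.
Variables (R : realType) (q : R[i]).
Hypotheses (q1 : nm q < 1) (q0 : q != 0).
Local Notation P a n := (qpoch a q n).
Local Notation Pi a := (qpoch_inf a q).
Let qn0 n : q ^+ n != 0. Proof. exact: expf_neq0. Qed.
Let qn1 n : 1 - q ^+ n.+1 != 0.
Proof. by apply: sub1_neq0; rewrite nmX exprn_ilt1 ?nm_ge0. Qed.

Lemma qpE x n : qp q x n = P x n. Proof. by []. Qed.

Lemma ccont_et : ccont (fun w : R[i] => et w).
Proof. by apply: ccontD; [exact: ccont_id|exact: ccont_inv]. Qed.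

Lemma ccont_horner (F : {poly R[i]}) : ccont (fun w => F.[et w]).
Proof.
apply: eq_ccont (ccont_sum (index_enum _) (fun i : 'I_(size F) => ccontZ F`_i (ccontX i ccont_et))) => t.
by rewrite horner_coef.
Qed.

(** A basis polynomial times the weight is the weight with a raised parameter, so that
    the moments below are values of the Askey-Wilson integral. *)
Lemma awbasis_aw_factor a i w : nm a < 1 -> nm w = 1 -> awbasis q a i (et w) * aw_factor q a w = aw_factor q (a * q ^+ i) w.
Proof.
move=> a1 w1; have w0 : w != 0 by rewrite -nm_gt0 w1.
rewrite (awbasis_et q _ _ w0) !qpE /aw_factor.
rewrite (qinf_split q1 (a * w) i) (qinf_split q1 (a / w) i).
have -> : a * q ^+ i * w = a * w * q ^+ i by rewrite mulrAC.
have -> : a * q ^+ i / w = a / w * q ^+ i by rewrite mulrAC.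
have h1 : nm (a * w) < 1 by rewrite nmM w1 mulr1.
have h2 : nm (a / w) < 1 by rewrite nmM nmV w1 invr1 mulr1.
have := qpoch_neq0 q1 i h1; have := qpoch_neq0 q1 i h2.
have := qinf_neq0 q1 (le_lt_trans (nm_qn q1 _ i) h1); have := qinf_neq0 q1 (le_lt_trans (nm_qn q1 _ i) h2).
by move: (P _ _) (P _ _) (Pi _) (Pi _) => x y z t x0 y0 z0 t0; field; rewrite x0 y0 z0 t0.
Qed.

Variables a b c d : R[i].
Hypotheses (a1 : nm a < 1) (b1 : nm b < 1) (c1 : nm c < 1) (d1 : nm d < 1).
Hypotheses (a0 : a != 0) (b0 : b != 0) (c0 : c != 0) (d0 : d != 0).
Local Notation D := (a * b * c * d).

Definition aw_weight w := aw_factor q a w * (aw_factor q b w * (aw_factor q c w * (aw_factor q d w * hermite_weight q w))).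

Let m2 (x y : R[i]) : nm x < 1 -> nm y < 1 -> nm (x * y) < 1.
Proof. by move=> x1 y1; rewrite nmM; apply: le_lt_trans y1; rewrite ler_piMl ?nm_ge0 // ltW. Qed.
Let D1 : nm D < 1. Proof. by do 3 (apply: (m2 _) => //). Qed.
Let qlt x n : nm x < 1 -> nm (x * q ^+ n) < 1.
Proof. by apply: le_lt_trans; exact: nm_qn. Qed.

Lemma ccont_aw_weight : ccont aw_weight.
Proof. by apply: ccontM; [exact: ccont_aw_factor|exact: ccont_rest]. Qed.

Lemma cmean_awbasis2 i m : cmean (fun w => awbasis q a i (et w) * awbasis q b m (et w) * aw_weight w) =
  AW_val q a b c d * (P (a * b) (i + m) * (P (a * c) i * P (a * d) i) * (P (b * c) m * P (b * d) m) / P D (i + m)).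
Proof.
transitivity (AW_val q (a * q ^+ i) (b * q ^+ m) c d).
  rewrite -(askey_wilson_integral q1 q0 (qlt i a1) (qlt m b1) c1 d1).
  apply: eq_cmean => t; rewrite /aw_weight -!awbasis_aw_factor ?nm_expi //.
  by move: (awbasis _ _ _ _) (awbasis _ _ _ _) (aw_factor _ _ _) (aw_factor _ _ _) (aw_factor _ _ _) (aw_factor _ _ _) (hermite_weight _ _) => *; ring.
rewrite /AW_val.
have -> : a * q ^+ i * (b * q ^+ m) = a * b * q ^+ (i + m) by rewrite exprD; ring.
have -> : a * b * q ^+ (i + m) * c * d = D * q ^+ (i + m) by ring.
have -> : a * q ^+ i * c = a * c * q ^+ i by ring.
have -> : a * q ^+ i * d = a * d * q ^+ i by ring.
have -> : b * q ^+ m * c = b * c * q ^+ m by ring.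
have -> : b * q ^+ m * d = b * d * q ^+ m by ring.
rewrite (qinf_split q1 D (i + m)) (qinf_split q1 (a * b) (i + m)) (qinf_split q1 (a * c) i) (qinf_split q1 (a * d) i)
  (qinf_split q1 (b * c) m) (qinf_split q1 (b * d) m).
have := qpoch_neq0 q1 (i + m) D1; have := qpoch_neq0 q1 (i + m) (m2 a1 b1); have := qpoch_neq0 q1 i (m2 a1 c1);
have := qpoch_neq0 q1 i (m2 a1 d1); have := qpoch_neq0 q1 m (m2 b1 c1); have := qpoch_neq0 q1 m (m2 b1 d1).
have := qinf_neq0 q1 (qlt (i + m) (m2 a1 b1)); have := qinf_neq0 q1 (qlt i (m2 a1 c1));
have := qinf_neq0 q1 (qlt i (m2 a1 d1)); have := qinf_neq0 q1 (qlt m (m2 b1 c1)); have := qinf_neq0 q1 (qlt m (m2 b1 d1)).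
have := qinf_neq0 q1 q1; have := qinf_neq0 q1 (m2 c1 d1).
move: (P D (i + m)) (P (a * b) (i + m)) (P (a * c) i) (P (a * d) i) (P (b * c) m) (P (b * d) m) => y1 y2 y3 y4 y5 y6.
move: (Pi (D * _)) (Pi (a * b * _)) (Pi (a * c * _)) (Pi (a * d * _)) (Pi (b * c * _)) (Pi (b * d * _)) (Pi q) (Pi (c * d)) => z1 z2 z3 z4 z5 z6 z7 z8.
move=> h1 h2 h3 h4 h5 h6 h7 h8 h9 h10 h11 h12 h13.
by field; rewrite h1 h2 h3 h4 h5 h6 h7 h8 h9 h10 h11 h12 h13.
Qed.

Definition moment j m := cmean (fun w => (AWpol q j a b c d).[et w] * awbasis q b m (et w) * aw_weight w).

Lemma momentE j m : moment j m = a ^- j * AW_val q a b c d * (P (a * b) j * P (a * c) j * P (a * d) j) * (P (b * c) m * P (b * d) m) *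
  \sum_(i < j.+1) P (q ^- j) i / P q i * q ^+ i * (P (D * q ^+ j / q) i * P (a * b * q ^+ i) m / P D (i + m)).
Proof.
have cp i : ccont (fun w => awbasis q a i (et w) * awbasis q b m (et w) * aw_weight w).
  by apply: ccontM ccont_aw_weight; apply: ccontM; exact: ccont_horner.
transitivity (cmean (fun w => \sum_(i < j.+1) (a ^- j * awc q j a b c d i) * (awbasis q a i (et w) * awbasis q b m (et w) * aw_weight w))).
  apply: eq_cmean => t; rewrite AWpol_horner mulr_sumr !mulr_suml; apply: eq_bigr => i _.
  by rewrite !mulrA.
rewrite (cmean_sum _ (fun i : 'I_j.+1 => ccontZ (a ^- j * awc q j a b c d i) (cp i))) mulr_sumr.
apply: eq_bigr => -[i /= hi] _; rewrite (cmeanZ _ (cp i)) cmean_awbasis2 /awc.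
rewrite !qpE.
rewrite -(subnKC (hi : (i <= j)%N)); move: (j - i)%N => l; rewrite addKn.
rewrite !(qpochD _ (a * c) i l) !(qpochD _ (a * d) i l) !(qpochD _ (a * b) i l) (qpochD _ (a * b) i m).
have := qpoch_neq0 q1 i q1; have := qpoch_neq0 q1 (i + m) D1.
have : a ^+ (i + l) != 0 by exact: expf_neq0.
move: (P D _) (P q i) (P (_^-1) _) (P (_ / q) i) (P (a * b) i) (P (a * b * _) l) (P (a * c) i) (P (a * c * _) l) (P (a * d) i) (P (a * d * _) l).
move=> x1 x2 x3 x4 x5 x6 x7 x8 x9 x10; move: (a ^+ _) (P (b * c) m) (P (b * d) m) (AW_val _ _ _ _ _) (q ^+ i) (P (a * b * _) m) => y1 y2 y3 y4 y5 y6 h1 h2 h3.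
by field; rewrite h1 h2 h3.
Qed.

(** Apart from the weights of [qsum], the summand of [momentE] is a polynomial of degree at
    most j - 1 in q^i. *)
Lemma moment_lt j m : (m < j)%N -> moment j m = 0.
Proof.
case: j => // j; rewrite ltnS => mj; rewrite momentE [X in _ * X](_ : _ = 0) ?mulr0 //.
transitivity (qsum q j.+1 (horner ((P D j)^-1 *: (qpolX q (a * b) m * qpolX q (D * q ^+ m) (j - m))))).
  apply: eq_bigr => i _; congr (_ * _); rewrite hornerZ hornerM !qpolX_horner.
  have -> : D * q ^+ j.+1 / q = D * q ^+ j by rewrite exprSr mulrA mulfK.
  have e : P D (i + m) * P (D * q ^+ m * q ^+ i) (j - m) = P D j * P (D * q ^+ j) i.
    have -> : D * q ^+ m * q ^+ i = D * q ^+ (i + m) by rewrite exprD; ring.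
    have ee : (i + m + (j - m) = j + i)%N by rewrite -addnA subnKC // addnC.
    by rewrite -!qpochD ee.
  have h1 := qpoch_neq0 q1 (i + m) D1; have h2 := qpoch_neq0 q1 j D1.
  apply: (mulfI h1); apply: (mulfI h2); move: e; move: (P D j) h2 (P D (i + m)) h1 (P _ i) (P _ m) (P _ (j - m)) => x x0 y y0 z t u e.
  transitivity (t * (x * z)); first by field.
  by rewrite -e; field.
apply: qsum_poly => //; apply: leq_trans (size_scale_leq _ _) _.
apply: leq_trans (size_polyMleq _ _) _.
have := qpolX_size q (a * b) m; have := qpolX_size q (D * q ^+ m) (j - m).
by move: (size _) (size _) => u v hu hv; exact: size_arith hu hv mj.
Qed.

Definition awnorm j := AW_val q a b c d *
  (P q j * P (a * b) j * P (a * c) j * P (a * d) j * P (b * c) j * P (b * d) j * P (c * d) j) / P D (j + j).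

(** The summand of [momentE] now has a simple pole in q^i and [qsum_pole_eval] applies. *)
Lemma moment_diag j : moment j j = (- b) ^+ j * q ^+ 'C(j, 2) * awnorm j.
Proof.
rewrite /awnorm momentE; case: j => [|j].
  by rewrite big_ord1 !qpoch0 !expr0 !invr1 !mulr1 !mul1r.
set E := D * q ^+ j.
have E0 : E != 0 by rewrite !mulf_neq0.
have hE i : 1 - E * q ^+ i != 0 by apply: sub1_neq0; apply: qlt; exact: qlt.
have PD n : P D n != 0 by exact: qpoch_neq0.
have PE n : P E n != 0 by apply: qpoch_neq0 => //; exact: qlt.
rewrite [X in _ * X = _](_ : _ = (P D j)^-1 * qsum q j.+1 (fun x => P (a * b * x) j.+1 / (1 - E * x))); last first.
  rewrite -qsumZ; apply: eq_bigr => i _; congr (_ * _).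
  rewrite (_ : D * q ^+ j.+1 / q = E); last by rewrite exprSr mulrA mulfK.
  have e : P D (i + j.+1) = P D j * P E i * (1 - E * q ^+ i).
    by rewrite -[RHS]mulrA -(qpochS q E i) -qpochD addnS addnC addnS.
  rewrite e; have := PD j; have := PE i; have := hE i.
  move: (1 - E * q ^+ i) (P E i) (P D j) (P (_ * q ^+ i) _) => x y z t x0 y0 z0.
  by field; rewrite x0 y0 z0.
rewrite qsum_pole_eval //.
have -> : a * b / E = q / (q ^+ j.+1 * (c * d)).
  by rewrite /E exprS; have := qn0 j; move: (q ^+ j) => z z0; field; rewrite z0 q0 a0 b0 c0 d0.
rewrite qpoch_reverse ?mulf_neq0 //.
have -> : P D (j.+1 + j.+1) = P D j * P E j.+2 by rewrite -qpochD addSnnS.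
have -> : E ^+ j.+1 = (a * b * c * d) ^+ j.+1 * q ^+ 'C(j.+1, 2) * q ^+ 'C(j.+1, 2).
  by rewrite -[RHS]mulrA -exprD bin2_double /E exprMn -exprM.
rewrite -[- b]mulN1r !exprMn.
have := PD j; have := PE j.+2; have := qn0 'C(j.+1, 2).
have e0 (x : R[i]) : x != 0 -> x ^+ j.+1 != 0 by move=> x0; exact: expf_neq0.
have := e0 _ a0; have := e0 _ c0; have := e0 _ d0; clear.
move: (P D j) (P E _) => {E} y1 y2.
move: ((-1) ^+ _) (q ^+ _) (a ^+ _) (b ^+ _) (c ^+ _) (d ^+ _) (AW_val _ _ _ _ _).
move: (P q _) (P (a * b) _) (P (a * c) _) (P (a * d) _) (P (b * c) _) (P (b * d) _) (P (c * d) _).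
move=> x1 x2 x3 x4 x5 x6 x7 y3 y4 y5 y6 y7 y8 y9 h7 h6 h4 h3 h2 h1.
by field; rewrite h1 h2 h3 h4 h6 h7.
Qed.

Lemma awbasisP_lead_b m : (awbasisP q b m)`_m = (- b) ^+ m * q ^+ 'C(m, 2).
Proof.
rewrite (awbasisP_size q b m).2; elim: m => [|m IH]; first by rewrite big_ord0 !expr0 mulr1.
rewrite big_ord_recr /= IH binS bin1 exprD exprS; move: (q ^+ m) (q ^+ _) (_ ^+ m) => x y z; ring.
Qed.

Lemma awbasisP_lead_neq0 m : (awbasisP q b m)`_m != 0.
Proof. by rewrite awbasisP_lead_b mulf_neq0 ?qn0 // expf_neq0 // oppr_eq0. Qed.

Lemma cmean_AWpol_expand j N (F : {poly R[i]}) (E : nat -> R[i]) : F = \sum_(m < N) E m *: awbasisP q b m ->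
  cmean (fun w => (AWpol q j a b c d).[et w] * F.[et w] * aw_weight w) = \sum_(m < N) E m * moment j m.
Proof.
move=> ->.
have cp m : ccont (fun w => (AWpol q j a b c d).[et w] * awbasis q b m (et w) * aw_weight w).
  by apply: ccontM ccont_aw_weight; apply: ccontM; exact: ccont_horner.
transitivity (cmean (fun w => \sum_(m < N) E m * ((AWpol q j a b c d).[et w] * awbasis q b m (et w) * aw_weight w))).
  apply: eq_cmean => t; rewrite horner_sum mulr_sumr mulr_suml; apply: eq_bigr => m _.
  rewrite [(E m *: _).[_]]hornerZ -/(awbasis q b m _).
  by move: (_.[_]) (awbasis _ _ _ _) (aw_weight _) (E m) => x y z u; ring.
by rewrite (cmean_sum _ (fun m : 'I_N => ccontZ (E m) (cp m))); apply: eq_bigr => m _; rewrite (cmeanZ _ (cp m)).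
Qed.

(** Expanding the polynomial of lower degree in the basis (b w, b / w; q)_m. *)
Lemma AWpol_orth_lt i j : (i < j)%N -> cmean (fun w => (AWpol q j a b c d).[et w] * (AWpol q i a b c d).[et w] * aw_weight w) = 0.
Proof.
move=> ij; have [|E hE] := @tri_expand _ _ (fun m => (awbasisP_size q b m).1) awbasisP_lead_neq0 j (AWpol q i a b c d).
  by apply: leq_trans ij; exact: (AWpol_size q0 qn1 b c d i a0).1.
rewrite (cmean_AWpol_expand j hE) big1 // => m _; by rewrite moment_lt ?mulr0.
Qed.

Theorem AWpol_orth i j : i != j -> cmean (fun w => (AWpol q j a b c d).[et w] * (AWpol q i a b c d).[et w] * aw_weight w) = 0.
Proof.
case: (ltngtP i j) => // ij _; first exact: AWpol_orth_lt.
by rewrite -(AWpol_orth_lt ij); apply: eq_cmean => t; rewrite [_.[_] * _.[_]]mulrC.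
Qed.

Theorem AWpol_norm j : cmean (fun w => (AWpol q j a b c d).[et w] * (AWpol q j a b c d).[et w] * aw_weight w) =
  P (D * q ^+ j / q) j * awnorm j.
Proof.
have sz := (AWpol_size q0 qn1 b c d j a0).1.
have [E hE] := @tri_expand _ _ (fun m => (awbasisP_size q b m).1) awbasisP_lead_neq0 j.+1 _ sz.
have := @tri_top _ _ (fun m => (awbasisP_size q b m).1) awbasisP_lead_neq0 j.+1 E j (ltnSn j).
rewrite -hE => /(_ sz); rewrite (AWpol_size q0 qn1 b c d j a0).2 awbasisP_lead_b qpE => <-.
rewrite (cmean_AWpol_expand j hE) big_ord_recr big1 ?add0r => [|m _]; last by rewrite /= moment_lt ?mulr0 //; exact: ltn_ord.
by rewrite [LHS]add0r moment_diag mulrA.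
Qed.

End Norm.

(** * The expansion of the integrand *)

Section Kernel.
Variables (R : realType) (q : R[i]).
Hypotheses (q1 : nm q < 1) (q0 : q != 0).
Local Notation P a n := (qpoch a q n).
Local Notation Pi a := (qpoch_inf a q).
Let qn1 n : 1 - q ^+ n.+1 != 0.
Proof. by apply: sub1_neq0; rewrite nmX exprn_ilt1 ?nm_ge0. Qed.

(** Both sides satisfy the recurrence of [gpol_rec]. *)
Lemma hpol_gpol k w r n : w != 0 -> r != 0 ->
  hpol q n w w^-1 (k * r / w) (k * w / r) = gpol q (et w) (k * et r) (k ^+ 2) n.
Proof.
move=> w0 r0.
have e1 : k * r / w * w + k * w / r * w^-1 = k * et r by rewrite /et; field; rewrite w0 r0.
have e2 : k * r / w * (k * w / r) = k ^+ 2 by field; rewrite w0 r0.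
have step m : hpol q m w w^-1 (k * r / w) (k * w / r) = gpol q (et w) (k * et r) (k ^+ 2) m /\
   hpol q m.+1 w w^-1 (k * r / w) (k * w / r) = gpol q (et w) (k * et r) (k ^+ 2) m.+1.
  elim: m => [|m [IH1 IH2]].
    split; first by rewrite hpol0.
    have n1 := qn1 0; rewrite expr1 in n1; apply: (mulfI n1); rewrite (hpol1 q1) e1.
    have := gpol_rec qn1 (et w) (k * et r) (k ^+ 2) 0; rewrite expr0 mul1r => ->.
    have -> : gpol q (et w) (k * et r) (k ^+ 2) 0 = 1 by [].
    have -> : gpolm q (et w) (k * et r) (k ^+ 2) 0 = 0 by [].
    by rewrite mul1r mulr0 mulr1 subr0.
  split=> //; apply: (mulfI (qn1 m.+1)); rewrite (hpol_rec q1) e1 e2 IH1 IH2 divff //.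
  have := gpol_rec qn1 (et w) (k * et r) (k ^+ 2) m.+1; rewrite -exprSr => ->.
  by rewrite gpolmS mul1r [q ^+ m.+1]exprSr !mulrA mulfK.
exact: (step n).1.
Qed.

Variables (k t x y r s : R[i]) (kr tr : R).
Hypotheses (hk : nm k = kr) (ht : nm t = tr) (hx : nm x = 1) (hy : nm y = 1) (hr : nm r = 1) (hs : nm s = 1).
Hypotheses (k01 : 0 < kr < 1) (t01 : 0 < tr < 1).

Definition kern_term n := t ^+ n * (P q n / P (k ^+ 2) n) *
  (gpol q (et x) (k * et r) (k ^+ 2) n * gpol q (et y) (k * et s) (k ^+ 2) n).

Let nz (z : R[i]) : nm z = 1 -> z != 0. Proof. by move=> h; rewrite -nm_gt0 h. Qed.
Let x0 := nz hx.
Let y0 := nz hy.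
Let r0 := nz hr.
Let s0 := nz hs.
Let nms := (nmM, nmV, hk, ht, hx, hy, hr, hs, invr1, mulr1, mul1r).

Lemma kern_termE n : bilin_term q (t * x) (t / x) (k * r / x) (k * x / r) y y^-1 (k * s / y) (k * y / s) n = kern_term n.
Proof.
rewrite /bilin_term /kern_term [t * x]mulrC [t / x]mulrC hpol_scale !hpol_gpol //.
have -> : k * r / x * (k * x / r) = k ^+ 2 by field; rewrite x0 r0.
by move: (t ^+ n) (P q n) (P _ n)^-1 => *; ring.
Qed.

Lemma kern_sumto : sumto kern_term (kern q k t x y r s).
Proof.
apply: eq_sumto kern_termE _; apply: (@bilin_sumto _ q q1 _ _ _ _ _ _ _ _ tr 1).
- by rewrite !nms.
- by rewrite !nms.
- by rewrite hy.
- by rewrite nmV hy invr1.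
- by rewrite !nms; case/andP: k01 => k0 k1; rewrite -expr2 exprn_ilt1 ?ltW.
- by rewrite mulr1; case/andP: t01.
Qed.

Definition kern_bound n := bilin_maj q kr kr kr kr (kr * kr) * (n.+1%:R ^+ 2 * tr ^+ n).

Lemma kern_term_bound n : nm (kern_term n) <= kern_bound n.
Proof.
rewrite -kern_termE /kern_bound -[tr]mulr1.
apply: bilin_term_bound; rewrite ?nms //.
by case/andP: k01 => k0 k1; rewrite -expr2 exprn_ilt1 ?ltW.
Qed.

Lemma kern_bound_dom : exists M, dom kern_bound M.
Proof.
have [||M dM] := @dom_bilin R (bilin_maj q kr kr kr kr (kr * kr)) tr; first exact: bilin_maj_ge0.
  by case/andP: t01 => /ltW -> ->.
by exists M.
Qed.

End Kernel.

Section Mean.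
Variable R : realType.

(** On the unit circle, d w = i w d t. *)
Lemma circle_integral_cmean (f F : R[i] -> R[i]) : ccont F -> (forall t, f (expi t) * expi t = F (expi t)) ->
  (4 * pi%:C * 'i%C)^-1 * circle_integral f = 2^-1 * cmean F.
Proof.
move=> [cF1 cF2] hF; rewrite /circle_integral /cmean.
set A := period_int (fun t => complex.Re (F (expi t))); set B := period_int (fun t => complex.Im (F (expi t))).
have -> : (\int[lebesgue_measure]_(t in `[0%R, (2 * pi)%R]) complex.Re (f (expi t) * ('i%C * expi t)))%R = - B.
  rewrite /B -mulN1r -period_intZ //; apply: eq_Rintegral => t _.
  by rewrite mulrCA hF; case: (F _) => u v /=; ring.
have -> : (\int[lebesgue_measure]_(t in `[0%R, (2 * pi)%R]) complex.Im (f (expi t) * ('i%C * expi t)))%R = A.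
  by apply: eq_Rintegral => t _; rewrite mulrCA hF; case: (F _) => u v /=; ring.
have -> : (- B +i* A)%C = 'i%C * (A +i* B)%C :> R[i] by simpc.
have i0 : 'i%C != 0 :> R[i] by apply/eqP => /(congr1 (@complex.Im R)) /eqP; rewrite /= oner_eq0.
have p0 : pi%:C != 0 :> R[i] by rewrite -nm_gt0 nmC ger0_norm ?pi_ge0 // pi_gt0.
rewrite fmorphV rmorphM rmorph_nat /=; move: (A +i* B)%C (pi%:C) p0 ('i%C) i0 => z p p0 i i0.
by field; rewrite i0 p0.
Qed.

(** The denominators (ab, ac, ad; q)_i are absorbed into the prefactor. *)
Lemma AW_poly_AWpol (q : R[i]) j w a b c d : nm q < 1 -> q != 0 -> w != 0 ->
  nm (a * b) < 1 -> nm (a * c) < 1 -> nm (a * d) < 1 ->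
  AW_poly j w a b c d q = (AWpol q j a b c d).[et w].
Proof.
move=> q1 q0 w0 ab ac ad; rewrite /AW_poly AWpol_horner -mulrA mulr_sumr; congr (_ * _).
apply: eq_bigr => -[i /= hi] _; rewrite /awc awbasis_et //.
rewrite /pm !qpochs_cons !qpochs_nil !mulr1.
have -> : a * b * c * d * q ^ (j%:Z - 1) = a * b * c * d * q ^+ j / q.
  by rewrite expfzDr // exprN1 mulrA.
move: (hi); rewrite ltnS => /subnKC <-; move: (j - i)%N => l; rewrite addKn !qpE.
rewrite (qpochD q (a * b)) (qpochD q (a * c)) (qpochD q (a * d)).
have := qpoch_neq0 q1 i ab; have := qpoch_neq0 q1 i ac; have := qpoch_neq0 q1 i ad; have := qpoch_neq0 q1 i q1.
move: (qpoch (a * b) q i) (qpoch (a * c) q i) (qpoch (a * d) q i) (qpoch q q i) => x1 x2 x3 x4 h4 h3 h2 h1.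
move: (qpoch _ q i) (qpoch _ q i) (qpoch _ q i) (qpoch _ q i) (qpoch _ q l) (qpoch _ q l) (qpoch _ q l) => *.
by field; rewrite h1 h2 h3 h4.
Qed.

End Mean.

(** * The mean of the product of two kernels *)

Section RegularPoints.
Variables (R : realType) (q : R[i]).
Hypotheses (q1 : nm q < 1) (q0 : q != 0).

(** The points required by [kernel_expansion]: any integer m >= 2 with nm q * m > 1 will do. *)
Lemma regular_points : exists ws : nat -> R[i], (forall n, regular q (ws n)) /\ injective (fun n => et (ws n)).
Proof.
have p0 : 0 < nm q by rewrite nm_gt0.
(* The offset ensures q M^2 > 1, which keeps 1 - q w^2 away from 0. *)
pose M := (Num.truncn (nm q)^-1).+2.
have Mq m : (M <= m)%N -> 1 < nm q * m%:R.
  move=> Mm; rewrite mulrC -ltr_pdivrMr // div1r; apply: (lt_le_trans (truncnS_gt _)).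
  by rewrite ler_nat; apply: leq_trans Mm; rewrite /M.
have nn m : nm (m%:R : R[i]) = m%:R by rewrite -(rmorph_nat (real_complex R)) nmC normr_nat.
have ne1 (z : R[i]) : nm z != 1 -> 1 - z != 0.
  by apply: contraNN; rewrite subr_eq0 => /eqP <-; rewrite nm1.
exists (fun n => (M + n)%:R); split=> [n|n m /=].
  set m := (M + n)%N; have m2 : (2 <= m)%N by rewrite /m /M.
  have m1 : 1 < (m%:R : R) by rewrite ltr1n.
  have mm : 1 < (m%:R : R) ^+ 2 by rewrite exprn_egt1.
  have qm : 1 < nm q * (m%:R : R) ^+ 2.
    rewrite expr2 mulrA; apply: lt_le_trans (_ : nm q * m%:R <= _); first by apply: Mq; rewrite /m leq_addr.
    by rewrite ler_peMr ?(ltW m1) // mulr_ge0 ?nm_ge0.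
  split.
  - by rewrite pnatr_eq0 -lt0n; apply: leq_trans m2.
  - by apply: ne1; rewrite nmX nn gt_eqF.
  - by apply: ne1; rewrite nmM nmX nn gt_eqF.
  - rewrite subr_eq0; apply/eqP => e; have := congr1 (@ComplexField.Normc.normc R) e.
    by rewrite nmX nn => e2; move: mm; rewrite e2 ltNge (ltW q1).
set x := (M + n)%N; set y := (M + m)%N => e.
have x0 : (x%:R : R[i]) != 0 by rewrite pnatr_eq0.
have y0 : (y%:R : R[i]) != 0 by rewrite pnatr_eq0.
have : (x%:R - y%:R) * ((x * y)%:R - 1) = 0 :> R[i].
  have := congr1 (fun z => z * (x%:R * y%:R)) e; rewrite /et natrM => /eqP; rewrite -subr_eq0 => /eqP <-.
  by move: (x%:R : R[i]) (y%:R : R[i]) x0 y0 => u v u0 v0; field; rewrite u0 v0.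
move/eqP; rewrite mulf_eq0 !subr_eq0 eqr_nat (_ : (x * y)%:R == 1 :> R[i] = false) ?orbF.
  by rewrite eqn_add2l => /eqP.
by rewrite -[1]/(1%:R) eqr_nat /x /y /M !addSn; apply/negP => /eqP; rewrite mulSn addSn => -[].
Qed.

End RegularPoints.

Section Assembly.
Variables (R : realType) (q : R[i]).
Hypotheses (q1 : nm q < 1) (q0 : q != 0).
Variables (k1 k2 t rho sigma tau zeta xi : R[i]) (r1 r2 tr : R).
Hypotheses (hk1 : nm k1 = r1) (hk2 : nm k2 = r2) (ht : nm t = tr).
Hypotheses (k101 : 0 < r1 < 1) (k201 : 0 < r2 < 1) (t01 : 0 < tr < 1).
Hypotheses (hrho : nm rho = 1) (hsigma : nm sigma = 1) (htau : nm tau = 1) (hzeta : nm zeta = 1) (hxi : nm xi = 1).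
Local Notation P a n := (qpoch a q n).
Local Notation Pi a := (qpoch_inf a q).
Let qn1 n : 1 - q ^+ n.+1 != 0.
Proof. by apply: sub1_neq0; rewrite nmX exprn_ilt1 ?nm_ge0. Qed.
Let nz (z : R[i]) : nm z = 1 -> z != 0. Proof. by move=> h; rewrite -nm_gt0 h. Qed.
Let rho0 := nz hrho. Let sigma0 := nz hsigma. Let tau0 := nz htau. Let zeta0 := nz hzeta. Let xi0 := nz hxi.
Let k10 : k1 != 0. Proof. by rewrite -nm_gt0 hk1; case/andP: k101. Qed.
Let k20 : k2 != 0. Proof. by rewrite -nm_gt0 hk2; case/andP: k201. Qed.
Let t0 : t != 0. Proof. by rewrite -nm_gt0 ht; case/andP: t01. Qed.
Local Notation al := (k1 ^+ 2).
Local Notation be := (k2 ^+ 2).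
Local Notation a := (k2 * xi).
Local Notation b := (k2 / xi).
Local Notation c := (k1 * rho).
Local Notation d := (k1 / rho).
Let nms := (nmM, nmV, hk1, hk2, ht, hrho, hsigma, htau, hzeta, hxi, invr1, mulr1, mul1r).
Let r1_ge0 : 0 <= r1 := ltW (andP k101).1.
Let r2_ge0 : 0 <= r2 := ltW (andP k201).1.

Definition pomega i w := (AWpol q i a b c d).[et w].
Definition pzeta i := (AWpol q i (k2 * sigma) (k2 / sigma) (k1 * tau) (k1 / tau)).[et zeta].
Definition den j := P q j * P al j * P be j * P (al * be * q ^+ j / q) j.
Definition coef N j := t ^+ N * (P q (N - j) / (den j * P (be * al * (q ^+ j) ^+ 2) (N - j)) *
    (gpol q (et xi) (k2 * q ^+ j * (k1 * et rho)) (be * al * (q ^+ j) ^+ 2) (N - j) *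
     gpol q (et sigma) (k2 * q ^+ j * (k1 * et tau)) (be * al * (q ^+ j) ^+ 2) (N - j))) * pzeta j.

Definition prod_term N w := \sum_(n < N.+1) kern_term q k1 t w zeta rho tau n * kern_term q k2 t xi sigma w zeta (N - n).

Let al1 : nm al < 1. Proof. by rewrite nmX hk1; case/andP: k101 => *; rewrite exprn_ilt1. Qed.
Let be1 : nm be < 1. Proof. by rewrite nmX hk2; case/andP: k201 => *; rewrite exprn_ilt1. Qed.
Let lt1q (z : R[i]) m : nm z < 1 -> 1 - z * q ^+ m != 0.
Proof. by move=> z1; apply: sub1_neq0; apply: le_lt_trans z1; exact: nm_qn. Qed.
Let m2 (x y : R[i]) : nm x < 1 -> nm y < 1 -> nm (x * y) < 1.
Proof. by move=> x1 y1; rewrite nmM; apply: le_lt_trans y1; rewrite ler_piMl ?nm_ge0 // ltW. Qed.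

(** The coefficients of t^N of the product of the two kernels, by [kernel_expansion]. *)
Lemma prod_termE N w : prod_term N w = \sum_(i < N.+1) coef N i * pomega i w.
Proof.
have [ws [ws1 ws2]] := regular_points q1 q0.
have sq (x : R[i]) : exists z, z ^+ 2 = x by exists (sqrtc x); exact: sqr_sqrtc.
have := @kernel_expansion _ q q0 qn1 k2 al k20 (fun m => lt1q m al1) (fun m => lt1q m be1) (fun m => lt1q m (m2 al1 be1))
  ws ws1 ws2 N a c (k2 * sigma) (k1 * tau) (et w) (et zeta) sq.
rewrite !mulf_neq0 // => /(_ isT isT isT isT) h.
transitivity (t ^+ N * \sum_(n < N.+1) kweight q k2 al N n * (gprod q k2 al a c (et w) n (N - n) * gprod q k2 al (k2 * sigma) (k1 * tau) (et zeta) n (N - n))).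
  rewrite mulr_sumr; apply: eq_bigr => -[n /= hn] _.
  rewrite /kern_term /kweight /gprod /pX /pS.
  have -> : t ^+ N = t ^+ n * t ^+ (N - n) by rewrite -exprD subnKC.
  have -> : (a + be / a) / k2 = et xi by rewrite /et; field; rewrite k20 xi0.
  have -> : (k2 * sigma + be / (k2 * sigma)) / k2 = et sigma by rewrite /et; field; rewrite k20 sigma0.
  have -> : c + al / c = k1 * et rho by rewrite /et; field; rewrite k10 rho0.
  have -> : k1 * tau + al / (k1 * tau) = k1 * et tau by rewrite /et; field; rewrite k10 tau0.
  rewrite !qpE invfM; move: (t ^+ n) (t ^+ (N - n)) (P q n) (P q _) (P al n)^-1 (P be _)^-1 => x1 x2 x3 x4 x5 x6.
  move: (gpol _ _ _ _ _) (gpol _ _ _ _ _) (gpol _ _ _ _ _) (gpol _ _ _ _ _) => y1 y2 y3 y4; ring.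
rewrite h mulr_sumr; apply: eq_bigr => -[i /= hi] _; rewrite /coef /pomega /pzeta /pP /pX /pS /den !qpE.
have -> : (a + be / a) / k2 = et xi by rewrite /et; field; rewrite k20 xi0.
have -> : (k2 * sigma + be / (k2 * sigma)) / k2 = et sigma by rewrite /et; field; rewrite k20 sigma0.
have -> : c + al / c = k1 * et rho by rewrite /et; field; rewrite k10 rho0.
have -> : k1 * tau + al / (k1 * tau) = k1 * et tau by rewrite /et; field; rewrite k10 tau0.
have -> : be / a = b by field; rewrite k20 xi0.
have -> : al / c = d by field; rewrite k10 rho0.
have -> : be / (k2 * sigma) = k2 / sigma by field; rewrite k20 sigma0.
have -> : al / (k1 * tau) = k1 / tau by field; rewrite k10 tau0.
by rewrite -!mulrA; do 5 congr (_ * _); rewrite mulrC.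
Qed.

Lemma prod_term_sumto w : nm w = 1 ->
  sumto (prod_term^~ w) (kern q k1 t w zeta rho tau * kern q k2 t xi sigma w zeta).
Proof.
move=> hw.
have [M1 dM1] := @kern_bound_dom R q r1 tr t01.
have [M2 dM2] := @kern_bound_dom R q r2 tr t01.
rewrite -(CsumE (kern_sumto q1 q0 hk1 ht hw hzeta hrho htau k101 t01)) -(CsumE (kern_sumto q1 q0 hk2 ht hxi hsigma hw hzeta k201 t01)).
apply: (sumto_cauchy dM1 dM2) => n; exact: kern_term_bound.
Qed.

Lemma prod_term_bound : exists bb M, dom bb M /\ forall n w, nm w = 1 -> nm (prod_term n w) <= bb n.
Proof.
have [M1 dM1] := @kern_bound_dom R q r1 tr t01.
have [M2 dM2] := @kern_bound_dom R q r2 tr t01.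
exists (fun n => \sum_(i < n.+1) kern_bound q r1 tr i * kern_bound q r2 tr (n - i)), (M1 * M2).
split; first exact: dom_cauchy.
move=> n w hw; apply: le_trans (nm_sum _ _ _) _; apply: ler_sum => i _; rewrite nmM.
by apply: ler_pM; rewrite ?nm_ge0 //; exact: kern_term_bound.
Qed.

Local Notation kj j := (k1 * k2 * q ^+ j).

(** Orthogonality leaves the j-th term of every coefficient; the terms that remain are those
    of a kernel with k = k1 k2 q^j. *)
Lemma cmean_kernels j : let f w := kern q k1 t w zeta rho tau * kern q k2 t xi sigma w zeta * (pomega j w * aw_weight q a b c d w) in
  ccont f /\ cmean f =
  t ^+ j * pzeta j * (awnorm q a b c d j * P (al * be * q ^+ j / q) j / den j) * kern q (kj j) t xi sigma rho tau.
Proof.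
move=> f; have [bb [M [dM hbb]]] := prod_term_bound.
have a1 : nm a < 1 by rewrite !nms; case/andP: k201.
have b1 : nm b < 1 by rewrite !nms; case/andP: k201.
have c1 : nm c < 1 by rewrite !nms; case/andP: k101.
have d1 : nm d < 1 by rewrite !nms; case/andP: k101.
have a0 : a != 0 by rewrite mulf_neq0.
have b0 : b != 0 by rewrite mulf_neq0 ?invr_eq0.
have c0 : c != 0 by rewrite mulf_neq0.
have d0 : d != 0 by rewrite mulf_neq0 ?invr_eq0.
have cW : ccont (aw_weight q a b c d) by exact: ccont_aw_weight.
have cp i : ccont (pomega i) by exact: ccont_horner.
pose g w := pomega j w * aw_weight q a b c d w.
have cg : ccont g by apply: ccontM.
have [G G0 hG] := ccont_bounded cg.
have cgi i : ccont (fun w => pomega j w * pomega i w * aw_weight q a b c d w) by apply: ccontM => //; exact: ccontM.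
have cF N : ccont (fun w => prod_term N w * g w).
  apply: eq_ccont (ccont_sum (index_enum _) (fun i : 'I_N.+1 => ccontZ (coef N i) (cgi i))) => w.
  by rewrite prod_termE mulr_suml; apply: eq_bigr => i _; rewrite /g; move: (coef _ _) (pomega _ _) (pomega _ _) (aw_weight _ _ _ _ _ _) => x y z u; ring.
have hF N w : nm (prod_term N (expi w) * g (expi w)) <= bb N * G.
  by rewrite nmM; apply: ler_pM; rewrite ?nm_ge0 //; apply: hbb; exact: nm_expi.
have dF : dom (fun n => bb n * G) (M * G).
  by rewrite mulrC; apply: dom_le (domM G0 dM) => n; rewrite mulr_ge0 ?dM.1 // mulrC lexx.
have IF N : cmean (fun w => prod_term N w * g w) = if (j <= N)%N then coef N j * (P (al * be * q ^+ j / q) j * awnorm q a b c d j) else 0.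
  transitivity (\sum_(i < N.+1) coef N i * cmean (fun w => pomega j w * pomega i w * aw_weight q a b c d w)).
    transitivity (cmean (fun w => \sum_(i < N.+1) coef N i * (pomega j w * pomega i w * aw_weight q a b c d w))).
      apply: eq_cmean => w; rewrite prod_termE mulr_suml; apply: eq_bigr => i _; rewrite /g.
      by move: (coef _ _) (pomega _ _) (pomega _ _) (aw_weight _ _ _ _ _ _) => x y z u; ring.
    by rewrite (cmean_sum _ (fun i : 'I_N.+1 => ccontZ (coef N i) (cgi i))); apply: eq_bigr => i _; rewrite (cmeanZ _ (cgi i)).
  have eD : a * b * c * d = al * be by field; rewrite rho0 xi0.
  have diag : cmean (fun w => pomega j w * pomega j w * aw_weight q a b c d w) = P (al * be * q ^+ j / q) j * awnorm q a b c d j.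
    by rewrite /pomega (AWpol_norm q1 q0 a1 b1 c1 d1 a0 b0 c0 d0) eD.
  have off i : i != j -> cmean (fun w => pomega j w * pomega i w * aw_weight q a b c d w) = 0.
    by move=> ij; exact: AWpol_orth.
  case: leqP => jN.
    have jN' : (j < N.+1)%N by [].
    rewrite (bigD1 (Ordinal jN')) //= diag big1 ?addr0 // => i ij; rewrite off ?mulr0 //.
  rewrite big1 // => i _; rewrite off ?mulr0 // neq_ltn.
  by rewrite (leq_trans (ltn_ord i)).
pose K := t ^+ j * pzeta j * (awnorm q a b c d j * P (al * be * q ^+ j / q) j / den j).
have hk : nm (kj j) = r1 * r2 * nm q ^+ j by rewrite !nmM nmX hk1 hk2.
have kj01 : 0 < r1 * r2 * nm q ^+ j < 1.
  case/andP: k101 => k1p k1l; case/andP: k201 => k2p k2l.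
  rewrite !mulr_gt0 ?exprn_gt0 ?nm_gt0 //=; apply: le_lt_trans (mulr_ilt1 (ltW k1p) (ltW k2p) k1l k2l).
  by rewrite ler_piMr ?mulr_ge0 ?exprn_ile1 ?nm_ge0 // ltW.
have hs := sumtoZ K (kern_sumto q1 q0 hk ht hxi hsigma hrho htau kj01 t01).
have ef w : Csum (fun n => prod_term n (expi w) * g (expi w)) = f (expi w).
  apply: CsumE; have := sumtoZ (g (expi w)) (prod_term_sumto (nm_expi w)).
  by rewrite mulrC; apply: eq_sumto => n; rewrite mulrC.
split; first exact: eq_ccont ef (ccont_Csum dF cF hF).
have := cmean_Csum dF cF hF; rewrite (eq_cmean ef) => hI; apply: sumto_uniq hI _; rewrite -/K.
apply: (@ccvg_unshift _ j); apply: eq_ccvg hs => n.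
rewrite addnC big_split_ord /= [X in _ = X + _]big1 ?add0r => [|i _]; last by rewrite IF leqNgt ltn_ord.
apply: eq_bigr => i _; rewrite IF leq_addr /coef addKn /kern_term /K.
have -> : kj j ^+ 2 = be * al * (q ^+ j) ^+ 2 by ring.
have -> : kj j * et rho = k2 * q ^+ j * (k1 * et rho) by ring.
have -> : kj j * et tau = k2 * q ^+ j * (k1 * et tau) by ring.
rewrite exprD [(den j * _)^-1]invfM.
by move: (gpol _ _ _ _ _) (gpol _ _ _ _ _) (den j)^-1 (P _ i)^-1 (P q i) (t ^+ i) (t ^+ j) (pzeta j) (awnorm _ _ _ _ _ _) (P _ j) => x1 x2 x3 x4 x5 x6 x7 x8 x9 x10; ring.
Qed.

Let A := Pi (t * xi * sigma) * Pi (t * xi / sigma) * (Pi (t * sigma / xi) * Pi (t / (xi * sigma))).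

Lemma mean_constant j :
  2^-1 * (t ^- j * (Pi al * Pi be * Pi q * A * (Pi (kj j * xi * rho) * Pi (kj j * xi / rho) * (Pi (kj j / xi * rho) * Pi (kj j / xi / rho)))) *
   (t ^+ j * pzeta j * (awnorm q a b c d j * P (al * be * q ^+ j / q) j / den j) * kern q (kj j) t xi sigma rho tau)) =
  Pi (kj j ^+ 2) * (A * kern q (kj j) t xi sigma rho tau) * pzeta j.
Proof.
have r1l := (andP k101).2; have r2l := (andP k201).2.
have a1 : nm a < 1 by rewrite !nms.
have b1 : nm b < 1 by rewrite !nms.
have c1 : nm c < 1 by rewrite !nms.
have d1 : nm d < 1 by rewrite !nms.
have D1 : nm (al * be) < 1 by exact: m2.
have qlt x n : nm x < 1 -> nm (x * q ^+ n) < 1 by apply: le_lt_trans; exact: nm_qn.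
rewrite /awnorm /AW_val /den.
have -> : a * b * c * d = al * be by field; rewrite rho0 xi0.
have -> : a * b = be by field.
have -> : c * d = al by field.
have -> : kj j * xi * rho = a * c * q ^+ j by ring.
have -> : kj j * xi / rho = a * d * q ^+ j by ring.
have -> : kj j / xi * rho = b * c * q ^+ j by ring.
have -> : kj j / xi / rho = b * d * q ^+ j by ring.
have -> : kj j ^+ 2 = al * be * q ^+ (j + j) by rewrite exprD; ring.
rewrite (qinf_split q1 (al * be) (j + j)) (qinf_split q1 (a * c) j) (qinf_split q1 (a * d) j) (qinf_split q1 (b * c) j) (qinf_split q1 (b * d) j).
have : P (al * be * q ^+ j / q) j != 0.
  case: j => [|j]; first by rewrite qpoch0 oner_eq0.
  have -> : al * be * q ^+ j.+1 / q = al * be * q ^+ j by rewrite [q ^+ _.+1]exprSr mulrA mulfK.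
  by apply: qpoch_neq0 => //; exact: qlt.
have := qpoch_neq0 q1 j q1; have := qpoch_neq0 q1 j al1; have := qpoch_neq0 q1 j be1.
have := qpoch_neq0 q1 (j + j) D1.
have := qinf_neq0 q1 (qlt _ j (m2 a1 c1)); have := qinf_neq0 q1 (qlt _ j (m2 a1 d1)).
have := qinf_neq0 q1 (qlt _ j (m2 b1 c1)); have := qinf_neq0 q1 (qlt _ j (m2 b1 d1)).
have := qpoch_neq0 q1 j (m2 a1 c1); have := qpoch_neq0 q1 j (m2 a1 d1).
have := qpoch_neq0 q1 j (m2 b1 c1); have := qpoch_neq0 q1 j (m2 b1 d1).
have := qinf_neq0 q1 q1; have := qinf_neq0 q1 al1; have := qinf_neq0 q1 be1.
have : t ^+ j != 0 by exact: expf_neq0.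
move: (kern _ _ _ _ _ _ _) (pzeta j) A => kk zz AA.
move: (P (al * be * q ^+ j / q) j) (Pi (al * be * _)) (P (al * be) _) (Pi (a * c * _)) (Pi (a * d * _)) (Pi (b * c * _)) (Pi (b * d * _)) => u1 u2 u3 u4 u5 u6 u7.
move: (P (a * c) j) (P (a * d) j) (P (b * c) j) (P (b * d) j) (P q j) (P al j) (P be j) (Pi q) (Pi al) (Pi be) (t ^+ j) => v1 v2 v3 v4 v5 v6 v7 v8 v9 v10 v11.
move=> h1 h2 h3 h4 h5 h6 h7 h8 h9 h10 h11 h12 h13 h14 h15 h16 h17.
by field; rewrite h1 h2 h3 h4 h5 h6 h7 h8 h9 h10 h11 h12 h13 h14 h15 h16 h17.
Qed.

End Assembly.

(** * The product formula *)

(* The entry q of the first qpochs_inf below, i.e. the factor (q; q)_oo, is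
   missing from the published formula, whose two sides differ by exactly this
   constant: for j = 0 and k1, k2, k4 -> 0 the left-hand side tends to 1, and
   the integral without this factor tends to 1 / (q; q)_oo. *)
Theorem theorem8p10 (R : realType) (q k1 k2 k4 : R) (j : nat)
    (rho sigma tau zeta xi : R[i])
    (hq : 0 < q < 1) (hk1 : 0 < k1 < 1) (hk2 : 0 < k2 < 1) (hk4 : 0 < k4 < 1)
    (hrho : `|rho| = 1) (hsigma : `|sigma| = 1) (htau : `|tau| = 1)
    (hzeta : `|zeta| = 1) (hxi : `|xi| = 1) :
  let Q : R[i] := q%:C in
  let K1 : R[i] := k1%:C in
  let K2 : R[i] := k2%:C in
  let K4 : R[i] := k4%:C in
  AW_fun sigma rho (K1 * K2 * xi * Q ^+ j) (K4 * tau) (K4 / tau)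
         (xi * Q ^ (1 - j%:Z) / (K1 * K2)) Q *
  AW_poly j zeta (K2 * sigma) (K2 / sigma) (K1 * tau) (K1 / tau) Q
  = (4 * pi%:C * 'i%C)^-1 *
    circle_integral (fun omega : R[i] =>
      AW_poly j omega (K2 * xi) (K2 / xi) (K1 * rho) (K1 / rho) Q *
      AW_fun tau omega (K1 * rho) (K4 * zeta) (K4 / zeta) (Q * rho / K1) Q *
      AW_fun sigma omega (K2 * xi) (K4 * zeta) (K4 / zeta) (xi * Q / K2) Q *
      (K4 ^- j *
       qpochs_inf ([:: Q; omega ^+ 2; omega ^- 2] ++
                   pm (K1 * K2 * xi * Q ^+ j) rho ++
                   pm (K1 * K2 * Q ^+ j / xi) rho) Q /
       qpochs_inf (pm (K2 * xi) omega ++ pm (K2 / xi) omega ++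
                   pm (K4 * zeta) omega ++ pm (K4 / zeta) omega ++
                   pm (K1 * rho) omega ++ pm (K1 / rho) omega) Q) /
      omega).
Proof.
move=> Q K1 K2 K4.
have un (z : R[i]) : `|z| = 1 -> nm z = 1 by rewrite nmE => /(congr1 (@complex.Re R)).
have rC (x : R) : 0 < x < 1 -> nm (x%:C) = x by case/andP=> x0 _; rewrite nmC ger0_norm // ltW.
have {hrho} hrho := un _ hrho; have {hsigma} hsigma := un _ hsigma; have {htau} htau := un _ htau.
have {hzeta} hzeta := un _ hzeta; have {hxi} hxi := un _ hxi.
have q1 : nm Q < 1 by rewrite rC //; case/andP: hq.
have q0 : Q != 0 by rewrite -nm_gt0 rC //; case/andP: hq.
have nK1 : nm K1 = k1 := rC _ hk1; have nK2 : nm K2 = k2 := rC _ hk2; have nK4 : nm K4 = k4 := rC _ hk4.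
have K10 : K1 != 0 by rewrite -nm_gt0 nK1; case/andP: hk1.
have K20 : K2 != 0 by rewrite -nm_gt0 nK2; case/andP: hk2.
have K40 : K4 != 0 by rewrite -nm_gt0 nK4; case/andP: hk4.
have nz (z : R[i]) : nm z = 1 -> z != 0 by move=> h; rewrite -nm_gt0 h.
have xi0 := nz _ hxi; have rho0 := nz _ hrho.
have qj0 : Q ^+ j != 0 by exact: expf_neq0.
pose kj := K1 * K2 * Q ^+ j.
have ekj : kj = (k1 * k2 * q ^+ j)%:C by rewrite /kj !rmorphM rmorphXn.
have kj01 : 0 < k1 * k2 * q ^+ j < 1.
  case/andP: hk1 => k1p k1l; case/andP: hk2 => k2p k2l; case/andP: hq => qp ql.
  rewrite !mulr_gt0 ?exprn_gt0 //=; apply: le_lt_trans (mulr_ilt1 (ltW k1p) (ltW k2p) k1l k2l).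
  by rewrite ler_piMr ?mulr_ge0 ?exprn_ile1 // ltW.
have nkj : nm kj = k1 * k2 * q ^+ j by rewrite ekj rC.
have lt2 (x y z w : R[i]) (s s' : R) : nm x = s -> nm y = s' -> nm z = 1 -> nm w = 1 -> 0 < s < 1 -> 0 < s' < 1 -> nm (x * z * (y * w)) < 1.
  move=> hx hy hz hw /andP[s0 s1] /andP[s0' s1']; rewrite !nmM hx hy hz hw !mulr1.
  by rewrite mulr_ilt1 ?ltW.
have poly w u v : nm w = 1 -> nm u = 1 -> nm v = 1 ->
    AW_poly j w (K2 * u) (K2 / u) (K1 * v) (K1 / v) Q = (AWpol Q j (K2 * u) (K2 / u) (K1 * v) (K1 / v)).[et w].
  move=> hw hu hv; have hu' : nm u^-1 = 1 by rewrite nmV hu invr1.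
  have hv' : nm v^-1 = 1 by rewrite nmV hv invr1.
  apply: AW_poly_AWpol => //; [exact: nz|exact: (lt2 _ _ _ _ _ _ nK2 nK2 hu hu' hk2 hk2)|exact: (lt2 _ _ _ _ _ _ nK2 nK1 hu hv hk2 hk1)|exact: (lt2 _ _ _ _ _ _ nK2 nK1 hu hv' hk2 hk1)].
have e1 : K1 * K2 * xi * Q ^+ j = kj * xi by rewrite /kj mulrAC.
have e2 : xi * Q ^ (1 - j%:Z) / (K1 * K2) = Q * xi / kj.
  rewrite expfzDr // expr1z -exprnN /kj; move: (Q ^+ j) qj0 => z z0.
  by field; rewrite K10 K20 z0.
rewrite e1 e2 (AW_fun_kern q1 q0 nkj nK4 hrho htau hxi hsigma kj01 hk4 ekj erefl) poly //.
pose A := qpoch_inf (K4 * xi * sigma) Q * qpoch_inf (K4 * xi / sigma) Q *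
  (qpoch_inf (K4 * sigma / xi) Q * qpoch_inf (K4 / (xi * sigma)) Q).
pose B := qpoch_inf (kj * xi * rho) Q * qpoch_inf (kj * xi / rho) Q * (qpoch_inf (kj / xi * rho) Q * qpoch_inf (kj / xi / rho) Q).
pose C0 := K4 ^- j * (qpoch_inf (K1 ^+ 2) Q * qpoch_inf (K2 ^+ 2) Q * qpoch_inf Q Q * A * B).
have [cf IIf] := cmean_kernels q1 q0 nK1 nK2 nK4 hk1 hk2 hk4 hrho hsigma htau hzeta hxi j.
set f := fun w => _ in cf IIf.
rewrite (@circle_integral_cmean R _ (fun w => C0 * f w)); first last.
- move=> u; set w := expi u; have hw : nm w = 1 := nm_expi u.
  have w0 := nz _ hw; have zeta0 := nz _ hzeta.
  rewrite divfK // poly // (AW_fun_kern q1 q0 nK1 nK4 hw hzeta hrho htau hk1 hk4 erefl erefl).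
  have -> : xi * Q / K2 = Q * xi / K2 by rewrite [xi * Q]mulrC.
  rewrite (AW_fun_kern q1 q0 nK2 nK4 hw hzeta hxi hsigma hk2 hk4 erefl erefl).
  rewrite -(mulrA (qpoch_inf (K2 ^+ 2) Q)) (kern_sym q1 q0 nK2 nK4 hw hzeta hxi hsigma hk2 hk4) -/A.
  rewrite /pm /= !qinfs_cons !qinfs_nil !mulr1 /f /aw_weight /aw_factor /hermite_weight /pomega /C0 /B.
  rewrite -/kj (mulrAC K4 zeta w) (mulrAC K4 zeta^-1 w) -(mulrA K4 zeta^-1 w^-1) -invfM (mulrC zeta w).
  have nwV : nm w^-1 = 1 by rewrite nmV hw invr1.
  have n1 (x y z : R[i]) (s : R) : nm x = s -> 0 < s < 1 -> nm y = 1 -> nm z = 1 -> qpoch_inf (x * y * z) Q != 0.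
    by move=> hx /andP[_ s1] hy hz; apply: qinf_neq0 => //; rewrite !nmM hx hy hz !mulr1.
  have n2 (x y z : R[i]) (s : R) : nm x = s -> 0 < s < 1 -> nm y = 1 -> nm z = 1 -> qpoch_inf (x * y / z) Q != 0.
    by move=> hx hs hy hz; apply: n1 hx hs hy _; rewrite nmV hz invr1.
  have n3 (x y z : R[i]) (s : R) : nm x = s -> 0 < s < 1 -> nm y = 1 -> nm z = 1 -> qpoch_inf (x / y * z) Q != 0.
    by move=> hx hs hy hz; apply: n1 hx hs _ hz; rewrite nmV hy invr1.
  have n4 (x y z : R[i]) (s : R) : nm x = s -> 0 < s < 1 -> nm y = 1 -> nm z = 1 -> qpoch_inf (x / y / z) Q != 0.
    by move=> hx hs hy hz; apply: n2 hx hs _ hz; rewrite nmV hy invr1.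
  have := n1 _ _ _ _ nK2 hk2 hxi hw; have := n2 _ _ _ _ nK2 hk2 hxi hw.
  have := n3 _ _ _ _ nK2 hk2 hxi hw; have := n4 _ _ _ _ nK2 hk2 hxi hw.
  have := n1 _ _ _ _ nK1 hk1 hrho hw; have := n2 _ _ _ _ nK1 hk1 hrho hw.
  have := n3 _ _ _ _ nK1 hk1 hrho hw; have := n4 _ _ _ _ nK1 hk1 hrho hw.
  have := n1 _ _ _ _ nK4 hk4 hw hzeta; have := n2 _ _ _ _ nK4 hk4 hw hzeta; have := n2 _ _ _ _ nK4 hk4 hzeta hw.
  have : qpoch_inf (K4 / (w * zeta)) Q != 0 by rewrite invfM mulrA; exact: n4 nK4 hk4 hw hzeta.
  have : K4 ^+ j != 0 by exact: expf_neq0.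
  move: (AWpol _ _ _ _ _ _).[_] (kern _ _ _ _ _ _ _) (kern _ _ _ _ _ _ _) (A) => pp kk1 kk2 AA.
  clear cf IIf C0 f B A.
  move: (qpoch_inf (K2 * xi * w) Q) (qpoch_inf (K2 * xi / w) Q) (qpoch_inf (K2 / xi * w) Q) (qpoch_inf (K2 / xi / w) Q) => x1 x2 x3 x4.
  move: (qpoch_inf (K1 * rho * w) Q) (qpoch_inf (K1 * rho / w) Q) (qpoch_inf (K1 / rho * w) Q) (qpoch_inf (K1 / rho / w) Q) => y1 y2 y3 y4.
  move: (qpoch_inf (K4 * w * zeta) Q) (qpoch_inf (K4 * w / zeta) Q) (qpoch_inf (K4 * zeta / w) Q) (qpoch_inf (K4 / (w * zeta)) Q) (K4 ^+ j) => z1 z2 z3 z4 z5.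
  move: (qpoch_inf _ _) (qpoch_inf _ _) (qpoch_inf _ _) (qpoch_inf _ _) (qpoch_inf _ _) (qpoch_inf _ _) (qpoch_inf _ _) (qpoch_inf _ _) (qpoch_inf _ _).
  move=> u1 u2 u3 u4 u5 u6 u7 u8 u9 h1 h2 h3 h4 h5 h6 h7 h8 h9 h10 h11 h12 h13.
  by field; rewrite h1 h2 h3 h4 h5 h6 h7 h8 h9 h10 h11 h12 h13.
- exact: ccontZ.
rewrite (cmeanZ _ cf) IIf /C0 -/A -/B.
have := mean_constant q1 q0 sigma tau zeta nK1 nK2 nK4 hk1 hk2 hk4 hrho hxi j.
rewrite -/kj -/A -/B => ->.
rewrite /A -(kern_sym q1 q0 nkj nK4 hrho htau hxi hsigma kj01 hk4) /pzeta.
by rewrite -!mulrA.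
Qed.
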